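(* Let $\Omega_1,\Omega_2\subset\mathbb{R}^2$ be two open disks with non-empty intersection, neither contained in the other, and let $\gamma_1,\gamma_2$, $\theta$, $\sigma$ be as in the context. Let $\mathcal{S}^*=\{z\in\mathbb{C}:|\mathrm{Im}\,z|<1/2\}$ and $\widehat{\mathscr{P}}_{\pi-\theta}(z)=\frac{\sinh(\theta z)}{\sinh(\pi z)}$. Then the spectrum of the operator $\gamma_1\gamma_2:L^2(\partial\Omega_1)\to L^2(\partial\Omega_1)$ is $$\sigma(\gamma_1\gamma_2)=\mathrm{cl}\,\big\{\overline{\lambda}\in\mathbb{C}:\lambda\in\widehat{\mathscr{P}}_{\pi-\theta}^{\,2}(\mathcal{S}^* )\big\},$$ where $\mathrm{cl}$ denotes the closure in $\mathbb{C}$. In particular the spectral radius is $\rho(\gamma_1\gamma_2)=\frac{1-\cos\theta}{2}$. Moreover, for every $z_0\in\mathcal{S}^*$, with $\lambda=\widehat{\mathscr{P}}_{\pi-\theta}(z_0)^2$, the number $\overline{\lambda}$ is an eigenvalue of $\gamma_1\gamma_2$ with eigenfunction $$f(\phi)=\left(\frac{1-\cos(\phi+\sigma)}{\cos\phi-\cos\sigma}\right)^{\mathrm{i}\,\overline{z_0}}\in L^2(\Gamma_1^{\rm int})$$ (extended by zero to $\Gamma_1^{\rm ext}$), where $\phi\in(-\sigma,\sigma)$ is the angular coordinate on the arc $\Gamma_1^{\rm int}$ measured at the center of $\Omega_1$ from the midpoint of the arc.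
   Context: Geometry: $\Omega_i=B_{r_i}(\mathbf{x}_i)\subset\mathbb{R}^2$, $i=1,2$; $\Omega=\Omega_1\cup\Omega_2$; $\Gamma_i^{\rm ext}=\partial\Omega_i\cap\partial\Omega$, $\Gamma_i^{\rm int}=\partial\Omega_i\setminus\Gamma_i^{\rm ext}$. $\theta\in(0,\pi)$ is the angle, at one of the two points $p$ of $\partial\Omega_1\cap\partial\Omega_2$, between the segments from $p$ to $\mathbf{x}_1$ and from $p$ to $\mathbf{x}_2$. $\sigma\in(0,\pi)$ is half the aperture angle of the arc $\Gamma_1^{\rm int}$ seen from $\mathbf{x}_1$. $L^2(\partial\Omega_i)$ is the complex $L^2$ space for the one-dimensional Hausdorff measure $\mathscr{H}^1$. For $i\ne j$, $\gamma_j:L^2(\partial\Omega_i)\to L^2(\partial\Omega_j)$ is the bounded operator sending $g$ to the function equal to $\mathrm{P}_i[g]|_{\Gamma_j^{\rm int}}$ on $\Gamma_j^{\rm int}$ and $0$ on $\Gamma_j^{\rm ext}$, where $\mathrm{P}_i[g](\mathbf{x})=\frac1{2\pi}\int_{\partial\Omega_i}\frac{r_i^2-|\mathbf{x}-\mathbf{x}_i|^2}{r_i|\mathbf{x}-\mathbf{y}|^2}g(\mathbf{y})\,d\mathscr{H}^1(\mathbf{y})$ for $\mathbf{x}\in\Omega_i$ is the Poisson integral. The base in the formula for $f$ is a positive real number $a$, and $a^{\mathrm{i}w}=e^{\mathrm{i}w\log a}$ for $w\in\mathbb{C}$. At $z=0$, $\widehat{\mathscr{P}}_{\pi-\theta}(0)=\theta/\pi$.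 *)

(* Defs.v *)
From HB Require Import structures.
From mathcomp Require Import all_boot all_order all_algebra.
From mathcomp Require Import ring_quotient generic_quotient.
From mathcomp.real_closed Require Import complex.
From mathcomp Require Import all_classical all_reals all_analysis.
From mathcomp Require Import measurable_realfun.

Set Implicit Arguments.
Unset Strict Implicit.
Unset Printing Implicit Defensive.
Import Order.TTheory GRing.Theory Num.Theory.
Import numFieldNormedType.Exports.
Import Normc.
Local Open Scope classical_set_scope.
Local Open Scope ring_scope.

Section Plane.
Variable R : realType.
Implicit Types (x y a b p : R * R) (r t : R) (A B : set (R * R)).

Definition edist x y : R :=
  Num.sqrt ((x.1 - y.1) ^+ 2 + (x.2 - y.2) ^+ 2).

Definition disk x r : set (R * R) := [set y | edist y x < r].

(* The product topology on R * R is the Euclidean one. *)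
Definition boundary A : set (R * R) := closure A `\` A°.

(* With A and B the two disks, these are the exterior and interior parts of
   the boundary of A in the union of A and B. *)
Definition Gamma_ext A B : set (R * R) := boundary A `&` boundary (A `|` B).
Definition Gamma_int A B : set (R * R) := boundary A `\` Gamma_ext A B.

(* Angle at p between the segments from p to a and from p to b. *)
Definition angle a p b : R :=
  acos (((a.1 - p.1) * (b.1 - p.1) + (a.2 - p.2) * (b.2 - p.2))
        / (edist a p * edist b p)).

Definition circle_point x r t : R * R := (x.1 + r * cos t, x.2 + r * sin t).

End Plane.

Section Hausdorff.
Variable R : realType.
Local Notation plane := (R * R)%type.
Local Open Scope ereal_scope.

(* The value 0 is added so that the empty set has diameter 0 and not -oo. *)
Definition ediam (A : set plane) : \bar R :=
  ereal_sup (0 |` [set (edist p.1 p.2)%:E | p in A `*` A]).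

Lemma ediam_ge0 A : 0 <= ediam A.
Proof. by apply: ereal_sup_ubound; left. Qed.
#[local] Hint Extern 0 (is_true (_ <= ediam _)) => exact: ediam_ge0 : core.

Lemma ediam0 : ediam set0 = 0.
Proof.
apply/eqP; rewrite eq_le ediam_ge0 andbT.
by apply: ge_ereal_sup => _ [->//|[p [[]]]].
Qed.

Definition cover_le (delta : R) (A : set plane) : set ((set plane)^nat) :=
  [set U | A `<=` \bigcup_k U k /\ forall k, ediam (U k) <= delta%:E].

Definition hausdorff1_pre (delta : R) (A : set plane) : \bar R :=
  ereal_inf [set \sum_(k <oo) ediam (U k) | U in cover_le delta A].

(* The constant in front of the sum of the diameters is 1, so that the measure
   of a segment is its length. *)
Definition hausdorff1 (A : set plane) : \bar R :=
  ereal_sup [set hausdorff1_pre delta A | delta in [set d : R | (0 < d)%R]].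

Lemma hausdorff1_pre_ge0 delta A : 0 <= hausdorff1_pre delta A.
Proof.
apply: le_ereal_inf_tmp => x [U _ <-{x}].
by apply: nneseries_ge0 => k _ _; exact: ediam_ge0.
Qed.

Lemma hausdorff1_pre0 delta : (0 < delta)%R -> hausdorff1_pre delta set0 = 0.
Proof.
move=> d0; apply/eqP; rewrite eq_le hausdorff1_pre_ge0 andbT.
apply: ereal_inf_lbound; exists (fun=> set0).
  by split => // k; rewrite ediam0 lee_fin ltW.
by apply: eseries0 => k _ _; rewrite ediam0.
Qed.

Lemma le_hausdorff1_pre delta :
  {homo hausdorff1_pre delta : A B / A `<=` B >-> A <= B}.
Proof.
move=> A B AB; apply/ereal_inf_le_tmp => x [U [BU dU]] <-{x}.
by exists U => //; split => //; exact: subset_trans BU.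
Qed.

Lemma hausdorff1_pre_sigma_subadditive delta :
  sigma_subadditive (hausdorff1_pre delta).
Proof.
move=> A; have [[i ioo]|] := pselect (exists i, hausdorff1_pre delta (A i) = +oo).
  rewrite (eseries_pinfty _ _ ioo) ?leey// => n _.
  by rewrite -ltNye (lt_le_trans _ (hausdorff1_pre_ge0 _ _)).
rewrite -forallNE => Aoo.
suff add2e (e : {posnum R}) : hausdorff1_pre delta (\bigcup_n A n) <=
    \sum_(i <oo) hausdorff1_pre delta (A i) + e%:num%:E.
  by apply/lee_addgt0Pr => _/posnumP[].
rewrite (le_trans _ (epsilon_trick _ _ _))//; last first.
  by move=> n; exact: hausdorff1_pre_ge0.
pose P n (B : (set plane)^nat) := cover_le delta (A n) B /\
  \sum_(k <oo) ediam (B k) <=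
  hausdorff1_pre delta (A n) + (e%:num / (2 ^ n.+1)%:R)%:E.
have [G PG] : {G : ((set plane)^nat)^nat & forall n, P n (G n)}.
  apply: (@choice _ _ P) => n; rewrite /P /hausdorff1_pre.
  set S := (X in ereal_inf X); move infS : (ereal_inf S) => iS.
  case: iS infS => [r Sr|Soo|Soo].
  - have en1 : (0 < e%:num / (2 ^ n.+1)%:R)%R by [].
    have /(lb_ereal_inf_adherent en1) : ereal_inf S \is a fin_num by rewrite Sr.
    move=> [x [B cB muBx] xS].
    by exists B; split => //; rewrite muBx -Sr; exact/ltW.
  - by have := Aoo n; rewrite /hausdorff1_pre Soo.
  - suff : lbound S 0 by move/le_ereal_inf_tmp; rewrite Soo.
    by move=> /= _ [B _ <-]; apply: nneseries_ge0 => *; exact: ediam_ge0.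
have muG_ge0 x : 0 <= (ediam \o uncurry G) x by exact: ediam_ge0.
apply: (@le_trans _ _ (\esum_(i in setT) (ediam \o uncurry G) i)).
  apply: ereal_inf_lbound => /=.
  have /card_esym/ppcard_eqP[f] := card_nat2.
  exists (uncurry G \o f).
    split => [|i]; last by have := (PG (f i).1).1.2 (f i).2; rewrite /=; case: (f i).
    apply: (@subset_trans _  (\bigcup_n \bigcup_k G n k)) => [t [i _]|].
      by move=> /((PG i).1.1) -[j _ ?]; exists i => //; exists j.
    move=> t [i _ [j _ Bijt]]; exists (f^-1%FUN (i, j)) => //=.
    by rewrite invK ?inE.
  rewrite -(esum_pred_image (ediam \o uncurry G) _ xpredT) ?[fun=> _]set_true//.
  by rewrite image_eq.
rewrite (_ : esum _ _ = \sum_(i <oo) \sum_(j <oo ) ediam (G i j)); last first.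
  pose J : nat -> set (nat * nat) := fun i => [set (i, j) | j in setT].
  rewrite (_ : setT = \bigcup_k J k); last first.
    by rewrite predeqE => -[a b]; split => // _; exists a => //; exists b.
  rewrite esum_bigcupT /=; last 2 first.
    - apply/trivIsetP => i j _ _ ij.
      rewrite predeqE => -[n m] /=; split => //= -[] [_] _ [<-{n} _].
      by move=> [m' _] [] /esym/eqP; rewrite (negbTE ij).
    - by move=> /= [n m]; exact: ediam_ge0.
  rewrite -(image_id [set: nat]) -fun_true esum_pred_image//; last first.
    by move=> n _; apply: esum_ge0 => *; exact: ediam_ge0.
  apply: eq_eseriesr => /= j _.
  rewrite -(esum_pred_image (ediam \o uncurry G) (pair j) predT)//=; last first.
    by move=> ? ? _ _; exact: (@can_inj _ _ _ snd).
  by congr esum; rewrite predeqE => -[a b]; split; move=> [i _ <-]; exists i.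
apply: lee_lim.
- apply: is_cvg_nneseries => n *.
  by apply: nneseries_ge0 => m *; exact: (muG_ge0 (n, m)).
- apply: is_cvg_nneseries => n *; apply: adde_ge0 => //.
  exact: hausdorff1_pre_ge0.
- by near=> n; apply: lee_sum => i _; exact: (PG i).2.
Unshelve. all: by end_near. Qed.

Lemma hausdorff1_ge0 A : 0 <= hausdorff1 A.
Proof.
apply: (le_trans (hausdorff1_pre_ge0 1 A)).
by apply: ereal_sup_ubound; exists 1%R => //=.
Qed.

Lemma hausdorff1_0 : hausdorff1 set0 = 0.
Proof.
apply/eqP; rewrite eq_le hausdorff1_ge0 andbT.
by apply: ge_ereal_sup => _ [d /= d0 <-]; rewrite hausdorff1_pre0.
Qed.

Lemma le_hausdorff1 : {homo hausdorff1 : A B / A `<=` B >-> A <= B}.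
Proof.
move=> A B AB; apply: ge_ereal_sup => _ [d /= d0 <-].
apply: (le_trans (le_hausdorff1_pre d AB)).
by apply: ereal_sup_ubound; exists d.
Qed.

Lemma hausdorff1_sigma_subadditive : sigma_subadditive hausdorff1.
Proof.
move=> F; apply: ge_ereal_sup => _ [d /= d0 <-].
apply: (le_trans (hausdorff1_pre_sigma_subadditive d F)).
apply: lee_nneseries => [i _ _|i _]; first exact: hausdorff1_pre_ge0.
by apply: ereal_sup_ubound; exists d.
Qed.

HB.instance Definition _ := isOuterMeasure.Build R plane hausdorff1
  hausdorff1_0 hausdorff1_ge0 le_hausdorff1 hausdorff1_sigma_subadditive.

(* Restriction to D of the one-dimensional Hausdorff measure, as a measure on
   its Caratheodory-measurable sets: L^2(D) is L^2 of the plane for it. *)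
Section restriction.
Variable D : set plane.

Definition hausdorff1_on (A : set plane) : \bar R := hausdorff1 (A `&` D).

Let hausdorff1_on0 : hausdorff1_on set0 = 0.
Proof. by rewrite /hausdorff1_on set0I outer_measure0. Qed.

Let hausdorff1_on_ge0 A : 0 <= hausdorff1_on A.
Proof. exact: outer_measure_ge0. Qed.

Let le_hausdorff1_on : {homo hausdorff1_on : A B / A `<=` B >-> A <= B}.
Proof. by move=> A B AB; apply: le_outer_measure; exact: setSI. Qed.

Let hausdorff1_on_sigma_subadditive : sigma_subadditive hausdorff1_on.
Proof.
move=> F; rewrite /hausdorff1_on setI_bigcupl.
exact: outer_measure_sigma_subadditive.
Qed.

HB.instance Definition _ := isOuterMeasure.Build R plane hausdorff1_on
  hausdorff1_on0 hausdorff1_on_ge0 le_hausdorff1_on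
  hausdorff1_on_sigma_subadditive.

Definition hausdorff1_measure : set (caratheodory_type hausdorff1_on) -> \bar R :=
  hausdorff1_on.

Let hausdorff1_measure0 : hausdorff1_measure set0 = 0.
Proof. exact: outer_measure0. Qed.

Let hausdorff1_measure_ge0 A : 0 <= hausdorff1_measure A.
Proof. exact: outer_measure_ge0. Qed.

Let hausdorff1_measure_semi_sigma_additive : semi_sigma_additive hausdorff1_measure.
Proof. exact: caratheodory_measure_sigma_additive. Qed.

HB.instance Definition _ := isMeasure.Build _ _ _ hausdorff1_measure
  hausdorff1_measure0 hausdorff1_measure_ge0 hausdorff1_measure_semi_sigma_additive.

End restriction.
End Hausdorff.
Arguments hausdorff1_measure {R} D _.

Section ComplexL2.
Context d (T : measurableType d) (R : realType).
Variable mu : {measure set T -> \bar R}.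
Local Notation C := R[i].
Implicit Types (f g : T -> C) (a : C).

Definition CL2fun : {pred T -> C} :=
  mem [set f : T -> C | [/\ measurable_fun [set: T] (@complex.Re R \o f),
                            measurable_fun [set: T] (@complex.Im R \o f) &
                            finite_norm mu 2%:E (@normc R \o f)]].

Definition CL2norm f : R := fine ('N[mu]_2%:E [EFin \o (@normc R \o f)])%E.

Lemma CL2funP f : (f \in CL2fun) <->
  [/\ measurable_fun [set: T] (@complex.Re R \o f),
      measurable_fun [set: T] (@complex.Im R \o f) &
      finite_norm mu 2%:E (@normc R \o f)].
Proof. by rewrite /CL2fun inE. Qed.

Lemma measurable_normc f : measurable_fun [set: T] (@complex.Re R \o f) ->
  measurable_fun [set: T] (@complex.Im R \o f) ->
  measurable_fun [set: T] (@normc R \o f).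
Proof.
move=> mr mi.
rewrite (_ : _ \o _ = (fun x : R => x `^ 2^-1) \o
    (fun t => complex.Re (f t) ^+ 2 + complex.Im (f t) ^+ 2)); last first.
  apply/funext => t /=; rewrite powR12_sqrt ?addr_ge0 ?sqr_ge0//.
  by case: (f t).
apply: measurableT_comp; first exact: measurable_powR.
by apply: measurable_funD; exact: measurable_funX.
Qed.

Lemma normc_ge0 (z : C) : 0 <= normc z.
Proof. by case: z => a b; exact: sqrtr_ge0. Qed.

Lemma finite_normc_fine f : finite_norm mu 2%:E (@normc R \o f) ->
  (CL2norm f)%:E = ('N[mu]_2%:E [EFin \o (@normc R \o f)])%E.
Proof. by move=> h; rewrite fineK// ge0_fin_numE ?Lnorm_ge0. Qed.

Let LnormcD f g : f \in CL2fun -> g \in CL2fun ->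
  ('N[mu]_2%:E [EFin \o (@normc R \o (f + g)%R)] <=
   'N[mu]_2%:E [EFin \o (@normc R \o f)] +
   'N[mu]_2%:E [EFin \o (@normc R \o g)])%E.
Proof.
move=> /CL2funP[rf jf _] /CL2funP[rg jg _].
have mf := measurable_normc rf jf; have mg := measurable_normc rg jg.
apply: (le_trans _ (@minkowski_EFin _ _ _ mu _ _ 2 mf mg _)); last first.
  by rewrite ler1n.
rewrite Lnorm.unlock; apply: gt0_ler_poweR; first by [].
- by rewrite in_itv/= leey andbT integral_ge0// => x _; exact: poweR_ge0.
- by rewrite in_itv/= leey andbT integral_ge0// => x _; exact: poweR_ge0.
have mfg : measurable_fun [set: T] (@normc R \o (f + g)%R).
  apply: measurable_normc.
    rewrite (_ : _ \o _ = (@complex.Re R \o f) \+ (@complex.Re R \o g)).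
      exact: measurable_funD.
    by apply/funext => t; rewrite /= raddfD.
  rewrite (_ : _ \o _ = (@complex.Im R \o f) \+ (@complex.Im R \o g)).
    exact: measurable_funD.
  by apply/funext => t; rewrite /= raddfD.
apply: ge0_le_integral => //=.
- apply/measurable_EFinP/(@measurableT_comp _ _ _ _ _ _ (@powR R ^~ 2)) => //.
  exact: measurableT_comp.
- apply/measurable_EFinP/(@measurableT_comp _ _ _ _ _ _ (@powR R ^~ 2)) => //.
  by apply: measurableT_comp => //; exact: measurable_funD.
move=> t _; rewrite lee_fin ge0_ler_powR ?nnegrE//.
rewrite !ger0_norm ?addr_ge0 ?normc_ge0//.
exact: le_normcD.
Qed.

Let le1_2 : (1 <= 2%:E :> \bar R)%E. Proof. by rewrite lee_fin ler1n. Qed.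

Let LnormcZ a f : f \in CL2fun ->
  ('N[mu]_2%:E [EFin \o (@normc R \o (a *: f)%R)] =
   (normc a)%:E * 'N[mu]_2%:E [EFin \o (@normc R \o f)])%E.
Proof.
move=> /CL2funP[rf jf nf].
have gP : @normc R \o f \in Lfun mu 2%:E.
  by apply/andP; split; rewrite inE//=; exact: measurable_normc.
rewrite -[in RHS](Lfun_valP le1_2 gP) -[normc a in RHS]ger0_norm ?normc_ge0//.
rewrite -LnormZ; congr Lnorm; apply/funext => t /=.
by congr EFin; exact: normcM.
Qed.

Let CL2funZ a f : f \in CL2fun -> a *: f \in CL2fun.
Proof.
move=> fP; have /CL2funP[rf jf nf] := fP; apply/CL2funP; split.
- rewrite (_ : _ \o _ = (fun t => complex.Re a * complex.Re (f t) -
                                 complex.Im a * complex.Im (f t))).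
    by apply: measurable_funB; apply: measurable_funM => //; exact: measurable_cst.
  by apply/funext => t /=; rewrite fctE; case: a => x y; case: (f t).
- rewrite (_ : _ \o _ = (fun t => complex.Re a * complex.Im (f t) +
                                 complex.Im a * complex.Re (f t))).
    by apply: measurable_funD; apply: measurable_funM => //; exact: measurable_cst.
  by apply/funext => t /=; rewrite fctE; case: a => x y; case: (f t).
- by rewrite /finite_norm LnormcZ// lte_mul_pinfty// lee_fin normc_ge0.
Qed.

Let CL2funD f g : f \in CL2fun -> g \in CL2fun -> f + g \in CL2fun.
Proof.
move=> fP gP; have /CL2funP[rf jf nf] := fP; have /CL2funP[rg jg ng] := gP.
apply/CL2funP; split.
- rewrite (_ : _ \o _ = (@complex.Re R \o f) \+ (@complex.Re R \o g)).
    exact: measurable_funD.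
  by apply/funext => t; rewrite /= raddfD.
- rewrite (_ : _ \o _ = (@complex.Im R \o f) \+ (@complex.Im R \o g)).
    exact: measurable_funD.
  by apply/funext => t; rewrite /= raddfD.
- by apply: (le_lt_trans (LnormcD fP gP)); rewrite lte_add_pinfty.
Qed.

Lemma CL2fun_submod_closed : submod_closed CL2fun.
Proof.
split=> [|a f g fP gP]; last by apply: CL2funD => //; exact: CL2funZ.
apply/CL2funP; split; [exact: measurable_cst..|].
rewrite /finite_norm (_ : EFin \o _ = cst 0%E) ?Lnorm0//.
by apply/funext => t; congr EFin; exact: normc0.
Qed.

HB.instance Definition _ := GRing.isSubmodClosed.Build _ _ CL2fun
  CL2fun_submod_closed.

Record CL2rep := CL2Rep { CL2val :> T -> C ; _ : CL2val \in CL2fun }.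

HB.instance Definition _ := [isSub for CL2val].
HB.instance Definition _ := [Choice of CL2rep by <:].
HB.instance Definition _ := [SubChoice_isSubLmodule of CL2rep by <:].

Definition CL2null : {pred CL2rep} :=
  [pred f | `[< \forall x \ae mu, CL2val f x = 0 >]].

Lemma CL2null_zmod_closed : zmod_closed CL2null.
Proof.
split=> [|f g]; first by apply/asboolP; exact: aeW.
move=> /asboolP f0 /asboolP g0; apply/asboolP.
by apply: filterS2 f0 g0 => x fx gx; rewrite (_ : CL2val (f - g) x = CL2val f x - CL2val g x)// fx gx subr0.
Qed.

HB.instance Definition _ := GRing.isZmodClosed.Build _ CL2null
  CL2null_zmod_closed.

(* L^2 classes: square-integrable functions modulo those vanishing a.e. *)
Definition CL2 : Type := {ideal_quot CL2null}.
HB.instance Definition _ := GRing.Zmodule.on CL2.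
HB.instance Definition _ := EqQuotient.on CL2.

Local Open Scope quotient_scope.

Lemma CL2_piP (f g : CL2rep) :
  \pi_CL2 f = \pi_CL2 g <-> \forall x \ae mu, CL2val f x = CL2val g x.
Proof.
split=> [/eqmodP /asboolP|fg].
  by apply: filterS => x fgx; apply: subr0_eq; exact: fgx.
apply/eqmodP/asboolP; move: fg; apply: filterS => x fgx.
by have /eqP := fgx; rewrite -subr_eq0 => /eqP h; exact: h.
Qed.

Lemma CL2_repr_pi (f : CL2rep) :
  \forall x \ae mu, CL2val (repr (\pi_CL2 f)) x = CL2val f x.
Proof. by apply/CL2_piP; rewrite reprK. Qed.

Definition CL2scale a (u : CL2) : CL2 := \pi_CL2 (a *: repr u).

Let CL2scale_pi a (f : CL2rep) : CL2scale a (\pi_CL2 f) = \pi_CL2 (a *: f).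
Proof.
apply/CL2_piP; have := CL2_repr_pi f; apply: filterS => x fx.
exact: (congr1 (fun z : C => a *: z) fx).
Qed.

Let CL2scaleA a b u : CL2scale a (CL2scale b u) = CL2scale (a * b) u.
Proof. 
rewrite -[u]reprK (CL2scale_pi b (repr u)) (CL2scale_pi a (b *: repr u)).
by rewrite (CL2scale_pi (a * b) (repr u)) scalerA.
Qed.

Let CL2scale1 : left_id 1 CL2scale.
Proof. by move=> u; rewrite /CL2scale scale1r reprK. Qed.

Let CL2scaleDr : right_distributive CL2scale +%R.
Proof.
move=> a u v; rewrite -[u]reprK -[v]reprK -raddfD.
rewrite (CL2scale_pi a (repr u)) (CL2scale_pi a (repr v)).
by rewrite (CL2scale_pi a (repr u + repr v)) scalerDr raddfD.
Qed.

Let CL2scaleDl u : {morph CL2scale^~ u : a b / a + b}.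
Proof. by move=> a b; rewrite /CL2scale scalerDl raddfD. Qed.

HB.instance Definition _ := GRing.Zmodule_isLmodule.Build C CL2
  CL2scaleA CL2scale1 CL2scaleDr CL2scaleDl.

(* The scalars being R[i], the norm of a normed module takes its values in
   R[i] as well. *)
Definition CL2normc (u : CL2) : C := (CL2norm (repr u))%:C%C.

Let CL2norm_ae (f g : CL2rep) : (\forall x \ae mu, CL2val f x = CL2val g x) ->
  CL2norm f = CL2norm g.
Proof.
move=> fg; rewrite /CL2norm Lnorm.unlock; apply: (congr1 (fun z => fine (poweR z _))).
have [/CL2funP[rf jf nf] /CL2funP[rg jg ng]] := (valP f, valP g).
apply: ae_eq_integral => //=.
- apply/measurable_EFinP/(@measurableT_comp _ _ _ _ _ _ (@powR R ^~ 2)) => //.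
  by apply: measurableT_comp => //; exact: measurable_normc.
- apply/measurable_EFinP/(@measurableT_comp _ _ _ _ _ _ (@powR R ^~ 2)) => //.
  by apply: measurableT_comp => //; exact: measurable_normc.
- by apply: filterS fg => x /= -> _.
Qed.

Lemma CL2normc_pi (f : CL2rep) : CL2normc (\pi_CL2 f) = (CL2norm f)%:C%C.
Proof. by congr (_%:C%C); apply: CL2norm_ae; exact: CL2_repr_pi. Qed.

Let CL2norm_fine (f : CL2rep) :
  (CL2norm f)%:E = ('N[mu]_2%:E [EFin \o (@normc R \o f)])%E.
Proof. by apply: finite_normc_fine; have /CL2funP[] := valP f. Qed.

Let ler_CL2normD u v : CL2normc (u + v) <= CL2normc u + CL2normc v.
Proof.
rewrite -[u]reprK -[v]reprK -raddfD !CL2normc_pi -rmorphD lecR.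
have [uP vP] := (valP (repr u), valP (repr v)).
by rewrite -lee_fin EFinD !CL2norm_fine; exact: LnormcD.
Qed.

Let CL2normZ a u : CL2normc (a *: u) = `|a| * CL2normc u.
Proof.
have -> : CL2normc (a *: u) = (CL2norm (a *: repr u))%:C%C.
  exact: (CL2normc_pi (a *: repr u)).
have fP := valP (repr u).
have -> : CL2norm (a *: repr u) = normc a * CL2norm (repr u).
  by apply: EFin_inj; rewrite EFinM !CL2norm_fine; exact: LnormcZ.
exact: (rmorphM (real_complex R) (normc a) (CL2norm (repr u))).
Qed.

Let CL2norm0_eq0 u : CL2normc u = 0 -> u = 0.
Proof.
move=> u0; have f0 : CL2norm (repr u) = 0 := congr1 (@complex.Re R) u0.
have /CL2funP[rf jf nf] := valP (repr u).
have : ('N[mu]_2%:E [EFin \o (@normc R \o repr u)] = 0)%E.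
  by rewrite -finite_normc_fine// f0.
have m : measurable_fun [set: T] (EFin \o (@normc R \o repr u)).
  by apply/measurable_EFinP; exact: measurable_normc.
have p0 : (0 < 2%:E :> \bar R)%E by rewrite lte_fin.
move=> N0; have h := Lnorm_eq0_eq0 m p0 N0.
rewrite -[u]reprK; transitivity (\pi_CL2 (0 : CL2rep)); last exact: raddf0.
apply/CL2_piP; move: h; apply: filterS => x /(_ I)[].
exact: eq0_normc.
Qed.

HB.instance Definition _ := Lmodule_isNormed.Build C CL2
  ler_CL2normD CL2normZ CL2norm0_eq0.

(* The class of f when f is square-integrable (and 0 otherwise). *)
Definition CL2class f : CL2 := \pi_CL2 (insubd (0 : CL2rep) f).

End ComplexL2.
Arguments CL2class {d T R} mu f.

Section Spectrum.
Variables (R : realType) (V : normedModType R[i]).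

(* l is not in the spectrum when l - A has a bounded (i.e. continuous linear)
   two-sided inverse. *)
Definition spectrum (A : V -> V) : set R[i] :=
  [set l | ~ exists S : {linear V -> V}, [/\ continuous S,
     forall u, S (l *: u - A u) = u & forall u, l *: S u - A (S u) = u]].

Definition spectral_radius (A : V -> V) : R :=
  sup [set normc l | l in spectrum A].

Definition eigenvector (A : V -> V) (l : R[i]) (u : V) : Prop :=
  u != 0 /\ A u = l *: u.

End Spectrum.

Section ComplexFunctions.
Variable R : realType.
Implicit Types (z w : R[i]) (a theta : R).

Definition cexp z : R[i] :=
  (expR (complex.Re z))%:C%C
  * (cos (complex.Im z) +i* sin (complex.Im z))%C.

Definition csinh z : R[i] := (cexp z - cexp (- z)) / 2.

(* a ^ w for a real base a > 0. *)
Definition cpow a w : R[i] := cexp (w * (ln a)%:C%C).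

(* sinh (theta z) / sinh (pi z), extended by its limit at z = 0; on strip there
   is no other zero of the denominator. *)
Definition Phat theta z : R[i] :=
  if z == 0 then (theta / pi)%:C%C
  else csinh (theta%:C%C * z) / csinh (pi%:C%C * z).

Definition strip : set R[i] := [set z | `|complex.Im z| < 2^-1].

End ComplexFunctions.
Arguments strip R : clear implicits.

Section Operators.
Variable R : realType.
Implicit Types (x : R * R) (r : R).

Definition circle_measure x r :
    {measure set (caratheodory_type (hausdorff1_on (boundary (disk x r)))) -> \bar R} :=
  hausdorff1_measure (boundary (disk x r)).
Arguments circle_measure : clear implicits.

Definition cintegral d (T : measurableType d)
    (mu : {measure set T -> \bar R}) (f : T -> R[i]) : R[i] :=
  (\int[mu]_y complex.Re (f y) +i* \int[mu]_y complex.Im (f y))%C.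

Definition poisson x r (g : R * R -> R[i]) (z : R * R) : R[i] :=
  (2 * pi)^-1%:C%C * cintegral (circle_measure x r) (fun y =>
    ((r ^+ 2 - edist z x ^+ 2) / (r * edist z y ^+ 2))%:C%C * g y).

(* The operator from L^2 of the circle i to L^2 of the circle j: the Poisson
   integral does not depend on the representative of u, and the extended trace
   is square-integrable, so that CL2class never falls back to 0 here. *)
Definition gamma_op xi ri xj rj
    (u : CL2 (circle_measure xi ri)) : CL2 (circle_measure xj rj) :=
  CL2class (circle_measure xj rj) (fun z =>
    if z \in Gamma_int (disk xj rj) (disk xi ri)
    then poisson xi ri (repr u) z else 0).

End Operators.
Arguments circle_measure {R} x r.
Arguments gamma_op {R} xi ri xj rj u.

(* Main.v *)
Require Import Defs.
From HB Require Import structures.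
From mathcomp Require Import all_boot all_order all_algebra.
From mathcomp.real_closed Require Import complex.
From mathcomp Require Import all_classical all_reals all_analysis.
From mathcomp Require Import measurable_realfun.
From mathcomp Require Import ring lra.
Import Order.TTheory GRing.Theory Num.Theory.
Import numFieldNormedType.Exports.
Import Normc.
Import Defs.
Set Implicit Arguments.
Unset Strict Implicit.
Unset Printing Implicit Defensive.
Local Open Scope classical_set_scope.
Local Open Scope ring_scope.

(** The operator is diagonalized by bipolar coordinates.  Let [P] and [Q] be the
    points where the circles meet, and [tau y = ln (|y - Q| / |y - P|)].  On each
    of the four arcs cut by [P] and [Q], [tau] is a coordinate with values in the
    whole line, and [jac y = |P - Q| / (|y - P| |y - Q|)] is the density, with
    respect to arc length, of the Lebesgue measure of [tau].  The poles are the
    same for both circles.  In these coordinates the Poisson kernel of one disk,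
    from a point of its interior arc to a point [z] of the interior arc of the
    other circle, is the Poisson kernel
      [stripP theta t = sin theta / (2 pi (cosh t + cos theta))]
    of a strip, taken at [t = tau z - tau y] ([poisson_kernel]); from a point of
    the exterior arc it is the same kernel for [pi - theta].  A trace vanishes on
    the exterior arc, so that after one step only the interior arcs matter, and
    there [gamma_1 gamma_2] is the convolution with the kernel twice.

    The coordinate does not carry [L^2] of the arc to [L^2] of the line: [jac] is
    comparable with [exp |tau|], hence the norm of the arc is the one with weight
    [exp (- |t|)].  Convolution with a kernel that decays faster than
    [exp (- |t| / 2)] is bounded for this norm ([arcR_sqr_integral]), and the
    exponentials [exp (i k t)] with [|Im k| < 1/2] belong to the space.  They
    are eigenvectors, with eigenvalue the square of the Fourier transform of the
    kernel, which is [sinh (theta k) / sinh (pi k)] ([ft_stripP]).  The spectrum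
    contains the closure of a set of eigenvalues ([closure_eigenvalues]).

    Conversely let [l] be outside this closure, and [h] the transform of the
    kernel [p].  Then [l - h^2] is bounded below on the strip [|Im z| < 1/2], and
    also, [h] being Lipschitz, on a slightly larger strip.  Hence [h^2 / (l - h^2)]
    is holomorphic and integrable on horizontal lines there, and after a shift of
    the contour its inverse transform [K] is seen to decay faster than
    [exp (- |t| / 2)] ([resolvent_kernel]).  The convolution with [K] is therefore
    bounded, and [l K = p * p + p * (p * K)] says that it gives the resolvent on
    the functions supported by the interior arc ([two_arc_resolvent]); one more
    application of the operator gives the resolvent on the whole space
    ([resolvent_of_remainder]).

    The transform is largest at the boundary points [+- i/2] of the strip, because
    the exponentials of the Fourier integrals are convex functions of [Im z]
    ([Phat_le]); its value [sin (theta / 2)] there gives the spectral radius.  The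
    eigenfunctions of the statement are the exponentials [exp (i k tau)] written
    in terms of the angle ([eigenfunctionE]). *)

(** * Complex-valued functions of a real variable *)

Section ComplexBasics.
Variable R : realType.
Local Notation C := R[i].
Local Notation Re := (@complex.Re R).
Local Notation Im := (@complex.Im R).
Implicit Types (z w : C) (r x : R).

Lemma cx_ext z w : Re z = Re w -> Im z = Im w -> z = w.
Proof. by case: z => a b; case: w => c d /= -> ->. Qed.

Lemma cReD z w : Re (z + w) = Re z + Re w. Proof. by case: z; case: w. Qed.
Lemma cImD z w : Im (z + w) = Im z + Im w. Proof. by case: z; case: w. Qed.
Lemma cReN z : Re (- z) = - Re z. Proof. by case: z. Qed.
Lemma cImN z : Im (- z) = - Im z. Proof. by case: z. Qed.
Lemma cReM z w : Re (z * w) = Re z * Re w - Im z * Im w.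
Proof. by case: z; case: w. Qed.
Lemma cImM z w : Im (z * w) = Re z * Im w + Im z * Re w.
Proof. by case: z; case: w. Qed.

Lemma normc_sqrtE z : normc z = Num.sqrt (Re z ^+ 2 + Im z ^+ 2).
Proof. by case: z. Qed.

Lemma normc_sqr z : normc z ^+ 2 = Re z ^+ 2 + Im z ^+ 2.
Proof. by rewrite normc_sqrtE sqr_sqrtr // addr_ge0 ?sqr_ge0. Qed.

Lemma Re_le_normc z : `|Re z| <= normc z.
Proof.
rewrite -(@ler_pXn2r _ 2) ?nnegrE ?normc_ge0//.
by rewrite normc_sqr real_normK ?num_real// lerDl sqr_ge0.
Qed.

Lemma Im_le_normc z : `|Im z| <= normc z.
Proof.
rewrite -(@ler_pXn2r _ 2) ?nnegrE ?normc_ge0//.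
by rewrite normc_sqr real_normK ?num_real// lerDr sqr_ge0.
Qed.

Lemma normc_le z : normc z <= `|Re z| + `|Im z|.
Proof.
rewrite -(@ler_pXn2r _ 2) ?nnegrE ?normc_ge0 ?addr_ge0//.
rewrite normc_sqr sqrrD !real_normK ?num_real// -addrA lerD2l lerDr.
by rewrite mulrn_wge0 // mulr_ge0.
Qed.

Lemma normc_real r : normc (r%:C)%C = `|r|.
Proof. by rewrite normc_sqrtE /= expr0n addr0 sqrtr_sqr. Qed.

Lemma normc2 : normc (2 : C) = 2.
Proof.
rewrite (_ : (2 : C) = (2%:C)%C) ?normc_real ?ger0_norm//.
by apply: cx_ext => /=; ring.
Qed.

Lemma normcD z w : normc (z + w) <= normc z + normc w.
Proof. exact: le_normcD. Qed.

Lemma normcNE z : normc (- z) = normc z.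
Proof. exact: normcN. Qed.

Lemma normcBC z w : normc (z - w) = normc (w - z).
Proof. by rewrite -normcNE opprB. Qed.

Lemma normcB z w : normc (z - w) <= normc z + normc w.
Proof. by rewrite -(normcNE w) normcD. Qed.

Lemma normc_sub_ge z w : normc z - normc w <= normc (z - w).
Proof. by rewrite lerBlDr -{1}(subrK w z) normcD. Qed.

Lemma normcX z n : normc (z ^+ n) = normc z ^+ n.
Proof. by elim: n => [|n IH]; rewrite ?expr0 ?normc1 // !exprS normcM IH. Qed.

Lemma normc_gt0 z : (0 < normc z) = (z != 0).
Proof.
rewrite lt_neqAle normc_ge0 andbT eq_sym; apply/idP/idP.
  by apply: contra => /eqP ->; rewrite normc0.
by apply: contra => /eqP /eq0_normc ->.
Qed.

Lemma normcJ z : normc (conjc z) = normc z.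
Proof. by rewrite !normc_sqrtE; case: z => a b /=; rewrite sqrrN. Qed.

Lemma normi : normc ('i%C : C) = 1.
Proof. by rewrite normc_sqrtE /= expr0n expr1n add0r sqrtr1. Qed.

Lemma normcE_norm z : `|z| = ((normc z)%:C)%C.
Proof. by []. Qed.

Lemma real_C_M r x : ((r * x)%:C)%C = (r%:C)%C * (x%:C)%C.
Proof. by apply: cx_ext; rewrite ?cReM ?cImM /=; ring. Qed.

Lemma Re_cexp z : Re (cexp z) = expR (Re z) * cos (Im z).
Proof. by rewrite /cexp cReM /= mul0r subr0. Qed.
Lemma Im_cexp z : Im (cexp z) = expR (Re z) * sin (Im z).
Proof. by rewrite /cexp cImM /= mul0r addr0. Qed.

Lemma cexpD z w : cexp (z + w) = cexp z * cexp w.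
Proof.
apply: cx_ext.
  by rewrite [RHS]cReM !(Re_cexp, Im_cexp) cReD cImD expRD cosD; ring.
by rewrite [RHS]cImM !(Re_cexp, Im_cexp) cReD cImD expRD sinD; ring.
Qed.

Lemma cexp0 : cexp 0 = 1 :> C.
Proof. by apply: cx_ext; rewrite ?Re_cexp ?Im_cexp /= ?expR0 ?cos0 ?sin0; ring. Qed.

Lemma normc_cexp z : normc (cexp z) = expR (Re z).
Proof.
rewrite normc_sqrtE Re_cexp Im_cexp !exprMn -mulrDr cos2Dsin2 mulr1 sqrtr_sqr.
by rewrite ger0_norm // expR_ge0.
Qed.

Lemma cexp_neq0 z : cexp z != 0.
Proof. by rewrite -normc_gt0 normc_cexp expR_gt0. Qed.

Lemma cexp_real r : cexp (r%:C)%C = ((expR r)%:C)%C.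
Proof. by apply: cx_ext; rewrite ?Re_cexp ?Im_cexp /= ?cos0 ?sin0; ring. Qed.

Lemma cexpJ z : cexp (conjc z) = conjc (cexp z).
Proof.
by case: z => a b; apply: cx_ext; rewrite ?Re_cexp ?Im_cexp /= ?cosN ?sinN; ring.
Qed.

End ComplexBasics.

Section ComplexDerivative.
Variable R : realType.
Local Notation C := R[i].
Local Notation Re := (@complex.Re R).
Local Notation Im := (@complex.Im R).

(** Derivative with respect to a real variable: the real and imaginary parts are
    differentiable, so that the real theory applies to each. *)
Definition cderive (f : R -> C) (x : R) (l : C) : Prop :=
  is_derive x 1 (fun t => Re (f t)) (Re l) /\
  is_derive x 1 (fun t => Im (f t)) (Im l).

Implicit Types (f g : R -> C) (x : R) (l : C).

Lemma cderive_eq f x l l' : cderive f x l -> l = l' -> cderive f x l'.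
Proof. by move=> h <-. Qed.

Lemma cderive_ext f g x l : f =1 g -> cderive f x l -> cderive g x l.
Proof. by move=> /funext ->. Qed.

Lemma cderive_cst (c : C) x : cderive (fun=> c) x 0.
Proof. by split; exact: is_derive_cst. Qed.

Lemma cderive_real (h : R -> R) x (r : R) :
  is_derive x 1 h r -> cderive (fun t => ((h t)%:C)%C) x (r%:C)%C.
Proof. by move=> hr; split => //=; exact: is_derive_cst. Qed.

Lemma cderiveD f g x l m :
  cderive f x l -> cderive g x m -> cderive (fun t => f t + g t) x (l + m).
Proof.
move=> [f1 f2] [g1 g2]; split; rewrite ?cReD ?cImD.
  by under eq_fun do rewrite cReD; exact: is_deriveD.
by under eq_fun do rewrite cImD; exact: is_deriveD.
Qed.

Lemma cderiveN f x l : cderive f x l -> cderive (fun t => - f t) x (- l).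
Proof.
move=> [f1 f2]; split; rewrite ?cReN ?cImN.
  by under eq_fun do rewrite cReN; exact: is_deriveN.
by under eq_fun do rewrite cImN; exact: is_deriveN.
Qed.

Lemma cderiveM f g x l m : cderive f x l -> cderive g x m ->
  cderive (fun t => f t * g t) x (l * g x + f x * m).
Proof.
move=> [f1 f2] [g1 g2]; split.
  under eq_fun do rewrite cReM.
  apply: is_derive_eq; rewrite /= !cReD !cReM /GRing.scale/=; ring.
under eq_fun do rewrite cImM.
apply: is_derive_eq; rewrite /= !cImD !cImM /GRing.scale/=; ring.
Qed.

Lemma cderiveZ (c : C) f x l : cderive f x l -> cderive (fun t => c * f t) x (c * l).
Proof.
move=> h; apply: cderive_eq (cderiveM (cderive_cst c x) h) _.
by rewrite mul0r add0r.
Qed.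

Lemma cReV (z : C) : Re z^-1 = Re z / (Re z ^+ 2 + Im z ^+ 2).
Proof. by case: z. Qed.
Lemma cImV (z : C) : Im z^-1 = - Im z / (Re z ^+ 2 + Im z ^+ 2).
Proof. by case: z => a b /=; rewrite mulNr. Qed.

Lemma cderiveV f x l : f x != 0 -> cderive f x l ->
  cderive (fun t => (f t)^-1) x (- l / f x ^+ 2).
Proof.
move=> fx0 [f1 f2].
have n0 : Re (f x) ^+ 2 + Im (f x) ^+ 2 != 0.
  by rewrite -normc_sqr sqrf_eq0 gt_eqF // normc_gt0.
have dn : is_derive x 1 (fun t => (Re (f t) ^+ 2 + Im (f t) ^+ 2)^-1)
    (- (2 * (Re (f x) * Re l + Im (f x) * Im l)) / (Re (f x) ^+ 2 + Im (f x) ^+ 2) ^+ 2).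
  have d1 : is_derive x 1 (fun t => Re (f t) ^+ 2 + Im (f t) ^+ 2)
      (2 * (Re (f x) * Re l + Im (f x) * Im l)).
    by apply: is_derive_eq; rewrite /GRing.scale/=; ring.
  have d2 := @is_deriveV R (fun t => Re (f t) ^+ 2 + Im (f t) ^+ 2) x _ 1 n0 d1.
  by apply: is_derive_eq; rewrite /GRing.scale/= mulrC mulrN mulNr.
rewrite (_ : - l / f x ^+ 2 = (- l) * (f x)^-1 ^+ 2); last by rewrite exprVn.
split.
  under eq_fun do rewrite cReV.
  apply: is_derive_eq.
  rewrite expr2 !cReM !cImM !cReV !cImV cReN cImN /GRing.scale/=; field.
  by [].
under eq_fun do rewrite cImV.
apply: is_derive_eq.
rewrite expr2 !cImM !cReM !cReV !cImV cReN cImN /GRing.scale/=; field.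
by [].
Qed.

Lemma cderive_exp f x l : cderive f x l ->
  cderive (fun t => cexp (f t)) x (cexp (f x) * l).
Proof.
move=> [f1 f2].
have de : is_derive x 1 (fun t => expR (Re (f t))) (expR (Re (f x)) * Re l).
  by apply: is_derive_eq; rewrite /GRing.scale/= mulrC.
have dc : is_derive x 1 (fun t => cos (Im (f t))) (- sin (Im (f x)) * Im l).
  by apply: is_derive_eq; rewrite /GRing.scale/= mulrC.
have ds : is_derive x 1 (fun t => sin (Im (f t))) (cos (Im (f x)) * Im l).
  by apply: is_derive_eq; rewrite /GRing.scale/= mulrC.
split.
  under eq_fun do rewrite Re_cexp.
  apply: is_derive_eq; rewrite cReM Re_cexp Im_cexp /GRing.scale/=; ring.
under eq_fun do rewrite Im_cexp.
apply: is_derive_eq; rewrite cImM Re_cexp Im_cexp /GRing.scale/=; ring.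
Qed.

Lemma is_derive0_itv (f : R -> R) u v :
  (forall x, u < x < v -> is_derive x 1 f 0) ->
  forall x y, u < x < v -> u < y < v -> f x = f y.
Proof.
move=> df.
suff H x y : u < x < v -> u < y < v -> x < y -> f x = f y.
  move=> x y hx hy; have [xy|xy|->//] := ltgtP x y; first exact: H.
  by apply/esym; exact: H.
move=> /andP[ux xv] /andP[uy yv] xy.
have d0 z : z \in `]x, y[ -> is_derive z 1 f ((fun=> 0) z).
  rewrite in_itv/= => /andP[xz zy]; apply: df.
  by rewrite (lt_trans ux xz) (lt_trans zy yv).
have cf : {within `[x, y], continuous f}.
  apply: derivable_within_continuous => z; rewrite in_itv/= => /andP[xz zy].
  by apply: ex_derive; apply: df; rewrite (lt_le_trans ux xz) (le_lt_trans zy yv).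
have [c _] := MVT xy d0 cf.
by rewrite mul0r => /eqP; rewrite subr_eq0 => /eqP.
Qed.

Lemma cderive0_itv f u v : (forall x, u < x < v -> cderive f x 0) ->
  forall x y, u < x < v -> u < y < v -> f x = f y.
Proof.
move=> df x y hx hy; apply: cx_ext.
  by apply: (@is_derive0_itv (fun t => Re (f t)) u v) => // z /df[].
by apply: (@is_derive0_itv (fun t => Im (f t)) u v) => // z /df[].
Qed.

Definition ccontinuous f : Prop :=
  continuous (fun t => Re (f t)) /\ continuous (fun t => Im (f t)).

Lemma derive_continuous (h h' : R -> R) :
  (forall x, is_derive x 1 h (h' x)) -> continuous h.
Proof.
by move=> dh x; apply/differentiable_continuous/derivable1_diffP; apply: ex_derive.
Qed.

Lemma cderive_ccontinuous f f' : (forall x, cderive f x (f' x)) -> ccontinuous f.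
Proof.
by move=> h; split; apply: derive_continuous => x; have [] := h x.
Qed.

Lemma ccontinuousM f g : ccontinuous f -> ccontinuous g ->
  ccontinuous (fun t => f t * g t).
Proof.
move=> [f1 f2] [g1 g2]; split => x.
  under eq_fun do rewrite cReM.
  by apply: cvgB; apply: cvgM; [exact: f1|exact: g1|exact: f2|exact: g2].
under eq_fun do rewrite cImM.
by apply: cvgD; apply: cvgM; [exact: f1|exact: g2|exact: f2|exact: g1].
Qed.

Lemma ccontinuousD f g : ccontinuous f -> ccontinuous g ->
  ccontinuous (fun t => f t + g t).
Proof.
move=> [f1 f2] [g1 g2]; split => x.
  under eq_fun do rewrite cReD.
  by apply: cvgD; [exact: f1|exact: g1].
under eq_fun do rewrite cImD.
by apply: cvgD; [exact: f2|exact: g2].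
Qed.

Lemma ccontinuous_cst (c : C) : ccontinuous (fun=> c).
Proof. by split => x; exact: cvg_cst. Qed.

Lemma ccontinuous_real (h : R -> R) : continuous h -> ccontinuous (fun t => ((h t)%:C)%C).
Proof. by move=> ch; split => //= x; exact: cvg_cst. Qed.

Lemma ccontinuous_comp f (h : R -> R) : ccontinuous f -> continuous h ->
  ccontinuous (f \o h).
Proof.
move=> [f1 f2] ch; split => x.
  exact: (@continuous_comp _ _ _ h (fun t => Re (f t)) x (ch x) (f1 (h x))).
exact: (@continuous_comp _ _ _ h (fun t => Im (f t)) x (ch x) (f2 (h x))).
Qed.

End ComplexDerivative.

(** * Integrals of complex-valued functions *)

Section ComplexIntegral.
Variable R : realType.
Local Notation C := R[i].
Local Notation Re := (@complex.Re R).
Local Notation Im := (@complex.Im R).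

Definition cmeas d (T : measurableType d) (f : T -> C) : Prop :=
  measurable_fun [set: T] (fun t => Re (f t)) /\
  measurable_fun [set: T] (fun t => Im (f t)).

Definition cintegrable d (T : measurableType d) (mu : {measure set T -> \bar R})
    (f : T -> C) : Prop :=
  mu.-integrable [set: T] (fun t => (Re (f t))%:E) /\
  mu.-integrable [set: T] (fun t => (Im (f t))%:E).

Section meas.
Context d (T : measurableType d).
Implicit Types f g : T -> C.

Lemma cmeas_cst (c : C) : cmeas ((fun=> c) : T -> C).
Proof. by split; exact: measurable_cst. Qed.

Lemma cmeas_real (h : T -> R) : measurable_fun [set: T] h ->
  cmeas (fun t => ((h t)%:C)%C).
Proof. by move=> mh; split => //=; exact: measurable_cst. Qed.

Lemma cmeasD f g : cmeas f -> cmeas g -> cmeas (fun t => f t + g t).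
Proof.
move=> [f1 f2] [g1 g2]; split.
  by under eq_fun do rewrite cReD; exact: measurable_funD.
by under eq_fun do rewrite cImD; exact: measurable_funD.
Qed.

Lemma cmeasM f g : cmeas f -> cmeas g -> cmeas (fun t => f t * g t).
Proof.
move=> [f1 f2] [g1 g2]; split.
  by under eq_fun do rewrite cReM; apply: measurable_funB; exact: measurable_funM.
by under eq_fun do rewrite cImM; apply: measurable_funD; exact: measurable_funM.
Qed.

Lemma cmeasZ (c : C) f : cmeas f -> cmeas (fun t => c * f t).
Proof. by move=> mf; apply: cmeasM => //; exact: cmeas_cst. Qed.

Lemma cmeasB f g : cmeas f -> cmeas g -> cmeas (fun t => f t - g t).
Proof.
move=> mf mg; rewrite (_ : (fun _ => _) = (fun t => f t + (-1) * g t)).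
  by apply: cmeasD => //; exact: cmeasZ.
by apply/funext => t; rewrite mulN1r.
Qed.

Lemma cmeas_ind (A : set T) : measurable A -> cmeas (fun t => ((\1_A t : R)%:C)%C).
Proof. by move=> mA; apply: cmeas_real; exact: measurable_indic. Qed.

Lemma if_indC (A : set T) (f : T -> C) t :
  (if t \in A then f t else 0) = ((\1_A t : R)%:C)%C * f t.
Proof. by rewrite indicE; case: ifP => _; rewrite ?mul1r ?mul0r. Qed.

Lemma cmeas_if (A : set T) f : measurable A -> cmeas f ->
  cmeas (fun t => if t \in A then f t else 0).
Proof.
move=> mA mf; under eq_fun do rewrite if_indC.
by apply: cmeasM => //; exact: cmeas_ind.
Qed.

Lemma cmeas_normc f : cmeas f -> measurable_fun [set: T] (fun t => normc (f t)).
Proof. by move=> [f1 f2]; exact: measurable_normc. Qed.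

End meas.

Lemma cmeas_comp d d' (T : measurableType d) (T' : measurableType d')
    (f : T' -> C) (h : T -> T') : cmeas f -> measurable_fun [set: T] h ->
  cmeas (f \o h).
Proof.
move=> [f1 f2] mh; split.
  exact: (@measurableT_comp _ _ _ _ _ _ (fun t => Re (f t)) _ h).
exact: (@measurableT_comp _ _ _ _ _ _ (fun t => Im (f t)) _ h).
Qed.

Lemma cmeas_continuous (f : measurableTypeR R -> C) : ccontinuous f -> cmeas f.
Proof. by move=> [f1 f2]; split; exact: continuous_measurable_fun. Qed.

Section integral.
Context d (T : measurableType d) (mu : {measure set T -> \bar R}).
Implicit Types f g : T -> C.

Lemma cintegrable_cmeas f : cintegrable mu f -> cmeas f.
Proof.
by move=> [/measurable_int/measurable_EFinP ? /measurable_int/measurable_EFinP ?].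
Qed.

Lemma cintegrable_dom f (g : T -> R) : cmeas f ->
  mu.-integrable [set: T] (fun t => (g t)%:E) -> (forall t, normc (f t) <= g t) ->
  cintegrable mu f.
Proof.
move=> [f1 f2] ig fg; split.
  apply: (le_integrable _ _ _ ig) => //; first exact/measurable_EFinP.
  move=> t _ /=; rewrite lee_fin (le_trans (Re_le_normc _))//.
  by rewrite (le_trans (fg t))// ler_norm.
apply: (le_integrable _ _ _ ig) => //; first exact/measurable_EFinP.
move=> t _ /=; rewrite lee_fin (le_trans (Im_le_normc _))//.
by rewrite (le_trans (fg t))// ler_norm.
Qed.

Lemma cintegrable_normc f : cintegrable mu f ->
  mu.-integrable [set: T] (fun t => (normc (f t))%:E).
Proof.
move=> h; have mf := cintegrable_cmeas h; have [h1 h2] := h.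
have h3 : mu.-integrable [set: T] (fun t => `|(Re (f t))%:E| + `|(Im (f t))%:E|)%E.
  by apply: integrableD => //; exact: integrable_abse.
apply: (le_integrable _ _ _ h3) => //.
  by apply/measurable_EFinP; exact: cmeas_normc.
move=> t _ /=; rewrite lee_fin ger0_norm ?normc_ge0//.
by rewrite (le_trans (normc_le _))// ler_norm.
Qed.

Lemma cintegrableD f g : cintegrable mu f -> cintegrable mu g ->
  cintegrable mu (fun t => f t + g t).
Proof.
move=> [f1 f2] [g1 g2]; split.
  by under eq_fun do rewrite cReD EFinD; exact: integrableD.
by under eq_fun do rewrite cImD EFinD; exact: integrableD.
Qed.

Lemma cintegrableZ (c : C) f : cintegrable mu f -> cintegrable mu (fun t => c * f t).
Proof.
move=> h; have hn := cintegrable_normc h; have mf := cintegrable_cmeas h.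
have hc : mu.-integrable [set: T] (fun t => ((normc c)%:E * (normc (f t))%:E)%E).
  exact: integrableZl.
apply: (@cintegrable_dom _ (fun t => normc c * normc (f t))) => //.
  exact: cmeasZ.
by move=> t; rewrite normcM.
Qed.

Lemma cintegral_ext f g : f =1 g -> cintegral mu f = cintegral mu g.
Proof. by move=> /funext ->. Qed.

Lemma cintegralD f g : cintegrable mu f -> cintegrable mu g ->
  cintegral mu (fun t => f t + g t) = cintegral mu f + cintegral mu g.
Proof.
move=> [f1 f2] [g1 g2]; rewrite /cintegral; apply: cx_ext => /=.
  by under eq_Rintegral do rewrite cReD; exact: RintegralD.
by under eq_Rintegral do rewrite cImD; exact: RintegralD.
Qed.

Lemma cintegralZ (c : C) f : cintegrable mu f ->
  cintegral mu (fun t => c * f t) = c * cintegral mu f.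
Proof.
move=> [f1 f2]; rewrite /cintegral; apply: cx_ext => /=.
  under eq_Rintegral do rewrite cReM.
  have k1 : mu.-integrable [set: T] (fun t => (Re c * Re (f t))%:E).
    by under eq_fun do rewrite EFinM; exact: integrableZl.
  have k2 : mu.-integrable [set: T] (fun t => (Im c * Im (f t))%:E).
    by under eq_fun do rewrite EFinM; exact: integrableZl.
  by rewrite RintegralB// cReM/= !RintegralZl.
under eq_Rintegral do rewrite cImM.
have k1 : mu.-integrable [set: T] (fun t => (Re c * Im (f t))%:E).
  by under eq_fun do rewrite EFinM; exact: integrableZl.
have k2 : mu.-integrable [set: T] (fun t => (Im c * Re (f t))%:E).
  by under eq_fun do rewrite EFinM; exact: integrableZl.
by rewrite RintegralD// cImM/= !RintegralZl.
Qed.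

Lemma cintegralB f g : cintegrable mu f -> cintegrable mu g ->
  cintegral mu (fun t => f t - g t) = cintegral mu f - cintegral mu g.
Proof.
move=> hf hg.
rewrite (_ : (fun _ => _) = (fun t => f t + (-1) * g t)); last first.
  by apply/funext => t; rewrite mulN1r.
by rewrite cintegralD ?cintegralZ ?mulN1r//; exact: cintegrableZ.
Qed.

Lemma cintegral0 : cintegral mu (fun=> (0 : C)) = 0.
Proof. by apply: cx_ext => /=; rewrite /Rintegral integral0. Qed.

(** The triangle inequality with constant 1: rotate the integral to the
    positive real axis and integrate real parts. *)
Lemma normc_cintegral f : cintegrable mu f ->
  normc (cintegral mu f) <= \int[mu]_t normc (f t).
Proof.
move=> h; have hn := cintegrable_normc h.
set I := cintegral mu f; have [->|I0] := eqVneq I 0.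
  by rewrite normc0; apply: Rintegral_ge0 => t _; exact: normc_ge0.
pose w : C := conjc I / ((normc I)%:C)%C.
have nI : normc I != 0 by rewrite gt_eqF // normc_gt0.
have wI : w * I = ((normc I)%:C)%C.
  have -> : w * I = ((normc I)%:C)%C^-1 * (conjc I * I) by rewrite /w; ring.
  have -> : conjc I * I = ((normc I ^+ 2)%:C)%C.
    by rewrite normc_sqr; case: (I) => a b; apply: cx_ext => /=; ring.
  rewrite expr2 real_C_M mulrA mulVf ?mul1r//.
  by rewrite -normc_gt0 normc_real gtr0_norm normc_gt0.
have w1 : normc w = 1.
  by rewrite normcM normcV normcJ normc_real ger0_norm ?normc_ge0// mulfV.
have := cintegralZ w h; rewrite -/I wI => /(congr1 Re) /= <-.
have [h1 _] := cintegrableZ w h.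
apply: le_Rintegral => // t _.
by rewrite (le_trans (ler_norm _))// (le_trans (Re_le_normc _))// normcM w1 mul1r.
Qed.

Lemma normc_cintegral_le f (g : T -> R) : cmeas f ->
  mu.-integrable [set: T] (fun t => (g t)%:E) -> (forall t, normc (f t) <= g t) ->
  normc (cintegral mu f) <= \int[mu]_t g t.
Proof.
move=> mf ig fg; have h := cintegrable_dom mf ig fg.
apply: (le_trans (normc_cintegral h)); apply: le_Rintegral => //.
exact: cintegrable_normc.
Qed.

Lemma cintegral_ae f g : cmeas f -> cmeas g -> (\forall t \ae mu, f t = g t) ->
  cintegral mu f = cintegral mu g.
Proof.
move=> [f1 f2] [g1 g2] fg; apply: cx_ext => /=; rewrite /Rintegral; congr fine.
  apply: ae_eq_integral => //; try exact/measurable_EFinP.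
  by apply: filterS fg => t /= -> _.
apply: ae_eq_integral => //; try exact/measurable_EFinP.
by apply: filterS fg => t /= -> _.
Qed.

(** Dominated convergence, for the integrals of the moduli of the errors. *)
Lemma Rintegral_dom_cvg0 (h : nat -> T -> R) (g : T -> R) :
  (forall n, measurable_fun [set: T] (h n)) ->
  (forall n t, 0 <= h n t <= g t) ->
  mu.-integrable [set: T] (fun t => (g t)%:E) ->
  (\forall t \ae mu, h ^~ t @ \oo --> 0) ->
  (\int[mu]_t h n t) @[n --> \oo] --> (0 : R).
Proof.
move=> mh hg ig h0.
have mh' n : measurable_fun [set: T] (fun t => (h n t)%:E).
  by apply/measurable_EFinP; exact: mh.
have H : (\int[mu]_t (h n t)%:E)%E @[n --> \oo] --> (0 : R)%:E.
  rewrite (_ : 0%:E = \int[mu]_t (cst 0%E t : \bar R))%E; last by rewrite integral0.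
  have [] // := @dominated_convergence _ _ _ mu [set: T] measurableT
    (fun n t => (h n t)%:E) (cst 0%E) (fun t => (g t)%:E) mh' (measurable_cst _).
    apply: filterS h0 => t /= ht _; apply: cvg_EFin => //; exact: nearW.
  apply: aeW => t n _; rewrite lee_fin ger0_norm; last by case/andP: (hg n t).
  by case/andP: (hg n t).
exact: (fine_cvg H).
Qed.

End integral.

Section fubini.
Context d1 d2 (T1 : measurableType d1) (T2 : measurableType d2).
Variables (m1 : {sigma_finite_measure set T1 -> \bar R})
          (m2 : {sigma_finite_measure set T2 -> \bar R}).

Lemma Rintegral_fubini (F : T1 * T2 -> R) :
  (m1 \x m2)%E.-integrable [set: T1 * T2] (fun z => (F z)%:E) ->
  \int[m1]_x \int[m2]_y F (x, y) = \int[m2]_y \int[m1]_x F (x, y).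
Proof.
move=> iF; rewrite {1 3}/Rintegral; congr fine.
transitivity (\int[m1]_x \int[m2]_y (F (x, y))%:E)%E.
  have iG := integrable_fubini_F iF.
  apply: ae_eq_integral => //.
  - apply/measurable_EFinP/measurableT_comp => //.
    exact: (measurable_int _ iG).
  - exact: (measurable_int _ iG).
  - have := integrable_ae measurableT iG.
    by apply: filterS => x /= /(_ I) hx _; rewrite /Rintegral fineK.
rewrite (Fubini iF).
have mG := measurable_fubini_G iF.
apply: ae_eq_integral => //.
- by apply/measurable_EFinP/measurableT_comp.
- have := ae_integrable2 iF.
  by apply: filterS => x /= hx _; rewrite /Rintegral fineK// integrable_fin_num.
Qed.

(** The hypothesis is stated on the modulus; it bounds both components. *)
Lemma cFubini (F : T1 * T2 -> C) : cmeas F ->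
  (\int[m1]_x \int[m2]_y (normc (F (x, y)))%:E < +oo)%E ->
  cintegral m1 (fun x => cintegral m2 (fun y => F (x, y))) =
  cintegral m2 (fun y => cintegral m1 (fun x => F (x, y))).
Proof.
move=> mF finF; have [F1 F2] := mF.
have mn := cmeas_normc mF.
have iN : (m1 \x m2)%E.-integrable [set: T1 * T2] (fun z => (normc (F z))%:E).
  apply/integrable12ltyP; first exact/measurable_EFinP.
  under eq_integral do under eq_integral do rewrite gee0_abs ?lee_fin ?normc_ge0//.
  by [].
have [I1 I2] := cintegrable_dom mF iN (fun=> lexx _).
apply: cx_ext; first exact: (Rintegral_fubini (F := fun z => Re (F z))).
exact: (Rintegral_fubini (F := fun z => Im (F z))).
Qed.

Lemma cmeas_cintegral (F : T1 * T2 -> C) : cmeas F ->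
  cmeas (fun x => cintegral m2 (fun y => F (x, y))).
Proof.
have key (G : T1 * T2 -> R) : measurable_fun [set: T1 * T2] G ->
    measurable_fun [set: T1] (fun x => \int[m2]_y G (x, y)).
  move=> mG; rewrite /Rintegral; apply: measurableT_comp => //.
  pose E : T1 * T2 -> \bar R := EFin \o G.
  have mE : measurable_fun [set: T1 * T2] E by exact/measurable_EFinP.
  under eq_fun do rewrite integralE.
  apply: emeasurable_funB.
    have H : measurable_fun [set: T1] (fubini_F m2 (E^\+)%E).
      apply: measurable_fun_fubini_tonelli_F; first exact: measurable_funepos.
      by move=> z; exact: funepos_ge0.
    rewrite (_ : (fun x => _) = fubini_F m2 (E^\+)%E)//.
    by apply/funext => x; apply: eq_integral => y _; rewrite /E !funeposE.
  have H : measurable_fun [set: T1] (fubini_F m2 (E^\-)%E).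
    apply: measurable_fun_fubini_tonelli_F; first exact: measurable_funeneg.
    by move=> z; exact: funeneg_ge0.
  rewrite (_ : (fun x => _) = fubini_F m2 (E^\-)%E)//.
  by apply/funext => x; apply: eq_integral => y _; rewrite /E !funenegE.
move=> [F1 F2]; split; first exact: (key (fun z => Re (F z))).
exact: (key (fun z => Im (F z))).
Qed.

End fubini.

End ComplexIntegral.

(** * Integrals over the line and shifts of contours *)

Section LineIntegrals.
Variable R : realType.
Local Notation C := R[i].
Local Notation Re := (@complex.Re R).
Local Notation Im := (@complex.Im R).
Local Notation mu := (@lebesgue_measure R).

Lemma le_expR (x : R) : x <= expR x.
Proof. by rewrite (le_trans _ (expR_ge1Dx x))// lerDr. Qed.

Lemma continuous_expabs (a : R) : continuous (fun t : R => expR (- (a * `|t|))).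
Proof.
move=> x; apply: (@continuous_comp _ _ _ (fun t => - (a * `|t|)) expR); last first.
  exact: continuous_expR.
apply: cvgN; apply: cvgM; first exact: cvg_cst.
exact: norm_continuous.
Qed.

Lemma cvgy_expRN (a : R) : 0 < a -> expR (- (a * x)) @[x --> +oo] --> (0 : R).
Proof.
move=> a0; apply: (@cvg_comp _ _ _ (fun x : R => a * x) (fun y => expR (- y)) _ +oo).
  by apply: gt0_cvgMry => //; exact: cvg_id.
exact: cvgr_expR.
Qed.

Lemma integral_expabs (a : R) : 0 < a ->
  (\int[mu]_t (expR (- (a * `|t|)))%:E = (2 / a)%:E)%E.
Proof.
move=> a0; rewrite ge0_symfun_integralT; last 3 first.
- by move=> x; exact: expR_ge0.
- exact: continuous_expabs.
- by move=> x /=; rewrite normrN.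
rewrite -set_itvcy.
have -> : (\int[mu]_(x in `[0%R, +oo[) (expR (- (a * `|x|)))%:E =
  \int[mu]_(x in `[0%R, +oo[) (expR (- (a * x)))%:E)%E.
  apply: eq_integral => x; rewrite inE/= in_itv/= andbT => x0.
  by rewrite ger0_norm.
have dF (x : R) : is_derive x 1 (fun x => - (a^-1 * expR (- (a * x)))) (expR (- (a * x))).
  apply: is_derive_eq; rewrite /GRing.scale/=.
  by rewrite mulr1; field; rewrite gt_eqF.
rewrite (@ge0_continuous_FTC2y _ _ (fun x => - (a^-1 * expR (- (a * x)))) 0 0).
- rewrite mulr0 oppr0 expR0 mulr1 -EFinB -EFinM; congr EFin; field.
  by rewrite gt_eqF.
- by move=> x _; exact: expR_ge0.
- apply: continuous_subspaceT => x.
  apply: (@continuous_comp _ _ _ (fun t => - (a * t)) expR); last exact: continuous_expR.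
  by apply: cvgN; apply: cvgM; [exact: cvg_cst|exact: cvg_id].
- rewrite -[X in _ --> X]oppr0 -[X in _ --> - X](mulr0 a^-1).
  by apply: cvgN; apply: cvgM; [exact: cvg_cst|exact: cvgy_expRN].
- by move=> x _; apply: ex_derive.
- by apply: cvg_at_right_filter; exact: (derive_continuous dF).
- by move=> x _; rewrite derive1E; exact: derive_val.
Qed.

Lemma integrable_expabs (a M : R) : 0 < a ->
  mu.-integrable [set: R] (fun t => (M * expR (- (a * `|t|)))%:E).
Proof.
move=> a0; under eq_fun do rewrite EFinM; apply: integrableZl => //.
apply/integrableP; split.
  apply/measurable_EFinP; apply: continuous_measurable_fun; exact: continuous_expabs.
under eq_integral do rewrite gee0_abs ?lee_fin ?expR_ge0//.
by rewrite integral_expabs// ltry.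
Qed.

Lemma Rintegral_expabs (a : R) : 0 < a -> \int[mu]_t (expR (- (a * `|t|))) = 2 / a.
Proof. by move=> a0; rewrite /Rintegral integral_expabs. Qed.

Lemma abs_expabs (a c t : R) : 0 < c ->
  `|t| * expR (- (a * `|t|)) <= c^-1 * expR (- ((a - c) * `|t|)).
Proof.
move=> c0; have -> : - ((a - c) * `|t|) = c * `|t| + - (a * `|t|) by ring.
rewrite expRD mulrA ler_wpM2r ?expR_ge0// mulrC ler_pdivlMr// mulrC.
exact: le_expR.
Qed.

(** Lebesgue measure is determined by its values on intervals, so that a map
    which multiplies the lengths of intervals by [k] changes variables. *)
Lemma scaling_integral (k : R) (h : R -> R) (f : R -> R) : 0 < k ->
  measurable_fun [set: R] h ->
  (forall u v, u < v -> mu (h @^-1` `]u, v]) = (k * (v - u))%:E) ->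
  mu.-integrable [set: R] (EFin \o f) ->
  mu.-integrable [set: R] (EFin \o (f \o h)) /\
  \int[mu]_t f (h t) = k * \int[mu]_t f t.
Proof.
move=> k0 mh hmu intf.
have k'0 : 0 <= k^-1 by rewrite invr_ge0 ltW.
pose kV := NngNum k'0; pose kN := NngNum (ltW k0).
have eqm (A : set R) : measurable A ->
    pushforward mu (h : _ -> measurableTypeR R) A = mscale kN mu A.
  move=> mA.
  have -> : mscale kN mu A = (k%:E * mu A)%E by [].
  have -> : mu A = mscale kV (pushforward mu (h : _ -> measurableTypeR R)) A.
    move=> m; apply: lebesgue_measure_unique => //.
    move=> X /ocitvP[->|[[u v] /= uv ->]]; first by rewrite !measure0.
    transitivity ((k^-1)%:E * mu (h @^-1` `]u, v]))%E; last by [].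
    rewrite hmu// lebesgue_measure_itv/= lte_fin uv.
    by rewrite -EFinM mulrA mulVf ?mul1r ?gt_eqF// EFinB.
  by rewrite /mscale/= muleA -EFinM mulfV ?gt_eqF// mul1e.
have ge0int (g : R -> \bar R) : measurable_fun [set: R] g -> (forall x, 0 <= g x)%E ->
    (\int[mu]_x g (h x) = k%:E * \int[mu]_x g x)%E.
  move=> mg g0; have := @ge0_integral_pushforward _ _ (measurableTypeR R) (measurableTypeR R) R h mh mu setT g measurableT mg.
  rewrite preimage_setT => <-; last by move=> y _; exact: g0.
  rewrite [LHS](eq_measure_integral (mscale kN mu)); last by move=> A mA _; exact: eqm.
  by rewrite ge0_integral_mscale.
have [mf finf] := integrableP _ _ _ intf.
have mfh : measurable_fun [set: R] (EFin \o (f \o h)).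
  exact: (measurableT_comp mf mh).
have ifh : mu.-integrable [set: R] (EFin \o (f \o h)).
  apply/integrableP; split => //.
  rewrite (ge0int (fun x => `|(EFin \o f) x|)%E) => //.
    by rewrite lte_mul_pinfty// lee_fin ltW.
  exact: measurableT_comp.
split => //; rewrite /Rintegral -[k * _]/(fine k%:E * _) -fineM//; last first.
  exact: integrable_fin_num.
congr fine.
rewrite integralE [in RHS]integralE muleBr//; last first.
  by rewrite fin_num_adde_defl// fin_numN integrable_neg_fin_num.
congr (_ - _)%E.
  rewrite -(ge0int (EFin \o f)^\+%E); first by apply: eq_integral => x _; rewrite !funeposE.
    exact: measurable_funepos.
  by move=> x; exact: funepos_ge0.
rewrite -(ge0int (EFin \o f)^\-%E); first by apply: eq_integral => x _; rewrite !funenegE.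
  exact: measurable_funeneg.
by move=> x; exact: funeneg_ge0.
Qed.

Lemma cintegral_reflect (f : R -> C) (a : R) : cintegrable mu f ->
  cintegrable mu (fun t => f (a - t)) /\
  cintegral mu (fun t => f (a - t)) = cintegral mu f.
Proof.
have mh : measurable_fun [set: R] (fun t : R => a - t).
  by apply: measurable_funB => //; exact: measurable_cst.
have hmu u v : u < v -> mu ((fun t => a - t) @^-1` `]u, v]) = (1 * (v - u))%:E.
  move=> uv; rewrite (_ : _ @^-1` _ = `[a - v, a - u[%classic).
    rewrite lebesgue_measure_itv/= lte_fin ltrD2l ltrN2 uv -EFinB.
    by congr EFin; ring.
  apply/seteqP; split => t /=; rewrite !in_itv/= => /andP[h1 h2]; apply/andP; split; lra.
move=> [f1 f2].
have [g1 e1] := scaling_integral ltr01 mh hmu f1.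
have [g2 e2] := scaling_integral ltr01 mh hmu f2.
by split=> //; apply: cx_ext; rewrite /= ?e1 ?e2 mul1r.
Qed.

Lemma cintegral_affine (f : R -> C) (c a : R) : 0 < c -> cintegrable mu f ->
  cintegrable mu (fun t => f (c * t + a)) /\
  cintegral mu (fun t => f (c * t + a)) = (c^-1%:C)%C * cintegral mu f.
Proof.
move=> c0; have mh : measurable_fun [set: R] (fun t : R => c * t + a).
  apply: measurable_funD; last exact: measurable_cst.
  by apply: measurable_funM => //; exact: measurable_cst.
have hmu u v : u < v -> mu ((fun t => c * t + a) @^-1` `]u, v]) = (c^-1 * (v - u))%:E.
  move=> uv; rewrite (_ : _ @^-1` _ = `](u - a) / c, (v - a) / c]%classic).
    rewrite lebesgue_measure_itv/= lte_fin ltr_pM2r ?invr_gt0// ltrD2r uv -EFinB.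
    by congr EFin; ring.
  apply/seteqP; split => t /=; rewrite !in_itv/= ltr_pdivrMr// ler_pdivlMr//;
    by move=> /andP[h1 h2]; apply/andP; split; lra.
have cV : 0 < c^-1 by rewrite invr_gt0.
move=> [f1 f2].
have [g1 e1] := scaling_integral cV mh hmu f1.
have [g2 e2] := scaling_integral cV mh hmu f2.
split=> //; apply: cx_ext; rewrite ?cReM ?cImM /= ?e1 ?e2; ring.
Qed.

(** The primitive tends to 0 at both ends of the line. *)
Lemma Rintegral_derivative0 (F f : R -> R) (M c : R) : 0 < c ->
  (forall x : R, is_derive x 1 F (f x)) -> continuous f ->
  (forall x, `|F x| <= M * expR (- (c * `|x|))) ->
  mu.-integrable [set: R] (EFin \o f) -> \int[mu]_x f x = 0.
Proof.
move=> c0 dF cf bF intf.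
pose D (n : nat) : set R := `[- (n.+1%:R : R), n.+1%:R]%classic.
have mf := measurable_int _ intf.
have FTC n : (\int[mu]_(x in D n) (f x)%:E = (F n.+1%:R - F (- n.+1%:R))%:E)%E.
  rewrite EFinB /D; apply: continuous_FTC2.
  - by rewrite gtrN.
  - exact: continuous_subspaceT.
  - split; first by move=> x _; apply: ex_derive.
      by apply: cvg_at_right_filter; exact: (derive_continuous dF).
    by apply: cvg_at_left_filter; exact: (derive_continuous dF).
  - by move=> x _; rewrite derive1E; exact: derive_val.
have mD n : measurable (D n) by exact: measurable_itv.
have cv : (\int[mu]_(x in D n) (f x)%:E)%E @[n --> \oo] --> (\int[mu]_x (f x)%:E)%E.
  under eq_fun do rewrite integral_mkcond.
  apply: (@dominated_cvg _ _ _ mu [set: R] measurableT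
    (fun n => (EFin \o f) \_ (D n)) (EFin \o f) (fun x => `|(f x)%:E|)%E) => //.
  - move=> n; apply/(measurable_restrictT _ (mD n)).
    exact: (measurable_funS _ _ mf).
  - move=> x _; apply: cvg_near_cst.
    near=> n; rewrite /patch; case: ifPn => //; rewrite notin_setE => -[].
    rewrite /D/= in_itv/= -ler_norml.
    near: n; have [N hN] : exists N : nat, `|x| < N%:R.
      by exists (Num.bound `|x|); apply: archi_boundP.
    by exists N => // n /= Nn; rewrite (le_trans (ltW hN))// ler_nat (leq_trans Nn).
  - exact: integrable_abse.
  - move=> n x _; rewrite /patch; case: ifP => _ //=.
    by rewrite normr0 lee_fin.
have c2 : (F n.+1%:R - F (- n.+1%:R)) @[n --> \oo] --> (0 : R).
  apply/norm_cvg0P.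
  apply: (@squeeze_cvgr _ _ _ _ (fun=> 0) (fun n : nat => (2 * M) * expR (- (c * n.+1%:R)))).
  - near=> n; rewrite normr_ge0 /=.
    rewrite (le_trans (ler_normB _ _))// mulr2n mulrDl mul1r mulrDl lerD//.
      by rewrite (le_trans (bF _))// ger0_norm.
    by rewrite (le_trans (bF _))// normrN ger0_norm.
  - exact: cvg_cst.
  - rewrite -[X in _ --> X](mulr0 (2 * M)); apply: cvgM; first exact: cvg_cst.
    apply: (@cvg_comp _ _ _ (fun n : nat => n.+1%:R : R) (fun y => expR (- (c * y))) _ +oo).
      by rewrite (cvg_shiftS (fun n => n%:R : R)); exact: cvgr_idn.
    exact: cvgy_expRN.
have c3 : (\int[mu]_(x in D n) (f x)%:E)%E @[n --> \oo] --> (0%:E : \bar R).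
  by under eq_fun do rewrite FTC; apply: cvg_EFin => //; exact: nearW.
have e : (\int[mu]_x (f x)%:E)%E = 0%:E.
  exact: (cvg_unique _ cv c3).
by rewrite /Rintegral e.
Unshelve. all: by end_near. Qed.

Lemma cintegral_derivative0 (F f : R -> C) (M c : R) : 0 < c ->
  (forall x, cderive F x (f x)) -> ccontinuous f ->
  (forall x, normc (F x) <= M * expR (- (c * `|x|))) ->
  cintegrable mu f -> cintegral mu f = 0.
Proof.
move=> c0 dF [cf1 cf2] bF [i1 i2]; apply: cx_ext => /=.
  apply: (@Rintegral_derivative0 (fun x => Re (F x)) _ M c) => //.
    by move=> x; have [] := dF x.
  by move=> x; exact: le_trans (Re_le_normc _) (bF x).
apply: (@Rintegral_derivative0 (fun x => Im (F x)) _ M c) => //.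
  by move=> x; have [] := dF x.
by move=> x; exact: le_trans (Im_le_normc _) (bF x).
Qed.

Section under.
Context d (T : measurableType d) (nu : {measure set T -> \bar R}).

(** Differentiation under the integral sign, for each component. *)
Lemma cderive_under (f f' : R -> T -> C) (g : T -> R) (u v a : R) : u < a < v ->
  (forall x, u < x < v -> cintegrable nu (f x)) ->
  (forall x t, u < x < v -> cderive (f^~ t) x (f' x t)) ->
  nu.-integrable [set: T] (fun t => (g t)%:E) ->
  (forall x t, u < x < v -> normc (f' x t) <= g t) ->
  cderive (fun x => cintegral nu (f x)) a (cintegral nu (f' a)).
Proof.
move=> auv inf df ig bf.
have key (k k' : R -> T -> R) :
  (forall x, u < x < v -> nu.-integrable [set: T] (EFin \o k x)) ->
  (forall x t, u < x < v -> is_derive x 1 (k^~ t) (k' x t)) ->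
  (forall x t, u < x < v -> `|k' x t| <= g t) ->
  is_derive a 1 (fun x => \int[nu]_t k x t) (\int[nu]_t k' a t).
  move=> ik dk bk.
  have Ia : `]u, v[%classic a by rewrite /= in_itv.
  have ik' x : `]u, v[%classic x -> nu.-integrable [set: T] (EFin \o k x).
    by rewrite /= in_itv/=; exact: ik.
  have dk' x y : `]u, v[%classic x -> [set: T] y -> derivable (k ^~ y) x 1.
    by rewrite /= in_itv/= => /(dk x y) ? _; apply: ex_derive.
  have pE x t : u < x < v -> partial1of2 k x t = k' x t.
    by move=> /(dk x t) h; rewrite partial1of2E derive_val.
  have g0 y : 0 <= g y by exact: le_trans (bk a y auv).
  have bk' x y : `]u, v[%classic x -> [set: T] y -> `|partial1of2 k x y| <= g y.
    by rewrite /= in_itv/= => xuv _; rewrite pE// bk.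
  split.
    exact: (derivable_under_integral measurableT Ia ik' dk' g0 ig bk').
  rewrite -derive1E (differentiation_under_integral measurableT Ia ik' dk' g0 ig bk').
  by apply: eq_Rintegral => t _; rewrite pE.
split.
  apply: (key (fun x t => Re (f x t)) (fun x t => Re (f' x t))).
  - by move=> x /inf[].
  - by move=> x t /(df x t)[].
  - by move=> x t /(bf x t); exact: le_trans (Re_le_normc _).
apply: (key (fun x t => Im (f x t)) (fun x t => Im (f' x t))).
- by move=> x /inf[].
- by move=> x t /(df x t)[].
- by move=> x t /(bf x t); exact: le_trans (Im_le_normc _).
Qed.

Lemma ccontinuous_under (f : R -> T -> C) (g : T -> R) :
  (forall x, cmeas (f x)) ->
  (forall t, ccontinuous (f^~ t)) ->
  nu.-integrable [set: T] (fun t => (g t)%:E) ->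
  (forall x t, normc (f x t) <= g t) ->
  ccontinuous (fun x => cintegral nu (f x)).
Proof.
move=> mf cf ig bf.
have inf x := cintegrable_dom (mf x) ig (bf x).
have key (k : R -> T -> R) :
  (forall x, nu.-integrable [set: T] (EFin \o k x)) ->
  (forall t, continuous (k^~ t)) -> (forall x t, `|k x t| <= g t) ->
  continuous (fun x => \int[nu]_t k x t).
  move=> ik ck bk x.
  apply: (@continuity_under_integral _ _ _ nu k [set: T] measurableT (x - 1) (x + 1) _ _ g ig).
  - by move=> y _; exact: ik.
  - by apply: aeW => t _ y _; exact: ck.
  - by move=> y _; apply: aeW => t _; exact: bk.
  - by rewrite inE/= in_itv/= ltrBlDr ltrDl ltr01.
split.
  apply: (key (fun x t => Re (f x t))).
  - by move=> x; have [] := inf x.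
  - by move=> t; have [] := cf t.
  - by move=> x t; exact: le_trans (Re_le_normc _) (bf x t).
apply: (key (fun x t => Im (f x t))).
- by move=> x; have [] := inf x.
- by move=> t; have [] := cf t.
- by move=> x t; exact: le_trans (Im_le_normc _) (bf x t).
Qed.

End under.

(** [F] satisfies the Cauchy-Riemann equations in the strip.  The derivative in
    [y] of the integral over the line at height [y] is [i] times the integral of
    the derivative in [x], which is 0. *)
Lemma contour_shift (F F' : R -> R -> C) (b c M : R) : 0 < c ->
  (forall x y, - b < y < b -> cderive (F^~ y) x (F' x y)) ->
  (forall x y, - b < y < b -> cderive (F x) y ('i%C * F' x y)) ->
  (forall x y, - b < y < b -> normc (F x y) <= M * expR (- (c * `|x|))) ->
  (forall x y, - b < y < b -> normc (F' x y) <= M * expR (- (c * `|x|))) ->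
  (forall y, - b < y < b -> ccontinuous (F'^~ y)) ->
  forall y y', - b < y < b -> - b < y' < b ->
  cintegral mu (F^~ y) = cintegral mu (F^~ y').
Proof.
move=> c0 dx dy bF bF' cF'.
have ig := integrable_expabs M c0.
have iF y : - b < y < b -> cintegrable mu (F^~ y).
  move=> hy; apply: (cintegrable_dom _ ig) => [|t]; last exact: bF.
  apply: cmeas_continuous; apply: cderive_ccontinuous => x; exact: dx.
have iF' y : - b < y < b -> cintegrable mu (F'^~ y).
  move=> hy; apply: (cintegrable_dom _ ig) => [|t]; last exact: bF'.
  by apply: cmeas_continuous; exact: cF'.
apply: cderive0_itv => y hy.
apply: cderive_eq.
  apply: (@cderive_under _ _ mu (fun y x => F x y) (fun y x => 'i%C * F' x y)
    (fun x => M * expR (- (c * `|x|))) (- b) b) => //.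
    by move=> x t hx; exact: dy.
  by move=> x t hx; rewrite normcM normi mul1r bF'.
rewrite cintegralZ; last exact: iF'.
rewrite (@cintegral_derivative0 (F^~ y) (F'^~ y) M c) ?mulr0//.
- by move=> x; exact: dx.
- exact: cF'.
- by move=> x; exact: bF.
- exact: iF'.
Qed.

End LineIntegrals.

(** * The Poisson kernel of a strip and Fourier transforms *)

Section Elementary.
Variable R : realType.

Lemma sin_MVT (x : R) : 0 < x -> exists2 c, 0 < c < x & sin x = cos c * x.
Proof.
move=> x0.
have d (z : R) : z \in `]0, x[ -> is_derive z 1 sin (cos z) by move=> _; exact: is_derive_sin.
have cf : {within `[0, x], continuous (@sin R)}.
  by apply: continuous_subspaceT; exact: continuous_sin.
have [c] := MVT x0 d cf.
by rewrite in_itv/= sin0 !subr0 => cx ->; exists c.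
Qed.

Lemma abs_sin_le (x : R) : `|sin x| <= `|x|.
Proof.
wlog x0 : x / 0 < x.
  move=> H; have [x0|x0|<-] := ltgtP 0 x; first exact: H.
    by rewrite -(normrN (sin x)) -sinN -(normrN x) H// oppr_gt0.
  by rewrite sin0.
have [c _ ->] := sin_MVT x0.
by rewrite normrM ler_piMl// cos_max.
Qed.

Lemma expR_sub1_le (a : R) : `|expR a - 1| <= `|a| * expR `|a|.
Proof.
have h1 := expR_ge1Dx (- a); have h2 := expR_ge1Dx a.
have e0 := expR_gt0 a; have e1 : expR a * expR (- a) = 1 by rewrite -expRD subrr expR0.
have [a0|a0] := leP 0 a.
  rewrite ger0_norm; last by rewrite subr_ge0 -expR0 ler_expR.
  rewrite (ger0_norm a0).
  have : 0 <= expR a * (expR (- a) - (1 + - a)) by rewrite mulr_ge0 ?subr_ge0// ltW.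
  by rewrite mulrBr e1; lra.
rewrite ler0_norm; last by rewrite subr_le0 -expR0 ler_expR ltW.
rewrite (ltr0_norm a0).
have h3 : 1 <= expR (- a) by rewrite -expR0 ler_expR oppr_ge0 ltW.
have h4 : - a * 1 <= - a * expR (- a) by rewrite ler_wpM2l// oppr_ge0 ltW.
by lra.
Qed.

Lemma normc_cexp_sub1 (w : R[i]) :
  normc (cexp w - 1) <= (`|complex.Re w| + `|complex.Im w|) * expR `|complex.Re w|.
Proof.
case: w => a b; rewrite [complex.Re _]/= [complex.Im _]/=.
have -> : cexp (a +i* b)%C - 1 =
    ((expR a - 1)%:C)%C + ((expR a)%:C)%C * (cexp (0 +i* b)%C - 1).
  have -> : ((a +i* b)%C : R[i]) = (a%:C)%C + (0 +i* b)%C.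
    by apply: cx_ext => /=; ring.
  by rewrite cexpD cexp_real rmorphB /= rmorph1; ring.
rewrite (le_trans (normcD _ _))// normcM !normc_real mulrDl lerD//.
  exact: expR_sub1_le.
rewrite ger0_norm ?expR_ge0// mulrC ler_pM ?normc_ge0 ?expR_ge0//; last first.
  by rewrite ler_expR ler_norm.
have -> : normc (cexp (0 +i* b)%C - 1) = `|2 * sin (b / 2)|.
  have hb : b = b / 2 + b / 2 by lra.
  rewrite normc_sqrtE cReD cImD Re_cexp Im_cexp cReN cImN /= expR0 !mul1r.
  have -> : (cos b - 1) ^+ 2 + (sin b - 0) ^+ 2 = (2 * sin (b / 2)) ^+ 2.
    rewrite {1 2}hb cosD sinD; have := cos2Dsin2 (b / 2).
    by move: (cos _) (sin _) => c s h; nra.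
  by rewrite sqrtr_sqr.
rewrite normrM ger0_norm//; have := abs_sin_le (b / 2).
by rewrite normrM [`|2^-1|]ger0_norm//; lra.
Qed.

Definition ch (t : R) : R := (expR t + expR (- t)) / 2.

Lemma chN t : ch (- t) = ch t. Proof. by rewrite /ch opprK addrC. Qed.

Lemma ch_abs t : ch t = ch `|t|.
Proof.
have [t0|t0] := leP 0 t; first by rewrite ger0_norm.
by rewrite ltr0_norm// chN.
Qed.

Lemma ch_ge t : expR `|t| / 2 <= ch t.
Proof. by rewrite ch_abs /ch; have := expR_ge0 (- `|t|); lra. Qed.

Lemma ch_le t : ch t <= expR `|t|.
Proof.
rewrite ch_abs /ch.
have : expR (- `|t|) <= expR `|t|.
  by rewrite ler_expR; have := normr_ge0 t; lra.
by lra.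
Qed.

(** Weaker than [1 + t^2 / 2], and enough to compare [ch t - 1] with [t^2]. *)
Lemma ch_ge_sqr t : 1 + t ^+ 2 / 8 <= ch t.
Proof.
rewrite ch_abs -(real_normK (num_real t)); move: (`|t|) (normr_ge0 t) => x x0.
have e1 := expR_ge1Dx (x / 2).
set u := expR (x / 2).
have -> : ch x = (u ^+ 2 + u^-1 ^+ 2) / 2.
  rewrite /ch /u -expRN !expr2 -!expRD; congr ((expR _ + expR _) / 2); lra.
have u0 : 0 < u := expR_gt0 _.
have h : x / 2 <= u - u^-1.
  rewrite -(ler_pM2r u0) mulrBl mulVf ?gt_eqF//.
  have : 1 + x / 2 <= u := e1.
  nra.
have uV : u * u^-1 = 1 by rewrite divff// gt_eqF.
have : (x / 2) ^+ 2 <= (u - u^-1) ^+ 2.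
  by rewrite ler_pXn2r// nnegrE ?divr_ge0// (le_trans _ h)// divr_ge0.
move: (u^-1) uV => v uv; nra.
Qed.

Lemma ch_ge1 t : 1 <= ch t.
Proof. by rewrite (le_trans _ (ch_ge_sqr t))// lerDl divr_ge0 ?sqr_ge0. Qed.

Lemma continuous_ch : continuous ch.
Proof.
move=> x; apply: cvgM; last exact: cvg_cst.
apply: cvgD; first exact: continuous_expR.
apply: (@continuous_comp _ _ _ (fun t : R => - t) expR); last exact: continuous_expR.
by apply: cvgN; exact: cvg_id.
Qed.

Lemma abs_cos_lt1 (th : R) : 0 < th < pi -> `|cos th| < 1.
Proof.
move=> hth; have s0 := sin_gt0_pi hth; have h := cos2Dsin2 th.
rewrite -(@ltr_pXn2r _ 2)// ?nnegrE// expr1n real_normK ?num_real//.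
by have : 0 < sin th ^+ 2 by [exact: exprn_gt0]; lra.
Qed.

Lemma chDcos_ge (c t : R) : `|c| <= 1 -> (1 - `|c|) * ch t <= ch t + c.
Proof.
move=> c1; have h := ch_ge1 t; have := ler_norm (- c); rewrite normrN => h2.
have : `|c| * 1 <= `|c| * ch t by rewrite ler_wpM2l.
by lra.
Qed.

Lemma chDcos_gt0 (c t : R) : `|c| < 1 -> 0 < ch t + c.
Proof.
move=> c1; have := chDcos_ge t (ltW c1); have h := ch_ge1 t.
have : 0 < (1 - `|c|) * ch t by rewrite mulr_gt0 ?subr_gt0// (lt_le_trans ltr01).
by move=> *; lra.
Qed.

(** The Poisson kernel of a strip of width [pi], with data 0 on one side, on the
    line at distance [th] from that side. *)
Definition stripP (th t : R) : R := sin th / (2 * pi * (ch t + cos th)).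

Lemma stripP_ge0 th t : 0 < th < pi -> 0 <= stripP th t.
Proof.
move=> hth; rewrite divr_ge0 ?ltW ?sin_gt0_pi//.
by rewrite !mulr_gt0// ?pi_gt0// chDcos_gt0// abs_cos_lt1.
Qed.

Lemma stripPN th t : stripP th (- t) = stripP th t.
Proof. by rewrite /stripP chN. Qed.

Lemma continuous_stripP th : 0 < th < pi -> continuous (stripP th).
Proof.
move=> hth x; apply: cvgM; first exact: cvg_cst.
apply: cvgV.
  by rewrite gt_eqF// !mulr_gt0// ?pi_gt0// chDcos_gt0// abs_cos_lt1.
apply: cvgM; first exact: cvg_cst.
by apply: cvgD; [exact: continuous_ch|exact: cvg_cst].
Qed.

End Elementary.

Section FourierTransform.
Variable R : realType.
Local Notation C := R[i].
Local Notation Re := (@complex.Re R).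
Local Notation Im := (@complex.Im R).
Local Notation mu := (@lebesgue_measure R).
Implicit Types (z : C) (x y t a c M : R).

Definition ft (w : R -> C) z : C := cintegral mu (fun t => w t * cexp ('i%C * z * (t%:C)%C)).

Lemma normc_expi z t : normc (cexp ('i%C * z * (t%:C)%C)) = expR (- (Im z * t)).
Proof. by rewrite normc_cexp; congr expR; case: z => a b /=; ring. Qed.

Lemma normc_expi_le z t : normc (cexp ('i%C * z * (t%:C)%C)) <= expR (`|Im z| * `|t|).
Proof.
rewrite normc_expi ler_expR (le_trans (ler_norm _))// normrN normrM.
exact: lexx.
Qed.

Lemma cderive_lin (c : C) t : cderive (fun s : R => c * (s%:C)%C) t c.
Proof.
apply: cderive_eq (cderiveZ c (cderive_real (is_derive_id t 1))) _.
by rewrite rmorph1 mulr1.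
Qed.

Lemma ccontinuous_expi (c : C) : ccontinuous (fun t => cexp (c * (t%:C)%C)).
Proof.
apply: cderive_ccontinuous => t; exact: cderive_exp (cderive_lin c t).
Qed.

(** The functions for which Fubini, convolution and the shifts of contours are
    justified without further conditions. *)
Definition expdec (w : R -> C) M a : Prop :=
  ccontinuous w /\ forall t, normc (w t) <= M * expR (- (a * `|t|)).

Lemma expdec_M_ge0 w M a : expdec w M a -> 0 <= M.
Proof.
move=> [_ /(_ 0)]; rewrite normr0 mulr0 oppr0 expR0 mulr1.
by apply: le_trans; exact: normc_ge0.
Qed.

Lemma expdec_integrable w M a : 0 < a -> expdec w M a -> cintegrable mu w.
Proof.
move=> a0 [cw bw]; apply: (cintegrable_dom _ (integrable_expabs M a0)) => //.
exact: cmeas_continuous.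
Qed.

Lemma expdec_ft w M a z : expdec w M a ->
  expdec (fun t => w t * cexp ('i%C * z * (t%:C)%C)) M (a - `|Im z|).
Proof.
move=> h; have M0 := expdec_M_ge0 h; have [cw bw] := h; split.
  by apply: ccontinuousM => //; exact: ccontinuous_expi.
move=> t; rewrite normcM (le_trans (ler_pM (normc_ge0 _) (normc_ge0 _) (bw t) (normc_expi_le z t)))//.
by rewrite -mulrA -expRD ler_wpM2l// ler_expR; lra.
Qed.

Lemma expdec_mulid w M a c : 0 < c -> expdec w M a ->
  expdec (fun t => 'i%C * (t%:C)%C * w t) (M / c) (a - c).
Proof.
move=> c0 h; have M0 := expdec_M_ge0 h; have [cw bw] := h; split.
  apply: ccontinuousM => //; apply: ccontinuousM; first exact: ccontinuous_cst.
  by apply: ccontinuous_real => x; exact: cvg_id.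
move=> t; rewrite !normcM normi mul1r normc_real.
rewrite (le_trans (ler_wpM2l (normr_ge0 t) (bw t)))//.
rewrite mulrCA -mulrA ler_wpM2l//; exact: abs_expabs.
Qed.

Lemma expdecW w M a b : b <= a -> expdec w M a -> expdec w M b.
Proof.
move=> ba h; have M0 := expdec_M_ge0 h; have [cw bw] := h; split => // t.
rewrite (le_trans (bw t))// ler_wpM2l// ler_expR lerN2 ler_wpM2r//.
Qed.

Lemma ft_le w M a z : expdec w M a -> `|Im z| < a ->
  normc (ft w z) <= M * (2 / (a - `|Im z|)).
Proof.
move=> h hz; have a0 : 0 < a - `|Im z| by rewrite subr_gt0.
have [c1 b1] := expdec_ft z h.
rewrite (le_trans (normc_cintegral_le (cmeas_continuous c1) (integrable_expabs M a0) b1))//.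
rewrite RintegralZl//; last first.
  by have := integrable_expabs 1 a0; under eq_fun do rewrite mul1r.
by rewrite Rintegral_expabs.
Qed.

(** Cauchy-Riemann equations, by differentiation under the integral sign; the
    part [c] of the rate of decay pays for the factor [t]. *)
Lemma ft_cderive w M a c x y : 0 < c -> expdec w M a -> `|y| < a - c ->
  cderive (fun x => ft w (x +i* y)%C) x (ft (fun t => 'i%C * (t%:C)%C * w t) (x +i* y)%C) /\
  cderive (fun y => ft w (x +i* y)%C) y ('i%C * ft (fun t => 'i%C * (t%:C)%C * w t) (x +i* y)%C).
Proof.
move=> c0 h hy; have h' := expdec_mulid c0 h.
have inw z : `|Im z| < a -> cintegrable mu (fun t => w t * cexp ('i%C * z * (t%:C)%C)).
  by move=> hz; apply: (expdec_integrable _ (expdec_ft z h)); rewrite subr_gt0.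
pose b := (`|y| + (a - c)) / 2.
have yb : `|y| < b by rewrite /b; lra.
have bac : b < a - c by rewrite /b; lra.
have dz (l m : C) (s t : R) : cderive (fun s => (l + m * (s%:C)%C) * (t%:C)%C) s (m * (t%:C)%C).
  apply: cderive_eq (cderiveM (cderiveD (cderive_cst l s) (cderive_lin m s)) (cderive_cst _ s)) _.
  by ring.
have dexp (l m : C) (s t : R) : cderive (fun s => w t * cexp ((l + m * (s%:C)%C) * (t%:C)%C)) s
    (m * (t%:C)%C * w t * cexp ((l + m * (s%:C)%C) * (t%:C)%C)).
  by apply: cderive_eq (cderiveZ _ (cderive_exp (dz l m s t))) _; ring.
split.
  have ig := integrable_expabs (M / c) (_ : 0 < a - c - `|y|).
  apply: (@cderive_under _ _ _ mu (fun x t => w t * cexp ('i%C * (x +i* y)%C * (t%:C)%C))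
    (fun x t => 'i%C * (t%:C)%C * w t * cexp ('i%C * (x +i* y)%C * (t%:C)%C))
    (fun t => (M / c) * expR (- ((a - c - `|y|) * `|t|))) (x - 1) (x + 1)).
  - by rewrite ltrBlDr !ltrDl ltr01.
  - by move=> s _; apply: inw => /=; lra.
  - move=> s t _; have e (u : R) : ('i%C * (u +i* y)%C : C) = - (y%:C)%C + 'i%C * (u%:C)%C.
      by apply: cx_ext => /=; ring.
    by under eq_fun do rewrite e; rewrite e; exact: dexp.
  - by apply: ig; rewrite subr_gt0.
  - by move=> s t _; have [_] := expdec_ft (s +i* y)%C h'; exact.
rewrite /ft -cintegralZ; last first.
  by apply: (expdec_integrable _ (expdec_ft (x +i* y)%C h')); rewrite /= subr_gt0.
have ig := integrable_expabs (M / c) (_ : 0 < a - c - b).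
apply: (@cderive_under _ _ _ mu (fun y t => w t * cexp ('i%C * (x +i* y)%C * (t%:C)%C))
    (fun y t => 'i%C * ('i%C * (t%:C)%C * w t * cexp ('i%C * (x +i* y)%C * (t%:C)%C)))
    (fun t => (M / c) * expR (- ((a - c - b) * `|t|))) (- b) b).
- by rewrite -ltr_norml.
- by move=> s; rewrite -ltr_norml => sb; apply: inw => /=; lra.
- move=> s t _; have e (u : R) : ('i%C * (x +i* u)%C : C) = 'i%C * (x%:C)%C + (-1) * (u%:C)%C.
    by apply: cx_ext => /=; ring.
  under eq_fun do rewrite e; rewrite e; apply: cderive_eq (dexp _ _ _ _) _.
  have -> : (-1 : C) = 'i%C * 'i%C by apply: cx_ext => /=; ring.
  by ring.
- by apply: ig; rewrite subr_gt0.
- move=> s t; rewrite -ltr_norml => sb; rewrite normcM normi mul1r.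
  have [_ /(_ t)] := expdec_ft (s +i* y)%C h'.
  have [_ /(_ t) H _] := expdec_ft (x +i* s)%C h'.
  rewrite (le_trans H)// ler_wpM2l//; first by rewrite divr_ge0 ?(expdec_M_ge0 h)// ltW.
  by rewrite ler_expR lerN2 ler_wpM2r//= lerD2l lerN2 ltW.
Qed.

End FourierTransform.

(** * The squared hyperbolic secant *)

Section StripTransform.
Variable R : realType.
Local Notation C := R[i].
Local Notation Re := (@complex.Re R).
Local Notation Im := (@complex.Im R).
Local Notation mu := (@lebesgue_measure R).
Implicit Types (z k : C) (x y t a b c M th : R).

Lemma cos_ge_abs b y : `|y| <= b -> b <= pi -> cos b <= cos y.
Proof.
move=> yb bp; rewrite -(cos_norm y).
have [->//|ne] := eqVneq `|y| b.
have hy : `|y| \in `[0, pi] by rewrite in_itv/= normr_ge0 (le_trans yb bp).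
have hb : b \in `[0, pi] by rewrite in_itv/= (le_trans (normr_ge0 y) yb).
by apply/ltW; rewrite ltr_cos// lt_neqAle ne.
Qed.

Section bounded_angle.
Variable b : R.
Hypothesis hb : 0 < b < pi.

Let d := 1 - `|cos b|.
Let d_gt0 : 0 < d. Proof. by rewrite subr_gt0 abs_cos_lt1. Qed.

Lemma chDcos_unif y t : `|y| <= b -> d * ch t <= ch t + cos y.
Proof.
move=> yb; have /andP[b0 bp] := hb.
have := cos_ge_abs yb (ltW bp); have := chDcos_ge t (ltW (abs_cos_lt1 hb)).
by rewrite -/d => *; lra.
Qed.

Lemma chDcos_inv y t : `|y| <= b -> (ch t + cos y)^-1 <= 2 / d * expR (- (1 * `|t|)).
Proof.
move=> yb; have h := chDcos_unif t yb; have h1 := ch_ge t; have e0 := expR_gt0 `|t|.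
have c0 : 0 < d * (expR `|t| / 2) by rewrite mulr_gt0// divr_gt0.
have h2 : d * (expR `|t| / 2) <= ch t + cos y by rewrite (le_trans _ h)// ler_pM2l.
have -> : 2 / d * expR (- (1 * `|t|)) = (d * (expR `|t| / 2))^-1.
  by rewrite mul1r expRN; field; rewrite !gt_eqF.
by rewrite lef_pV2// posrE// (lt_le_trans c0).
Qed.

Lemma stripP_abs_le th t : `|th| <= b ->
  `|stripP th t| <= (pi * d)^-1 * expR (- (1 * `|t|)).
Proof.
move=> tb; have h := chDcos_inv t tb; have p0 := pi_gt0 R.
have D0 : 0 < ch t + cos th.
  by rewrite (lt_le_trans _ (chDcos_unif t tb))// mulr_gt0// (lt_le_trans ltr01 (ch_ge1 t)).
have hp : 0 <= (2 * pi)^-1 :> R by rewrite invr_ge0 mulr_ge0// ltW.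
rewrite /stripP normrM -[leRHS]mul1r; apply: ler_pM => //; first exact: sin_max.
rewrite invfM ger0_norm; last by rewrite mulr_ge0// invr_ge0 ltW.
apply: le_trans (ler_wpM2l hp h) _.
rewrite [leLHS](_ : _ = (pi * d)^-1 * expR (- (1 * `|t|)))//.
have dn : d != 0 by rewrite gt_eqF.
have pn : (pi : R) != 0 by rewrite gt_eqF.
move: (expR _) => e; move: (d) dn (pi) pn => d' dn pi' pn.
by field; rewrite dn pn.
Qed.

End bounded_angle.

Definition ccosh z : C := (cexp z + cexp (- z)) / 2.

Lemma C2E (z : C) : z / 2 = ((2^-1)%:C)%C * z.
Proof.
by rewrite mulrC; congr (_ * _); apply: cx_ext; rewrite ?cReV ?cImV /=; field.
Qed.

Lemma Re_ccosh x y : Re (ccosh (x +i* y)%C) = ch x * cos y.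
Proof.
by rewrite /ccosh C2E [LHS]cReM cReD cImD !Re_cexp !Im_cexp /= cosN sinN /ch; field.
Qed.

Lemma Im_ccosh x y : Im (ccosh (x +i* y)%C) = (expR x - expR (- x)) / 2 * sin y.
Proof.
by rewrite /ccosh C2E [LHS]cImM cReD cImD !Re_cexp !Im_cexp /= cosN sinN; field.
Qed.

Lemma ch_sqr x : ((expR x - expR (- x)) / 2) ^+ 2 = ch x ^+ 2 - 1.
Proof.
rewrite /ch; have : expR x * expR (- x) = 1 by rewrite -expRD subrr expR0.
move: (expR x) (expR (- x)) => u v uv.
have -> : ((u - v) / 2) ^+ 2 = ((u + v) / 2) ^+ 2 - u * v by field.
by rewrite uv.
Qed.

(** [1 + cosh z = 2 (cosh (z / 2))^2], whose modulus is [cosh x + cos y]. *)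
Lemma normc_1Dccosh_sqr x y : Re (1 + ccosh (x +i* y)%C) ^+ 2 + Im (1 + ccosh (x +i* y)%C) ^+ 2 =
  (ch x + cos y) ^+ 2.
Proof.
rewrite cReD cImD Re_ccosh Im_ccosh /= add0r [X in _ + X]exprMn ch_sqr.
rewrite sin2cos2; ring.
Qed.

Lemma normc_1Dccosh x y : normc (1 + ccosh (x +i* y)%C) = ch x + cos y.
Proof.
rewrite normc_sqrtE normc_1Dccosh_sqr sqrtr_sqr ger0_norm//.
by have := ch_ge1 x; have := cos_geN1 y; lra.
Qed.

Lemma normc_csinh x y : normc (csinh (x +i* y)%C) <= ch x.
Proof.
rewrite /csinh C2E normcM normc_real ger0_norm//.
have := normcB (cexp (x +i* y)%C) (cexp (- (x +i* y)%C)).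
by rewrite !normc_cexp /= /ch => h; lra.
Qed.

(** This is [1 / (cosh (z / 2))^2]. *)
Definition sech2 z : C := 2 / (1 + ccosh z).
Definition sech2' z : C := - (2 * csinh z) / (1 + ccosh z) ^+ 2.

Lemma cderive_affine_sech2 (l m : C) (s : R) : 1 + ccosh (l + m * (s%:C)%C) != 0 ->
  cderive (fun s => sech2 (l + m * (s%:C)%C)) s (m * sech2' (l + m * (s%:C)%C)).
Proof.
move=> n0.
have dl : cderive (fun s : R => l + m * (s%:C)%C) s m.
  by apply: cderive_eq (cderiveD (cderive_cst l s) (cderive_lin m s)) _; rewrite add0r.
have dd := cderiveD (cderive_cst 1 s) (cderiveM (cderiveD (cderive_exp dl)
  (cderive_exp (cderiveN dl))) (cderive_cst (2^-1) s)).
apply: cderive_eq (cderiveZ 2 (cderiveV n0 dd)) _.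
by rewrite /sech2' /csinh; ring.
Qed.

Lemma sech2_le b x y : 0 < b < pi -> `|y| <= b ->
  normc (sech2 (x +i* y)%C) <= 4 / (1 - `|cos b|) * expR (- (1 * `|x|)).
Proof.
move=> hb yb; rewrite /sech2 normcM normcV normc_1Dccosh normc2.
by have := chDcos_inv hb x yb => h; lra.
Qed.

Section shift.
Variable k : C.
Hypothesis hk : `|Im k| < 1.
Let eta := `|Im k|.

Let F x y : C := sech2 (x +i* y)%C * cexp ('i%C * k * (x +i* y)%C).
Let F' x y : C := (sech2' (x +i* y)%C + 'i%C * k * sech2 (x +i* y)%C) *
  cexp ('i%C * k * (x +i* y)%C).

Lemma xy_hor x y : ((x +i* y)%C : C) = 'i%C * (y%:C)%C + 1 * (x%:C)%C.
Proof. by apply: cx_ext => /=; ring. Qed.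
Lemma xy_ver x y : ((x +i* y)%C : C) = (x%:C)%C + 'i%C * (y%:C)%C.
Proof. by apply: cx_ext => /=; ring. Qed.

Let dF (l m : C) (s : R) : 1 + ccosh (l + m * (s%:C)%C) != 0 ->
  cderive (fun s => sech2 (l + m * (s%:C)%C) * cexp ('i%C * k * (l + m * (s%:C)%C))) s
   (m * ((sech2' (l + m * (s%:C)%C) + 'i%C * k * sech2 (l + m * (s%:C)%C)) *
     cexp ('i%C * k * (l + m * (s%:C)%C)))).
Proof.
move=> n0.
have dl : cderive (fun s : R => l + m * (s%:C)%C) s m.
  by apply: cderive_eq (cderiveD (cderive_cst l s) (cderive_lin m s)) _; rewrite add0r.
apply: cderive_eq (cderiveM (cderive_affine_sech2 n0) (cderive_exp (cderiveZ ('i%C * k) dl))) _.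
by ring.
Qed.

(** Shift of the line of integration from height [y] to height 0 for
    [sech2 z * exp (i k z)], which is holomorphic in the strip [|Im z| < pi]. *)
Lemma sech2_shift y : `|y| < pi ->
  cintegrable mu (fun x => sech2 (x +i* y)%C * cexp ('i%C * k * (x%:C)%C)) /\
  cintegral mu (fun x => sech2 (x +i* y)%C * cexp ('i%C * k * (x%:C)%C)) =
  cexp (k * (y%:C)%C) * cintegral mu (fun x => sech2 (x +i* 0)%C * cexp ('i%C * k * (x%:C)%C)).
Proof.
move=> ypi; pose b := (`|y| + pi) / 2; have p0 := pi_gt0 R; have y0 := normr_ge0 y.
have hb : 0 < b < pi by apply/andP; rewrite /b; split; lra.
have yb : `|y| < b by rewrite /b; lra.
set d := 1 - `|cos b|; have d0 : 0 < d by rewrite subr_gt0 abs_cos_lt1.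
have n0 x s : - b < s < b -> 1 + ccosh (x +i* s)%C != 0.
  rewrite -ltr_norml => sb; rewrite -normc_gt0 normc_1Dccosh.
  by rewrite (lt_le_trans _ (chDcos_unif hb x (ltW sb)))// mulr_gt0// (lt_le_trans ltr01 (ch_ge1 x)).
have bs x s : - b < s < b -> normc (sech2 (x +i* s)%C) <= 4 / d * expR (- (1 * `|x|)).
  by rewrite -ltr_norml => /ltW sb; exact: sech2_le.
have bs' x s : - b < s < b -> normc (sech2' (x +i* s)%C) <= 4 / d ^+ 2 * expR (- (1 * `|x|)).
  rewrite -ltr_norml => /ltW sb; rewrite /sech2' normcM normcNE normcM normcV normcX normc_1Dccosh.
  rewrite normc2.
  have h := chDcos_inv hb x sb; rewrite -/d in h; have h1 := chDcos_unif hb x sb; rewrite -/d in h1.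
  have D0 : 0 < ch x + cos s by rewrite (lt_le_trans _ h1)// mulr_gt0// (lt_le_trans ltr01 (ch_ge1 x)).
  have h2 := normc_csinh x s.
  have h3 : ch x * (ch x + cos s)^-1 <= d^-1.
    by rewrite ler_pdivrMr// ler_pdivlMl.
  have h4 : normc (csinh (x +i* s)%C) * (ch x + cos s)^-1 <= d^-1.
    by rewrite (le_trans _ h3)// ler_wpM2r// invr_ge0 ltW.
  have -> : 2 * normc (csinh (x +i* s)%C) * ((ch x + cos s) ^+ 2)^-1 =
    2 * ((normc (csinh (x +i* s)%C) * (ch x + cos s)^-1) * (ch x + cos s)^-1).
    by rewrite expr2 invfM; ring.
  have -> : 4 / d ^+ 2 * expR (- (1 * `|x|)) = 2 * (d^-1 * (2 / d * expR (- (1 * `|x|)))).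
    by rewrite [d ^+ 2]expr2 invfM; ring.
  rewrite ler_pM2l// ler_pM// ?mulr_ge0 ?normc_ge0 ?invr_ge0 ?ltW//.
pose E := expR (`|Re k| * b).
have bE x s : - b < s < b -> normc (cexp ('i%C * k * (x +i* s)%C)) <= E * expR (eta * `|x|).
  rewrite -ltr_norml => /ltW sb; rewrite normc_cexp /E -expRD ler_expR.
  have -> : Re ('i%C * k * (x +i* s)%C) = - (Re k * s) - Im k * x by case: (k) => p q /=; ring.
  have h1 : - (Re k * s) <= `|Re k| * b.
    by rewrite (le_trans (ler_norm _))// normrN normrM ler_wpM2l.
  have h2 : - (Im k * x) <= eta * `|x| by rewrite (le_trans (ler_norm _))// normrN normrM.
  by lra.
have E0 : 0 < E := expR_gt0 _.
pose M := (4 / d + 4 / d ^+ 2 + normc k * (4 / d)) * E.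
have kd : 0 <= normc k * (4 / d) by rewrite mulr_ge0 ?normc_ge0// divr_ge0// ltW.
have dd2 : 0 <= 4 / d ^+ 2 by rewrite divr_ge0// exprn_ge0// ltW.
have dd1 : 0 <= 4 / d by rewrite divr_ge0// ltW.
have prodb (u e : C) (A : R) x s : - b < s < b -> 0 <= A <= 4 / d + 4 / d ^+ 2 + normc k * (4 / d) ->
   normc u <= A * expR (- (1 * `|x|)) ->
   normc (u * cexp ('i%C * k * (x +i* s)%C)) <= M * expR (- ((1 - eta) * `|x|)).
  move=> hs /andP[A0 hA] hu; rewrite normcM.
  rewrite (le_trans (ler_pM (normc_ge0 _) (normc_ge0 _) hu (bE x s hs)))//.
  have -> : A * expR (- (1 * `|x|)) * (E * expR (eta * `|x|)) = A * E * expR (- ((1 - eta) * `|x|)).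
    have -> : - ((1 - eta) * `|x|) = - (1 * `|x|) + eta * `|x| by ring.
    by rewrite expRD; ring.
  by rewrite ler_wpM2r ?expR_ge0// /M ler_wpM2r// ltW.
have H1 x s : - b < s < b -> cderive (F^~ s) x (F' x s).
  move=> hs; apply: cderive_eq.
    rewrite /F; under eq_fun do rewrite xy_hor.
    by apply: dF; rewrite -xy_hor; exact: n0.
  by rewrite mul1r /F' xy_hor.
have H3 x s : - b < s < b -> normc (F x s) <= M * expR (- ((1 - eta) * `|x|)).
  move=> hs; apply: (prodb _ 0 (4 / d)) => //; last exact: bs.
  by apply/andP; split => //; lra.
have hyb : - b < y < b by rewrite -ltr_norml.
have iF : cintegrable mu (F^~ y).
  have ig := integrable_expabs M (_ : 0 < 1 - eta).
  apply: (cintegrable_dom _ (ig _)) => [||t]; last exact: H3.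
    by apply: cmeas_continuous; apply: cderive_ccontinuous => x; exact: H1.
  by rewrite subr_gt0.
have key : cintegral mu (F^~ y) = cintegral mu (F^~ 0).
  have H2 : forall x y, - b < y < b -> cderive (F x) y ('i%C * F' x y).
    move=> x s hs; apply: cderive_eq.
      rewrite /F; under eq_fun do rewrite xy_ver.
      by apply: dF; rewrite -xy_ver; exact: n0.
    by rewrite /F' xy_ver.
  apply: (@contour_shift _ F F' b (1 - eta) M) => //.
  - by rewrite subr_gt0.
  - move=> x s hs; apply: (prodb _ 0 (4 / d + 4 / d ^+ 2 + normc k * (4 / d))) => //.
      by apply/andP; split => //; lra.
    rewrite (le_trans (normcD _ _))// (normcM ('i%C * k)) (normcM 'i%C) normi mul1r.
    have := bs x s hs; have := bs' x s hs => h1 h2.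
    have h3 : normc k * normc (sech2 (x +i* s)%C) <= normc k * (4 / d * expR (- (1 * `|x|))).
      by rewrite ler_wpM2l ?normc_ge0.
    have : 0 <= 4 / d * expR (- (1 * `|x|)) by rewrite mulr_ge0// expR_ge0.
    by lra.
  - move=> s hs.
    have cexpl : ccontinuous (fun x : R => cexp ('i%C * k * (x +i* s)%C)).
      apply: (@cderive_ccontinuous _ _ (fun x => cexp ('i%C * k * (x +i* s)%C) * ('i%C * k * 1))).
      move=> x; apply: cderive_exp; apply: cderiveZ.
      under eq_fun do rewrite xy_hor.
      by apply: cderive_eq (cderiveD (cderive_cst _ _) (cderive_lin 1 x)) _; rewrite add0r.
    have cs2 : ccontinuous (fun x : R => sech2 (x +i* s)%C).
      apply: (@cderive_ccontinuous _ _ (fun x => 1 * sech2' (x +i* s)%C)) => x.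
      under eq_fun do rewrite xy_hor.
      by rewrite xy_hor; apply: cderive_affine_sech2; rewrite -xy_hor; exact: n0.
    have csh : ccontinuous (fun x : R => csinh (x +i* s)%C).
      have dl (x : R) : cderive (fun x : R => (x +i* s)%C : C) x 1.
        under eq_fun do rewrite xy_hor.
        by apply: cderive_eq (cderiveD (cderive_cst _ _) (cderive_lin 1 x)) _; rewrite add0r.
      apply: cderive_ccontinuous => x.
      exact: (cderiveM (cderiveD (cderive_exp (dl x)) (cderiveN (cderive_exp (cderiveN (dl x)))))
         (cderive_cst (2^-1) x)).
    apply: ccontinuousM => //; apply: ccontinuousD; last first.
      by apply: ccontinuousM => //; exact: ccontinuous_cst.
    rewrite (_ : (fun x => _) = (fun x : R => - (2^-1) * csinh (x +i* s)%C *
        (sech2 (x +i* s)%C * sech2 (x +i* s)%C))); last first.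
      apply/funext => x; rewrite /sech2' /sech2 expr2 invfM.
      have h2 : (2 : C) * 2^-1 = 1 by rewrite divff// pnatr_eq0.
      move: (csinh _) ((1 + ccosh _)^-1) => u v; move: (2^-1 : C) h2 => w h2.
      have -> : - w * u * (2 * v * (2 * v)) = (2 * w) * (- (2 * u) * (v * v)) by ring.
      by rewrite h2 mul1r.
    by apply: ccontinuousM; [apply: ccontinuousM => //; exact: ccontinuous_cst|exact: ccontinuousM].
  - by case/andP: hb => b0 _; rewrite oppr_lt0 b0.
have F0 : F^~ 0 = (fun x : R => sech2 (x +i* 0)%C * cexp ('i%C * k * (x%:C)%C)).
  by apply/funext => x; rewrite /F.
rewrite -F0 -key -(cintegralZ _ iF).
have -> : (fun x => sech2 (x +i* y)%C * cexp ('i%C * k * (x%:C)%C)) =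
    (fun x => cexp (k * (y%:C)%C) * F x y).
  apply/funext => x; rewrite /F [RHS]mulrCA; congr (_ * _); rewrite -cexpD; congr cexp.
  by case: (k) => p q; apply: cx_ext => /=; ring.
split; [exact: cintegrableZ iF|exact: erefl].
Qed.

End shift.
End StripTransform.

Section StripMass.
Variable R : realType.
Local Notation C := R[i].
Local Notation Re := (@complex.Re R).
Local Notation Im := (@complex.Im R).
Local Notation mu := (@lebesgue_measure R).
Implicit Types (z k : C) (x y t a b c M th : R).

Lemma sin_half_double th : sin th = 2 * sin (th / 2) * cos (th / 2).
Proof. by rewrite {1}(_ : th = th / 2 + th / 2) ?sinD; lra. Qed.

Lemma cos_half_double th : 1 + cos th = 2 * cos (th / 2) ^+ 2.
Proof.
rewrite {1}(_ : th = th / 2 + th / 2) ?cosD; last by lra.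
by have := cos2Dsin2 (th / 2); lra.
Qed.

(** A primitive of the kernel is [atan ((exp t + cos th) / sin th) / pi]. *)
Lemma integral_stripP th : 0 < th < pi ->
  mu.-integrable [set: R] (fun t => (stripP th t)%:E) /\
  \int[mu]_t stripP th t = th / pi.
Proof.
move=> hth; have /andP[t0 tp] := hth; have s0 := sin_gt0_pi hth; have p0 := pi_gt0 R.
have c1 := abs_cos_lt1 hth.
have D0 t : 0 < ch t + cos th by exact: chDcos_gt0.
have cP := continuous_stripP hth.
suff H : (\int[mu]_t (stripP th t)%:E = (th / pi)%:E)%E.
  split; last by rewrite /Rintegral H.
  apply/integrableP; split.
    by apply/measurable_EFinP; exact: continuous_measurable_fun.
  by under eq_integral do rewrite gee0_abs ?lee_fin ?stripP_ge0//; rewrite H ltry.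
rewrite ge0_symfun_integralT; last 3 first.
- by move=> x; exact: stripP_ge0.
- by [].
- by move=> x /=; rewrite stripPN.
rewrite -set_itvcy.
pose F t := pi^-1 * atan ((expR t + cos th) / sin th).
have dF (t : R) : is_derive t 1 F (stripP th t).
  have d1 : is_derive t 1 (fun t => (expR t + cos th) / sin th) (expR t / sin th).
    by apply: is_derive_eq; rewrite /GRing.scale/=; ring.
  have d2 : is_derive t 1 (fun t => atan ((expR t + cos th) / sin th))
      (expR t / sin th * (1 + ((expR t + cos th) / sin th) ^+ 2)^-1).
    apply: is_derive_eq (@is_derive1_comp R atan (fun t => (expR t + cos th) / sin th) t _ _
      (is_derive1_atan _) d1) _.
    by rewrite mulrC.
  rewrite /F; apply: is_derive_eq (is_deriveZ _ d2) _; rewrite /GRing.scale/= /stripP.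
  have := D0 t; rewrite /ch expRN; have e0 := expR_gt0 t; have cs := cos2Dsin2 th.
  move: (expR t) (sin th) (cos th) s0 e0 cs => e s c s0 e0 cs h.
  have n1 : 0 < e ^+ 2 + 2 * e * c + 1.
    have -> : e ^+ 2 + 2 * e * c + 1 = 2 * e * ((e + e^-1) / 2 + c) by field; rewrite gt_eqF.
    by rewrite !mulr_gt0.
  have n2 : s ^+ 2 + (e + c) ^+ 2 = e ^+ 2 + 2 * e * c + 1.
    have -> : s ^+ 2 + (e + c) ^+ 2 = e ^+ 2 + 2 * e * c + (c ^+ 2 + s ^+ 2) by ring.
    by rewrite cs.
  have -> : (1 + ((e + c) / s) ^+ 2) = (e ^+ 2 + 2 * e * c + 1) / s ^+ 2.
    by rewrite -n2; field; rewrite gt_eqF.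
  have -> : (e + e^-1) / 2 + c = (e ^+ 2 + 2 * e * c + 1) / (2 * e).
    by field; rewrite gt_eqF.
  move: (e ^+ 2 + 2 * e * c + 1) n1 => n n0.
  have sn : s != 0 by rewrite gt_eqF.
  have en : e != 0 by rewrite gt_eqF.
  have nn : n != 0 by rewrite gt_eqF.
  have pn : (pi : R) != 0 by rewrite gt_eqF.
  by move: (pi : R) pn => q qn; field; rewrite ?sn ?en ?nn ?qn.
rewrite (@ge0_continuous_FTC2y _ _ F 0 2^-1).
- have -> : F 0 = pi^-1 * (pi / 2 - th / 2).
    rewrite /F expR0 cos_half_double sin_half_double.
    have c0 : 0 < cos (th / 2) by apply: cos_gt0_pihalf; apply/andP; split; lra.
    have s0' : 0 < sin (th / 2) by apply: sin_gt0_pihalf; apply/andP; split; lra.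
    rewrite (_ : _ / _ = tan (pi / 2 - th / 2)); last first.
      rewrite /tan sinB cosB sin_pihalf cos_pihalf; field.
      by rewrite !gt_eqF//=; lra.
    by rewrite tanK// in_itv/=; apply/andP; split; lra.
  rewrite -EFinB -EFinM; congr EFin; move: (pi : R) (gt_eqF p0) => q qn.
  by field; rewrite qn.
- by move=> x _; exact: stripP_ge0.
- exact: continuous_subspaceT.
- have -> : (2^-1 : R) = pi^-1 * (pi / 2) by rewrite mulrA mulVf ?mul1r// gt_eqF.
  apply: cvgM; first exact: cvg_cst.
  apply: (@cvg_comp _ _ _ (fun x : R => (expR x + cos th) / sin th) atan _ +oo).
    apply: gt0_cvgMly; first by rewrite invr_gt0.
    apply: (@ger_cvgy _ _ _ _ id); last exact: cvg_id.
    apply: nearW => x; have := expR_ge1Dx x; have := cos_geN1 th.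
    by move=> h1 h2; rewrite /=; lra.
  exact: cvgy_atan.
- by move=> x _; apply: ex_derive.
- by apply: cvg_at_right_filter; exact: (derive_continuous dF).
- by move=> x _; rewrite derive1E; exact: derive_val.
Qed.

End StripMass.

(** * The Fourier transform of the Poisson kernel *)

Section StripTransform2.
Variable R : realType.
Local Notation C := R[i].
Local Notation Re := (@complex.Re R).
Local Notation Im := (@complex.Im R).
Local Notation mu := (@lebesgue_measure R).
Implicit Types (z k : C) (x y t a b c M th : R).

Definition stripPC th t : C := ((stripP th t)%:C)%C.

Lemma sech2_add th t : `|th| < pi ->
  sech2 (t +i* th)%C + sech2 (t +i* - th)%C =
  ((4 * (1 + ch t * cos th) / (ch t + cos th) ^+ 2)%:C)%C.
Proof.
move=> hth; have D0 : 0 < ch t + cos th.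
  have [->|n0] := eqVneq th 0; first by rewrite cos0; have := ch_ge1 t; lra.
  have h : 0 < `|th| < pi by rewrite hth normr_gt0 n0.
  rewrite -(cos_norm th); apply: chDcos_gt0; exact: abs_cos_lt1.
have n1 := normc_1Dccosh_sqr t th; have n2 := normc_1Dccosh_sqr t (- th).
rewrite cosN in n2.
have i2 (z : C) : 2 / z = (2%:C)%C * z^-1 by congr (_ * _); apply: cx_ext => /=; ring.
have Dn : ch t + cos th != 0 by rewrite gt_eqF.
rewrite /sech2 !i2 -mulrDr; apply: cx_ext.
  rewrite cReM [complex.Re (2%:C)%C]/= [complex.Im (2%:C)%C]/= mul0r subr0 cReD.
  rewrite !cReV n1 n2 !cReD !Re_ccosh cosN [complex.Re 1]/= [RHS]/=.
  by move: (ch t) (cos th) Dn => u c Dn; field.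
rewrite cImM [complex.Re (2%:C)%C]/= [complex.Im (2%:C)%C]/= mul0r addr0 cImD.
rewrite !cImV n1 n2 !cImD !Im_ccosh sinN [complex.Im 1]/= [RHS]/=.
by move: (ch t) (cos th) (sin th) ((_ - _) / 2) Dn => u c s v Dn; field.
Qed.

(** The derivative of the kernel in [th] is a sum of boundary values of one
    holomorphic function, whose transform follows from a shift of contour. *)
Lemma cderive_stripP th t : `|th| < pi ->
  cderive (fun th => stripPC th t) th
   (((8 * pi)^-1%:C)%C * (sech2 (t +i* th)%C + sech2 (t +i* - th)%C)).
Proof.
move=> hth; have D0 : ch t + cos th != 0.
  rewrite gt_eqF//.
  have [->|n0] := eqVneq th 0; first by rewrite cos0; have := ch_ge1 t; lra.
  have h : 0 < `|th| < pi by rewrite hth normr_gt0 n0.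
  rewrite -(cos_norm th); apply: chDcos_gt0; exact: abs_cos_lt1.
rewrite sech2_add// -real_C_M; apply: cderive_real.
have p0 := gt_eqF (pi_gt0 R).
have d1 : is_derive th 1 (fun th => 2 * pi * (ch t + cos th)) (2 * pi * - sin th).
  by apply: is_derive_eq; rewrite /GRing.scale/=; ring.
have n1 : 2 * pi * (ch t + cos th) != 0 by rewrite !mulf_neq0// p0.
have d2 := @is_deriveV R (fun th => 2 * pi * (ch t + cos th)) th _ 1 n1 d1.
have d3 := is_derive_sin th.
rewrite /stripP; apply: is_derive_eq; rewrite /GRing.scale/=.
have s2 := sin2cos2 th; move: (sin th) s2 => s s2.
have -> : s * (- (2 * pi * (ch t + cos th)) ^- 2 * (2 * pi * - s)) =
  s ^+ 2 * (2 * pi) / (2 * pi * (ch t + cos th)) ^+ 2 by ring.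
rewrite s2; move: (ch t) (cos th) D0 => u c D0; move: (pi : R) p0 => q qn.
by field; rewrite qn D0.
Qed.

Section fixed_k.
Variable k : C.
Hypothesis hk : `|Im k| < 1.

(** This is [sinh (k th) / k], extended to [k = 0] by continuity. *)
Definition shc th : C :=
  if k == 0 then (th%:C)%C else csinh (k * (th%:C)%C) / k.

Lemma cderive_shc th : cderive shc th
  ((cexp (k * (th%:C)%C) + cexp (- (k * (th%:C)%C))) / 2).
Proof.
rewrite /shc; case: eqVneq => [->|k0].
  rewrite mul0r oppr0 cexp0; have -> : ((1 + 1) / 2 : C) = 1 by rewrite divff// pnatr_eq0.
  exact: (cderive_real (is_derive_id th 1)).
have dl := cderive_lin k th.
have dd := cderiveM (cderiveM (cderiveD (cderive_exp dl) (cderiveN (cderive_exp (cderiveN dl))))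
         (cderive_cst (2^-1) th)) (cderive_cst (k^-1) th).
rewrite /csinh; apply: cderive_eq dd _.
rewrite !mulr0 !addr0.
move: (cexp _) (cexp _) => u v; by rewrite mulrN opprK -mulrDl mulrAC mulfK.
Qed.

Let T0 : C := cintegral mu (fun x => sech2 (x +i* 0)%C * cexp ('i%C * k * (x%:C)%C)).

Let cS y : `|y| < pi -> cintegrable mu (fun x => sech2 (x +i* y)%C * cexp ('i%C * k * (x%:C)%C)).
Proof. by move=> /(sech2_shift hk)[]. Qed.

Let Ft th : C := cintegral mu (fun t => stripPC th t * cexp ('i%C * k * (t%:C)%C)).

Lemma expdec_stripP b th : 0 < b < pi -> `|th| <= b ->
  expdec (stripPC th) (pi * (1 - `|cos b|))^-1 1.
Proof.
move=> hb tb; split.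
  apply: ccontinuous_real => x; apply: cvgM; first exact: cvg_cst.
  have D0 : 0 < ch x + cos th.
    rewrite (lt_le_trans _ (chDcos_unif hb x tb))// mulr_gt0 ?subr_gt0 ?abs_cos_lt1//.
    by rewrite (lt_le_trans ltr01 (ch_ge1 x)).
  apply: cvgV; first by rewrite gt_eqF// !mulr_gt0// pi_gt0.
  apply: cvgM; first exact: cvg_cst.
  by apply: cvgD; [exact: continuous_ch|exact: cvg_cst].
by move=> t; rewrite /stripPC normc_real; exact: stripP_abs_le.
Qed.

Let dFt th : `|th| < pi -> cderive Ft th
  (((4 * pi)^-1%:C)%C * T0 * ((cexp (k * (th%:C)%C) + cexp (- (k * (th%:C)%C))) / 2)).
Proof.
move=> tpi; pose b := (`|th| + pi) / 2; have p0 := pi_gt0 R; have y0 := normr_ge0 th.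
have hb : 0 < b < pi by apply/andP; rewrite /b; split; lra.
have tb : `|th| < b by rewrite /b; lra.
set d := 1 - `|cos b|; have d0 : 0 < d by rewrite subr_gt0 abs_cos_lt1.
have e0 : 0 < 1 - `|Im k| by rewrite subr_gt0.
pose G s t : C := ((8 * pi)^-1%:C)%C * (sech2 (t +i* s)%C + sech2 (t +i* - s)%C).
have bG s t : `|s| <= b -> normc (G s t * cexp ('i%C * k * (t%:C)%C)) <=
    (8 * pi)^-1 * (8 / d) * expR (- ((1 - `|Im k|) * `|t|)).
  move=> sb; have q0 : 0 <= (8 * pi)^-1 :> R by rewrite invr_ge0 mulr_ge0// ltW.
  have h1 : normc (G s t) <= (8 * pi)^-1 * (8 / d * expR (- (1 * `|t|))).
    rewrite /G normcM normc_real ger0_norm// ler_wpM2l//.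
    rewrite (le_trans (normcD _ _))//.
    have := sech2_le t hb sb.
    have sb' : `|- s| <= b by rewrite normrN.
    by have := sech2_le t hb sb'; rewrite -/d => *; lra.
  rewrite normcM (le_trans (ler_pM (normc_ge0 _) (normc_ge0 _) h1 (normc_expi_le k t)))//.
  have -> : - ((1 - `|Im k|) * `|t|) = - (1 * `|t|) + `|Im k| * `|t| by ring.
  by rewrite expRD !mulrA.
apply: cderive_eq.
  apply: (@cderive_under _ _ _ mu (fun s t => stripPC s t * cexp ('i%C * k * (t%:C)%C))
     (fun s t => G s t * cexp ('i%C * k * (t%:C)%C))
     (fun t => (8 * pi)^-1 * (8 / d) * expR (- ((1 - `|Im k|) * `|t|))) (- b) b).
  - by rewrite -ltr_norml.
  - move=> s; rewrite -ltr_norml => /ltW sb.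
    exact: (expdec_integrable e0 (expdec_ft k (expdec_stripP hb sb))).
  - move=> s t; rewrite -ltr_norml => sb.
    have sp : `|s| < pi by case/andP: hb => _; exact: lt_trans.
    apply: cderive_eq (cderiveM (cderive_stripP t sp) (cderive_cst _ s)) _.
    by rewrite mulr0 addr0.
  - exact: integrable_expabs.
  - by move=> s t; rewrite -ltr_norml => /ltW; exact: bG.
have [i1 e1] := sech2_shift hk tpi.
have tpi' : `|- th| < pi by rewrite normrN.
have [i2 e2] := sech2_shift hk tpi'.
rewrite (_ : (fun t => G th t * _) = (fun t => ((8 * pi)^-1%:C)%C *
  (sech2 (t +i* th)%C * cexp ('i%C * k * (t%:C)%C) +
   sech2 (t +i* - th)%C * cexp ('i%C * k * (t%:C)%C)))); last first.
  by apply/funext => t; rewrite /G -[LHS]mulrA; congr (_ * _); rewrite mulrDl.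
rewrite cintegralZ; last exact: cintegrableD.
rewrite cintegralD// e1 e2 -/T0.
have -> : k * ((- th)%:C)%C = - (k * (th%:C)%C) by rewrite rmorphN mulrN.
have -> : ((8 * pi)^-1%:C)%C = ((4 * pi)^-1%:C)%C * 2^-1 :> C.
  have -> : (2^-1 : C) = (2^-1%:C)%C by rewrite -[LHS]mul1r C2E mulr1.
  rewrite -real_C_M; apply: (congr1 (fun r : R => (r%:C)%C)).
  by rewrite -invfM; congr (_^-1); ring.
by ring.
Qed.

Let Ft_shc th : `|th| < pi -> Ft th = ((4 * pi)^-1%:C)%C * T0 * shc th.
Proof.
move=> tpi; have p0 := pi_gt0 R.
have h0 : - pi < (0 : R) < pi by rewrite oppr_lt0 p0.
have ht : - pi < th < pi by rewrite -ltr_norml.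
have D x : - pi < x < pi -> cderive (fun th => Ft th - ((4 * pi)^-1%:C)%C * T0 * shc th) x 0.
  rewrite -ltr_norml => hx.
  apply: cderive_eq (cderiveD (dFt hx) (cderiveN (cderiveZ _ (cderive_shc x)))) _.
  by rewrite subrr.
have := cderive0_itv D ht h0.
have -> : Ft 0 = 0.
  rewrite /Ft (@cintegral_ext _ _ _ _ _ (fun=> 0)) ?cintegral0// => t.
  by rewrite /stripPC /stripP sin0 mul0r mul0r.
have -> : shc 0 = 0.
  by rewrite /shc; case: eqVneq => // _; rewrite mulr0 /csinh oppr0 subrr !mul0r.
by rewrite mulr0 subr0 => /eqP; rewrite subr_eq0 => /eqP.
Qed.

(** Near [th = pi] the kernel itself is not bounded at [t = 0]; a factor [|t|]
    makes it so.  That gives the integrable majorant for the limit [th -> pi]. *)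
Lemma stripP_abs_unif th t : pi / 2 <= th < pi ->
  stripP th t * `|t| <= (2 + `|t|) * 2 * expR (- `|t|).
Proof.
move=> /andP[t1 t2]; have p0 := pi_gt0 R.
have hth : 0 < th < pi by apply/andP; split => //; lra.
have s0 := sin_gt0_pi hth; have D0 : 0 < ch t + cos th by exact: chDcos_gt0 (abs_cos_lt1 hth).
have c0 : cos th <= 0.
  have h1 : th \in `[0, pi] by rewrite in_itv/=; apply/andP; split; lra.
  have h2 : (pi : R) / 2 \in `[0, pi] by rewrite in_itv/=; apply/andP; split; lra.
  have [->|ne] := eqVneq th (pi / 2); first by rewrite cos_pihalf.
  by rewrite -(cos_pihalf R) ltW// ltr_cos// lt_neqAle eq_sym ne.
have c1 := cos_geN1 th; have cs := cos2Dsin2 th; have sq := ch_ge_sqr t.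
rewrite -(real_normK (num_real t)) in sq.
have e0 := expR_gt0 `|t|; have chg := ch_ge t; have a0 := normr_ge0 t.
have pi2 := pi_ge2 R.
(* arithmetic-geometric mean inequality between [1 + c] and [a ^+ 2 / 8] *)
have h1 : sin th * `|t| <= 2 * (ch t + cos th).
  move: (sin th) (cos th) (ch t) `|t| s0 c0 c1 cs sq a0 {D0 chg} => s c u a s0 c0 c1 cs sq a0.
  rewrite -(@ler_pXn2r _ 2)// ?nnegrE ?mulr_ge0//; [|exact: ltW|nra].
  have -> : (s * a) ^+ 2 = (1 - c ^+ 2) * a ^+ 2 by rewrite -cs; ring.
  have h2 : (1 - c ^+ 2) <= 2 * (1 + c) by nra.
  have h3 : (1 - c ^+ 2) * a ^+ 2 <= 2 * (1 + c) * a ^+ 2 by rewrite ler_wpM2r// sqr_ge0.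
  have h4 : 1 + c + a ^+ 2 / 8 <= u + c by lra.
  have h5 : (1 + c + a ^+ 2 / 8) ^+ 2 <= (u + c) ^+ 2.
    by rewrite ler_pXn2r// nnegrE; have := sqr_ge0 a => *; lra.
  have := sqr_ge0 (1 + c - a ^+ 2 / 8) => h6.
  nra.
have E : stripP th t * `|t| = (sin th * `|t|) / (2 * pi * (ch t + cos th)).
  by rewrite /stripP mulrAC.
rewrite E ler_pdivrMr; last by rewrite !mulr_gt0.
rewrite expRN; have [big|small] := leP 4 (expR `|t|).
  have h2 : expR `|t| / 4 <= ch t + cos th.
    by have := chg; lra.
  have s1 := sin_le1 th.
  have h3 : sin th * `|t| <= `|t| by rewrite ler_piMl.
  rewrite (le_trans h3)//.
  have h4 : 4 * (expR `|t| / 4) <= 2 * pi * (ch t + cos th).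
    by rewrite ler_pM//; lra.
  have h5 : (2 + `|t|) * 2 / expR `|t| * expR `|t| <= (2 + `|t|) * 2 / expR `|t| * (2 * pi * (ch t + cos th)).
    by rewrite ler_pM2l; [lra|rewrite divr_gt0//; lra].
  by move: h5; rewrite divfK ?gt_eqF//; lra.
rewrite (le_trans h1)//.
have h2 : 1 <= 4 / expR `|t| by rewrite ler_pdivlMr//; lra.
have h3 : 2 * (ch t + cos th) * 1 <= (2 * pi * (ch t + cos th)) * (4 / expR `|t|).
  apply: ler_pM => //; first by rewrite mulr_ge0// ltW.
  by rewrite ler_pM2r//; lra.
have h4 : (2 * pi * (ch t + cos th)) * (4 / expR `|t|) <=
   (2 + `|t|) * 2 / expR `|t| * (2 * pi * (ch t + cos th)).
  rewrite mulrC ler_wpM2r//; first by rewrite !mulr_ge0// ?ltW.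
  by apply: ler_wpM2r; [rewrite invr_ge0 ltW|lra].
by lra.
Qed.

Lemma stripP_cvg0 (t : R) (u : nat -> R) : t != 0 ->
  (forall n, pi / 2 <= u n < pi) -> u n @[n --> \oo] --> (pi : R) ->
  stripP (u n) t @[n --> \oo] --> (0 : R).
Proof.
move=> t0 hu cu; have p0 := pi_gt0 R.
have D : 0 < ch t + -1.
  have := ch_ge_sqr t; have : 0 < t ^+ 2 by rewrite exprn_even_gt0.
  by lra.
rewrite -[X in _ --> X](mul0r ((2 * pi * (ch t + -1))^-1)).
apply: cvgM.
  rewrite -(sinpi R); apply: (@cvg_comp _ _ _ u sin); first exact: cu.
  exact: continuous_sin.
apply: cvgV; first by rewrite gt_eqF// !mulr_gt0.
apply: cvgM; first exact: cvg_cst.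
apply: cvgD; first exact: cvg_cst.
rewrite -(cospi R); apply: (@cvg_comp _ _ _ u cos); first exact: cu.
exact: continuous_cos.
Qed.

Let u (n : nat) : R := pi - pi / 2 * (n.+1%:R)^-1.

Let u_range n : pi / 2 <= u n < pi.
Proof.
have p0 := pi_gt0 R; rewrite /u.
have h1 : 0 < (n.+1%:R : R)^-1 by rewrite invr_gt0.
have h2 : (n.+1%:R : R)^-1 <= 1 by rewrite invf_le1// ler1n.
have h3 : 0 < pi / 2 * (n.+1%:R : R)^-1 by rewrite mulr_gt0// divr_gt0.
have h4 : pi / 2 * (n.+1%:R : R)^-1 <= pi / 2 * 1 by rewrite ler_wpM2l// divr_ge0// ltW.
move: h3 h4; rewrite mulr1; move: (pi / 2 * _) => q h3 h4.
by apply/andP; split; lra.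
Qed.

Let u_cvg : u n @[n --> \oo] --> (pi : R).
Proof.
rewrite -[X in _ --> X]subr0 -[X in _ --> _ - X](mulr0 (pi / 2)).
apply: cvgB; first exact: cvg_cst.
by apply: cvgM; [exact: cvg_cst|exact: cvg_harmonic].
Qed.

(** As [th] tends to [pi] the kernels concentrate at 0, where the exponential is
    1; their mass is [th / pi]. *)
Lemma ft_stripP_cvg1 : (normc (Ft (u n) - ((u n / pi)%:C)%C)) @[n --> \oo] --> (0 : R).
Proof.
have p0 := pi_gt0 R; set eta := `|Im k|; have eta0 : 0 <= eta := normr_ge0 _.
have e0 : 0 < 1 - eta by rewrite subr_gt0.
pose A := `|Re k| + `|Im k|.
have A0 : 0 <= A by rewrite addr_ge0.
pose h n t := stripP (u n) t * normc (cexp ('i%C * k * (t%:C)%C) - 1).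
pose c := (1 - eta) / 2; have c0 : 0 < c by rewrite divr_gt0.
pose g t := A * (4 + 2 / c) * expR (- (c * `|t|)).
have hth n : 0 < u n < pi.
  by have /andP[h1 h2] := u_range n; rewrite h2 andbT (lt_le_trans _ h1)// divr_gt0.
have bexp t : normc (cexp ('i%C * k * (t%:C)%C) - 1) <= A * `|t| * expR (eta * `|t|).
  rewrite (le_trans (normc_cexp_sub1 _))//.
  have -> : Re ('i%C * k * (t%:C)%C) = - (Im k * t) by case: (k) => p q /=; ring.
  have -> : Im ('i%C * k * (t%:C)%C) = Re k * t by case: (k) => p q /=; ring.
  by rewrite normrN !normrM -mulrDl addrC.
have hg n t : 0 <= h n t <= g t.
  rewrite /h mulr_ge0 ?normc_ge0 ?stripP_ge0//=.
  have h1 := ler_wpM2l (stripP_ge0 t (hth n)) (bexp t).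
  rewrite (le_trans h1)//.
  have h2 := stripP_abs_unif t (u_range n).
  have -> : stripP (u n) t * (A * `|t| * expR (eta * `|t|)) =
     A * expR (eta * `|t|) * (stripP (u n) t * `|t|) by ring.
  have h3 : 0 <= A * expR (eta * `|t|) by rewrite mulr_ge0// expR_ge0.
  rewrite (le_trans (ler_wpM2l h3 h2))//.
  have -> : A * expR (eta * `|t|) * ((2 + `|t|) * 2 * expR (- `|t|)) =
    A * (4 * expR (- ((1 - eta) * `|t|)) + 2 * (`|t| * expR (- ((1 - eta) * `|t|)))).
    have -> : - ((1 - eta) * `|t|) = eta * `|t| + - `|t| by ring.
    by rewrite expRD; ring.
  rewrite /g -[leRHS]mulrA; apply: ler_wpM2l => //; rewrite [leRHS]mulrDl; apply: lerD.
    by rewrite ler_wpM2l// ler_expR lerN2 ler_wpM2r// /c; lra.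
  rewrite -[leRHS]mulrA ler_wpM2l//.
  by rewrite (le_trans (abs_expabs _ _ c0))// (_ : 1 - eta - c = c)//; rewrite /c; lra.
have ig : mu.-integrable [set: R] (fun t => (g t)%:E) by exact: integrable_expabs.
have mexp : cmeas (fun t : measurableTypeR R => cexp ('i%C * k * (t%:C)%C) - 1).
  apply: cmeasB; last exact: cmeas_cst.
  by apply: cmeas_continuous; exact: ccontinuous_expi.
have mP n : measurable_fun [set: R] (stripP (u n)).
  by apply: continuous_measurable_fun; exact: continuous_stripP.
have mh n : measurable_fun [set: R] (h n).
  by apply: measurable_funM; [exact: mP|exact: cmeas_normc].
have cv := @Rintegral_dom_cvg0 R _ (measurableTypeR R) mu h g mh hg ig.
apply: (@squeeze_cvgr _ _ _ _ (fun=> 0) (fun n => \int[mu]_t h n t)); last 2 first.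
- exact: cvg_cst.
- apply: cv; apply: aeW => t; have [->|t0] := eqVneq t 0.
    rewrite (_ : h^~ 0 = fun=> 0); first exact: cvg_cst.
    by apply/funext => n; rewrite /h mulr0 cexp0 subrr normc0 mulr0.
  rewrite -[X in _ --> X](mul0r (normc (cexp ('i%C * k * (t%:C)%C) - 1))).
  by apply: cvgM; [exact: stripP_cvg0|exact: cvg_cst].
apply: nearW => n; apply/andP; split; first exact: normc_ge0.
have [iP eP] := integral_stripP (hth n).
have i1 : cintegrable mu (stripPC (u n)) by split => //=; exact: integrable0.
have ipi : `|u n| <= u n by rewrite ger0_norm//; case/andP: (hth n) => /ltW.
have i2 : cintegrable mu (fun t => stripPC (u n) t * cexp ('i%C * k * (t%:C)%C)).
  exact: (expdec_integrable e0 (expdec_ft k (expdec_stripP (hth n) ipi))).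
have -> : ((u n / pi)%:C)%C = cintegral mu (stripPC (u n)).
  by apply: cx_ext => /=; rewrite ?eP// /Rintegral integral0.
rewrite -cintegralB// /Ft.
have hE (t : R) : stripPC (u n) t * cexp ('i%C * k * (t%:C)%C) - stripPC (u n) t =
   stripPC (u n) t * (cexp ('i%C * k * (t%:C)%C) - 1) by ring.
rewrite (@cintegral_ext _ _ _ mu _ _ hE).
apply: normc_cintegral_le.
- apply: (@cmeasM _ _ (measurableTypeR R)) => //.
  by apply: cmeas_real; exact: mP.
- apply: (le_integrable _ _ _ ig) => //; first by apply/measurable_EFinP; exact: mh.
  move=> t _ /=; have /andP[h1 h2] := hg n t.
  by rewrite lee_fin ger0_norm// (le_trans h2)// ler_norm.
- by move=> t; rewrite normcM normc_real ger0_norm// stripP_ge0.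
Qed.

(** As a function of [th], the transform vanishes at 0 and its derivative is a
    multiple of [cosh (k th)], so it is a multiple of [sinh (k th)]; the limit at
    [pi] determines the factor. *)
Lemma ft_stripP th : 0 < th < pi -> ft (stripPC th) k = Phat th k.
Proof.
move=> hth; have p0 := pi_gt0 R; set c := ((4 * pi)^-1%:C)%C * T0.
have uF n : Ft (u n) = c * shc (u n).
  by apply: Ft_shc; rewrite ltr_norml; have := u_range n => /andP[]; lra.
have cshc : ccontinuous shc by apply: cderive_ccontinuous => x; exact: cderive_shc.
have key : c * shc pi = 1.
  have c1 : ccontinuous (fun th => c * shc th - ((th / pi)%:C)%C).
    apply: ccontinuousD; first by apply: ccontinuousM => //; exact: ccontinuous_cst.
    rewrite (_ : (fun t => _) = (fun t : R => ((- (t / pi))%:C)%C)); last first.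
      by apply/funext => t; rewrite rmorphN.
    apply: ccontinuous_real => x; apply: cvgN; apply: cvgM; last exact: cvg_cst.
    exact: cvg_id.
  have [c1r c1i] := c1.
  have n1 : (normc (c * shc (u n) - ((u n / pi)%:C)%C)) @[n --> \oo] --> (0 : R).
    by have := ft_stripP_cvg1; under eq_fun do rewrite uF.
  have r0 : Re (c * shc pi - ((pi / pi)%:C)%C) = 0.
    have l1 : Re (c * shc (u n) - ((u n / pi)%:C)%C) @[n --> \oo] --> Re (c * shc pi - ((pi / pi)%:C)%C).
      exact: (@cvg_comp _ _ _ u (fun th => Re (c * shc th - ((th / pi)%:C)%C)) _ _ _ u_cvg (c1r pi)).
    have l2 : Re (c * shc (u n) - ((u n / pi)%:C)%C) @[n --> \oo] --> 0.
      apply/norm_cvg0P; apply: (@squeeze_cvgr _ _ _ _ (fun=> 0) _ _ _ _ _ n1); last exact: cvg_cst.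
      by apply: nearW => n; rewrite normr_ge0 Re_le_normc.
    exact: (cvg_unique _ l1 l2).
  have i0 : Im (c * shc pi - ((pi / pi)%:C)%C) = 0.
    have l1 : Im (c * shc (u n) - ((u n / pi)%:C)%C) @[n --> \oo] --> Im (c * shc pi - ((pi / pi)%:C)%C).
      exact: (@cvg_comp _ _ _ u (fun th => Im (c * shc th - ((th / pi)%:C)%C)) _ _ _ u_cvg (c1i pi)).
    have l2 : Im (c * shc (u n) - ((u n / pi)%:C)%C) @[n --> \oo] --> 0.
      apply/norm_cvg0P; apply: (@squeeze_cvgr _ _ _ _ (fun=> 0) _ _ _ _ _ n1); last exact: cvg_cst.
      by apply: nearW => n; rewrite normr_ge0 Im_le_normc.
    exact: (cvg_unique _ l1 l2).
  have : c * shc pi - ((pi / pi)%:C)%C = 0 by exact: cx_ext.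
  by rewrite divff ?gt_eqF// => /eqP; rewrite subr_eq0 => /eqP.
have spn : shc pi != 0.
  by apply/eqP => e; move: key; rewrite e mulr0 => /eqP; rewrite eq_sym oner_eq0.
have cE : c = (shc pi)^-1 by apply: (mulIf spn); rewrite key mulVf.
have tpi : `|th| < pi by case/andP: hth => t0 t1; rewrite ltr_norml t1 andbT; lra.
have := Ft_shc tpi; rewrite -/c cE /ft /Ft => ->.
rewrite /Phat /shc; case: (eqVneq k 0) => [k0|k0].
  by rewrite real_C_M fmorphV mulrC.
rewrite [(pi%:C)%C * k]mulrC [(th%:C)%C * k]mulrC.
move: (csinh (k * (pi%:C)%C)) (csinh (k * (th%:C)%C)) => a b.
have -> : (a / k)^-1 * (b / k) = b / a * (k / k) by rewrite invfM invrK; ring.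
by rewrite divff// mulr1.
Qed.

End fixed_k.
End StripTransform2.

(** * Fourier inversion for the Poisson kernel *)

Section Inversion.
Variable R : realType.
Local Notation C := R[i].
Local Notation Re := (@complex.Re R).
Local Notation Im := (@complex.Im R).
Local Notation mu := (@lebesgue_measure R).
Implicit Types (z k : C) (x y t a b c M th : R).

(** The hypothesis of Fubini, from a majorant with separated variables. *)
Lemma fubini_dom (F : R * R -> C) (f g : R -> R) :
  (forall x y, normc (F (x, y)) <= f x * g y) -> cmeas F ->
  (forall x, 0 <= f x) ->
  mu.-integrable [set: R] (fun x => (f x)%:E) ->
  mu.-integrable [set: R] (fun x => (g x)%:E) ->
  (\int[mu]_x \int[mu]_y (normc (F (x, y)))%:E < +oo)%E.
Proof.
move=> bF mF f0 intf intg.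
have mn := cmeas_normc mF.
have mg : measurable_fun [set: R] g by apply/measurable_EFinP; exact: measurable_int intg.
have mf : measurable_fun [set: R] f by apply/measurable_EFinP; exact: measurable_int intf.
have ig : (\int[mu]_y (`|g y|)%:E < +oo)%E by have /integrableP[_] := intg.
have if' : (\int[mu]_y (`|f y|)%:E < +oo)%E by have /integrableP[_] := intf.
apply: (@le_lt_trans _ _ (\int[mu]_x (`|f x|%:E * \int[mu]_y (`|g y|)%:E))%E).
  apply: ge0_le_integral => //.
  - by move=> x _; apply: integral_ge0 => y _; rewrite lee_fin normc_ge0.
  - have H := @measurable_fun_fubini_tonelli_F _ _ (measurableTypeR R) (measurableTypeR R) R mu (EFin \o (fun z : R * R => normc (F z))).
    by apply: H => [|z]; [exact/measurable_EFinP|rewrite lee_fin normc_ge0].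
  - by apply: emeasurable_funM; [apply/measurable_EFinP; exact: measurableT_comp|exact: measurable_cst].
  - move=> x _; rewrite -ge0_integralZl//; last first.
      by apply/measurable_EFinP; exact: measurableT_comp.
    apply: ge0_le_integral => //.
    + by move=> y _; rewrite lee_fin normc_ge0.
    + apply/measurable_EFinP; apply: (@cmeas_normc _ _ (measurableTypeR R) (fun y => F (x, y))).
      exact: (cmeas_comp mF (pair1_measurable x)).

    + apply/measurable_EFinP; apply: measurable_funM; first exact: measurable_cst.
      exact: measurableT_comp.
    + by move=> y _; rewrite -EFinM lee_fin (le_trans (bF x y))// -normrM ler_norm.
rewrite ge0_integralZr//.
- by rewrite lte_mul_pinfty// ?integral_ge0// ge0_fin_numE ?integral_ge0.
- by apply/measurable_EFinP; exact: measurableT_comp.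
- exact: integral_ge0.
Qed.

Lemma cmeas_fst (f : R -> C) : ccontinuous f -> cmeas (fun z : measurableTypeR R * measurableTypeR R => f z.1).
Proof.
move=> cf.
exact: (@cmeas_comp _ _ _ _ (measurableTypeR R) f fst (cmeas_continuous cf) measurable_fst).
Qed.

Lemma cmeas_snd (f : R -> C) : ccontinuous f -> cmeas (fun z : measurableTypeR R * measurableTypeR R => f z.2).
Proof.
move=> cf.
exact: (@cmeas_comp _ _ _ _ (measurableTypeR R) f snd (cmeas_continuous cf) measurable_snd).
Qed.

Lemma cmeas_comp2 (f : R -> C) (h : R * R -> R) : ccontinuous f ->
  measurable_fun [set: measurableTypeR R * measurableTypeR R] h ->
  cmeas (fun z : measurableTypeR R * measurableTypeR R => f (h z)).
Proof.
move=> cf mh.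
exact: (@cmeas_comp _ _ _ _ (measurableTypeR R) f h (cmeas_continuous cf) mh).
Qed.

Lemma measurable_mulxy : measurable_fun [set: measurableTypeR R * measurableTypeR R] (fun z : R * R => z.1 * z.2).
Proof. by apply: measurable_funM; [exact: measurable_fst|exact: measurable_snd]. Qed.

Lemma measurable_subxy (t : R) : measurable_fun [set: measurableTypeR R * measurableTypeR R] (fun z : R * R => t - z.1).
Proof. by apply: measurable_funB; [exact: measurable_cst|exact: measurable_fst]. Qed.

(** The inverse transform of even functions: the exponential has the same sign as
    in [ft]. *)
Definition ift (G : R -> C) t : C := ((2 * pi)^-1%:C)%C * ft G (t%:C)%C.

Lemma expi_real x t : cexp ('i%C * (t%:C)%C * (x%:C)%C) = cexp ('i%C * ((t * x)%:C)%C) :> C.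
Proof. by rewrite -mulrA -real_C_M. Qed.

Lemma normc_expi_real x t : normc (cexp ('i%C * (t%:C)%C * (x%:C)%C) : C) = 1.
Proof. by rewrite normc_expi /= mul0r oppr0 expR0. Qed.

Lemma pi2V_ge0 : 0 <= (2 * pi)^-1 :> R.
Proof. by rewrite invr_ge0 mulr_ge0// pi_ge0. Qed.

Definition convol (f g : R -> C) t : C := cintegral mu (fun s => f (t - s) * g s).

Section kernels.
Variables (f g : R -> C) (Mf Mg a b : R).
Hypotheses (hf : expdec f Mf a) (hg : expdec g Mg b) (b0 : 0 < b) (ba : b < a).

Let c := a - b.
Let c0 : 0 < c. Proof. by rewrite subr_gt0. Qed.

Let dom t s : normc (f (t - s) * g s) <= Mf * Mg * expR (- (b * `|t|)) * expR (- (c * `|t - s|)).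
Proof.
have [cf bf] := hf; have [cg bg] := hg.
rewrite normcM (le_trans (ler_pM (normc_ge0 _) (normc_ge0 _) (bf _) (bg _)))//.
rewrite mulrACA -[leRHS]mulrA ler_wpM2l ?mulr_ge0 ?(expdec_M_ge0 hf) ?(expdec_M_ge0 hg)//.
rewrite -!expRD ler_expR.
have h1 : `|t| <= `|t - s| + `|s| by rewrite -{1}(subrK s t) ler_normD.
have h2 : b * `|t| <= b * (`|t - s| + `|s|) by rewrite ler_pM2l.
rewrite /c; lra.
Qed.

Let cts t : ccontinuous (fun s => f (t - s) * g s).
Proof.
have [cf bf] := hf; have [cg bg] := hg.
apply: ccontinuousM => //; apply: (ccontinuous_comp cf) => x.
by apply: cvgB; [exact: cvg_cst|exact: cvg_id].
Qed.

Let idom t : mu.-integrable [set: R] (fun s => (Mf * Mg * expR (- (b * `|t|)) * expR (- (c * `|t - s|)))%:E).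
Proof.
have i1 : cintegrable mu (fun s => ((Mf * Mg * expR (- (b * `|t|)) * expR (- (c * `|s|)))%:C)%C).
  by split; [exact: integrable_expabs|exact: integrable0].
by have [[]] := cintegral_reflect t i1.
Qed.

Lemma convol_integrable t : cintegrable mu (fun s => f (t - s) * g s).
Proof. exact: (cintegrable_dom (cmeas_continuous (cts t)) (idom t) (dom t)). Qed.

(** The slower decay wins: [exp (- a |t - s|) exp (- b |s|)] is at most
    [exp (- b |t|) exp (- (a - b) |t - s|)]. *)
Lemma convol_le t : normc (convol f g t) <= Mf * Mg * (2 / c) * expR (- (b * `|t|)).
Proof.
rewrite (le_trans (normc_cintegral_le (cmeas_continuous (cts t)) (idom t) (dom t)))//.
have i1 : cintegrable mu (fun s => ((Mf * Mg * expR (- (b * `|t|)) * expR (- (c * `|s|)))%:C)%C).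
  by split; [exact: integrable_expabs|exact: integrable0].
have [_ /(congr1 Re) /= ->] := cintegral_reflect t i1.
rewrite RintegralZl//; last first.
  by have := integrable_expabs 1 c0; under eq_fun do rewrite mul1r.
by rewrite Rintegral_expabs// mulrAC.
Qed.

Lemma convolC t : convol f g t = cintegral mu (fun s => g (t - s) * f s).
Proof.
rewrite /convol; have [_ <-] := cintegral_reflect t (convol_integrable t).
by apply: cintegral_ext => s; rewrite opprB addrCA subrr addr0 mulrC.
Qed.

Lemma convol_continuous : ccontinuous (convol f g).
Proof.
have [cf bf] := hf; have [cg bg] := hg.
apply: (@ccontinuous_under _ _ (measurableTypeR R) mu (fun t s => f (t - s) * g s) (fun s => Mf * (Mg * expR (- (b * `|s|))))).
- by move=> t; exact: cmeas_continuous.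
- move=> s; apply: ccontinuousM; last exact: ccontinuous_cst.
  by apply: (ccontinuous_comp cf) => x; apply: cvgB; [exact: cvg_id|exact: cvg_cst].
- by have := integrable_expabs (Mf * Mg) b0; under eq_fun do rewrite -mulrA.
- move=> t s; rewrite normcM ler_pM ?normc_ge0//.
  rewrite (le_trans (bf _))// ler_piMr ?(expdec_M_ge0 hf)//.
  by rewrite -expR0 ler_expR oppr_le0 mulr_ge0// ltW// (lt_trans b0).
Qed.

Lemma expdec_convol : expdec (convol f g) (Mf * Mg * (2 / c)) b.
Proof. by split; [exact: convol_continuous|exact: convol_le]. Qed.

End kernels.

(** Fubini, with the kernel inside [ift]; evenness of [w] turns the transform at
    [- x] into the transform at [x]. *)
Lemma convol_ift (w G : R -> C) (Mw a Mg b : R) : 0 < a -> 0 < b ->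
  expdec w Mw a -> expdec G Mg b -> (forall t, w (- t) = w t) ->
  forall t, convol w (ift G) t = ift (fun x => ft w (x%:C)%C * G x) t.
Proof.
move=> a0 b0 hw hG ew t; have [cw bw] := hw; have [cG bG] := hG.
rewrite /convol /ift /ft.
pose F (z : R * R) : C := w (t - z.1) * (G z.2 * cexp ('i%C * (z.1%:C)%C * (z.2%:C)%C)).
have mF : cmeas (F : measurableTypeR R * measurableTypeR R -> C).
  apply: cmeasM; first exact: (cmeas_comp2 cw (measurable_subxy t)).
  apply: cmeasM; first exact: cmeas_snd.
  rewrite (_ : (fun _ => _) = (fun z : measurableTypeR R * measurableTypeR R => cexp ('i%C * ((z.1 * z.2)%:C)%C))).
    exact: (cmeas_comp2 (ccontinuous_expi 'i%C) measurable_mulxy).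
  by apply/funext => z; rewrite expi_real.
have Mw0 := expdec_M_ge0 hw; have MG0 := expdec_M_ge0 hG.
have fin : (\int[mu]_x \int[mu]_y (normc (F (x, y)))%:E < +oo)%E.
  apply: (@fubini_dom F (fun s => Mw * expR (- (a * `|t - s|))) (fun x => Mg * expR (- (b * `|x|)))) => //.
  - move=> x y; rewrite /F [(x, y).1]/= [(x, y).2]/= normcM [normc (G y * _)]normcM normc_expi_real mulr1.
    by rewrite ler_pM ?normc_ge0.
  - by move=> s; rewrite mulr_ge0// expR_ge0.
  - have i1 : cintegrable mu (fun s => ((Mw * expR (- (a * `|s|)))%:C)%C).
      by split; [exact: integrable_expabs|exact: integrable0].
    by have [[]] := cintegral_reflect t i1.
  - exact: integrable_expabs.
have e := cFubini mF fin.
have igG s : cintegrable mu (fun x => G x * cexp ('i%C * (s%:C)%C * (x%:C)%C)).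
  by apply: (expdec_integrable _ (expdec_ft (s%:C)%C hG)); rewrite /= normr0 subr0.
have -> : cintegral mu (fun s => w (t - s) * (((2 * pi)^-1%:C)%C * cintegral mu (fun x => G x * cexp ('i%C * (s%:C)%C * (x%:C)%C)))) =
    ((2 * pi)^-1%:C)%C * cintegral mu (fun s => cintegral mu (fun x => F (s, x))).
  have mm := @cmeas_cintegral _ _ _ (measurableTypeR R) (measurableTypeR R) mu F mF.
  have igd : mu.-integrable [set: R] (fun s => (Mw * Mg * (2 / b) * expR (- (a * `|t - s|)))%:E).
    have i1 : cintegrable mu (fun s => ((Mw * Mg * (2 / b) * expR (- (a * `|s|)))%:C)%C).
      by split; [exact: integrable_expabs|exact: integrable0].
    by have [[]] := cintegral_reflect t i1.
  have FE s : cintegral mu (fun x => F (s, x)) = w (t - s) * ft G (s%:C)%C.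
    by rewrite /F /ft -cintegralZ.
  have bnd s : normc (cintegral mu (fun x => F (s, x))) <= Mw * Mg * (2 / b) * expR (- (a * `|t - s|)).
    rewrite FE normcM.
    have h1 : normc (ft G (s%:C)%C) <= Mg * (2 / (b - 0)).
      by have := @ft_le _ G Mg b (s%:C)%C hG; rewrite [complex.Im _]/= normr0; apply.
    rewrite subr0 in h1.
    apply: (le_trans (ler_pM (normc_ge0 _) (normc_ge0 _) (bw _) h1)).
    by rewrite le_eqVlt; apply/orP; left; apply/eqP; ring.
  have iFs := @cintegrable_dom R _ (measurableTypeR R) mu _ _ mm igd bnd.
  rewrite -cintegralZ; last exact: iFs.
  by apply: cintegral_ext => s; rewrite FE [LHS]mulrCA.
congr (_ * _); rewrite e; apply: cintegral_ext => x; rewrite /F /=.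
have i2 : cintegrable mu (fun s => w s * cexp ('i%C * (x%:C)%C * (s%:C)%C)).
  by apply: (expdec_integrable _ (expdec_ft (x%:C)%C hw)); rewrite /= normr0 subr0.
have [i3 e3] := cintegral_reflect 0 i2.
have i4 : cintegrable mu (fun s => w s * cexp (- ('i%C * (x%:C)%C * (s%:C)%C))).
  suff <- : (fun s => w (0 - s) * cexp ('i%C * (x%:C)%C * ((0 - s)%:C)%C)) =
    (fun s => w s * cexp (- ('i%C * (x%:C)%C * (s%:C)%C))) by [].
  by apply/funext => s; rewrite sub0r ew rmorphN mulrN.
have [i5 e5] := cintegral_reflect t i4.
transitivity (cintegral mu (fun s => G x * cexp ('i%C * (t%:C)%C * (x%:C)%C) *
    (w (t - s) * cexp (- ('i%C * (x%:C)%C * ((t - s)%:C)%C))))).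
  apply: cintegral_ext => s.
  have -> : cexp ('i%C * (s%:C)%C * (x%:C)%C) = cexp ('i%C * (t%:C)%C * (x%:C)%C) *
      cexp (- ('i%C * (x%:C)%C * ((t - s)%:C)%C)).
    by rewrite -cexpD; congr cexp; rewrite rmorphB/=; ring.
  by move: (cexp _) (cexp _) => u v; ring.
rewrite cintegralZ; last exact: i5.
rewrite e5.
have -> : cintegral mu (fun s => w s * cexp (- ('i%C * (x%:C)%C * (s%:C)%C))) =
    cintegral mu (fun s => w s * cexp ('i%C * (x%:C)%C * (s%:C)%C)).
  by rewrite -e3; apply: cintegral_ext => s; rewrite sub0r ew rmorphN mulrN.
by move: (cintegral _ _) (cexp _) => u v; ring.
Qed.

End Inversion.

Section Regularization.
Variable R : realType.
Local Notation C := R[i].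
Local Notation Re := (@complex.Re R).
Local Notation Im := (@complex.Im R).
Local Notation mu := (@lebesgue_measure R).
Implicit Types (z k : C) (x y t a b c M th : R).

Let S := stripPC (pi / 2 : R).

Let hpi2 : 0 < (pi / 2 : R) < pi.
Proof. have p0 := pi_gt0 R; apply/andP; split; lra. Qed.

Lemma expdec_stripPC th : 0 < th < pi -> exists2 M, 0 < M & expdec (stripPC th) M 1.
Proof.
move=> hth; exists (pi * (1 - `|cos th|))^-1.
  by rewrite invr_gt0 mulr_gt0 ?pi_gt0// subr_gt0 abs_cos_lt1.
by apply: expdec_stripP => //; rewrite ger0_norm//; case/andP: hth => /ltW.
Qed.

Lemma stripPCN th t : stripPC th (- t) = stripPC th t.
Proof. by rewrite /stripPC stripPN. Qed.

Let SE t : S t = ((2 * pi * ch t)^-1%:C)%C.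
Proof. by rewrite /S /stripPC /stripP sin_pihalf cos_pihalf addr0 div1r. Qed.

Lemma csinh_real a : csinh (a%:C)%C = (((expR a - expR (- a)) / 2)%:C)%C :> C.
Proof.
rewrite /csinh -rmorphN !cexp_real C2E -rmorphB -real_C_M.
by congr (_%:C)%C; rewrite mulrC.
Qed.

(** [S] is a multiple of [1 / cosh], which is, up to scaling, its own transform:
    [sinh (pi z / 2) / sinh (pi z) = 1 / (2 cosh (pi z / 2))]. *)
Lemma ft_sech (k : R) : ft S (k%:C)%C = (pi%:C)%C * S (pi * k / 2).
Proof.
have p0 := pi_gt0 R; have pn : (pi : R) != 0 by rewrite gt_eqF.
rewrite ft_stripP//=; last by rewrite normr0.
rewrite /Phat SE; case: eqVneq => [k0|k0].
  have -> : k = 0 by move: k0 => /(congr1 Re).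
  rewrite mulr0 mul0r /ch oppr0 expR0 -real_C_M; apply: (congr1 (fun r => (r%:C)%C)).
  by move: (pi : R) pn => q qn; field; rewrite qn.
have kn : k != 0 by apply: contra k0 => /eqP ->.
rewrite -!real_C_M !csinh_real -fmorphV -real_C_M; apply: (congr1 (fun r => (r%:C)%C)).
set a := pi * k / 2.
have -> : pi / 2 * k = a by rewrite /a; ring.
have ea : pi * k = a + a by rewrite /a; lra.
rewrite ea opprD !expRD expRN /ch expRN.
have u0 := expR_gt0 a.
have un1 : expR a ^+ 2 != 1.
  rewrite expr2 -expRD -ea; apply/negP => /eqP /(congr1 (@ln R)).
  by rewrite expRK ln1 => /eqP; rewrite mulf_eq0 (negbTE pn) (negbTE kn).
move: (expR _) u0 un1 (pi : R) pn => u u0 un1 q qn.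
have un : u != 0 by rewrite gt_eqF.
have u1 : u ^+ 2 + 1 != 0 by rewrite gt_eqF// addr_gt0// exprn_gt0.
have u2 : u ^+ 2 - 1 != 0 by rewrite subr_eq0.
have -> : u * u - u^-1 / u = (u ^+ 2 - 1) * (u ^+ 2 + 1) / u ^+ 2 by field.
have -> : u - u^-1 = (u ^+ 2 - 1) / u by field.
have -> : u + u^-1 = (u ^+ 2 + 1) / u by field.
by move: (u ^+ 2 - 1) (u ^+ 2 + 1) u1 u2 => v w v0 w0; field; rewrite ?qn ?un ?v0 ?w0.
Qed.

Lemma csinh_ge (w : C) : 1 <= `|Re w| -> expR `|Re w| / 4 <= normc (csinh w).
Proof.
move=> w1; rewrite /csinh C2E normcM normc_real [`|2^-1|]ger0_norm//.
have h1 := normc_sub_ge (cexp w) (cexp (- w)).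
have h2 := normc_sub_ge (cexp (- w)) (cexp w); rewrite normcBC in h2.
rewrite !normc_cexp cReN in h1 h2.
suff : expR `|Re w| / 2 <= normc (cexp w - cexp (- w)) by lra.
have e1 := expR_ge1Dx (`|Re w| + `|Re w|); rewrite expRD in e1.
have e2 : expR `|Re w| * expR (- `|Re w|) = 1 by rewrite -expRD subrr expR0.
have u0 := expR_gt0 `|Re w|; have v0 := expR_gt0 (- `|Re w|).
suff h : expR (- `|Re w|) <= expR `|Re w| / 2.
  have [p|n] := leP 0 (Re w).
    by move: h h1; rewrite !ger0_norm// => h h1; lra.
  by move: h h2; rewrite !ltr0_norm// opprK => h h2; lra.
rewrite -(ler_pM2l u0) e2; lra.
Qed.

Lemma csinh_le (w : C) : normc (csinh w) <= expR `|Re w|.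
Proof.
case: w => a b; rewrite (le_trans (normc_csinh a b))//; exact: ch_le.
Qed.

Lemma Phat_decay th (z : C) : 0 < th < pi -> 1 <= `|Re z| ->
  normc (Phat th z) <= 4 * expR (- ((pi - th) * `|Re z|)).
Proof.
move=> /andP[t0 tp] z1; have p0 := pi_gt0 R; have p2 := pi_ge2 R.
have z0 : z != 0.
  apply/eqP => e; have : (1 : R) <= 0 by move: z1; rewrite e /= normr0.
  by rewrite ler10.
rewrite /Phat (negbTE z0) normcM normcV.
have ReE (a : R) : 0 < a -> `|Re ((a%:C)%C * z)| = a * `|Re z|.
  move=> a0; have -> : Re ((a%:C)%C * z) = a * Re z by rewrite cReM /= mul0r subr0.
  by rewrite normrM gtr0_norm.
have h1 : 1 <= `|Re ((pi%:C)%C * z)| by rewrite ReE// -[1]mulr1 ler_pM//; lra.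
have h2 := csinh_ge h1; have h3 := csinh_le ((th%:C)%C * z).
rewrite !ReE// in h2 h3.
have e0 := expR_gt0 (pi * `|Re z|).
have n0 : 0 < normc (csinh ((pi%:C)%C * z)) by apply: lt_le_trans h2; rewrite divr_gt0.
rewrite ler_pdivrMr//; apply: (le_trans h3).
have -> : expR (th * `|Re z|) = 4 * expR (- ((pi - th) * `|Re z|)) * (expR (pi * `|Re z|) / 4).
  have -> : th * `|Re z| = - ((pi - th) * `|Re z|) + pi * `|Re z| by ring.
  by rewrite expRD; field.
by rewrite ler_pM2l// mulr_gt0// expR_gt0.
Qed.

(** Far from the imaginary axis this is read off from the quotient of hyperbolic
    sines; near it, the transform is bounded. *)
Lemma ft_stripP_decay th : 0 < th < pi -> exists2 M, 0 < M &
  forall z : C, `|Im z| <= 3 / 4 ->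
  normc (ft (stripPC th) z) <= M * expR (- ((pi - th) * `|Re z|)).
Proof.
move=> hth; have [M M0 hP] := expdec_stripPC hth; have /andP[t0 tp] := hth.
exists (4 + M * 8 * expR (pi - th)).
  by rewrite addr_gt0// mulr_gt0 ?expR_gt0// mulr_gt0.
move=> z hz; have z1 : `|Im z| < 1 by lra.
have e0 := expR_gt0 (- ((pi - th) * `|Re z|)).
have [big|small] := leP 1 `|Re z|.
  rewrite ft_stripP// (le_trans (Phat_decay hth big))// ler_pM2r// lerDl.
  by rewrite mulr_ge0 ?expR_ge0// mulr_ge0// ltW.
have h := ft_le hP z1; rewrite (le_trans h)// mulrDl.
have h1 : 2 / (1 - `|Im z|) <= 8 by rewrite ler_pdivrMr; lra.
have h2 : 1 <= expR (pi - th) * expR (- ((pi - th) * `|Re z|)).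
  rewrite -expRD -expR0 ler_expR.
  have -> : pi - th - (pi - th) * `|Re z| = (pi - th) * (1 - `|Re z|) by ring.
  by rewrite mulr_ge0; lra.
have h3 : M * (2 / (1 - `|Im z|)) <= M * 8 by rewrite ler_pM2l.
have h4 : M * 8 * 1 <= M * 8 * (expR (pi - th) * expR (- ((pi - th) * `|Re z|))).
  by rewrite ler_pM2l// mulr_gt0.
by lra.
Qed.

Lemma ft_real_ccontinuous (w : R -> C) M a : 0 < a -> expdec w M a ->
  ccontinuous (fun x : R => ft w (x%:C)%C).
Proof.
move=> a0 hw.
apply: (@cderive_ccontinuous _ _ (fun x => ft (fun t => 'i%C * (t%:C)%C * w t) (x +i* 0)%C)) => x.
have c0 : 0 < a / 2 by rewrite divr_gt0.
have y0 : `|(0 : R)| < a - a / 2 by rewrite normr0; lra.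
by have [] := ft_cderive x c0 hw y0.
Qed.

Lemma expdec_ft_stripP th : 0 < th < pi -> exists2 M, 0 < M &
  expdec (fun x => ft (stripPC th) (x%:C)%C) M (pi - th).
Proof.
move=> hth; have [M M0 hM] := ft_stripP_decay hth; exists M => //.
have [MP _ hP] := expdec_stripPC hth.
split; first exact: (ft_real_ccontinuous ltr01 hP).
by move=> x; apply: hM; rewrite /= normr0; lra.
Qed.

(** Fubini: both sides are the integral of [w s * r x * exp (i (s + t) x)]. *)
Lemma ft_mul (w r : R -> C) Mw a Mr b t : 0 < a -> 0 < b ->
  expdec w Mw a -> expdec r Mr b ->
  cintegral mu (fun x => ft w (x%:C)%C * (r x * cexp ('i%C * (t%:C)%C * (x%:C)%C))) =
  cintegral mu (fun s => w s * ft r ((s + t)%:C)%C).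
Proof.
move=> a0 b0 hw hr; have [cw bw] := hw; have [cr br] := hr.
pose F (z : R * R) : C := w z.2 * cexp ('i%C * (z.1%:C)%C * (z.2%:C)%C) *
   (r z.1 * cexp ('i%C * (t%:C)%C * (z.1%:C)%C)).
have mF : cmeas (F : measurableTypeR R * measurableTypeR R -> C).
  apply: cmeasM; last first.
    exact: (@cmeas_fst _ (fun x => r x * cexp ('i%C * (t%:C)%C * (x%:C)%C))
      (ccontinuousM cr (ccontinuous_expi ('i%C * (t%:C)%C)))).
  apply: cmeasM; first exact: cmeas_snd.
  rewrite (_ : (fun _ => _) = (fun z : measurableTypeR R * measurableTypeR R => cexp ('i%C * ((z.1 * z.2)%:C)%C))).
    exact: (cmeas_comp2 (ccontinuous_expi 'i%C) (@measurable_mulxy R)).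
  by apply/funext => z; rewrite expi_real.
have Mw0 := expdec_M_ge0 hw; have Mr0 := expdec_M_ge0 hr.
have fin : (\int[mu]_x \int[mu]_y (normc (F (x, y)))%:E < +oo)%E.
  apply: (@fubini_dom _ F (fun x => Mr * expR (- (b * `|x|))) (fun s => Mw * expR (- (a * `|s|)))) => //.
  - move=> x y; rewrite /F [(x, y).1]/= [(x, y).2]/= normcM [normc (r x * _)]normcM.
    rewrite [normc (w y * _)]normcM !normc_expi_real !mulr1 mulrC.
    by rewrite ler_pM ?normc_ge0.
  - by move=> s; rewrite mulr_ge0// expR_ge0.
  - exact: integrable_expabs.
  - exact: integrable_expabs.
have igw x : cintegrable mu (fun s => w s * cexp ('i%C * (x%:C)%C * (s%:C)%C)).
  by apply: (expdec_integrable _ (expdec_ft (x%:C)%C hw)); rewrite /= normr0 subr0.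
have igr x : cintegrable mu (fun s => r s * cexp ('i%C * (x%:C)%C * (s%:C)%C)).
  by apply: (expdec_integrable _ (expdec_ft (x%:C)%C hr)); rewrite /= normr0 subr0.
transitivity (cintegral mu (fun x => cintegral mu (fun s => F (x, s)))).
  apply: cintegral_ext => x; rewrite /F/= /ft mulrC -cintegralZ; last exact: igw.
  by apply: cintegral_ext => s; rewrite mulrC.
rewrite (cFubini mF fin); apply: cintegral_ext => s; rewrite /F/= /ft -cintegralZ; last exact: igr.
apply: cintegral_ext => x.
have -> : cexp ('i%C * ((s + t)%:C)%C * (x%:C)%C) =
   cexp ('i%C * (x%:C)%C * (s%:C)%C) * cexp ('i%C * (t%:C)%C * (x%:C)%C).
  by rewrite -cexpD; congr cexp; rewrite rmorphD/=; ring.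
by move: (cexp _) (cexp _) => u v; ring.
Qed.

Lemma ccontinuous_seq (f : R -> C) (u : nat -> R) x : ccontinuous f ->
  u n @[n --> \oo] --> x -> normc (f (u n) - f x) @[n --> \oo] --> (0 : R).
Proof.
move=> [f1 f2] ux.
apply: (@squeeze_cvgr _ _ _ _ (fun=> 0)
   (fun n => `|Re (f (u n)) - Re (f x)| + `|Im (f (u n)) - Im (f x)|)).
- apply: nearW => n; apply/andP; split; first exact: normc_ge0.
  by rewrite (le_trans (normc_le _))// !cReD !cImD !cReN !cImN.
- exact: cvg_cst.
- rewrite -[X in _ --> X]addr0; apply: cvgD.
    apply/norm_cvg0P/subr_cvg0; exact: (@cvg_comp _ _ _ u (fun y => Re (f y)) _ _ _ ux (f1 x)).
  apply/norm_cvg0P/subr_cvg0; exact: (@cvg_comp _ _ _ u (fun y => Im (f y)) _ _ _ ux (f2 x)).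
Qed.

Lemma normc_cintegral_dom (f : R -> C) (g : R -> R) : ccontinuous f ->
  measurable_fun [set: measurableTypeR R] g ->
  (forall x, normc (f x) <= g x) -> (forall x, 0 <= g x) ->
  (exists h : R -> R, mu.-integrable [set: R] (fun x => (h x)%:E) /\ forall x, g x <= h x) ->
  normc (cintegral mu f) <= \int[mu]_x g x.
Proof.
move=> cf mg fg g0 [h [ih gh]].
apply: normc_cintegral_le => //; first exact: cmeas_continuous.
apply: (le_integrable _ _ _ ih) => //; first exact/measurable_EFinP.
by move=> x _ /=; rewrite lee_fin ger0_norm// (le_trans (gh x))// ler_norm.
Qed.

(** Fourier inversion for the Poisson kernel: a dilated hyperbolic secant is
    used as summability factor, and its transform as approximate identity. *)
Lemma ift_ft_stripP th t : 0 < th < pi ->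
  ift (fun x => ft (stripPC th) (x%:C)%C) t = stripPC th t.
Proof.
move=> hth; have p0 := pi_gt0 R; have pn : (pi : R) != 0 by rewrite gt_eqF.
have [M M0 hP] := expdec_stripPC hth; have [cP bP] := hP.
have [MS MS0 hS] := expdec_stripPC hpi2; have [cS bS] := hS.
have [MF MF0 hF] := expdec_ft_stripP hth; have [cF bF] := hF.
have c0 : 0 < pi - th by case/andP: hth => _; rewrite subr_gt0.
pose P := stripPC th.
have bP1 x : normc (P x) <= M.
  by rewrite (le_trans (bP _))// ler_piMr ?(ltW M0)//.
pose N (n : nat) : R := n.+1%:R.
have N0 n : 0 < N n by rewrite ltr0n.
pose r n x : C := ((2 * pi)%:C)%C * S ((N n)^-1 * x).
have hr n : expdec (r n) (2 * pi * MS) (N n)^-1.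
  have cl : continuous (fun x : R => (N n)^-1 * x).
    by move=> x; apply: cvgM; [exact: cvg_cst|exact: cvg_id].
  split; first by apply: ccontinuousM; [exact: ccontinuous_cst|exact: (ccontinuous_comp cS cl)].
  move=> x; have q0 : 0 <= 2 * pi :> R by rewrite mulr_ge0// ltW.
  rewrite /r normcM normc_real ger0_norm// -mulrA ler_wpM2l//.
  have := bS ((N n)^-1 * x); rewrite mul1r normrM [`|(N n)^-1|]ger0_norm; first exact.
  by rewrite invr_ge0 ltW.
have rE n x : r n x = ((ch ((N n)^-1 * x))^-1%:C)%C.
  rewrite /r SE -real_C_M; apply: (congr1 (fun q => (q%:C)%C)); have := ch_ge1 ((N n)^-1 * x).
  move: (ch _) => u u1; have u0 : u != 0 by rewrite gt_eqF// (lt_le_trans ltr01).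
  by move: (pi : R) pn => q qn; field; rewrite ?u0 ?qn.
pose A := cintegral mu (fun x => ft P (x%:C)%C * cexp ('i%C * (t%:C)%C * (x%:C)%C)).
pose An n := cintegral mu (fun x => ft P (x%:C)%C * (r n x * cexp ('i%C * (t%:C)%C * (x%:C)%C))).
have igA : cintegrable mu (fun x => ft P (x%:C)%C * cexp ('i%C * (t%:C)%C * (x%:C)%C)).
  by apply: (expdec_integrable _ (expdec_ft (t%:C)%C hF)); rewrite /= normr0 subr0.
have ce := ccontinuous_expi ('i%C * (t%:C)%C).
have cAn n : ccontinuous (fun x => ft P (x%:C)%C * (r n x * cexp ('i%C * (t%:C)%C * (x%:C)%C))).
  by apply: ccontinuousM => //; apply: ccontinuousM => //; have [] := hr n.
have r1 n x : 0 <= (ch ((N n)^-1 * x))^-1 <= 1.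
  have h := ch_ge1 ((N n)^-1 * x); rewrite invr_ge0 invf_le1 ?h ?andbT//.
    exact: le_trans h.
  exact: lt_le_trans h.
have igAn n : cintegrable mu (fun x => ft P (x%:C)%C * (r n x * cexp ('i%C * (t%:C)%C * (x%:C)%C))).
  apply: (cintegrable_dom (cmeas_continuous (cAn n)) (integrable_expabs MF c0)) => x.
  rewrite normcM [normc (r n x * _)]normcM normc_expi_real mulr1 rE normc_real.
  have /andP[h1 h2] := r1 n x; rewrite ger0_norm// (le_trans _ (bF x))//.
  by rewrite ler_piMr ?normc_ge0.
(* the regularized integrals converge to the inverse transform *)
have cv1 : normc (An n - A) @[n --> \oo] --> (0 : R).
  pose h n x := normc (ft P (x%:C)%C) * (1 - (ch ((N n)^-1 * x))^-1).
  have mh n : measurable_fun [set: measurableTypeR R] (h n).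
    apply: measurable_funM.
      by apply: cmeas_normc; exact: cmeas_continuous.
    apply: measurable_funB; first exact: measurable_cst.
    apply: continuous_measurable_fun => x; apply: cvgV.
      by rewrite gt_eqF// (lt_le_trans ltr01 (ch_ge1 _)).
    apply: (@continuous_comp _ _ _ (fun x : R => (N n)^-1 * x) (@ch R)).
      by apply: cvgM; [exact: cvg_cst|exact: cvg_id].
    exact: continuous_ch.
  have hg n x : 0 <= h n x <= MF * expR (- ((pi - th) * `|x|)).
    have /andP[h1 h2] := r1 n x; rewrite /h mulr_ge0 ?normc_ge0 ?subr_ge0//=.
    by rewrite (le_trans _ (bF x))// ler_piMr ?normc_ge0//; lra.
  have ig := integrable_expabs MF c0.
  have cv := @Rintegral_dom_cvg0 R _ (measurableTypeR R) mu h _ mh hg ig.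
  apply: (@squeeze_cvgr _ _ _ _ (fun=> 0) (fun n => \int[mu]_x h n x)); last 2 first.
  - exact: cvg_cst.
  - apply: cv; apply: aeW => x.
    rewrite -[X in _ --> X](mulr0 (normc (ft P (x%:C)%C))).
    apply: cvgM; first exact: cvg_cst.
    rewrite -[X in _ --> X](subrr 1); apply: cvgB; first exact: cvg_cst.
    have -> : (1 : R) = (ch (0 * x))^-1 by rewrite mul0r /ch oppr0 expR0 divff// invr1.
    apply: cvgV; first by rewrite gt_eqF// (lt_le_trans ltr01 (ch_ge1 _)).
    apply: (@cvg_comp _ _ _ (fun n => (N n)^-1 * x) (@ch R) _ (nbhs (0 * x))); last exact: continuous_ch.
    by apply: cvgM; [exact: cvg_harmonic|exact: cvg_cst].
  apply: nearW => n; apply/andP; split; first exact: normc_ge0.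
  rewrite /An /A -cintegralB//.
  apply: normc_cintegral_dom => //.
  - rewrite (_ : (fun x => _) = (fun x : R => ft P (x%:C)%C * ((r n x + -1) * cexp ('i%C * (t%:C)%C * (x%:C)%C)))).
      apply: ccontinuousM => //; apply: ccontinuousM => //; apply: ccontinuousD.
        by have [] := hr n.
      exact: ccontinuous_cst.
    by apply/funext => x; move: (cexp _) => u; ring.
  - move=> x.
    have -> : ft P (x%:C)%C * (r n x * cexp ('i%C * (t%:C)%C * (x%:C)%C)) - ft P (x%:C)%C * cexp ('i%C * (t%:C)%C * (x%:C)%C) =
       ft P (x%:C)%C * ((r n x - 1) * cexp ('i%C * (t%:C)%C * (x%:C)%C)).
      by move: (cexp _) => u; ring.
    rewrite normcM [normc ((_ - 1) * _)]normcM normc_expi_real mulr1 /h ler_wpM2l ?normc_ge0//.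
    have /andP[h1 h2] := r1 n x.
    rewrite normcBC rE (_ : 1 - _ = ((1 - (ch ((N n)^-1 * x))^-1)%:C)%C); last by rewrite rmorphB rmorph1.
    by rewrite normc_real ger0_norm// subr_ge0.
  - by move=> x; case/andP: (hg n x).
  - by exists (fun x => MF * expR (- ((pi - th) * `|x|))); split => // x; case/andP: (hg n x).
(* the regularized integrals as convolutions with an approximate identity *)
have ftr n (u : R) : ft (r n) (u%:C)%C = ((2 * pi * N n)%:C)%C * ((pi%:C)%C * S (pi * (N n * u) / 2)).
  rewrite -ft_sech.
  have i1 : cintegrable mu (fun s => S s * cexp ('i%C * ((N n * u)%:C)%C * (s%:C)%C)).
    by apply: (expdec_integrable _ (expdec_ft ((N n * u)%:C)%C hS)); rewrite /= normr0 subr0.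
  have NV : 0 < (N n)^-1 by rewrite invr_gt0.
  have [i2 e2] := cintegral_affine 0 NV i1.
  have -> : ft (r n) (u%:C)%C = ((2 * pi)%:C)%C * cintegral mu (fun s =>
      S ((N n)^-1 * s + 0) * cexp ('i%C * ((N n * u)%:C)%C * (((N n)^-1 * s + 0)%:C)%C)).
    rewrite -cintegralZ; last exact: i2.
    apply: cintegral_ext => x; rewrite addr0 /r -mulrA; congr (_ * (_ * _)); congr cexp.
    rewrite -!mulrA -!real_C_M; congr (_ * _); apply: (congr1 (fun q => (q%:C)%C)).
    by field; rewrite gt_eqF.
  by rewrite e2 invrK mulrA -real_C_M.
have AnE n : An n = ((4 * pi)%:C)%C * cintegral mu (fun v => P (2 / (pi * N n) * v - t) * S v).
  rewrite /An (ft_mul t ltr01 _ hP (hr n)) ?invr_gt0//.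
  have i1 : cintegrable mu (fun v => P (2 / (pi * N n) * v - t) * S v).
    apply: (cintegrable_dom _ (integrable_expabs (M * MS) ltr01)).
      apply: cmeas_continuous; apply: ccontinuousM => //; apply: (ccontinuous_comp cP) => x.
      by apply: cvgB; [apply: cvgM; [exact: cvg_cst|exact: cvg_id]|exact: cvg_cst].
    by move=> x; rewrite normcM -[leRHS]mulrA ler_pM ?normc_ge0.
  have q0 : 0 < pi * N n / 2 by rewrite divr_gt0// mulr_gt0.
  have [i2 e2] := cintegral_affine (pi * N n / 2 * t) q0 i1.
  have -> : cintegral mu (fun v => P (2 / (pi * N n) * v - t) * S v) =
      ((pi * N n / 2)%:C)%C * cintegral mu (fun s => P (2 / (pi * N n) * (pi * N n / 2 * s + pi * N n / 2 * t) - t) * S (pi * N n / 2 * s + pi * N n / 2 * t)).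
    by rewrite e2 mulrA -real_C_M mulfV ?mul1r// gt_eqF.
  rewrite mulrA -real_C_M -cintegralZ; last exact: i2.
  apply: cintegral_ext => s; rewrite ftr.
  have -> : 2 / (pi * N n) * (pi * N n / 2 * s + pi * N n / 2 * t) - t = s.
    have nn : N n != 0 by rewrite gt_eqF.
    by move: (N n) nn (pi : R) pn => m mn q qn; field; rewrite ?mn ?qn.
  have -> : pi * N n / 2 * s + pi * N n / 2 * t = pi * (N n * (s + t)) / 2 by ring.
  have -> : (4 * pi * (pi * N n / 2)) = (2 * pi * N n) * pi by field.
  have alg (u v q p : C) : p * (u * (v * q)) = u * v * (p * q) by ring.
  by rewrite (real_C_M (2 * pi * N n)); exact: alg.
have iS : cintegrable mu S := expdec_integrable ltr01 hS.
have S1 : cintegral mu S = (2^-1%:C)%C.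
  have h0 : `|Im (0 : C)| < 1 by rewrite /= normr0.
  have := ft_stripP h0 hpi2; rewrite /Phat eqxx.
  have -> : ft (stripPC (pi / 2)) 0 = cintegral mu S.
    by apply: cintegral_ext => s; rewrite mulr0 mul0r cexp0 mulr1.
  by move=> ->; apply: (congr1 (fun q => (q%:C)%C)); rewrite mulrAC mulfV ?mul1r.
have cv2 : normc (An n - ((2 * pi)%:C)%C * P t) @[n --> \oo] --> (0 : R).
  pose h n v := 4 * pi * (normc (P (2 / (pi * N n) * v - t) - P (- t)) * normc (S v)).
  have cPn n : ccontinuous (fun v => P (2 / (pi * N n) * v - t)).
    apply: (ccontinuous_comp cP) => x.
    by apply: cvgB; [apply: cvgM; [exact: cvg_cst|exact: cvg_id]|exact: cvg_cst].
  have cPn' n : ccontinuous (fun v => P (2 / (pi * N n) * v - t) - P (- t)).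
    by apply: ccontinuousD => //; exact: ccontinuous_cst.
  have mh n : measurable_fun [set: measurableTypeR R] (h n).
    apply: measurable_funM; first exact: measurable_cst.
    by apply: measurable_funM; apply: cmeas_normc; exact: cmeas_continuous.
  have hg n v : 0 <= h n v <= 4 * pi * (2 * M * MS) * expR (- (1 * `|v|)).
    have pi4 : 0 <= 4 * pi :> R by rewrite mulr_ge0// ltW.
    rewrite /h; apply/andP; split.
      by rewrite mulr_ge0// mulr_ge0 ?normc_ge0.
    rewrite -[leRHS]mulrA ler_wpM2l//.
    rewrite -[leRHS]mulrA ler_pM ?normc_ge0//.
    by rewrite (le_trans (normcB _ _))//; have := bP1 (2 / (pi * N n) * v - t); have := bP1 (- t); lra.
  have ig := integrable_expabs (4 * pi * (2 * M * MS)) ltr01.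
  have cv := @Rintegral_dom_cvg0 R _ (measurableTypeR R) mu h _ mh hg ig.
  apply: (@squeeze_cvgr _ _ _ _ (fun=> 0) (fun n => \int[mu]_x h n x)); last 2 first.
  - exact: cvg_cst.
  - apply: cv; apply: aeW => v.
    rewrite -[X in _ --> X](mulr0 (4 * pi)); apply: cvgM; first exact: cvg_cst.
    rewrite -[X in _ --> X](mul0r (normc (S v))); apply: cvgM; last exact: cvg_cst.
    apply: (@ccontinuous_seq P) => //.
    rewrite -[X in _ --> X]add0r; apply: cvgD; last exact: cvg_cst.
    rewrite -[X in _ --> X](mul0r v); apply: cvgM; last exact: cvg_cst.
    rewrite -[X in _ --> X](mulr0 (2 / pi)).
    under eq_fun do rewrite invfM mulrA.
    by apply: cvgM; [exact: cvg_cst|exact: cvg_harmonic].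
  apply: nearW => n; apply/andP; split; first exact: normc_ge0.
  have iPn : cintegrable mu (fun v => P (2 / (pi * N n) * v - t) * S v).
    apply: (cintegrable_dom _ (integrable_expabs (M * MS) ltr01)).
      by apply: cmeas_continuous; apply: ccontinuousM.
    by move=> x; rewrite normcM -[leRHS]mulrA ler_pM ?normc_ge0.
  have -> : ((2 * pi)%:C)%C * P t = ((4 * pi)%:C)%C * cintegral mu (fun v => P (- t) * S v).
    have e4 : 4 * pi * 2^-1 = 2 * pi :> R by field.
    have PN : P (- t) = P t by exact: stripPCN.
    rewrite PN cintegralZ; last exact: iS.
    by rewrite -e4 (real_C_M (4 * pi)) S1 -mulrA [_ * P t]mulrC.
  rewrite AnE -mulrBr -cintegralB//; last exact: cintegrableZ.
  rewrite -cintegralZ; last first.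
    have := cintegrableD iPn (cintegrableZ (- P (- t)) iS).
    by under eq_fun do rewrite mulNr.
  apply: normc_cintegral_dom => //.
  - apply: ccontinuousM; first exact: ccontinuous_cst.
    rewrite (_ : (fun x => _) = (fun v => (P (2 / (pi * N n) * v - t) - P (- t)) * S v)).
      exact: ccontinuousM.
    by apply/funext => v; rewrite mulrBl.
  - have pi4 : 0 <= 4 * pi :> R by rewrite mulr_ge0// ltW.
    move=> v; rewrite -mulrBl normcM normc_real [`|4 * pi|]ger0_norm//.
    by rewrite /h [normc (_ * S v)]normcM.
  - by move=> x; case/andP: (hg n x).
  - by exists (fun x => 4 * pi * (2 * M * MS) * expR (- (1 * `|x|))); split => // x; case/andP: (hg n x).
have key : normc (A - ((2 * pi)%:C)%C * P t) = 0.
  apply/eqP; rewrite eq_le normc_ge0 andbT.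
  have lim : (normc (An n - A) + normc (An n - ((2 * pi)%:C)%C * P t)) @[n --> \oo] --> (0 + 0 : R).
    exact: cvgD.
  rewrite addr0 in lim.
  apply: (@cvgr_to_ge _ _ _ _ _ _ _ lim).
  apply: nearW => n.
  have -> : A - ((2 * pi)%:C)%C * P t = - (An n - A) + (An n - ((2 * pi)%:C)%C * P t) by ring.
  by rewrite (le_trans (normcD _ _))// normcNE.
have AE : A = ((2 * pi)%:C)%C * P t by apply/eqP; rewrite -subr_eq0; apply/eqP; exact: eq0_normc.
rewrite /ift -[ft _ _]/A AE mulrA -real_C_M mulVf ?mul1r//.
by rewrite gt_eqF// mulr_gt0.
Qed.

End Regularization.

(** * The resolvent kernel *)

Section Resolvent.
Variable R : realType.
Local Notation C := R[i].
Local Notation Re := (@complex.Re R).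
Local Notation Im := (@complex.Im R).
Local Notation mu := (@lebesgue_measure R).
Implicit Types (z l : C) (x y t a b c M th : R).

(** The kernel has decay 1, and the strip needs only 1/2: the rest of the decay
    pays for the difference of the exponentials. *)
Lemma ft_stripP_lipschitz th : 0 < th < pi -> exists2 L, 0 < L &
  forall z d : C, `|Im z| <= 2^-1 -> normc d <= 8^-1 ->
  normc (ft (stripPC th) (z + d) - ft (stripPC th) z) <= L * normc d.
Proof.
move=> hth; have [M M0 [cP bP]] := expdec_stripPC hth.
exists (M * 16 * 8); first by rewrite !mulr_gt0.
move=> z d hz hd; pose P := stripPC th.
have hP : expdec P M 1 by split.
have igw (k : C) : `|Im k| < 1 -> cintegrable mu (fun s => P s * cexp ('i%C * k * (s%:C)%C)).
  by move=> hk; apply: (expdec_integrable _ (expdec_ft k hP)); rewrite subr_gt0.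
have d0 := normc_ge0 d.
have hR := Re_le_normc d; have hI := Im_le_normc d.
have hzd : `|Im (z + d)| < 1.
  by rewrite cImD (le_lt_trans (ler_normD _ _))//; lra.
have hz1 : `|Im z| < 1 by lra.
rewrite /ft -cintegralB; [|exact: igw hzd|exact: igw hz1].
have q0 : 0 < 4^-1 :> R by [].
have e0 : (fun t => P t * cexp ('i%C * (z + d) * (t%:C)%C) - P t * cexp ('i%C * z * (t%:C)%C)) =
  (fun t => P t * (cexp ('i%C * z * (t%:C)%C) * (cexp ('i%C * d * (t%:C)%C) - 1))).
  apply/funext => t; have -> : cexp ('i%C * (z + d) * (t%:C)%C) = cexp ('i%C * z * (t%:C)%C) * cexp ('i%C * d * (t%:C)%C).
    by rewrite -cexpD; congr cexp; ring.
  by move: (cexp _) (cexp _) => u v; ring.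
rewrite e0.
have cc : ccontinuous (fun t => P t * (cexp ('i%C * z * (t%:C)%C) * (cexp ('i%C * d * (t%:C)%C) - 1))).
  apply: ccontinuousM => //; apply: ccontinuousM; first exact: (ccontinuous_expi ('i%C * z)).
  by apply: ccontinuousD; [exact: (ccontinuous_expi ('i%C * d))|exact: ccontinuous_cst].
have ig := integrable_expabs (M * 16 * normc d) q0.
rewrite (le_trans (normc_cintegral_le (cmeas_continuous cc) ig _))//; last first.
  rewrite RintegralZl//; last by have := integrable_expabs 1 q0; under eq_fun do rewrite mul1r.
  by rewrite Rintegral_expabs// le_eqVlt; apply/orP; left; apply/eqP; field.
move=> t; have t0 := normr_ge0 t.
rewrite normcM [normc (cexp _ * _)]normcM.
have h1 : normc (cexp ('i%C * z * (t%:C)%C)) <= expR (2^-1 * `|t|).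
  by rewrite (le_trans (normc_expi_le _ _))// ler_expR ler_wpM2r.
have eR : Re ('i%C * d * (t%:C)%C) = - (Im d * t).
  by rewrite cReM /=; case: (d) => u v /=; ring.
have eI : Im ('i%C * d * (t%:C)%C) = Re d * t.
  by rewrite cImM /=; case: (d) => u v /=; ring.
have h2 : normc (cexp ('i%C * d * (t%:C)%C) - 1) <= 2 * normc d * (8 * expR (4^-1 * `|t|)).
  rewrite (le_trans (normc_cexp_sub1 _))// eR eI normrN !normrM.
  have k1 : `|Im d| * `|t| + `|Re d| * `|t| <= 2 * normc d * `|t|.
    by rewrite -mulrDl ler_wpM2r//; lra.
  have k2 : expR (`|Im d| * `|t|) <= expR (8^-1 * `|t|).
    by rewrite ler_expR ler_wpM2r//; lra.
  have k3 : `|t| <= 8 * expR (8^-1 * `|t|).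
    by have := expR_ge1Dx (8^-1 * `|t|); lra.
  have k4 : expR (4^-1 * `|t|) = expR (8^-1 * `|t|) * expR (8^-1 * `|t|).
    by rewrite -expRD; congr expR; lra.
  apply: (@le_trans _ _ (2 * normc d * `|t| * expR (8^-1 * `|t|))).
    by rewrite ler_pM ?expR_ge0// addr_ge0 ?mulr_ge0.
  by rewrite -mulrA ler_wpM2l ?mulr_ge0// k4 mulrA ler_wpM2r ?expR_ge0.
have h3 := ler_pM (normc_ge0 _) (normc_ge0 _) h1 h2.
have h4 := ler_pM (normc_ge0 _) (mulr_ge0 (normc_ge0 _) (normc_ge0 _)) (bP t) h3.
apply: (le_trans h4).
have -> : - (4^-1 * `|t|) = - (1 * `|t|) + (2^-1 * `|t| + 4^-1 * `|t|) by lra.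
rewrite expRD (expRD (2^-1 * _)) le_eqVlt; apply/orP; left; apply/eqP; ring.
Qed.

(** The transform is Lipschitz up to the boundary, uniformly on the strip, which
    is stronger than continuity since the strip is unbounded. *)
Lemma ft_stripP_sep_extend th l (e : R) : 0 < th < pi -> 0 < e ->
  (forall z, `|Im z| < 2^-1 -> e <= normc (l - ft (stripPC th) z ^+ 2)) ->
  exists2 d, 0 < d < 8^-1 & forall z, `|Im z| < 2^-1 + d ->
    e / 2 <= normc (l - ft (stripPC th) z ^+ 2).
Proof.
move=> hth e0 sep; have [L L0 hL] := ft_stripP_lipschitz hth.
have [B B0 hB] := ft_stripP_decay hth.
have hB1 z : `|Im z| <= 3 / 4 -> normc (ft (stripPC th) z) <= B.
  move=> /hB /le_trans; apply; rewrite ler_piMr ?(ltW B0)//.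
  rewrite -expR0 ler_expR oppr_le0 mulr_ge0// subr_ge0.
  by case/andP: hth => _ /ltW.
(* The point [z] is moved to [z'] in the small strip, by at most [4 * d]; the
   squares then differ by at most [L * (4 * d) * (2 * B) <= e / 2]. *)
pose d := Num.min 32^-1 (e / (16 * L * B)).
have q0 : 0 < e / (16 * L * B) by rewrite divr_gt0// !mulr_gt0.
have d0 : 0 < d by rewrite lt_min q0 andbT invr_gt0.
have d1 : d <= 32^-1 by rewrite ge_min lexx.
have d2 : d * (16 * L * B) <= e.
  by rewrite -ler_pdivlMr ?mulr_gt0// ge_min lexx orbT.
exists d; first by rewrite d0; lra.
move=> z hz; set f := ft (stripPC th).
pose u := Im z / (1 + 4 * d).
have n0 : 0 < 1 + 4 * d by lra.
have hu : `|u| < 2^-1.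
  by rewrite /u normrM normfV [`|1 + _|]gtr0_norm// ltr_pdivrMr//; lra.
pose z' : C := (Re z +i* u)%C; pose w : C := (0 +i* (Im z - u))%C.
have zE : z = z' + w by rewrite /z' /w; apply: cx_ext; rewrite ?cReD ?cImD /=; ring.
have hw : normc w <= 4 * d.
  rewrite (le_trans (normc_le _))//= normr0 add0r.
  have -> : Im z - u = 4 * d * u.
    by rewrite /u; move: (Im z) n0 => q n0; field; rewrite gt_eqF.
  by rewrite normrM [`|4 * d|]gtr0_norm ?mulr_gt0// ler_piMr; lra.
have hz' : `|Im z'| < 2^-1 by [].
have s1 := sep _ hz'.
have s2 : normc (f z - f z') <= L * (4 * d).
  by rewrite {1}zE; apply: le_trans (hL _ _ _ _) _; [exact: ltW|lra|rewrite ler_pM2l].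
have s3 : normc (f z + f z') <= 2 * B.
  rewrite (le_trans (normcD _ _))//.
  have := hB1 z; have := hB1 z'; rewrite -/f => h1 h2.
  have /h1 : `|Im z'| <= 3/4 by lra.
  have /h2 : `|Im z| <= 3/4 by lra.
  lra.
have s4 : normc (f z ^+ 2 - f z' ^+ 2) <= e / 2.
  rewrite subr_sqr normcM.
  apply: (le_trans (ler_pM (normc_ge0 _) (normc_ge0 _) s2 s3)); lra.
have : normc (l - f z' ^+ 2) <= normc (l - f z ^+ 2) + normc (f z ^+ 2 - f z' ^+ 2).
  by rewrite (le_trans _ (normcD _ _))// subrKA.
rewrite -/f in s1; lra.
Qed.

Lemma cderive_resolvent (h E : R -> C) (l : C) x (p m : C) :
  cderive h x p -> cderive E x (E x * m) -> l - h x * h x != 0 ->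
  cderive (fun s => h s * h s / (l - h s * h s) * E s) x
    ((h x * (2 * p * l / (l - h x * h x) ^+ 2) + h x * h x / (l - h x * h x) * m) * E x).
Proof.
move=> dh dE n0.
have dhh := cderiveM dh dh.
have dl := cderiveD (cderive_cst l x) (cderiveN dhh).
apply: cderive_eq (cderiveM (cderiveM dhh (@cderiveV _ (fun s => l + - (h s * h s)) _ _ n0 dl)) dE) _.
by move: (h x) (E x) n0 => u v n0; field.
Qed.

Lemma ft_ccontinuous_line (w : R -> C) M a y : expdec w M a -> `|y| < a ->
  ccontinuous (fun x => ft w (x +i* y)%C).
Proof.
move=> hw hy.
apply: (@cderive_ccontinuous _ _ (fun x => ft (fun t => 'i%C * (t%:C)%C * w t) (x +i* y)%C)) => x.
have c0 : 0 < (a - `|y|) / 2 by lra.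
have y0 : `|y| < a - (a - `|y|) / 2 by lra.
by have [] := ft_cderive x c0 hw y0.
Qed.

(** The analytic transform [h^2/(l - h^2)] of the resolvent kernel decays along
    horizontal lines; moving the contour to the lines [Im z = +-b], b > 1/2,
    gives the kernel more than the decay exp(-|t|/2). *)
Lemma resolvent_kernel th l (e : R) : 0 < th < pi -> 0 < e ->
  (forall z, `|Im z| < 2^-1 -> e <= normc (l - ft (stripPC th) z ^+ 2)) ->
  exists K : R -> C, exists2 b, 2^-1 < b < 1 & exists2 M, expdec K M b &
    forall t, l * K t = convol (stripPC th) (stripPC th) t +
                        convol (stripPC th) (convol (stripPC th) K) t.
Proof.
move=> hth e0 sep; have p0 := pi_gt0 R.
have [d /andP[d0 d8] sep'] := ft_stripP_sep_extend hth e0 sep.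
have [B B0 hB] := ft_stripP_decay hth.
have [MP MP0 hP] := expdec_stripPC hth.
have [MF MF0 hF] := expdec_ft_stripP hth.
pose c := pi - th; have c0 : 0 < c by case/andP: hth => _; rewrite subr_gt0.
pose P := stripPC th; pose h z := ft P z.
pose H z := h z * h z / (l - h z * h z).
have e2 : 0 < e / 2 by rewrite divr_gt0.
have hn z : `|Im z| < 2^-1 + d -> e / 2 <= normc (l - h z * h z).
  by move=> hz; rewrite -expr2; exact: sep'.
have hn0 z : `|Im z| < 2^-1 + d -> l - h z * h z != 0.
  move=> /hn; apply: contraTneq => ->; rewrite normc0 -ltNge//.
have hV z : `|Im z| < 2^-1 + d -> normc (l - h z * h z)^-1 <= 2 / e.
  move=> hz; rewrite normcV -[leRHS]invrK lef_pV2 ?posrE ?invr_gt0 ?divr_gt0//.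
    by rewrite invf_div; exact: hn.
  exact: lt_le_trans (hn _ hz).
have hh z : `|Im z| < 2^-1 + d -> normc (h z) <= B * expR (- (c * `|Re z|)).
  by move=> hz; apply: hB; lra.
have hh1 z : `|Im z| < 2^-1 + d -> normc (h z) <= B.
  move=> hz; rewrite (le_trans (hh _ hz))// ler_piMr ?(ltW B0)//.
  by rewrite -expR0 ler_expR oppr_le0 mulr_ge0// ltW.
have hH z : `|Im z| < 2^-1 + d -> normc (H z) <= B * B * (2 / e) * expR (- (c * `|Re z|)).
  move=> hz; rewrite normcM normcM.
  have k1 := ler_pM (normc_ge0 _) (normc_ge0 _) (hh _ hz) (hh1 _ hz).
  have := ler_pM (mulr_ge0 (normc_ge0 _) (normc_ge0 _)) (normc_ge0 _) k1 (hV _ hz).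
  by move=> /le_trans; apply; rewrite le_eqVlt; apply/orP; left; apply/eqP; ring.
have Im0 x : `|Im (x%:C)%C| < 2^-1 + d by rewrite /= normr0 addr_gt0.
have q4 : 0 < 4^-1 :> R by [].
have hPi := expdec_mulid q4 hP.
have dx x y : `|y| < 2^-1 + d -> _ := fun hy => proj1 (@ft_cderive R P MP 1 4^-1 x y q4 hP ltac:(lra)).
have dy x y : `|y| < 2^-1 + d -> _ := fun hy => proj2 (@ft_cderive R P MP 1 4^-1 x y q4 hP ltac:(lra)).
pose h' z := ft (fun t => 'i%C * (t%:C)%C * P t) z.
have cH : ccontinuous (fun x => H (x%:C)%C).
  have y0 : `|(0 : R)| < 2^-1 + d by rewrite normr0 addr_gt0.
  pose f' x := h (x +i* 0)%C * (2 * h' (x +i* 0)%C * l / (l - h (x +i* 0)%C * h (x +i* 0)%C) ^+ 2) + h (x +i* 0)%C * h (x +i* 0)%C / (l - h (x +i* 0)%C * h (x +i* 0)%C) * 0.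
  apply: (@cderive_ccontinuous _ _ (fun x => f' x * 1)) => x.
  have d1 : cderive (fun=> 1 : C) x (1 * 0) by rewrite mulr0; exact: cderive_cst.
  have n0 : l - h (x +i* 0)%C * h (x +i* 0)%C != 0 by exact: hn0.
  have := cderive_resolvent (dx x 0 y0) d1 n0.
  by apply: cderive_ext => s; rewrite mulr1.
pose HR x := H (x%:C)%C.
have hHR : expdec HR (B * B * (2 / e)) c by split => // t; exact: hH.
pose K := ift HR.
have [bK hbK] : exists bK, forall t, normc (K t) <= bK * expR (- ((2^-1 + d / 2) * `|t|)).
  exists ((2 * pi)^-1 * (B * B * (2 / e) * (2 / c))) => t.
  have pi2 : 0 <= (2 * pi)^-1 :> R by exact: pi2V_ge0.
  rewrite /K /ift normcM normc_real [`|_^-1|]ger0_norm// -[leRHS]mulrA ler_wpM2l//.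
  pose E x y := cexp ('i%C * (t%:C)%C * (x +i* y)%C) : C.
  pose F x y := H (x +i* y)%C * E x y.
  pose F' x y := (h (x +i* y)%C * (2 * h' (x +i* y)%C * l / (l - h (x +i* y)%C * h (x +i* y)%C) ^+ 2)
      + H (x +i* y)%C * ('i%C * (t%:C)%C)) * E x y.
  have nE x y : normc (E x y) = expR (- (t * y)).
    by rewrite /E normc_cexp; congr expR; rewrite /=; ring.
  have nE1 x y : `|y| < 2^-1 + d -> normc (E x y) <= expR `|t|.
    move=> hy; rewrite nE ler_expR (le_trans (ler_norm _))// normrN normrM.
    by rewrite ler_piMr//; lra.
  have hy1 y : - (2^-1 + d) < y < 2^-1 + d -> `|y| < 2^-1 + d by rewrite ltr_norml.
  have dEx x y : cderive (E^~ y) x (E x y * ('i%C * (t%:C)%C)).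
    apply: cderive_exp.
    have dd : cderive (fun s => (s +i* y)%C) x 1.
      by split => /=; [exact: is_derive_id|exact: is_derive_cst].
    by have := cderiveZ ('i%C * (t%:C)%C) dd; rewrite mulr1.
  have dEy x y : cderive (E x) y (E x y * ('i%C * ('i%C * (t%:C)%C))).
    apply: cderive_exp.
    have dd : cderive (fun s => (x +i* s)%C) y 'i%C.
      by split => /=; [exact: is_derive_cst|exact: is_derive_id].
    by apply: cderive_eq (cderiveZ ('i%C * (t%:C)%C) dd) _; rewrite mulrC.
  have [B' hB'] : exists B', forall x y, `|y| < 2^-1 + d -> normc (h' (x +i* y)%C) <= B'.
    exists (MP / 4^-1 * (2 / (1 - 4^-1 - (2^-1 + d)))) => x y hy.
    have hy2 : `|Im (x +i* y)%C| < 1 - 4^-1 by rewrite /=; lra.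
    rewrite (le_trans (ft_le hPi hy2))// [Im _]/=.
    rewrite ler_wpM2l ?(expdec_M_ge0 hPi)// ler_pM2l// lef_pV2 ?posrE; lra.
  pose MM := (B * (2 * B' * normc l * (2 / e) ^+ 2) + B * B * (2 / e) * `|t|) * expR `|t| + B * B * (2 / e) * expR `|t|.
  have B'0 : 0 <= B'.
    by apply: le_trans (hB' 0 0 _); [exact: normc_ge0|rewrite normr0 addr_gt0].
  have el0 : 0 <= 2 / e by rewrite divr_ge0// ltW.
  have BB0 : 0 <= B * B * (2 / e) by apply: mulr_ge0 => //; rewrite mulr_ge0 ?(ltW B0).
  have NB0 : 0 <= B * (2 * B' * normc l * (2 / e) ^+ 2).
    apply: mulr_ge0; first exact: ltW.
    by apply: mulr_ge0; [rewrite !mulr_ge0 ?normc_ge0|exact: exprn_ge0].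
  have cont y y' : - (2^-1 + d) < y < 2^-1 + d -> - (2^-1 + d) < y' < 2^-1 + d ->
      cintegral mu (F^~ y) = cintegral mu (F^~ y').
    apply: (@contour_shift R F F' (2^-1 + d) c MM c0).
    - move=> x y0 /hy1 hy.
      exact: (cderive_resolvent (dx x y0 hy) (dEx x y0) (hn0 (x +i* y0)%C hy)).
    - move=> x y0 /hy1 hy.
      apply: cderive_eq (cderive_resolvent (dy x y0 hy) (dEy x y0) (hn0 (x +i* y0)%C hy)) _.
      rewrite /F' /H /h'; have := hn0 (x +i* y0)%C hy; rewrite -/(h (x +i* y0)%C).
      move: (h (x +i* y0)%C) (E x y0) (ft _ (x +i* y0)%C) => v w u' n0.
      by move: 'i%C (t%:C)%C => i' t'; field.
    - move=> x y0 /hy1 hy; rewrite normcM.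
      have k := ler_pM (normc_ge0 _) (normc_ge0 _) (hH (x +i* y0)%C hy) (nE1 x y0 hy).
      apply: (le_trans k); rewrite mulrAC ler_wpM2r ?expR_ge0// /MM lerDr.
      by apply: mulr_ge0; [apply: addr_ge0 => //; apply: mulr_ge0|exact: expR_ge0].
    - move=> x y0 /hy1 hy; rewrite normcM.
      have k1 : normc (h (x +i* y0)%C * (2 * h' (x +i* y0)%C * l / (l - h (x +i* y0)%C * h (x +i* y0)%C) ^+ 2)) <=
         B * expR (- (c * `|x|)) * (2 * B' * normc l * (2 / e) ^+ 2).
        rewrite normcM ler_pM ?normc_ge0//; first exact: (hh (x +i* y0)%C hy).
        rewrite normcM [normc (_ * l)]normcM [normc (2 * _)]normcM normc2.
        rewrite ler_pM ?mulr_ge0 ?normc_ge0//.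
          by rewrite ler_wpM2r ?normc_ge0// ler_pM2l// hB'.
        by rewrite -exprVn normcX lerXn2r ?nnegrE ?normc_ge0//; exact: (hV (x +i* y0)%C hy).
      have k2 : normc (H (x +i* y0)%C * ('i%C * (t%:C)%C)) <= B * B * (2 / e) * expR (- (c * `|x|)) * `|t|.
        rewrite normcM [normc ('i%C * _)]normcM normi mul1r normc_real ler_wpM2r//.
        exact: (hH (x +i* y0)%C hy).
      have k3 := le_trans (normcD _ _) (lerD k1 k2).
      have k := ler_pM (normc_ge0 _) (normc_ge0 _) k3 (nE1 x y0 hy).
      apply: (le_trans k).
      have -> : (B * expR (- (c * `|x|)) * (2 * B' * normc l * (2 / e) ^+ 2) + B * B * (2 / e) * expR (- (c * `|x|)) * `|t|) * expR `|t| =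
        (B * (2 * B' * normc l * (2 / e) ^+ 2) + B * B * (2 / e) * `|t|) * expR `|t| * expR (- (c * `|x|)) by ring.
      rewrite ler_wpM2r ?expR_ge0// /MM lerDl.
      by apply: mulr_ge0 => //; exact: expR_ge0.
    - move=> y0 /hy1 hy; have hy2 : `|y0| < 1 by lra.
      have hy3 : `|y0| < 1 - 4^-1 by lra.
      have c1 := ft_ccontinuous_line hP hy2.
      have c2 := ft_ccontinuous_line hPi hy3.
      have cE : ccontinuous (E^~ y0) := cderive_ccontinuous (fun x => dEx x y0).
      have cV : ccontinuous (fun x => (l - h (x +i* y0)%C * h (x +i* y0)%C)^-1).
        pose g' x := - (0 + - (h' (x +i* y0)%C * h (x +i* y0)%C + h (x +i* y0)%C * h' (x +i* y0)%C)) / (l - h (x +i* y0)%C * h (x +i* y0)%C) ^+ 2.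
        apply: (@cderive_ccontinuous _ _ g') => x.
        have dl := cderiveD (cderive_cst l x) (cderiveN (cderiveM (dx x y0 hy) (dx x y0 hy))).
        exact: (@cderiveV _ (fun s => l + - (h (s +i* y0)%C * h (s +i* y0)%C)) _ _ (hn0 (x +i* y0)%C hy) dl).
      apply: ccontinuousM => //; apply: ccontinuousD.
        apply: ccontinuousM; first exact: c1.
        apply: ccontinuousM.
          apply: ccontinuousM; last exact: ccontinuous_cst.
          by apply: ccontinuousM; [exact: ccontinuous_cst|exact: c2].
        under eq_fun do rewrite -exprVn expr2.
        exact: ccontinuousM.
      apply: ccontinuousM; last exact: ccontinuous_cst.
      by apply: ccontinuousM => //; apply: ccontinuousM; exact: c1.
  have -> : ft HR (t%:C)%C = cintegral mu (F^~ 0) by [].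
  (* The line is moved to the side where [exp (i t z)] is small. *)
  have [y hy yt] : exists2 y, - (2^-1 + d) < y < 2^-1 + d & t * y = (2^-1 + d / 2) * `|t|.
    have [t0|t0] := leP 0 t.
      by exists (2^-1 + d / 2); [lra|rewrite ger0_norm// mulrC].
    by exists (- (2^-1 + d / 2)); [lra|rewrite ltr0_norm//; ring].
  have y0 : - (2^-1 + d) < 0 < 2^-1 + d by lra.
  rewrite (cont _ _ y0 hy).
  have ig := integrable_expabs (B * B * (2 / e) * expR (- ((2^-1 + d / 2) * `|t|))) c0.
  have cF : cmeas (F^~ y).
    apply: cmeas_continuous.
    apply: (@cderive_ccontinuous _ _ (F'^~ y)) => x.
    exact: (cderive_resolvent (dx x y (hy1 _ hy)) (dEx x y) (hn0 (x +i* y)%C (hy1 _ hy))).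
  have bF x : normc (F x y) <= B * B * (2 / e) * expR (- ((2^-1 + d / 2) * `|t|)) * expR (- (c * `|x|)).
    rewrite normcM nE yt [leRHS]mulrAC; apply: ler_wpM2r; first exact: expR_ge0.
    exact: (hH (x +i* y)%C (hy1 _ hy)).
  pose g x := B * B * (2 / e) * expR (- ((2^-1 + d / 2) * `|t|)) * expR (- (c * `|x|)).
  have HH := @normc_cintegral_le R _ (measurableTypeR R) mu (F^~ y) g cF ig bF.
  apply: (le_trans HH); rewrite /g.
  rewrite RintegralZl//; last by have := integrable_expabs 1 c0; under eq_fun do rewrite mul1r.
  by rewrite Rintegral_expabs// mulrAC.
exists K, (2^-1 + d / 2); first lra.
have cK : ccontinuous K.
  apply: ccontinuousM; first exact: ccontinuous_cst.
  exact: (ft_real_ccontinuous c0 hHR).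
exists bK; first by split.
move=> t.
pose hR x := h (x%:C)%C.
have PE : P = ift hR by apply/funext => s; rewrite /hR /h ift_ft_stripP.
have expdec_mul (f g : R -> C) Mf Mg : expdec f Mf c -> expdec g Mg c -> expdec (fun x => f x * g x) (Mf * Mg) c.
  move=> hf hg; have Mg0 := expdec_M_ge0 hg; case: hf hg => [cf bf] [cg bg].
  split; first exact: ccontinuousM.
  move=> x; rewrite normcM (le_trans (ler_pM (normc_ge0 _) (normc_ge0 _) (bf x) (bg x)))//.
  have Mf0 := expdec_M_ge0 (conj cf bf).
  rewrite mulrACA; apply: ler_wpM2l; first exact: mulr_ge0.
  by rewrite ler_piMr ?expR_ge0// -expR0 ler_expR oppr_le0 mulr_ge0// ltW.
have e1 : convol P P t = ift (fun x => hR x * hR x) t.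
  by rewrite {2}PE; exact: (convol_ift ltr01 c0 hP hF (stripPCN th)).
have e3 s : convol P K s = ift (fun x => hR x * HR x) s.
  exact: (convol_ift ltr01 c0 hP hHR (stripPCN th)).
have hm := expdec_mul _ _ _ _ hF hHR.
have e4 : convol P (convol P K) t = ift (fun x => hR x * (hR x * HR x)) t.
  have -> : convol P K = ift (fun x => hR x * HR x) by apply/funext.
  exact: (convol_ift ltr01 c0 hP hm (stripPCN th)).
rewrite e1 e4 /K /ift /ft -mulrDr mulrCA; congr (_ * _).
have it (f : R -> C) Mf : expdec f Mf c -> cintegrable mu (fun x => f x * cexp ('i%C * (t%:C)%C * (x%:C)%C)).
  by move=> hf; apply: (expdec_integrable _ (expdec_ft (t%:C)%C hf)); rewrite /= normr0 subr0.
rewrite -cintegralZ; last exact: it hHR.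
rewrite -cintegralD; [|exact: it (expdec_mul _ _ _ _ hF hF)|exact: it (expdec_mul _ _ _ _ hF hm)].
apply: cintegral_ext => x; rewrite /HR /H -/(hR x); have := hn0 _ (Im0 x); rewrite -/(hR x).
by move: (hR x) (cexp _) => u v n0; field.
Qed.

End Resolvent.

(** * Hausdorff measure of circular arcs; disks and their boundaries *)

Definition arcpt {R : realType} (x : R * R) (r al t : R) := circle_point x r (al + t).

Section CircleLength.
Variable R : realType.
Variables (x : R * R) (r al : R).
Hypothesis r0 : 0 < r.
Local Notation lst := ((@wlength R idfun)^*)%mu.
Local Notation cp := (arcpt x r al).
Implicit Types (s t u a b m c d : R) (A B V : set R).

Lemma eucl_ge0 (p q : R * R) : 0 <= edist p q.
Proof. exact: sqrtr_ge0. Qed.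

Lemma edist_cp s t : edist (cp s) (cp t) = 2 * r * `|sin ((s - t) / 2)|.
Proof.
have [m [h [-> ->]]] : exists m h, s = m + h /\ t = m - h.
  by exists ((s + t) / 2), ((s - t) / 2); split; lra.
have -> : (m + h - (m - h)) / 2 = h by lra.
rewrite /edist /arcpt /circle_point /= !addrA; move: (al + m) => n.
rewrite cosD cosB sinD sinB; have e := cos2Dsin2 n.
transitivity (Num.sqrt ((2 * r * sin h) ^+ 2)).
  by congr Num.sqrt; rewrite -[RHS]mulr1 -[X in _ = _ * X]e; ring.
by rewrite sqrtr_sqr normrM [`|2 * r|]gtr0_norm// mulr_gt0.
Qed.

Lemma ediam_leP (A : set (R * R)) m : 0 <= m ->
  (forall p q, A p -> A q -> edist p q <= m) -> (ediam A <= m%:E)%E.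
Proof.
move=> m0 h; apply: ge_ereal_sup => _ [->|[[p q] [/= Ap Aq] <-]].
  by rewrite lee_fin.
by rewrite lee_fin h.
Qed.

Lemma edist_ediam (A : set (R * R)) p q : A p -> A q -> ((edist p q)%:E <= ediam A)%E.
Proof. by move=> Ap Aq; apply: ereal_sup_ubound; right; exists (p, q). Qed.

Lemma ediam_arc a b : a <= b -> (ediam (cp @` `]a, b]%classic) <= (r * (b - a))%:E)%E.
Proof.
move=> ab; apply: ediam_leP; first by rewrite mulr_ge0 ?subr_ge0// ltW.
move=> _ _ [s /= hs <-] [t /= ht <-]; rewrite edist_cp.
rewrite !in_itv/= in hs ht; case/andP: hs => s1 s2; case/andP: ht => t1 t2.
have h : `|(s - t) / 2| <= (b - a) / 2.
  by rewrite ler_norml; lra.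
have := le_trans (abs_sin_le ((s - t) / 2)) h => h'.
by have := ler_wpM2l (ltW r0) h'; lra.
Qed.

Lemma hausdorff1_pre_le_ediam d (U : set (R * R)) : 0 < d -> (ediam U <= d%:E)%E ->
  (hausdorff1_pre d U <= ediam U)%E.
Proof.
move=> d0 Ud; apply: ereal_inf_lbound; exists (fun k => if k is 0%N then U else set0).
  split; first by move=> y Uy; exists 0%N.
  by case=> [//|k]; rewrite ediam0 lee_fin ltW.
rewrite nneseries_recl//; last by move=> k _; exact: ediam_ge0.
rewrite eseries0 ?adde0// => -[|k]//= _ _.
by rewrite ediam0.
Qed.

Definition hausdorff1_pre_outer d (d0 : 0 < d) : {outer_measure set (R * R) -> \bar R} :=
  HB.pack (@hausdorff1_pre R d)
    (isOuterMeasure.Build R (R * R)%type (@hausdorff1_pre R d) (hausdorff1_pre0 d0)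
       (hausdorff1_pre_ge0 d) (@le_hausdorff1_pre R d)
       (@hausdorff1_pre_sigma_subadditive R d)).

(** Arcs are halved until their diameters are at most [d]. *)
Lemma hausdorff1_pre_arc d (n : nat) a b : 0 < d -> a <= b -> r * (b - a) <= 2 ^+ n * d ->
  (hausdorff1_pre d (cp @` `]a, b]%classic) <= (r * (b - a))%:E)%E.
Proof.
move=> d0; elim: n a b => [|n IH] a b ab h.
  rewrite expr0 mul1r in h; have hd := ediam_arc ab.
  by rewrite (le_trans (hausdorff1_pre_le_ediam d0 _))// (le_trans hd)// lee_fin.
pose c := (a + b) / 2.
have -> : cp @` `]a, b]%classic = cp @` `]a, c]%classic `|` cp @` `]c, b]%classic.
  rewrite -image_setU; congr (_ @` _); apply/seteqP; split => t /=; rewrite !in_itv/=.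
    by case/andP => t1 t2; have [tc|tc] := leP t c; [left; rewrite t1|right].
  by rewrite /c; case=> /andP[t1 t2]; apply/andP; split; lra.
rewrite (le_trans (outer_measureU2 (hausdorff1_pre_outer d0) _ _))//.
have -> : r * (b - a) = r * (c - a) + r * (b - c) by rewrite /c; ring.
rewrite exprS in h; rewrite EFinD leeD//; apply: IH; rewrite /c; lra.
Qed.

(** Arcs can be cut into short pieces, whose chords are not longer than the
    pieces. *)
Lemma hausdorff1_arc_le B : (hausdorff1 (cp @` B) <= r%:E * lst B)%E.
Proof.
apply: ge_ereal_sup => _ [d /= d0 <-].
rewrite -[X in (X <= _)%E]mul1e -(mulfV (lt0r_neq0 r0)) EFinM -muleA.
apply: lee_wpmul2l; first by rewrite lee_fin ltW.
apply: le_ereal_inf_tmp => _ [F [mF BF] <-].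
rewrite -[X in (_ <= X)%E]mul1e -(mulVf (lt0r_neq0 r0)) EFinM -muleA.
apply: lee_wpmul2l; first by rewrite lee_fin invr_ge0 ltW.
rewrite -nneseriesZl; last by move=> k _; exact: wlength_ge0.
apply: (@le_trans _ _ (\sum_(0 <= k <oo) hausdorff1_pre d (cp @` F k))%E).
  apply: (le_trans _ (hausdorff1_pre_sigma_subadditive d (fun k => cp @` F k))).
  by apply: le_hausdorff1_pre => _ [t /BF [k _ Fk] <-]; exists k => //; exists t.
apply: lee_nneseries => k _; first by move=> _; exact: hausdorff1_pre_ge0.
have [[a b] _ /= <-] := mF k.
have [ab|ba] := leP a b.
  rewrite wlength_itv_bnd// -EFinM.
  have [n _ hn] : exists2 n : nat, True & r * (b - a) / d <= 2 ^+ n.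
    exists (Num.bound (r * (b - a) / d)) => //.
    have q0 : 0 <= r * (b - a) / d by rewrite divr_ge0 ?(ltW d0)// mulr_ge0 ?subr_ge0// ltW.
    rewrite (le_trans (ltW (archi_boundP q0)))// -natrX ler_nat.
    by rewrite ltnW// ltn_expl.
  by apply: (@hausdorff1_pre_arc d n) => //; rewrite -ler_pdivrMr.
rewrite set_itv_ge ?bnd_simp -?leNgt ?(ltW ba)// image_set0 hausdorff1_pre0//.
by rewrite mule_ge0// ?lee_fin ?ltW// wlength0.
Qed.

(** [sin v >= c v] for small [v >= 0].  The bound [|u| <= pi] is needed for a
    short chord to belong to a short arc. *)
Lemma chord_arc c : 0 < c < 1 -> exists2 d, 0 < d & forall u m, `|u| <= pi ->
  2 * r * `|sin (u / 2)| <= m -> m <= d -> r * c * `|u| <= m /\ `|u| <= 1.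
Proof.
move=> /andP[c0 c1]; have p2 := pi_ge2 R.
have cI : -1 <= c <= 1 by apply/andP; split; lra.
have cI' : -1 <= c < 1 by apply/andP; split; lra.
have a0 := acos_gt0 cI'; have ap := acos_lepi cI.
pose h := Num.min (acos c) 2^-1.
have h0 : 0 < h by rewrite lt_min; apply/andP; split; [exact: a0|lra].
have h1 : h <= 2^-1 by rewrite ge_min lexx orbT.
have h2 : h <= acos c by rewrite ge_min lexx.
exists (2 * r * sin h).
  by rewrite !mulr_gt0// sin_gt0_pi//; apply/andP; split; lra.
move=> u m up um md.
have e : `|sin (u / 2)| = sin (`|u| / 2).
  have [u0|u0] := leP 0 u.
    rewrite !ger0_norm// sin_ge0_pi//; move: up; rewrite ger0_norm// => up.
    by apply/andP; split; lra.
  have e1 : u / 2 = - (`|u| / 2) by rewrite ltr0_norm//; lra.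
  rewrite e1 sinN normrN ger0_norm// sin_ge0_pi//.
  by move: up; rewrite ltr0_norm// => up; apply/andP; split; lra.
rewrite e in um; move: up um; have := normr_ge0 u; move: (`|u|) => y y0 yp ym.
have sy : sin (y / 2) <= sin h.
  have k : 2 * r * sin (y / 2) <= 2 * r * sin h by exact: le_trans md.
  by rewrite ler_pM2l ?mulr_gt0// in k.
have yh : y / 2 <= h.
  rewrite leNgt; apply/negP => hy; move: sy; rewrite leNgt => /negP; apply.
  by rewrite ltr_sin// in_itv/=; apply/andP; split; lra.
split; last lra.
have [->|yn] := eqVneq y 0.
  rewrite mulr0; apply: le_trans ym; apply: mulr_ge0; first by rewrite mulr_ge0// ltW.
  by apply: sin_ge0_pi; apply/andP; split; lra.
have y20 : 0 < y / 2 by rewrite divr_gt0// lt_neqAle eq_sym yn.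
have [k /andP[k0 k1] sE] := sin_MVT y20.
have ck : c <= cos k.
  rewrite -{1}(acosK (x:=c)) ?in_itv/=//.
  rewrite leNgt; apply/negP; rewrite ltr_cos ?in_itv/=; first by lra.
    by apply/andP; split; lra.
  by apply/andP; split; lra.
apply: le_trans ym; rewrite sE.
have := ler_wpM2l (ltW (mulr_gt0 r0 y20)) ck; lra.
Qed.

Lemma cp_periodic t : cp (t + 2 * pi) = cp t.
Proof.
by rewrite /arcpt addrA /circle_point mulr_natl cosD2pi sinD2pi.
Qed.

Lemma cp_periodicB t : cp (t - 2 * pi) = cp t.
Proof. by have := cp_periodic (t - 2 * pi); rewrite subrK => ->. Qed.

Lemma lst_ge0 B : (0 <= lst B)%E.
Proof. exact: outer_measure_ge0. Qed.

Lemma lst_itvcc a b : a <= b -> lst `[a, b]%classic = (b - a)%:E.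
Proof.
move=> ab; have := @lebesgue_measure_itv R `[a, b]; rewrite /=.
have [lab|lba] := ltP a b.
  by rewrite lte_fin lab => h; exact: h.
have -> : b = a by apply/eqP; rewrite eq_le ab lba.
by rewrite lte_fin ltxx subrr => h; exact: h.
Qed.

(** A set of angles whose points are close together is contained in a short
    interval, after a shift by [2 pi] of the part of it beyond the cut at [pi];
    hence the two intervals of the proof. *)
Lemma lst_short_le c : 0 < c < 1 -> exists2 d, 0 < d & forall V m,
  V `<=` `]- pi, pi]%classic -> 0 <= m <= d ->
  (forall s t, V s -> V t -> edist (cp s) (cp t) <= m) ->
  ((r * c)%:E * lst V <= m%:E)%E.
Proof.
move=> hc; have [d d0 hd] := chord_arc hc; exists d => // V m Vpi /andP[m0 md] hV.
have p2 := pi_ge2 R; have rc0 : 0 < r * c by case/andP: hc => *; rewrite mulr_gt0.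
have [->|/set0P[t0 Vt0]] := eqVneq V set0.
  by rewrite outer_measure0 mule0 lee_fin.
pose V' := [set t | `|t - t0| <= 1 /\ (cp @` V) (cp t)].
have V'd s t : V' s -> V' t -> r * c * `|s - t| <= m /\ `|s - t| <= 2.
  move=> [s1 [s' Vs' es]] [t1 [t' Vt' et]].
  have st2 : `|s - t| <= 2.
    have -> : s - t = (s - t0) - (t - t0) by ring.
    by rewrite (le_trans (ler_normB _ _))//; lra.
  split => //; apply: (proj1 (hd (s - t) m _ _ md)); first lra.
  by rewrite -edist_cp -es -et; exact: hV.
have V't0 : V' t0 by split; [rewrite subrr normr0|exists t0].
have lift t : V t -> [\/ V' t, V' (t + 2 * pi) | V' (t - 2 * pi)].
  move=> Vt; have := Vpi _ Vt; have := Vpi _ Vt0; rewrite /= !in_itv/= => /andP[a1 a2] /andP[b1 b2].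
  have key t' : cp t' = cp t -> `|t' - t0| <= pi -> V' t'.
    move=> et ht; split; last by exists t.
    by apply: (proj2 (hd _ m ht _ md)); rewrite -edist_cp et; exact: hV.
  have [h1|h1] := lerP `|t - t0| pi; first by constructor 1; exact: key.
  have [h2|h2] := leP t t0.
    constructor 2; apply: key; first exact: cp_periodic.
    by move: h1; rewrite ler0_norm ?subr_le0// => h1; rewrite ler_norml; lra.
  constructor 3; apply: key; first exact: cp_periodicB.
  by move: h1; rewrite gtr0_norm ?subr_gt0// => h1; rewrite ler_norml; lra.
pose L := Num.min (m / (r * c)) 2.
have L0 : 0 <= L by rewrite le_min divr_ge0// ltW.
have L2 : L <= 2 by rewrite ge_min lexx orbT.
have Lm : r * c * L <= m.
  by rewrite mulrC -ler_pdivlMr// ge_min lexx.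
have V'L s t : V' s -> V' t -> s - t <= L.
  move=> Vs Vt; have [h1 h2] := V'd _ _ Vs Vt; rewrite (le_trans (ler_norm _))//.
  by rewrite le_min h2 andbT ler_pdivlMr// mulrC.
pose a := inf V'.
have infV' : has_inf V'.
  split; first by exists t0.
  by exists (t0 - 1) => t [+ _]; rewrite ler_norml; lra.
have aV t : V' t -> a <= t <= a + L.
  move=> Vt; apply/andP; split; first by apply: ge_inf => //; case: infV'.
  rewrite -lerBlDr; apply: lb_le_inf; first by exists t0.
  by move=> s Vs; have := V'L _ _ Vt Vs; lra.
have := Vpi _ Vt0; rewrite /= in_itv/= => /andP[b1 b2].
have /andP[b3 b4] := aV _ V't0.
suff [[p1 q1] [[p2' q2] [/= pq1 pq2 pqL Vsub]]] : exists I J : R * R,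
    [/\ I.1 <= I.2, J.1 <= J.2, (I.2 - I.1) + (J.2 - J.1) <= L &
       V `<=` `[I.1, I.2]%classic `|` `[J.1, J.2]%classic].
  have h1 : (lst V <= L%:E)%E.
    apply: (le_trans (le_outer_measure lst _ _ Vsub)).
    apply: (@le_trans _ _ (lst `[p1, q1]%classic + lst `[p2', q2]%classic)%E).
      exact: outer_measureU2.
    by rewrite !lst_itvcc// -EFinD lee_fin.
  apply: (le_trans (lee_wpmul2l _ h1)); first by rewrite lee_fin ltW.
  by rewrite lee_fin.
have [ca|ca] := ltP a (- pi).
  exists (- pi, a + L), (a + 2 * pi, pi); split => /=; [lra|lra|lra|].
  move=> t Vt; have := Vpi _ Vt; rewrite /= !in_itv/= => /andP[c1 c2].
  case: (lift _ Vt) => /aV /andP[d1 d2]; [left|exfalso|right]; try (apply/andP; split); lra.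
have [cb|cb] := ltP pi (a + L).
  exists (a, pi), (- pi, a + L - 2 * pi); split => /=; [lra|lra|lra|].
  move=> t Vt; have := Vpi _ Vt; rewrite /= !in_itv/= => /andP[c1 c2].
  case: (lift _ Vt) => /aV /andP[d1 d2]; [left|right|exfalso]; try (apply/andP; split); lra.
exists (a, a + L), (pi, pi); split => /=; [lra|lra|lra|].
move=> t Vt; have := Vpi _ Vt; rewrite /= !in_itv/= => /andP[c1 c2].
case: (lift _ Vt) => /aV /andP[d1 d2]; [left|exfalso|right]; try (apply/andP; split); lra.
Qed.

(** Each set of a cover by small sets meets the circle in an arc hardly longer
    than its diameter. *)
Lemma hausdorff1_arc_ge B : B `<=` `]- pi, pi]%classic ->
  (r%:E * lst B <= hausdorff1 (cp @` B))%E.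
Proof.
move=> Bpi; apply/lee_mul01Pr; first by apply: mule_ge0; [rewrite lee_fin ltW|exact: lst_ge0].
move=> c hc; have [d d0 hd] := lst_short_le hc.
apply: (@le_trans _ _ (hausdorff1_pre d (cp @` B))); last first.
  by apply: ereal_sup_ubound; exists d.
apply: le_ereal_inf_tmp => _ [U [BU Ud] <-].
pose V k := (cp @^-1` U k) `&` `]- pi, pi]%classic.
have BV : B `<=` \bigcup_k V k.
  move=> t Bt; have [k _ Uk] := BU (cp t) (ex_intro2 _ _ t Bt erefl).
  by exists k => //; split => //; exact: Bpi.
have rc0 : 0 <= r * c by case/andP: hc => c0 _; rewrite mulr_ge0// ltW.
rewrite muleA -EFinM mulrC.
apply: (@le_trans _ _ ((r * c)%:E * \sum_(0 <= k <oo) lst (V k))%E).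
  apply: lee_wpmul2l; first by rewrite lee_fin.
  rewrite (le_trans (le_outer_measure lst _ _ BV))//.
  exact: (outer_measure_sigma_subadditive lst).
rewrite -nneseriesZl; last by move=> k _; exact: lst_ge0.
apply: lee_nneseries => k _ //; first by move=> _; apply: mule_ge0; [rewrite lee_fin|exact: lst_ge0].
have fd : ediam (U k) \is a fin_num.
  by rewrite ge0_fin_numE ?ediam_ge0// (le_lt_trans (Ud k))// ltry.
rewrite -(fineK fd); apply: hd.
- by move=> t [].
- by rewrite -!lee_fin fineK// Ud andbT ediam_ge0.
- by move=> s t [Us _] [Ut _]; rewrite -lee_fin fineK//; exact: edist_ediam.
Qed.

Lemma hausdorff1_arc B : B `<=` `]- pi, pi]%classic ->
  (hausdorff1 (cp @` B) = r%:E * lst B)%E.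
Proof.
by move=> h; apply/eqP; rewrite eq_le hausdorff1_arc_le hausdorff1_arc_ge.
Qed.

End CircleLength.

Section Disks.
Variable R : realType.
Implicit Types (x y z p q : R * R) (r s t : R) (A B : set (R * R)).

Lemma eucl_continuous x : continuous (fun y => edist y x).
Proof.
move=> y; apply: (@continuous_comp _ _ _ (fun y : R * R => (y.1 - x.1) ^+ 2 + (y.2 - x.2) ^+ 2) Num.sqrt); last exact: sqrt_continuous.
have c1 : {for y, continuous (fun y : R * R => y.1 - x.1)}.
  by apply: cvgB; [exact: cvg_fst|exact: cvg_cst].
have c2 : {for y, continuous (fun y : R * R => y.2 - x.2)}.
  by apply: cvgB; [exact: cvg_snd|exact: cvg_cst].
by apply: cvgD; under eq_fun do rewrite expr2; apply: cvgM.
Qed.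

Lemma euclC x y : edist x y = edist y x.
Proof. by rewrite /edist; congr Num.sqrt; congr (_ + _); rewrite -sqrrN opprB. Qed.

Lemma open_disk x r : open (disk x r).
Proof.
have -> : disk x r = (fun y => edist y x) @^-1` [set t | t < r] by [].
by apply: open_comp; [move=> y _; exact: eucl_continuous|exact: open_lt].
Qed.

Lemma closure_disk x r : 0 < r -> closure (disk x r) = [set y | edist y x <= r].
Proof.
move=> r0; apply/seteqP; split.
  have cl : closed [set y | edist y x <= r].
    have -> : [set y | edist y x <= r] = (fun y => edist y x) @^-1` [set t | t <= r] by [].
    by apply: preimage_closed; [move=> y _; exact: eucl_continuous|exact: closed_le].
  rewrite [X in _ `<=` X]((closure_id _).1 cl); apply: closureS => z.
  by rewrite /disk/= => /ltW.
move=> y /= yr B /nbhs_ballP[e /= e0 eB].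
have n0 := eucl_ge0 y x.
pose k := e / (e + 2 * r).
have k0 : 0 < k by rewrite divr_gt0// addr_gt0// mulr_gt0.
have k1 : k < 1 by rewrite ltr_pdivrMr ?addr_gt0 ?mulr_gt0// mul1r ltrDl mulr_gt0.
pose z : R * R := (y.1 - k * (y.1 - x.1), y.2 - k * (y.2 - x.2)).
have kr : k * r < e.
  rewrite /k mulrAC ltr_pdivrMr ?addr_gt0 ?mulr_gt0//.
  by rewrite ltr_pM2l//; lra.
have b1 : `|y.1 - x.1| <= edist y x.
  by rewrite /edist -sqrtr_sqr ler_wsqrtr// lerDl sqr_ge0.
have b2 : `|y.2 - x.2| <= edist y x.
  by rewrite /edist -sqrtr_sqr ler_wsqrtr// lerDr sqr_ge0.
have bd u : `|u| <= edist y x -> `|k * u| < e.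
  move=> hu; rewrite normrM gtr0_norm// (le_lt_trans _ kr)// ler_pM2l//.
  exact: le_trans yr.
exists z; split.
  rewrite /disk/=.
  have -> : edist z x = (1 - k) * edist y x.
    rewrite /edist /z/=.
    have -> : (y.1 - k * (y.1 - x.1) - x.1) ^+ 2 + (y.2 - k * (y.2 - x.2) - x.2) ^+ 2 =
      (1 - k) ^+ 2 * ((y.1 - x.1) ^+ 2 + (y.2 - x.2) ^+ 2) by ring.
    by rewrite sqrtrM ?sqr_ge0// sqrtr_sqr gtr0_norm// subr_gt0.
  rewrite (@le_lt_trans _ _ ((1 - k) * r))//; first by rewrite ler_pM2l ?subr_gt0.
  by rewrite gtr_pMl// gtrBl.
apply: eB; split; rewrite /ball/= opprB addrCA subrr addr0; exact: bd.
Qed.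

Lemma boundary_disk x r : 0 < r -> boundary (disk x r) = [set y | edist y x = r].
Proof.
move=> r0; rewrite /boundary closure_disk// ((interior_id _).1 (@open_disk x r)).
apply/seteqP; split => y /=; rewrite /disk/=.
  by case=> h1 /negP; rewrite -leNgt => h2; apply/eqP; rewrite eq_le h1.
by move=> ->; rewrite lexx ltxx.
Qed.

Lemma Gamma_extE x r y s : 0 < r -> 0 < s ->
  Gamma_ext (disk x r) (disk y s) = [set z | edist z x = r /\ s <= edist z y].
Proof.
move=> r0 s0; rewrite /Gamma_ext boundary_disk// /boundary closureU !closure_disk//.
rewrite ((interior_id _).1 (openU (@open_disk x r) (@open_disk y s))).
apply/seteqP; split => z; rewrite /disk/=.
  by move=> [zr [_ /not_orP[_ /negP]]]; rewrite -leNgt.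
move=> [zr zs]; split => //; split; first by left; rewrite zr.
by move=> [|]; rewrite ?zr ?ltxx// ltNge zs.
Qed.

Lemma Gamma_intE x r y s : 0 < r -> 0 < s ->
  Gamma_int (disk x r) (disk y s) = [set z | edist z x = r /\ edist z y < s].
Proof.
move=> r0 s0; rewrite /Gamma_int Gamma_extE// boundary_disk//.
apply/seteqP; split => z /=.
  by move=> [zr /not_andP[//|/negP]]; rewrite -ltNge.
by move=> [zr zs]; split => // -[_]; rewrite leNgt zs.
Qed.

Lemma edist_circle_point x r t : 0 < r -> edist (circle_point x r t) x = r.
Proof.
move=> r0; rewrite /edist /circle_point /=.
have -> : (x.1 + r * cos t - x.1) ^+ 2 + (x.2 + r * sin t - x.2) ^+ 2 =
   r ^+ 2 * (cos t ^+ 2 + sin t ^+ 2) by ring.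
by rewrite cos2Dsin2 mulr1 sqrtr_sqr gtr0_norm.
Qed.

Lemma polar (u v : R) : u ^+ 2 + v ^+ 2 = 1 ->
  exists2 t, - pi < t <= pi & cos t = u /\ sin t = v.
Proof.
move=> uv; have p0 := pi_gt0 R.
have u1 : -1 <= u <= 1.
  rewrite -ler_norml -(expr_le1 (n := 2))// real_normK ?num_real//.
  by rewrite -uv lerDl sqr_ge0.
have a0 := acos_ge0 u1; have ap := acos_lepi u1.
have s1 := sin_acos u1; have c1 : cos (acos u) = u by rewrite acosK// in_itv.
have vE : 1 - u ^+ 2 = v ^+ 2 by rewrite -uv; ring.
rewrite vE sqrtr_sqr in s1.
have [v0|v0] := leP 0 v.
  exists (acos u); first by apply/andP; split => //; apply: lt_le_trans a0; rewrite oppr_lt0.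
  by rewrite c1 s1 ger0_norm.
exists (- acos u); last by rewrite cosN sinN c1 s1 ltr0_norm ?opprK.
have : acos u < pi.
  apply: acos_ltpi; case/andP: u1 => h1 ->; rewrite andbT lt_neqAle h1 andbT.
  apply/eqP => e; move: uv; rewrite -e sqrrN expr1n -[X in _ = X]addr0.
  by move=> /addrI/eqP; rewrite sqrf_eq0 lt_eqF.
by move=> h; apply/andP; split; lra.
Qed.

Lemma arcptP x r al y : 0 < r -> edist y x = r ->
  exists2 t, - pi < t <= pi & arcpt x r al t = y.
Proof.
move=> r0 yr; have rn := lt0r_neq0 r0.
pose u := (y.1 - x.1) / r; pose v := (y.2 - x.2) / r.
have uv : u ^+ 2 + v ^+ 2 = 1.
  have h : (y.1 - x.1) ^+ 2 + (y.2 - x.2) ^+ 2 = r ^+ 2.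
    by rewrite -yr sqr_sqrtr// addr_ge0 ?sqr_ge0.
  by rewrite /u /v !expr_div_n -mulrDl h divff// expf_neq0.
have e := cos2Dsin2 al.
have [|t ht [ct st]] := @polar (u * cos al + v * sin al) (v * cos al - u * sin al).
  transitivity ((u ^+ 2 + v ^+ 2) * (cos al ^+ 2 + sin al ^+ 2)); first by ring.
  by rewrite uv e mulr1.
exists t => //; rewrite /arcpt /circle_point cosD sinD ct st.
have -> : cos al * (u * cos al + v * sin al) - sin al * (v * cos al - u * sin al) = u.
  by rewrite -[RHS]mulr1 -[X in _ = _ * X]e; ring.
have -> : sin al * (u * cos al + v * sin al) + cos al * (v * cos al - u * sin al) = v.
  by rewrite -[RHS]mulr1 -[X in _ = _ * X]e; ring.
by rewrite /u /v; case: (y) => y1 y2 /=; congr pair; field.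
Qed.

Lemma arcpt_inj x r al s t : 0 < r -> - pi < s <= pi -> - pi < t <= pi ->
  arcpt x r al s = arcpt x r al t -> s = t.
Proof.
move=> r0 /andP[s1 s2] /andP[t1 t2] e; have rn := lt0r_neq0 r0.
have : sin ((s - t) / 2) = 0.
  have := edist_cp x al r0 s t; rewrite e /edist !subrr expr0n/= addr0 sqrtr0 => /esym/eqP.
  by rewrite mulf_eq0 mulf_eq0 pnatr_eq0 (negbTE rn)/= normr_eq0 => /eqP.
move=> h; apply/eqP; apply: contra_eqT h => st.
have [h|h|h] := ltgtP s t; last by rewrite h eqxx in st.
  rewrite -oppr_eq0 -sinN gt_eqF// sin_gt0_pi//; apply/andP; split; lra.
by rewrite gt_eqF// sin_gt0_pi//; apply/andP; split; lra.
Qed.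

End Disks.

(** * The length measure of a circle *)

Section CircleMeasure.
Variable R : realType.
Variables (x : R * R) (r : R).
Hypothesis r0 : 0 < r.
Local Notation lst := ((@wlength R idfun)^*)%mu.
Local Notation leb := (@lebesgue_measure R).
Local Notation X := (caratheodory_type (hausdorff1_on (boundary (disk x r)))).
Local Notation T := (`]- pi, pi]%classic : set (measurableTypeR R)).
Implicit Types (S : set (R * R)).

Section offset.
Variable al : R.
Local Notation cp := (arcpt x r al).

Lemma circle_measureE S : (circle_measure x r S = r%:E * lst (cp @^-1` S `&` T))%E.
Proof.
have := @hausdorff1_arc R x r al r0 (cp @^-1` S `&` T) (@subIsetr _ _ _).
move=> <-; rewrite /circle_measure/= /hausdorff1_measure /hausdorff1_on boundary_disk//.
congr hausdorff1; apply/seteqP; split => y.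
  move=> [Sy yr]; have [t ht e] := arcptP al r0 yr.
  by exists t => //; split; [rewrite /= e|rewrite /= in_itv].
move=> [t [St _] <-]; split => //=.
exact: edist_circle_point.
Qed.

(** The measure is, in the angle, the outer measure of Lebesgue, so that the
    criterion of Caratheodory is inherited from the line. *)
Lemma circle_measurable S : measurable (cp @^-1` S `&` T) ->
  measurable (S : set X).
Proof.
move=> mS; apply: le_caratheodory_measurable => A.
change ((circle_measure x r (A `&` S) + circle_measure x r (A `&` ~` S) <= circle_measure x r A)%E).
rewrite !circle_measureE -ge0_muleDr; [|exact: lst_ge0|exact: lst_ge0].
apply: lee_wpmul2l; first by rewrite lee_fin ltW.
set B := cp @^-1` A `&` T.
have h : lst B = (lst (B `&` (cp @^-1` S `&` T)) + lst (B `&` ~` (cp @^-1` S `&` T)))%E.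
  exact: (@sub_caratheodory _ (ocitv_type R) R (@wlength R idfun) _ mS B).
have -> : cp @^-1` (A `&` S) `&` T = B `&` (cp @^-1` S `&` T).
  by apply/seteqP; split => t; [case=> -[a b] c|case=> -[a c] [b _]].
have -> : cp @^-1` (A `&` ~` S) `&` T = B `&` ~` (cp @^-1` S `&` T).
  by apply/seteqP; split => t; [case=> -[a b] c; split => // -[]|case=> -[a c] b; split => //; split => // d; apply: b].
by rewrite -h.
Qed.

Lemma circle_measurable_fun d' (U : measurableType d') (f : R * R -> U) :
  measurable_fun T (f \o cp) -> measurable_fun [set: X] (f : X -> U).
Proof.
move=> mf _ B mB; rewrite setTI; apply: circle_measurable.
rewrite setIC; apply: mf => //; exact: measurable_itv.
Qed.

Let T0 : T 0.
Proof. by rewrite /= in_itv/= oppr_lt0 pi_gt0 pi_ge0. Qed.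

(** The angle of a point of the circle, through which integrals are pushed to the
    line.  It is arbitrary off the circle, a null set. *)
Let ang (y : X) : measurableTypeR R := xget 0 [set t | T t /\ cp t = y].

Let angT y : T (ang y).
Proof. by rewrite /ang; case: xgetP => [t _ []|]. Qed.

Let angK t : T t -> ang (cp t) = t.
Proof.
move=> Tt; rewrite /ang; case: xgetP => [s _ [Ts e]|/(_ t)[]//].
by apply: (arcpt_inj r0 _ _ e).
Qed.

Let mang : measurable_fun [set: X] ang.
Proof.
move=> _ B mB; rewrite setTI; apply: circle_measurable.
rewrite (_ : _ `&` T = B `&` T); first exact: measurableI.
apply/seteqP; split => t [/= h Tt]; split => //; last by rewrite angK.
by move: h; rewrite angK.
Qed.

Let off : circle_measure x r (~` boundary (disk x r)) = 0%E.
Proof. by rewrite /circle_measure/= /hausdorff1_measure /hausdorff1_on setICl outer_measure0. Qed.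

Lemma circle_boundary_ae : \forall y \ae circle_measure x r, edist y x = r.
Proof.
exists (~` boundary (disk x r)); split => //.
  apply: circle_measurable; rewrite (_ : _ `&` T = set0)//.
  apply/seteqP; split => t //= [+ _].
  by rewrite boundary_disk//= => h; apply: h; exact: edist_circle_point.
by rewrite boundary_disk.
Qed.

Lemma circle_integral (f : R * R -> R) : measurable_fun T (f \o cp) ->
  (forall y, 0 <= f y) ->
  (\int[circle_measure x r]_y (f y)%:E = r%:E * \int[leb]_(t in T) (f (cp t))%:E)%E.
Proof.
move=> mf f0.
have mT : measurable T by exact: measurable_itv.
have mh : measurable_fun T (fun t => (f (cp t))%:E) by exact/measurable_EFinP.
have := @ge0_integral_pushforward _ _ X (measurableTypeR R) R ang mang (circle_measure x r) T _ mT mh.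
have -> : ang @^-1` T = [set: X] by apply/seteqP; split => // y _; exact: angT.
have rn : 0 <= r by exact: ltW.
move=> h; transitivity (\int[pushforward (circle_measure x r) ang]_(t in T) (f (cp t))%:E)%E; last first.
  rewrite (@eq_measure_integral _ _ R T (mscale (NngNum rn) leb)).
    rewrite ge0_integral_mscale// => t _; rewrite lee_fin; exact: f0.
  move=> A mA AT; change ((circle_measure x r (ang @^-1` A) = r%:E * leb A)%E).
  rewrite circle_measureE.
  rewrite (_ : _ `&` T = A)//; apply/seteqP; split => t.
    by move=> [/= + Tt]; rewrite angK.
  by move=> At; split; [rewrite /= angK//; exact: AT|exact: AT].
rewrite h; last by move=> t _; rewrite lee_fin.
have mfX : measurable_fun [set: X] (f : X -> R) by exact: circle_measurable_fun.
apply: (@ge0_ae_eq_integral _ X R (circle_measure x r) setT (fun y => (f y)%:E) (fun y => (f (cp (ang y)))%:E)).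
- exact: measurableT.
- by apply/measurable_EFinP; exact: mfX.
- apply: (@measurable_comp _ _ _ X (measurableTypeR R) _ T (fun t => (f (cp t))%:E)) => //.
  by move=> _ [y _ <-]; exact: angT.
- by move=> y _; rewrite lee_fin.
- by move=> y _; rewrite lee_fin.
have [A [mA A0 hA]] := circle_boundary_ae; exists A; split => // y hy; apply: hA => /= yr.
by apply: hy => _ /=; have [t ht <-] := arcptP al r0 yr; rewrite angK//= in_itv.
Qed.

End offset.

Lemma circle_measure_finite : (circle_measure x r [set: R * R] < +oo)%E.
Proof.
rewrite (circle_measureE 0) preimage_setT setTI.
change ((r%:E * leb [set` `]- pi, pi]%R] < +oo)%E).
rewrite lebesgue_measure_itv /=.
by rewrite -EFinB; case: ifP => _; rewrite -?EFinM ?mule0 ltry.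
Qed.

(** The same measure, with its structure of finite measure. *)
Definition circle_fmeasure : {finite_measure set X -> \bar R} :=
  HB.pack (hausdorff1_measure (boundary (disk x r)))
    (Measure_isFinite.Build _ X R (hausdorff1_measure (boundary (disk x r)))
       (lty_fin_num_fun circle_measure_finite)).

End CircleMeasure.

(** * Bipolar coordinates on an arc *)

Section Chart.
Variables (R : realType) (s : R).
Hypothesis hs : 0 < s < pi.
Local Notation leb := (@lebesgue_measure R).
Implicit Types (t u : R).

Lemma sin_half_gt0 t : `|t| < s -> 0 < sin ((s + t) / 2) /\ 0 < sin ((s - t) / 2).
Proof.
move=> ts; have := ltr_normlW ts; have tN : - s < t by move: ts; rewrite ltr_norml => /andP[].
have /andP[s0 sp] := hs => ts'.
by split; apply: sin_gt0_pi; apply/andP; split; lra.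
Qed.

(** The bipolar coordinate of the point of angle [t] on an arc of half-aperture
    [s], as a function of the angle, and its derivative. *)
Definition bip t : R := ln (sin ((s + t) / 2)) - ln (sin ((s - t) / 2)).
Definition dbip t : R := sin s / (2 * (sin ((s + t) / 2) * sin ((s - t) / 2))).

Lemma bipN t : bip (- t) = - bip t.
Proof. by rewrite /bip opprK opprB. Qed.

Lemma dbip_gt0 t : `|t| < s -> 0 < dbip t.
Proof.
move=> ts; have [a b] := sin_half_gt0 ts.
by rewrite /dbip divr_gt0 ?sin_gt0_pi// !mulr_gt0.
Qed.

Lemma is_derive_bip t : `|t| < s -> is_derive t 1 bip (dbip t).
Proof.
move=> ts; have [a b] := sin_half_gt0 ts.
have d1 : is_derive t 1 (fun t => (s + t) / 2) (2^-1 : R).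
  by apply: is_derive_eq; rewrite /GRing.scale/=; ring.
have d2 : is_derive t 1 (fun t => (s - t) / 2) (- 2^-1 : R).
  by apply: is_derive_eq; rewrite /GRing.scale/=; ring.
have s1 : is_derive t 1 (fun t => sin ((s + t) / 2)) (cos ((s + t) / 2) * 2^-1).
  by apply: is_derive_eq; rewrite /GRing.scale/=; ring.
have s2 : is_derive t 1 (fun t => sin ((s - t) / 2)) (- (cos ((s - t) / 2) * 2^-1)).
  by apply: is_derive_eq; rewrite /GRing.scale/=; ring.
have l1 : is_derive t 1 (fun t => ln (sin ((s + t) / 2))) ((sin ((s + t) / 2))^-1 * (cos ((s + t) / 2) * 2^-1)).
  have h := is_derive1_ln a.
  have := @is_derive1_comp R (@ln R) (fun t => sin ((s + t) / 2)) t _ _ h s1.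
  by move=> k; exact: k.
have l2 : is_derive t 1 (fun t => ln (sin ((s - t) / 2))) ((sin ((s - t) / 2))^-1 * - (cos ((s - t) / 2) * 2^-1)).
  have h := is_derive1_ln b.
  have := @is_derive1_comp R (@ln R) (fun t => sin ((s - t) / 2)) t _ _ h s2.
  by move=> k; exact: k.
apply: is_derive_eq.
rewrite /dbip; have -> : sin s = sin ((s + t) / 2) * cos ((s - t) / 2) + cos ((s + t) / 2) * sin ((s - t) / 2).
  by rewrite -sinD; congr sin; lra.
move: (sin ((s + t) / 2)) (sin ((s - t) / 2)) a b => u v u0 v0.
by field; rewrite !gt_eqF.
Qed.

Lemma continuous_dbip t : `|t| < s -> {for t, continuous dbip}.
Proof.
move=> ts; have [a b] := sin_half_gt0 ts.
have c1 : {for t, continuous (fun t => sin ((s + t) / 2))}.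
  apply: (@continuous_comp _ _ _ (fun t => (s + t) / 2) sin); last exact: continuous_sin.
  by apply: cvgM; [apply: cvgD; [exact: cvg_cst|exact: cvg_id]|exact: cvg_cst].
have c2 : {for t, continuous (fun t => sin ((s - t) / 2))}.
  apply: (@continuous_comp _ _ _ (fun t => (s - t) / 2) sin); last exact: continuous_sin.
  by apply: cvgM; [apply: cvgB; [exact: cvg_cst|exact: cvg_id]|exact: cvg_cst].
apply: cvgM; first exact: cvg_cst.
apply: cvgV; first by rewrite !mulf_neq0// gt_eqF.
by apply: cvgM; [exact: cvg_cst|exact: cvgM].
Qed.

Lemma bip_mono u t : - s < u -> u < t -> t < s -> bip u < bip t.
Proof.
move=> u1 ut ts.
have d (z : R) : z \in `]u, t[ -> is_derive z 1 bip (dbip z).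
  by rewrite in_itv/= => /andP[z1 z2]; apply: is_derive_bip; rewrite ltr_norml; lra.
have c : {within `[u, t], continuous bip}.
  apply: continuous_in_subspaceT => z; rewrite inE/= in_itv/= => /andP[z1 z2].
  apply: differentiable_continuous; apply/derivable1_diffP.
  have zs : `|z| < s by rewrite ltr_norml; lra.
  by have [] := is_derive_bip zs.
have [z hz e] := MVT ut d c.
rewrite -subr_gt0 e mulr_gt0 ?subr_gt0//; apply: dbip_gt0.
by move: hz; rewrite in_itv/= => /andP[z1 z2]; rewrite ltr_norml; lra.
Qed.

Let sn (n : nat) : R := s - s / n.+2%:R.

Let sn_bnd n : 0 < sn n < s.
Proof.
have /andP[s0 sp] := hs; have h : 0 < s / n.+2%:R by rewrite divr_gt0.
have h1 : s / n.+2%:R < s by rewrite ltr_pdivrMr// ltr_pMr// ltr1n.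
by rewrite /sn; move: (s / _) h h1 => q h h1; apply/andP; split; lra.
Qed.

Let sn_mono n m : (n <= m)%N -> sn n <= sn m.
Proof.
move=> nm; have /andP[s0 sp] := hs; rewrite /sn lerD2l lerN2 ler_pM2l//.
by rewrite lef_pV2 ?posrE// ler_nat ltnS.
Qed.

Let sn_cvg t : t < s -> exists n, t < sn n.
Proof.
move=> ts; have /andP[s0 sp] := hs; have q : 0 < s - t by rewrite subr_gt0.
exists (Num.bound (s / (s - t))).
have h0 : 0 <= s / (s - t) by rewrite divr_ge0 ?ltW.
have h := archi_boundP h0; rewrite ltr_pdivrMr// in h.
set N := Num.bound _ in h *.
rewrite /sn ltrBrDr -ltrBrDl ltr_pdivrMr// (lt_le_trans h)//.
by rewrite mulrC ler_pM2l// ler_nat (leq_trans (leqnSn _)).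
Qed.

Let bip_cvg u : exists n, u < bip (sn n).
Proof.
have /andP[s0 sp] := hs; have p0 := pi_gt0 R.
pose d := 2 * cos (s / 2) * sin (s / 4).
have d0 : 0 < d.
  rewrite !mulr_gt0//; first by apply: cos_gt0_pihalf; apply/andP; split; lra.
  by apply: sin_gt0_pi; apply/andP; split; lra.
pose e := d * expR (- u).
have e0 : 0 < e by rewrite mulr_gt0 ?expR_gt0.
pose m := Num.max (s / 2) (s - e).
have ms : m < s by rewrite gt_max; apply/andP; split; lra.
have [n hn] := sn_cvg ms; exists n.
have /andP[t0 ts] := sn_bnd n; set t := sn n in hn t0 ts *.
have t1 : s / 2 < t by apply: le_lt_trans hn; rewrite le_max lexx.
have t2 : s - e < t by apply: le_lt_trans hn; rewrite le_max lexx orbT.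
have nts : `|t| < s by rewrite gtr0_norm.
have [a b] := sin_half_gt0 nts.
have h1 : d <= sin ((s + t) / 2).
  have : sin ((s + t) / 2) - sin ((s - t) / 2) = 2 * cos (s / 2) * sin (t / 2).
    have -> : (s + t) / 2 = s / 2 + t / 2 by lra.
    have -> : (s - t) / 2 = s / 2 - t / 2 by lra.
    by rewrite sinD sinB; ring.
  have : d <= 2 * cos (s / 2) * sin (t / 2).
    rewrite ler_pM2l; last by rewrite mulr_gt0//; apply: cos_gt0_pihalf; apply/andP; split; lra.
    rewrite leNgt; apply/negP; rewrite ltr_sin ?in_itv/=; first by lra.
      by apply/andP; split; lra.
    by apply/andP; split; lra.
  lra.
have h2 : sin ((s - t) / 2) < e.
  have := abs_sin_le ((s - t) / 2); rewrite [`|sin _|]gtr0_norm// [`|_ / 2|]gtr0_norm; last lra.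
  lra.
rewrite /bip -[u]expRK ltrBrDr -lnM ?posrE ?expR_gt0// ltr_ln ?posrE ?mulr_gt0 ?expR_gt0//.
apply: lt_le_trans h1; rewrite -ltr_pdivlMl ?expR_gt0// -expRN [_ * d]mulrC.
exact: h2.
Qed.

(** Change of variables on compact intervals, and monotone convergence. *)
Lemma bip_integral (F : R -> R) : continuous F -> (forall t, 0 <= F t) ->
  (\int[leb]_(t in [set` `]- s, s[%R]) (F (bip t) * dbip t)%:E = \int[leb]_t (F t)%:E)%E.
Proof.
move=> cF F0; have /andP[s0 sp] := hs.
pose A n : set R := `[- sn n, sn n]%classic.
pose B n : set R := `[bip (- sn n), bip (sn n)]%classic.
have inA n t : A n t -> `|t| < s.
  by rewrite /A/= in_itv/= -ler_norml => /le_lt_trans; apply; case/andP: (sn_bnd n).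
have AU : \bigcup_n A n = `]- s, s[%classic.
  apply/seteqP; split => t.
    by move=> [n _ /inA]; rewrite ltr_norml /= in_itv.
  rewrite /= in_itv/= -ltr_norml => /sn_cvg[n hn]; exists n => //.
  by rewrite /A/= in_itv/= -ler_norml ltW.
have BU : \bigcup_n B n = [set: R].
  apply/seteqP; split => // t _; have [n hn] := bip_cvg `|t|; exists n => //.
  by rewrite /B/= in_itv/= bipN -ler_norml ltW.
have Amono : nondecreasing_seq A.
  move=> n m nm; apply/subsetPset => t; rewrite /A/= !in_itv/= -!ler_norml => /le_trans; apply.
  exact: sn_mono.
have Bmono : nondecreasing_seq B.
  move=> n m nm; apply/subsetPset => t; rewrite /B/= !in_itv/= !bipN -!ler_norml => /le_trans; apply.
  have := sn_mono nm; rewrite le_eqVlt => /orP[/eqP -> //|lt].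
  have /andP[h1 h2] := sn_bnd n; have /andP[h3 h4] := sn_bnd m.
  by apply/ltW/bip_mono => //; lra.
have d1E t : `|t| < s -> (derive1 bip) t = dbip t.
  by move=> ts; rewrite derive1E; apply: derive_val; exact: is_derive_bip.
have cd t : `|t| < s -> {for t, continuous (derive1 bip)}.
  move=> ts; have h : dbip x @[x --> t] --> dbip t := continuous_dbip ts.
  change (derive1 bip x @[x --> t] --> derive1 bip t); rewrite d1E//.
  apply: cvg_trans h; apply: near_eq_cvg; near=> z; rewrite d1E//.
  near: z; have : nbhs t [set z | `|z| < s].
    apply: (@open_nbhs_nbhs _ t); split => //.
    have -> : [set z : R | `|z| < s] = (fun z : R => `|z|) @^-1` [set z | z < s] by [].
    by apply: open_comp; [move=> z _; exact: norm_continuous|exact: open_lt].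
  by [].
have eqn n : (\int[leb]_(t in A n) (F (bip t) * dbip t)%:E = \int[leb]_(t in B n) (F t)%:E)%E.
  have /andP[h1 h2] := sn_bnd n.
  have hl : `|- sn n| < s by rewrite normrN gtr0_norm.
  have hr : `|sn n| < s by rewrite gtr0_norm.
  have cb t : `|t| < s -> {for t, continuous bip}.
    move=> ts; apply: differentiable_continuous; apply/derivable1_diffP.
    by have [] := is_derive_bip ts.
  rewrite /B integration_by_substitution_increasing.
  - apply: eq_integral => t; rewrite inE => /inA ts.
    by rewrite -(d1E _ ts).
  - lra.
  - move=> x y; rewrite !in_itv/= => /andP[x1 x2] /andP[y1 y2] xy; apply: bip_mono => //; lra.
  - by move=> x; rewrite in_itv/= => /andP[x1 x2]; apply: cd; rewrite ltr_norml; lra.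
  - by apply/cvg_ex; exists ((derive1 bip) (- sn n)); apply: cvg_at_right_filter; exact: cd.
  - by apply/cvg_ex; exists ((derive1 bip) (sn n)); apply: cvg_at_left_filter; exact: cd.
  - split.
    + move=> x; rewrite in_itv/= => /andP[x1 x2].
      have xs : `|x| < s by rewrite ltr_norml; lra.
      by have [] := is_derive_bip xs.
    + by apply: cvg_at_right_filter; exact: cb.
    + by apply: cvg_at_left_filter; exact: cb.
  - exact: continuous_subspaceT.
have mA n : measurable (A n : set (measurableTypeR R)) by exact: measurable_itv.
have mB n : measurable (B n : set (measurableTypeR R)) by exact: measurable_itv.
have mF : measurable_fun [set: measurableTypeR R] (fun t => (F t)%:E).
  by apply/measurable_EFinP; exact: continuous_measurable_fun.
have cvB := @ge0_nondecreasing_set_cvg_integral _ (measurableTypeR R) R B (fun t => (F t)%:E) leb Bmono mB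
   (fun n => measurable_funS measurableT (@subsetT _ _) mF) (fun n t _ => F0 t).
have mS : measurable (`]- s, s[%classic : set (measurableTypeR R)) by exact: measurable_itv.
have mFb : measurable_fun (`]- s, s[%classic : set (measurableTypeR R)) (fun t => F (bip t) * dbip t).
  apply: open_continuous_measurable_fun; first exact: interval_open.
  move=> t; rewrite inE/= in_itv/= -ltr_norml => ts.
  apply: cvgM; last exact: continuous_dbip.
  apply: (@continuous_comp _ _ _ bip F); last exact: cF.
  apply: differentiable_continuous; apply/derivable1_diffP.
  by have [] := is_derive_bip ts.
have AS n : A n `<=` `]- s, s[%classic by rewrite -AU; exact: bigcup_sup.
have cvA := @ge0_nondecreasing_set_cvg_integral _ (measurableTypeR R) R A (fun t => (F (bip t) * dbip t)%:E) leb Amono mA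
   (fun n => proj2 (measurable_EFinP _ _) (measurable_funS mS (@AS n) mFb)) _.
rewrite -AU -BU.
have e : (fun n => \int[leb]_(t in A n) (F (bip t) * dbip t)%:E)%E = (fun n => \int[leb]_(t in B n) (F t)%:E)%E by apply/funext.
have cvA' : (\int[leb]_(t in A i) (F (bip t) * dbip t)%:E)%E @[i --> \oo] --> (\int[leb]_(t in \bigcup_i A i) (F (bip t) * dbip t)%:E)%E.
  by apply: cvA => n t /inA ts; rewrite lee_fin mulr_ge0// ltW// dbip_gt0.
rewrite e in cvA'.
exact: (cvg_unique _ cvA' cvB).
Unshelve. all: by end_near. Qed.

End Chart.

(** Bipolar coordinate with poles [p] and [q], and the density, with respect to
    length on a circle through the poles, of its Lebesgue measure. *)
Definition tau {R : realType} (p q y : R * R) : R := ln (edist y q) - ln (edist y p).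
Definition jac {R : realType} (p q y : R * R) : R := edist p q / (edist y p * edist y q).

(** What is used of the coordinate [ta] on an arc [G] and of its density [ja]:
    the change of variables to the line, and the comparison of the density with
    [exp |ta|]. *)
Record arc_chart d (T : measurableType d) (R : realType) (m : {measure set T -> \bar R})
    (G : set T) (ta ja : T -> R) (K : R) : Prop := ArcChart {
  chart_measurable : measurable G ;
  chart_tau : measurable_fun [set: T] ta ;
  chart_jac : measurable_fun [set: T] ja ;
  chart_jac_ge0 : forall y, 0 <= ja y ;
  chart_integral : forall F : R -> R, continuous F -> (forall t, 0 <= F t) ->
    (\int[m]_(y in G) (F (ta y) * ja y)%:E =
     \int[@lebesgue_measure R]_t (F t)%:E)%E ;
  chart_jac_le : forall y, G y -> ja y <= K * expR `|ta y| ;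
  chart_le_jac : forall y, G y -> expR `|ta y| <= K * ja y }.

Section CircleChart.
Variables (R : realType) (x : R * R) (r al s : R).
Hypotheses (r0 : 0 < r) (hs : 0 < s < pi).
Local Notation X := (caratheodory_type (hausdorff1_on (boundary (disk x r)))).
Local Notation cp := (arcpt x r al).
Local Notation leb := (@lebesgue_measure R).

Lemma continuous_arcpt : continuous cp.
Proof.
move=> t; have c : {for t, continuous (fun t => al + t)}.
  by apply: cvgD; [exact: cvg_cst|exact: cvg_id].
have c1 : {for t, continuous (fun t => x.1 + r * cos (al + t))}.
  apply: cvgD; first exact: cvg_cst.
  apply: cvgM; first exact: cvg_cst.
  by apply: (@continuous_comp _ _ _ (fun t => al + t) cos) => //; exact: continuous_cos.
have c2 : {for t, continuous (fun t => x.2 + r * sin (al + t))}.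
  apply: cvgD; first exact: cvg_cst.
  apply: cvgM; first exact: cvg_cst.
  by apply: (@continuous_comp _ _ _ (fun t => al + t) sin) => //; exact: continuous_sin.
exact: (cvg_pair c1 c2).
Qed.

Lemma measurable_edist_arcpt p :
  measurable_fun [set: measurableTypeR R] (fun t => edist (cp t) p).
Proof.
apply: continuous_measurable_fun => t.
exact: (@continuous_comp _ _ _ cp (fun y => edist y p) t (@continuous_arcpt t) (@eucl_continuous R p (cp t))).
Qed.

Lemma measurable_tau p q : measurable_fun [set: X] (tau p q : X -> R).
Proof.
apply: (circle_measurable_fun r0 (al := al)); apply: measurable_funTS.
by apply: measurable_funB; apply: measurableT_comp => //; exact: measurable_edist_arcpt.
Qed.

Lemma measurable_inv : measurable_fun [set: measurableTypeR R] (fun t : R => t^-1).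
Proof.
have -> : [set: measurableTypeR R] = [set 0 : R] `|` ~` [set 0 : R] by rewrite setUv.
have m1 : measurable ([set 0] : set (measurableTypeR R)) by exact: measurable_set1.
apply/(measurable_funU _ m1 (measurableC m1)); split.
  by move=> _ B mB; have [->|->] := subset_set1 (@subIsetl _ [set 0 : R] ((fun t : R => t^-1) @^-1` B)); [exact: measurable0|exact: measurable_set1].
apply: open_continuous_measurable_fun; first exact/closed_openC/closed_eq.
by move=> t; rewrite inE => /eqP t0; apply: cvgV => //; exact: cvg_id.
Qed.

Lemma measurable_jac p q : measurable_fun [set: X] (jac p q : X -> R).
Proof.
apply: (circle_measurable_fun r0 (al := al)); apply: measurable_funTS.
apply: measurable_funM; first exact: measurable_cst.
apply: (@measurableT_comp _ _ _ _ _ _ (fun t : R => t^-1)); first exact: measurable_inv.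
by apply: measurable_funM; exact: measurable_edist_arcpt.
Qed.

Lemma jac_ge0 (p q y : R * R) : 0 <= jac p q y.
Proof. by apply: divr_ge0; [exact: eucl_ge0|apply: mulr_ge0; exact: eucl_ge0]. Qed.

Lemma tauC (p q y : R * R) : tau q p y = - tau p q y.
Proof. by rewrite /tau opprB. Qed.

Lemma jacC (p q y : R * R) : jac q p y = jac p q y.
Proof. by rewrite /jac euclC [edist y p * _]mulrC. Qed.

Definition circle_arc : set (R * R) := [set cp t | t in [set t | `|t| < s]].

Lemma arcE t : - pi < t <= pi -> circle_arc (cp t) <-> `|t| < s.
Proof.
have /andP[s0 sp] := hs.
move=> ht; split => [[u /= us e]|ts]; last by exists t.
suff <- : u = t by [].
apply: (arcpt_inj r0 _ ht e); move: us; rewrite ltr_norml; lra.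
Qed.

Lemma measurable_arc : measurable (circle_arc : set X).
Proof.
apply: (circle_measurable r0 (al := al)).
have -> : cp @^-1` circle_arc `&` `]- pi, pi]%classic = `]- s, s[%classic; last exact: measurable_itv.
have /andP[s0 sp] := hs.
apply/seteqP; split => t; rewrite /= !in_itv/=.
  by move=> [h /arcE]; rewrite -ltr_norml => <-.
move=> ht; have ht' : - pi < t <= pi by lra.
by split => //; apply/(arcE ht'); rewrite ltr_norml.
Qed.

Lemma edist_arc_pos t : `|t| < s -> edist (cp t) (cp s) = 2 * r * sin ((s - t) / 2).
Proof.
move=> ts; have [a b] := sin_half_gt0 hs ts.
rewrite edist_cp// -[t - s]opprB mulNr sinN normrN gtr0_norm//.
Qed.

Lemma edist_arc_neg t : `|t| < s -> edist (cp t) (cp (- s)) = 2 * r * sin ((s + t) / 2).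
Proof.
move=> ts; have [a b] := sin_half_gt0 hs ts.
by rewrite edist_cp// opprK addrC gtr0_norm.
Qed.

Lemma edist_poles : edist (cp s) (cp (- s)) = 2 * r * sin s.
Proof.
rewrite edist_cp// opprK (_ : (s + s) / 2 = s); last lra.
by rewrite gtr0_norm// sin_gt0_pi.
Qed.

Lemma tau_arc t : `|t| < s -> tau (cp s) (cp (- s)) (cp t) = bip s t.
Proof.
move=> ts; have [a b] := sin_half_gt0 hs ts.
rewrite /tau edist_arc_pos// edist_arc_neg// /bip !lnM ?posrE ?mulr_gt0//; ring.
Qed.

Lemma jac_arc t : `|t| < s -> r * jac (cp s) (cp (- s)) (cp t) = dbip s t.
Proof.
move=> ts; have [a b] := sin_half_gt0 hs ts.
rewrite /jac (edist_arc_pos ts) (edist_arc_neg ts) edist_poles /dbip.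
move: (sin ((s + t) / 2)) (sin ((s - t) / 2)) a b => u v u0 v0.
by field; rewrite !gt_eqF.
Qed.

Lemma eucl_triangle (y p q : R * R) : edist p q <= edist y p + edist y q.
Proof.
have key (a b c d : R) : Num.sqrt ((a + b) ^+ 2 + (c + d) ^+ 2) <= Num.sqrt (a ^+ 2 + c ^+ 2) + Num.sqrt (b ^+ 2 + d ^+ 2).
  have := le_normcD (a +i* c)%C (b +i* d)%C.
  by rewrite /normc.
have := key (p.1 - y.1) (y.1 - q.1) (p.2 - y.2) (y.2 - q.2).
by rewrite !addrA !subrK -/(edist p q) -/(edist p y) -/(edist y q) euclC [edist y p]euclC euclC.
Qed.

(** For [y] closer to [q], both [jac] and [exp |tau|] are of the order of
    [1 / |y - q|], since then [|p - q| / 2 <= |y - p| <= D]. *)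
Lemma jac_weight (p q y : R * R) (D : R) : 0 < edist y p <= D -> 0 < edist y q <= D ->
  0 < edist p q ->
  jac p q y <= 4 / edist p q * expR `|tau p q y| /\
  expR `|tau p q y| <= D ^+ 2 / edist p q * jac p q y.
Proof.
wlog pq : p q / edist y q <= edist y p.
  move=> H hp hq h; have [le|/ltW le] := leP (edist y q) (edist y p); first exact: H.
  have h' : 0 < edist q p by rewrite euclC.
  have := H q p le hq hp h'; rewrite jacC tauC normrN.
  by rewrite [edist q p]euclC.
move=> /andP[p0 pD] /andP[q0 qD] a0; have tri := eucl_triangle y p q.
have e : expR `|tau p q y| = edist y p / edist y q.
  rewrite /tau ler0_norm ?opprB; last by rewrite subr_le0 ler_ln.
  by rewrite expRD expRN !lnK.
rewrite e /jac; move: (edist y p) (edist y q) (edist p q) p0 q0 a0 pD qD tri pq => u v a u0 v0 a0 uD vD tri vu {e}.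
have un : u != 0 by rewrite gt_eqF.
have vn : v != 0 by rewrite gt_eqF.
have an : a != 0 by rewrite gt_eqF.
split.
  have -> : 4 / a * (u / v) = (2 * u) ^+ 2 / a / (u * v) by field; rewrite ?un ?vn ?an.
  rewrite ler_pM2r ?invr_gt0 ?mulr_gt0// ler_pdivlMr// -expr2.
  by rewrite lerXn2r ?nnegrE; lra.
have -> : D ^+ 2 / a * (a / (u * v)) = D ^+ 2 / (u * v) by field; rewrite ?un ?vn ?an.
have -> : u / v = u ^+ 2 / (u * v) by field; rewrite ?un ?vn.
rewrite ler_pM2r ?invr_gt0 ?mulr_gt0// lerXn2r ?nnegrE; lra.
Qed.

Let P := cp s.
Let Q := cp (- s).

(** In the angle, [tau] is [bip] and [r * jac] is its derivative. *)
Lemma circle_arc_chart : exists K : R, arc_chart (circle_measure x r) (circle_arc : set X) (tau P Q) (jac P Q) K.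
Proof.
have /andP[s0 sp] := hs; have p0 := pi_gt0 R.
have a0 : 0 < edist P Q by rewrite /P /Q edist_poles !mulr_gt0 ?sin_gt0_pi.
exists (Num.max (4 / edist P Q) ((2 * r) ^+ 2 / edist P Q)).
have wt y : circle_arc y -> jac P Q y <= 4 / edist P Q * expR `|tau P Q y| /\
  expR `|tau P Q y| <= (2 * r) ^+ 2 / edist P Q * jac P Q y.
  move=> [t /= ts <-]; have [a b] := sin_half_gt0 hs ts.
  apply: jac_weight => //.
    by rewrite /P edist_arc_pos// !mulr_gt0//= ler_piMr ?sin_le1// mulr_ge0// ltW.
  by rewrite /Q edist_arc_neg// !mulr_gt0//= ler_piMr ?sin_le1// mulr_ge0// ltW.
split.
- exact: measurable_arc.
- exact: measurable_tau.
- exact: measurable_jac.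
- exact: jac_ge0.
- move=> F cF F0; rewrite -(bip_integral hs cF F0).
  rewrite integral_mkcond.
  pose f (y : R * R) : R := if y \in circle_arc then F (tau P Q y) * jac P Q y else 0.
  have f0 y : 0 <= f y by rewrite /f; case: ifP => // _; rewrite mulr_ge0// jac_ge0.
  have -> : (\int[circle_measure x r]_y ((fun y : X => (F (tau P Q y) * jac P Q y)%:E) \_ circle_arc) y =
     \int[circle_measure x r]_y (f y)%:E)%E.
    by apply: eq_integral => y _; rewrite /patch /f; case: ifP.
  have sub : `]- s, s[%classic `<=` (`]- pi, pi]%classic : set R).
    by move=> t; rewrite /= !in_itv/= => /andP[t1 t2]; lra.
  have fE t : t \in (`]- pi, pi]%classic : set R) -> r * f (cp t) = ((fun t => F (bip s t) * dbip s t) \_ (`]- s, s[%classic : set R)) t.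
    rewrite inE/= in_itv/= => ht; rewrite /f /patch; case: ifPn => [|].
      rewrite inE => /(arcE ht) ts; rewrite ifT; last by rewrite inE/= in_itv/= -ltr_norml.
      by rewrite mulrCA tau_arc// jac_arc.
    rewrite notin_setE => nts; rewrite ifF ?mulr0//.
    apply/negP; rewrite inE/= in_itv/= -ltr_norml => ts; apply: nts.
    by exists t.
  have mFb : measurable_fun (`]- s, s[%classic : set (measurableTypeR R)) (fun t => F (bip s t) * dbip s t).
    apply: open_continuous_measurable_fun; first exact: interval_open.
    move=> t; rewrite inE/= in_itv/= -ltr_norml => ts.
    apply: cvgM; last exact: continuous_dbip.
    apply: (@continuous_comp _ _ _ (bip s) F); last exact: cF.
    apply: differentiable_continuous; apply/derivable1_diffP.
    by have [] := is_derive_bip hs ts.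
  have mS : measurable (`]- s, s[%classic : set (measurableTypeR R)) by exact: measurable_itv.
  have mT : measurable (`]- pi, pi]%classic : set (measurableTypeR R)) by exact: measurable_itv.
  have mr : measurable_fun (`]- pi, pi]%classic : set (measurableTypeR R)) (fun t => r * f (cp t)).
    have := (measurable_restrictT _ mS).1 mFb.
    move=> /(measurable_funTS (D := (`]- pi, pi]%classic : set (measurableTypeR R)))).
    by apply: eq_measurable_fun => t ht; rewrite fE.
  have mf : measurable_fun (`]- pi, pi]%classic : set (measurableTypeR R)) (f \o cp).
    rewrite (_ : f \o cp = fun t => r^-1 * (r * f (cp t))).
      by apply: measurable_funM => //; exact: measurable_cst.
    by apply/funext => t /=; rewrite mulKf// gt_eqF.
  rewrite (circle_integral r0 mf f0) -ge0_integralZl//; last 3 first.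
    exact/measurable_EFinP.
    by move=> t _; rewrite lee_fin.
    by rewrite lee_fin ltW.
  rewrite [RHS]integral_mkcond [LHS]integral_mkcond.
  apply: eq_integral => t _; rewrite /patch; case: ifPn => ht.
    rewrite -EFinM fE// /patch; case: ifPn => //.
  rewrite ifF//; apply/negP => h; move/negP: ht; apply.
  by move: h; rewrite !inE; exact: sub.
- move=> y Gy; have [h _] := wt y Gy; rewrite (le_trans h)// ler_wpM2r ?expR_ge0//.
  by rewrite le_max lexx.
- move=> y Gy; have [_ h] := wt y Gy; rewrite (le_trans h)// ler_wpM2r ?jac_ge0//.
  by rewrite le_max lexx orbT.
Qed.

End CircleChart.

Lemma arc_chartC d (T : measurableType d) (R : realType) (m : {measure set T -> \bar R})
    (G : set T) (ta ja : T -> R) (K : R) :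
  arc_chart m G ta ja K -> arc_chart m G (fun y => - ta y) ja K.
Proof.
move=> [mG mt mj j0 h k1 k2]; split => //.
- exact: measurable_funN.
- move=> F cF F0; rewrite (h (fun t => F (- t)))//; last first.
    move=> t; apply: (@continuous_comp _ _ _ -%R F); last exact: cF.
    exact: opp_continuous.
  have mF : measurable_fun [set: measurableTypeR R] (fun t => (F t)%:E).
    by apply/measurable_EFinP; exact: continuous_measurable_fun.
  have mN : measurable_fun [set: measurableTypeR R] (-%R : measurableTypeR R -> measurableTypeR R).
    by apply: continuous_measurable_fun => t; exact: opp_continuous.
  have := @ge0_integral_pushforward _ _ (measurableTypeR R) (measurableTypeR R) R -%R mN
    (@lebesgue_measure R) setT (fun t => (F t)%:E) measurableT mF.
  rewrite preimage_setT => <-; last by move=> t _; rewrite lee_fin.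
  by apply: eq_measure_integral => A mA _; exact: lebesgue_measureN.
- by move=> y /k1; rewrite normrN.
- by move=> y /k2; rewrite normrN.
Qed.

(** * Convolution operators between arcs *)

Section SquareIntegrable.
Context d (T : measurableType d) (R : realType) (m : {measure set T -> \bar R}).
Local Notation C := R[i].
Implicit Types (f g : T -> C).

Lemma Lnorm2E f : ('N[m]_2%:E [EFin \o (@normc R \o f)] =
  (\int[m]_y ((normc (f y)) ^+ 2)%:E) `^ 2^-1)%E.
Proof.
rewrite Lnorm.unlock; congr poweR; apply: eq_integral => y _ /=.
by rewrite ger0_norm ?normc_ge0// powR_mulrn ?normc_ge0.
Qed.

Lemma sqr_integral_ge0 f : (0 <= \int[m]_y ((normc (f y)) ^+ 2)%:E)%E.
Proof. by apply: integral_ge0 => y _; rewrite lee_fin sqr_ge0. Qed.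

Lemma CL2funE f : (f \in CL2fun m) <->
  cmeas f /\ (\int[m]_y ((normc (f y)) ^+ 2)%:E < +oo)%E.
Proof.
split=> [/CL2funP[f1 f2 nf]|[[f1 f2] nf]].
  split; first by split.
  move: nf; rewrite /finite_norm Lnorm2E; case: (\int[m]_y _)%E (sqr_integral_ge0 f) => [r||] h0 h //.
    exact: ltry.
  by move: h; rewrite /= invr_eq0 pnatr_eq0.
apply/CL2funP; split => //; rewrite /finite_norm Lnorm2E.
exact: poweR_lty.
Qed.

Lemma CL2norm_ge0 f : 0 <= CL2norm m f.
Proof. by rewrite /CL2norm fine_ge0// Lnorm_ge0. Qed.

Lemma CL2norm_sqr f : f \in CL2fun m ->
  ((CL2norm m f ^+ 2)%:E = \int[m]_y ((normc (f y)) ^+ 2)%:E)%E.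
Proof.
move=> /CL2funE[_]; rewrite /CL2norm Lnorm2E.
have := sqr_integral_ge0 f; case: (\int[m]_y _)%E => //= r r0 _.
by rewrite lee_fin in r0; rewrite powR12_sqrt// sqr_sqrtr.
Qed.

End SquareIntegrable.

Section ArcOperator.
Context d (T : measurableType d) (R : realType) (m : {finite_measure set T -> \bar R}).
Local Notation C := R[i].
Local Notation Re := (@complex.Re R).
Local Notation Im := (@complex.Im R).
Local Notation leb := (@lebesgue_measure R).
Variables (G : set T) (ta ja : T -> R) (K : R).
Hypothesis hc : arc_chart m G ta ja K.
Implicit Types (k : R -> C) (t : R) (f g : T -> C) (M b c : R).

(** With the indicator inside the weight, all integrals are over the whole
    circle. *)
Definition arcw (y : T) : R := \1_G y * ja y.

Lemma arcw_ge0 y : 0 <= arcw y.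
Proof. by rewrite mulr_ge0// (chart_jac_ge0 hc). Qed.

Lemma measurable_arcw : measurable_fun [set: T] arcw.
Proof.
apply: measurable_funM; last exact: (chart_jac hc).
by apply: measurable_indic; exact: (chart_measurable hc).
Qed.

Lemma arcw_le y : arcw y <= `|K| * expR `|ta y|.
Proof.
rewrite /arcw indicE; case: (boolP (y \in G)) => [|_].
  rewrite inE mul1r => /(chart_jac_le hc) /le_trans; apply.
  by rewrite ler_wpM2r ?expR_ge0// ler_norm.
by rewrite mul0r mulr_ge0// expR_ge0.
Qed.

Lemma arcw_ge y : \1_G y * expR `|ta y| <= `|K| * arcw y.
Proof.
rewrite /arcw indicE; case: (boolP (y \in G)) => [|_]; last by rewrite !mul0r mulr0.
rewrite inE !mul1r => /(chart_le_jac hc) /le_trans; apply.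
by rewrite ler_wpM2r ?(chart_jac_ge0 hc)// ler_norm.
Qed.

Lemma arcw_integral (F : R -> R) : continuous F -> (forall t, 0 <= F t) ->
  (\int[m]_y (F (ta y) * arcw y)%:E = \int[leb]_t (F t)%:E)%E.
Proof.
move=> cF F0; rewrite -(chart_integral hc cF F0) [RHS]integral_mkcond.
apply: eq_integral => y _; rewrite /patch /arcw indicE; case: ifP => _.
  by rewrite mul1r.
by rewrite mul0r mulr0.
Qed.

Lemma measurable_comp_tau (F : R -> R) : continuous F -> measurable_fun [set: T] (fun y => F (ta y)).
Proof.
move=> cF; apply: (@measurableT_comp _ _ _ _ _ _ F _ ta); last exact: (chart_tau hc).
exact: continuous_measurable_fun.
Qed.

Lemma cmeas_comp_tau (F : R -> C) : ccontinuous F -> cmeas (fun y => F (ta y)).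
Proof.
move=> cF; exact: (@cmeas_comp R _ _ T (measurableTypeR R) F ta (cmeas_continuous cF) (chart_tau hc)).
Qed.

Lemma arcw_integrable (F h : R -> R) : continuous F -> continuous h ->
  leb.-integrable [set: R] (fun t => (h t)%:E) -> (forall t, `|F t| <= h t) ->
  m.-integrable [set: T] (fun y => (F (ta y) * arcw y)%:E).
Proof.
move=> cF ch ih Fh; have h0 t : 0 <= h t by apply: le_trans (Fh t).
apply/integrableP; split.
  apply/measurable_EFinP; apply: measurable_funM; last exact: measurable_arcw.
  exact: measurable_comp_tau.
apply: (@le_lt_trans _ _ (\int[m]_y (h (ta y) * arcw y)%:E)%E).
  apply: ge0_le_integral => //.
  - apply: measurableT_comp => //; apply/measurable_EFinP.
    by apply: measurable_funM; [exact: measurable_comp_tau|exact: measurable_arcw].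
  - apply/measurable_EFinP.
    by apply: measurable_funM; [exact: measurable_comp_tau|exact: measurable_arcw].
  - move=> y _; rewrite /= lee_fin normrM [`|arcw y|]ger0_norm ?arcw_ge0//.
    by rewrite ler_wpM2r ?arcw_ge0.
rewrite arcw_integral//; have /integrableP[_] := ih; apply: le_lt_trans.
apply: ge0_le_integral => //.
- by move=> t _; rewrite lee_fin.
- by apply/measurable_EFinP; exact: (continuous_measurable_fun ch).
- by apply: measurableT_comp => //; apply/measurable_EFinP; exact: (continuous_measurable_fun ch).
- by move=> t _; rewrite /= lee_fin ler_norm.
Qed.

Lemma arcw_Rintegral (F h : R -> R) : continuous F -> continuous h ->
  leb.-integrable [set: R] (fun t => (h t)%:E) -> (forall t, `|F t| <= h t) ->
  \int[m]_y (F (ta y) * arcw y) = \int[leb]_t (F t).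
Proof.
move=> cF ch ih Fh; have h0 t : 0 <= h t by apply: le_trans (Fh t).
have hh t : `|h t| <= h t by rewrite ger0_norm.
have pos (H : R -> R) : continuous H -> (forall t, 0 <= H t) ->
    \int[m]_y (H (ta y) * arcw y) = \int[leb]_t (H t).
  by move=> cH H0; rewrite /Rintegral arcw_integral.
have iF := arcw_integrable cF ch ih Fh; have iH := arcw_integrable ch ch ih hh.
have iFl : leb.-integrable [set: R] (fun t => (F t)%:E).
  apply: (le_integrable _ _ _ ih) => //.
    by apply/measurable_EFinP; exact: (continuous_measurable_fun cF).
  by move=> t _; rewrite /= lee_fin (le_trans (Fh t))// ler_norm.
have cFh : continuous (fun t => F t + h t).
  by move=> t; apply: cvgD; [exact: cF|exact: ch].
have e1 := pos _ cFh (fun t => ltac:(have := Fh t; rewrite ler_norml; lra)).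
have e2 := pos _ ch h0.
have e3 : \int[m]_y ((F (ta y) + h (ta y)) * arcw y) = \int[m]_y (F (ta y) * arcw y) + \int[m]_y (h (ta y) * arcw y).
  by rewrite -RintegralD//; under eq_Rintegral do rewrite mulrDl.
have e4 : \int[leb]_t (F t + h t) = \int[leb]_t (F t) + \int[leb]_t (h t) by rewrite RintegralD.
by move: e1; rewrite e3 e4 e2 => /addIr.
Qed.

Lemma arcw_cintegral (F : R -> C) (h : R -> R) : ccontinuous F -> continuous h ->
  leb.-integrable [set: R] (fun t => (h t)%:E) -> (forall t, normc (F t) <= h t) ->
  cintegrable m (fun y => ((arcw y)%:C)%C * F (ta y)) /\
  cintegral m (fun y => ((arcw y)%:C)%C * F (ta y)) = cintegral leb F.
Proof.
move=> [c1 c2] ch ih Fh.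
have h1 t : `|Re (F t)| <= h t by exact: le_trans (Re_le_normc _) _.
have h2 t : `|Im (F t)| <= h t by exact: le_trans (Im_le_normc _) _.
have eR y : Re (((arcw y)%:C)%C * F (ta y)) = Re (F (ta y)) * arcw y.
  by rewrite cReM /= mul0r subr0 mulrC.
have eI y : Im (((arcw y)%:C)%C * F (ta y)) = Im (F (ta y)) * arcw y.
  by rewrite cImM /= mul0r addr0 mulrC.
split.
  split; [under eq_fun do rewrite eR|under eq_fun do rewrite eI].
    exact: (arcw_integrable c1 ch ih h1).
  exact: (arcw_integrable c2 ch ih h2).
apply: cx_ext; rewrite /cintegral /=.
  by under eq_Rintegral do rewrite eR; exact: (arcw_Rintegral c1 ch ih h1).
by under eq_Rintegral do rewrite eI; exact: (arcw_Rintegral c2 ch ih h2).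
Qed.

Lemma arcw_expabs c t : 0 < c ->
  (\int[m]_y (arcw y * expR (- (c * `|t - ta y|)))%:E = (2 / c)%:E)%E.
Proof.
move=> c0.
have cX : continuous (fun u => expR (- (c * `|t - u|))).
  move=> u; apply: (@continuous_comp _ _ _ (fun u => t - u) (fun v => expR (- (c * `|v|)))).
    by apply: cvgB; [exact: cvg_cst|exact: cvg_id].
  exact: continuous_expabs.
under eq_integral do rewrite mulrC.
rewrite (arcw_integral cX); last by move=> u; exact: expR_ge0.
have i1 : cintegrable leb (fun s => ((expR (- (c * `|s|)))%:C)%C).
  split; last exact: integrable0.
  by have := integrable_expabs 1 c0; under eq_fun do rewrite mul1r.
have [[i2 _] /(congr1 Re)/= e] := cintegral_reflect t i1.
rewrite (Rintegral_expabs c0) in e.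
by rewrite -e /Rintegral fineK//; exact: integrable_fin_num i2.
Qed.

(** The convolution operator with kernel [k] in the coordinate of the arc. *)
Definition arcT k g t : C := cintegral m (fun y => ((arcw y)%:C)%C * k (t - ta y) * g y).

Section bound.
Variables (k : R -> C) (M b : R).
Hypotheses (hk : expdec k M b) (b2 : 2^-1 < b).
Let c := b - 2^-1.
Let c0 : 0 < c. Proof. by rewrite subr_gt0. Qed.
Let X t (y : T) : R := expR (- (c * `|t - ta y|)).

Let mX t : measurable_fun [set: T] (X t).
Proof.
apply: (@measurable_comp_tau (fun u => expR (- (c * `|t - u|)))) => u.
apply: (@continuous_comp _ _ _ (fun u => t - u) (fun v => expR (- (c * `|v|)))).
  by apply: cvgB; [exact: cvg_cst|exact: cvg_id].
exact: continuous_expabs.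
Qed.

Let X_ge0 t y : 0 <= X t y. Proof. exact: expR_ge0. Qed.

Let X_le1 t y : X t y <= 1.
Proof. by rewrite -expR0 ler_expR oppr_le0 mulr_ge0// ltW. Qed.

Let cX t : continuous (fun u => expR (- (c * `|t - u|))).
Proof.
move=> u; apply: (@continuous_comp _ _ _ (fun u => t - u) (fun v => expR (- (c * `|v|)))).
  by apply: cvgB; [exact: cvg_cst|exact: cvg_id].
exact: continuous_expabs.
Qed.

Let arcX_integral t : (\int[m]_y (X t y * arcw y)%:E = (2 / c)%:E)%E.
Proof. by rewrite -(arcw_expabs t c0); apply: eq_integral => y _; rewrite mulrC. Qed.

(* The two factors of the Cauchy-Schwarz inequality are [arcX_integral] and
   [Phi]; their geometric mean is an upper bound of [I]. *)
Let Phi g t : \bar R := (\int[m]_y (X t y * normc (g y) ^+ 2)%:E)%E.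

Let Phi_lty g t : g \in CL2fun m -> (Phi g t < +oo)%E.
Proof.
move=> /CL2funE[mg fg]; apply: le_lt_trans fg; apply: ge0_le_integral => //.
- by move=> y _; rewrite lee_fin mulr_ge0// sqr_ge0.
- apply/measurable_EFinP; apply: measurable_funM => //.
  by apply: measurable_funX; exact: cmeas_normc.
- by apply/measurable_EFinP; apply: measurable_funX; exact: cmeas_normc.
- by move=> y _; rewrite lee_fin ler_piMl// sqr_ge0.
Qed.

Let I g t : \bar R := (\int[m]_y (arcw y * expR (- (2^-1 * `|ta y|)) * X t y * normc (g y))%:E)%E.

Let I_ge0 g t y : 0 <= arcw y * expR (- (2^-1 * `|ta y|)) * X t y * normc (g y).
Proof.
apply: mulr_ge0; last exact: normc_ge0.
by apply: mulr_ge0 => //; apply: mulr_ge0; [exact: arcw_ge0|exact: expR_ge0].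
Qed.

Let I_integrable g t : cmeas g -> (I g t < +oo)%E ->
  m.-integrable [set: T] (fun y => (arcw y * expR (- (2^-1 * `|ta y|)) * X t y * normc (g y))%:E).
Proof.
move=> mg If; apply/integrableP; split.
  apply/measurable_EFinP; apply: measurable_funM; last exact: cmeas_normc.
  apply: measurable_funM => //; apply: measurable_funM; first exact: measurable_arcw.
  by apply: (@measurable_comp_tau (fun u => expR (- (2^-1 * `|u|)))) => u; exact: continuous_expabs.
by under eq_integral => y _ do rewrite gee0_abs ?lee_fin ?I_ge0//.
Qed.

Let mtaE : measurable_fun [set: T] (fun y => expR (- (2^-1 * `|ta y|))).
Proof. by apply: (@measurable_comp_tau (fun u => expR (- (2^-1 * `|u|)))) => u; exact: continuous_expabs. Qed.

Let mI g t : cmeas g -> measurable_fun [set: T] (fun y => arcw y * expR (- (2^-1 * `|ta y|)) * X t y * normc (g y)).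
Proof.
move=> mg; apply: measurable_funM; last exact: cmeas_normc.
apply: measurable_funM => //; apply: measurable_funM => //; exact: measurable_arcw.
Qed.

(* Cauchy-Schwarz in the form of an inequality between means, for every [e]:
   the square of a possibly infinite integral does not appear. *)
Let I_amgm g t e : 0 < e -> g \in CL2fun m ->
  (I g t <= (e / c)%:E + (`|K| / (2 * e))%:E * Phi g t)%E.
Proof.
move=> e0 /[dup] gL /CL2funE[mg fg].
have K2 : 0 <= `|K| / (2 * e) by rewrite divr_ge0// mulr_ge0// ltW.
have mn2 : measurable_fun [set: T] (fun y => normc (g y) ^+ 2).
  by apply: measurable_funX; exact: cmeas_normc.
have -> : ((e / c)%:E + (`|K| / (2 * e))%:E * Phi g t =
   \int[m]_y ((e / 2 * (X t y * arcw y))%:E + (`|K| / (2 * e) * (X t y * normc (g y) ^+ 2))%:E))%E.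
  rewrite ge0_integralD//; last 4 first.
  - move=> y _; rewrite lee_fin; apply: mulr_ge0; first by rewrite divr_ge0// ltW.
    by apply: mulr_ge0 => //; exact: arcw_ge0.
  - apply/measurable_EFinP; apply: measurable_funM; first exact: measurable_cst.
    by apply: measurable_funM => //; exact: measurable_arcw.
  - by move=> y _; rewrite lee_fin mulr_ge0// mulr_ge0// sqr_ge0.
  - apply/measurable_EFinP; apply: measurable_funM; first exact: measurable_cst.
    exact: measurable_funM.
  congr (_ + _)%E.
    under eq_integral do rewrite EFinM.
    rewrite ge0_integralZl//.
    + by rewrite arcX_integral -EFinM; congr EFin; field; rewrite gt_eqF.
    + by apply/measurable_EFinP; apply: measurable_funM => //; exact: measurable_arcw.
    + by move=> y _; rewrite lee_fin mulr_ge0// arcw_ge0.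
    + by rewrite lee_fin divr_ge0// ltW.
  under [RHS]eq_integral do rewrite EFinM.
  rewrite ge0_integralZl//.
  - by apply/measurable_EFinP; exact: measurable_funM.
  - by move=> y _; rewrite lee_fin mulr_ge0// sqr_ge0.
apply: ge0_le_integral => //.
- by move=> y _; rewrite lee_fin I_ge0.
- by apply/measurable_EFinP; exact: mI.
- apply: emeasurable_funD; apply/measurable_EFinP; (apply: measurable_funM; first exact: measurable_cst).
    by apply: measurable_funM => //; exact: measurable_arcw.
  exact: measurable_funM.
move=> y _; rewrite -EFinD lee_fin.
set n := normc (g y); set x := X t y; set h := expR (- (2^-1 * `|ta y|)); set w := arcw y.
have x0 : 0 <= x by exact: X_ge0.
have w0 : 0 <= w by exact: arcw_ge0.
have h2 : w * (h * h) <= `|K|.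
  rewrite -expRD; have -> : - (2^-1 * `|ta y|) + - (2^-1 * `|ta y|) = - `|ta y| by lra.
  have := ler_wpM2r (expR_ge0 (- `|ta y|)) (arcw_le y).
  by rewrite -[leRHS]mulrA -expRD subrr expR0 mulr1.
have sq : 0 <= x * w * (e - h * n) ^+ 2 by rewrite mulr_ge0 ?sqr_ge0// mulr_ge0.
have h3 : x * n ^+ 2 * (w * (h * h)) <= x * n ^+ 2 * `|K| by rewrite ler_wpM2l// mulr_ge0// sqr_ge0.
have e20 : 0 < 2 * e by rewrite mulr_gt0.
rewrite -(ler_pM2l e20).
have -> : 2 * e * (e / 2 * (x * w) + `|K| / (2 * e) * (x * n ^+ 2)) = e * e * (x * w) + `|K| * (x * n ^+ 2).
  by field; rewrite gt_eqF.
have : x * w * (e - h * n) ^+ 2 = e * e * (x * w) + x * n ^+ 2 * (w * (h * h)) - 2 * e * (w * h * x * n) by ring.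
lra.
Qed.

Let I_fin g t : g \in CL2fun m -> I g t \is a fin_num.
Proof.
move=> gL; have h := I_amgm t ltr01 gL.
rewrite ge0_fin_numE; last first.
  by apply: integral_ge0 => y _; rewrite lee_fin I_ge0.
apply: (le_lt_trans h); apply: lte_add_pinfty; first exact: ltry.
apply: lte_mul_pinfty; [|by []|exact: Phi_lty].
by rewrite lee_fin divr_ge0.
Qed.

Let kernel_le g t y : normc (((arcw y)%:C)%C * k (t - ta y) * g y) <=
  M * expR (2^-1 * `|t|) * (arcw y * expR (- (2^-1 * `|ta y|)) * X t y * normc (g y)).
Proof.
have [ck bk] := hk; have M0 := expdec_M_ge0 hk.
rewrite normcM [normc (_ * k _)]normcM normc_real [`|arcw y|]ger0_norm ?arcw_ge0//.
rewrite mulrA ler_wpM2r ?normc_ge0//.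
have -> : M * expR (2^-1 * `|t|) * (arcw y * expR (- (2^-1 * `|ta y|)) * X t y) =
  arcw y * (M * (expR (2^-1 * `|t|) * expR (- (2^-1 * `|ta y|)) * X t y)) by ring.
rewrite ler_wpM2l ?arcw_ge0// (le_trans (bk _))// ler_wpM2l//.
rewrite /X -!expRD ler_expR.
have h1 : `|ta y| <= `|t - ta y| + `|t|.
  by rewrite -[X in `|X| <= _](subKr t (ta y)) (le_trans (ler_normB _ _))// addrC.
rewrite /c; lra.
Qed.

Lemma arcT_integrable g t : g \in CL2fun m ->
  cintegrable m (fun y => ((arcw y)%:C)%C * k (t - ta y) * g y).
Proof.
move=> gL; have /CL2funE[mg _] := gL; have [ck bk] := hk.
have ck' : ccontinuous (fun u => k (t - u)).
  by apply: (ccontinuous_comp ck) => u; apply: cvgB; [exact: cvg_cst|exact: cvg_id].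
have mk : cmeas (fun y => ((arcw y)%:C)%C * k (t - ta y) * g y).
  apply: cmeasM => //; apply: cmeasM; first by apply: cmeas_real; exact: measurable_arcw.
  exact: (cmeas_comp_tau ck').
apply: (cintegrable_dom mk _ (kernel_le g t)).
have iI : m.-integrable [set: T] (fun y => (arcw y * expR (- (2^-1 * `|ta y|)) * X t y * normc (g y))%:E).
  apply: I_integrable => //; have := I_fin t gL.
  by rewrite fin_numE => /andP[_]; rewrite ltey.
by under eq_fun do rewrite EFinM; apply: integrableZl.
Qed.

(** Cauchy-Schwarz.  The kernel is at most [exp (- |ta y| / 2)] times an
    integrable function of [t - ta y]; squared, that exponential cancels the
    growth of the density in front of [normc (g y) ^+ 2]. *)
Lemma arcT_sqr_le g t : g \in CL2fun m ->
  ((normc (arcT k g t) ^+ 2)%:E <= (M ^+ 2 * (2 * `|K| / (b - 2^-1)) * expR `|t|)%:E *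
     \int[m]_y (expR (- ((b - 2^-1) * `|t - ta y|)) * normc (g y) ^+ 2)%:E)%E.
Proof.
rewrite -/c -/(Phi g t) => gL; have /CL2funE[mg fg] := gL; have M0 := expdec_M_ge0 hk.
have iI : m.-integrable [set: T] (fun y => (arcw y * expR (- (2^-1 * `|ta y|)) * X t y * normc (g y))%:E).
  apply: I_integrable => //; have := I_fin t gL.
  by rewrite fin_numE => /andP[_]; rewrite ltey.
have iMI : m.-integrable [set: T] (fun y => (M * expR (2^-1 * `|t|) * (arcw y * expR (- (2^-1 * `|ta y|)) * X t y * normc (g y)))%:E).
  by under eq_fun do rewrite EFinM; apply: integrableZl.
have h1 := normc_cintegral_le (cintegrable_cmeas (arcT_integrable t gL)) iMI (kernel_le g t).
rewrite RintegralZl// in h1; rewrite -/(arcT k g t) in h1.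
have Pf : Phi g t \is a fin_num.
  rewrite ge0_fin_numE ?Phi_lty//; apply: integral_ge0 => y _.
  by rewrite lee_fin mulr_ge0// sqr_ge0.
have P0 : 0 <= fine (Phi g t).
  by apply: fine_ge0; apply: integral_ge0 => y _; rewrite lee_fin mulr_ge0// sqr_ge0.
set S := (\int[m]_y _)%R in h1.
have S0 : 0 <= S by apply: Rintegral_ge0 => y _; exact: I_ge0.
have am e : 0 < e -> S <= e / c + `|K| / (2 * e) * fine (Phi g t).
  move=> e0; have := I_amgm t e0 gL.
  by rewrite -(fineK Pf) -(fineK (I_fin t gL)) -EFinM -EFinD lee_fin.
have S2 : S ^+ 2 <= 2 * `|K| / c * fine (Phi g t).
  have [->|Sn] := eqVneq S 0.
    by rewrite expr0n/= !mulr_ge0// invr_ge0 ltW.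
  have Sp : 0 < S by rewrite lt_neqAle eq_sym Sn.
  (* The optimal parameter is of the order of [S]. *)
  have e0 : 0 < S * c / 2 by rewrite divr_gt0// mulr_gt0.
  have := am _ e0; rewrite -(ler_pM2l Sp).
  have -> : S * (S * c / 2 / c + `|K| / (2 * (S * c / 2)) * fine (Phi g t)) = S ^+ 2 / 2 + `|K| / c * fine (Phi g t).
    by field; rewrite Sn gt_eqF.
  rewrite -expr2; have -> : 2 * `|K| / c * fine (Phi g t) = 2 * (`|K| / c * fine (Phi g t)) by ring.
  by move: (_ / c * _) => q; lra.
rewrite -(fineK Pf) -EFinM lee_fin.
apply: (@le_trans _ _ ((M * expR (2^-1 * `|t|) * S) ^+ 2)).
  by rewrite lerXn2r ?nnegrE ?normc_ge0// !mulr_ge0 ?expR_ge0.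
rewrite !exprMn (_ : expR (2^-1 * `|t|) ^+ 2 = expR `|t|); last first.
  by rewrite -expRM_natl; congr expR; lra.
have -> : M ^+ 2 * (2 * `|K| / c) * expR `|t| * fine (Phi g t) = M ^+ 2 * expR `|t| * (2 * `|K| / c * fine (Phi g t)) by ring.
by rewrite ler_wpM2l// mulr_ge0 ?expR_ge0// sqr_ge0.
Qed.

End bound.

End ArcOperator.

Section TwoArcs.
Context d1 (T1 : measurableType d1) d2 (T2 : measurableType d2) (R : realType).
Variables (m1 : {finite_measure set T1 -> \bar R}) (m2 : {finite_measure set T2 -> \bar R}).
Local Notation C := R[i].
Local Notation Re := (@complex.Re R).
Local Notation Im := (@complex.Im R).
Local Notation leb := (@lebesgue_measure R).
Variables (G1 : set T1) (ta1 ja1 : T1 -> R) (K1 : R) (hc1 : arc_chart m1 G1 ta1 ja1 K1).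
Variables (G2 : set T2) (ta2 ja2 : T2 -> R) (K2 : R) (hc2 : arc_chart m2 G2 ta2 ja2 K2).
Implicit Types (k : R -> C) (t : R) (g : T1 -> C) (M b c : R).

(** The values of [arcT] along another arc, extended by 0 to its circle. *)
Definition arcR k g (w : T2) : C :=
  if w \in G2 then arcT m1 G1 ta1 ja1 k g (ta2 w) else 0.

Let mta21 : measurable_fun [set: T2 * T1] (fun z : T2 * T1 => ta2 z.1 - ta1 z.2).
Proof.
apply: measurable_funB.
  by apply: measurableT_comp; [exact: (chart_tau hc2)|exact: measurable_fst].
by apply: measurableT_comp; [exact: (chart_tau hc1)|exact: measurable_snd].
Qed.

Let mta12 : measurable_fun [set: T1 * T2] (fun z : T1 * T2 => ta2 z.2 - ta1 z.1).
Proof.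
apply: measurable_funB.
  by apply: measurableT_comp; [exact: (chart_tau hc2)|exact: measurable_snd].
by apply: measurableT_comp; [exact: (chart_tau hc1)|exact: measurable_fst].
Qed.

Lemma cmeas_arcR k g : ccontinuous k -> cmeas g -> cmeas (arcR k g).
Proof.
move=> ck mg; apply: (cmeas_if (chart_measurable hc2)).
pose F (z : T2 * T1) : C := ((arcw G1 ja1 z.2)%:C)%C * k (ta2 z.1 - ta1 z.2) * g z.2.
have mF : cmeas F.
  apply: cmeasM; last exact: (cmeas_comp mg measurable_snd).
  apply: cmeasM.
    apply: cmeas_real; apply: measurableT_comp; last exact: measurable_snd.
    exact: (measurable_arcw hc1).
  exact: (cmeas_comp (cmeas_continuous ck) mta21).
exact: (@cmeas_cintegral R _ _ T2 T1 m1 F mF).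
Qed.

(** Schur's test: [arcT_sqr_le] is integrated along the second arc, where the
    factor [expR |t|] is again at most a multiple of the density. *)
Lemma arcR_sqr_integral k M b g : expdec k M b -> 2^-1 < b -> g \in CL2fun m1 ->
  (\int[m2]_w (normc (arcR k g w) ^+ 2)%:E <=
   (M ^+ 2 * (2 * `|K1| / (b - 2^-1)) * `|K2| * (2 / (b - 2^-1)))%:E *
     \int[m1]_y (normc (g y) ^+ 2)%:E)%E.
Proof.
move=> hk b2 gL; have [ck bk] := hk; have [mg fg] := (CL2funE m1 g).1 gL.
have M0 := expdec_M_ge0 hk.
set c := b - 2^-1; have c0 : 0 < c by rewrite subr_gt0.
set A := M ^+ 2 * (2 * `|K1| / c).
have A0 : 0 <= A by rewrite mulr_ge0 ?sqr_ge0// divr_ge0 ?mulr_ge0// ltW.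
pose E (z : T2 * T1) : R := A * `|K2| * (arcw G2 ja2 z.1 * (expR (- (c * `|ta2 z.1 - ta1 z.2|)) * normc (g z.2) ^+ 2)).
have cX : continuous (fun u : R => expR (- (c * `|u|))) by exact: continuous_expabs.
have mE : measurable_fun [set: T2 * T1] E.
  apply: measurable_funM; first exact: measurable_cst.
  apply: measurable_funM.
    by apply: measurableT_comp; [exact: (measurable_arcw hc2)|exact: measurable_fst].
  apply: measurable_funM.
    by apply: (@measurableT_comp _ _ _ _ _ _ (fun u : R => expR (- (c * `|u|)))) => //; exact: continuous_measurable_fun.
  apply: (measurableT_comp (f := fun y => normc (g y) ^+ 2)); last exact: measurable_snd.
  by apply: measurable_funX; exact: cmeas_normc.
have E0 z : 0 <= E z.
  apply: mulr_ge0; first exact: mulr_ge0.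
  apply: mulr_ge0; first exact: (arcw_ge0 hc2).
  by apply: mulr_ge0; [exact: expR_ge0|exact: sqr_ge0].
have aw0 w : 0 <= A * `|K2| * arcw G2 ja2 w.
  by apply: mulr_ge0; [exact: mulr_ge0|exact: (arcw_ge0 hc2)].
have mEe : measurable_fun [set: T2 * T1] (EFin \o E) by exact/measurable_EFinP.
have mn2 : measurable_fun [set: T1] (fun y => normc (g y) ^+ 2).
  by apply: measurable_funX; exact: cmeas_normc.
apply: (@le_trans _ _ (\int[m2]_w \int[m1]_y (E (w, y))%:E)%E).
  apply: ge0_le_integral => //.
  - by move=> w _; rewrite lee_fin sqr_ge0.
  - by apply/measurable_EFinP; apply: measurable_funX; apply: cmeas_normc; exact: cmeas_arcR.
  - by apply: (@measurable_fun_fubini_tonelli_F _ _ T2 T1 R m1 (EFin \o E)) => // z; rewrite lee_fin.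
  move=> w _; rewrite /E /=; under eq_integral do rewrite mulrA EFinM.
  rewrite ge0_integralZl//; last 3 first.
  - apply/measurable_EFinP; apply: measurable_funM => //.
    have cX' : continuous (fun u : R => expR (- (c * `|ta2 w - u|))).
      move=> u; apply: (@continuous_comp _ _ _ (fun u => ta2 w - u) (fun v => expR (- (c * `|v|)))); last exact: cX.
      by apply: cvgB; [exact: cvg_cst|exact: cvg_id].
    exact: (measurable_comp_tau hc1 cX').
  - by move=> y _; rewrite lee_fin mulr_ge0 ?expR_ge0 ?sqr_ge0.
  - by rewrite lee_fin.
  rewrite /arcR; case: (boolP (w \in G2)) => wG; last first.
    rewrite normc0 expr0n/=; apply: mule_ge0.
      by rewrite lee_fin.
    by apply: integral_ge0 => y _; rewrite lee_fin mulr_ge0 ?expR_ge0 ?sqr_ge0.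
  apply: (le_trans (arcT_sqr_le hc1 hk b2 (ta2 w) gL)).
  rewrite -/c -/A; apply: lee_wpmul2r.
    by apply: integral_ge0 => y _; rewrite lee_fin mulr_ge0 ?expR_ge0 ?sqr_ge0.
  rewrite lee_fin -mulrA ler_wpM2l//.
  by have := arcw_ge hc2 w; rewrite indicE wG mul1r.
rewrite (@fubini_tonelli _ _ T2 T1 R m2 m1 (EFin \o E) mEe (fun z => E0 z)) /=.
rewrite -ge0_integralZl//; last 3 first.
- exact/measurable_EFinP.
- by move=> y _; rewrite lee_fin sqr_ge0.
- by rewrite lee_fin; apply: mulr_ge0; [apply: mulr_ge0|rewrite divr_ge0// ltW].
apply: ge0_le_integral => //.
- by move=> y _; apply: integral_ge0 => w _; rewrite lee_fin.
- apply: (@measurable_fun_fubini_tonelli_G _ _ T2 T1 R m2 (EFin \o E)) => // z; rewrite lee_fin//.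
- by apply/measurable_EFinP; apply: measurable_funM => //; exact: measurable_cst.
move=> y _; rewrite /E /=.
have -> : (\int[m2]_w (A * `|K2| * (arcw G2 ja2 w * (expR (- (c * `|ta2 w - ta1 y|)) * normc (g y) ^+ 2)))%:E =
   \int[m2]_w ((A * `|K2| * normc (g y) ^+ 2)%:E * (arcw G2 ja2 w * expR (- (c * `|ta1 y - ta2 w|)))%:E))%E.
  by apply: eq_integral => w _; rewrite distrC -EFinM; congr EFin; ring.
rewrite ge0_integralZl//; last 3 first.
- apply/measurable_EFinP; apply: measurable_funM; first exact: (measurable_arcw hc2).
  have cX' : continuous (fun u : R => expR (- (c * `|ta1 y - u|))).
    move=> u; apply: (@continuous_comp _ _ _ (fun u => ta1 y - u) (fun v => expR (- (c * `|v|)))); last exact: cX.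
    by apply: cvgB; [exact: cvg_cst|exact: cvg_id].
  exact: (measurable_comp_tau hc2 cX').
- by move=> w _; rewrite lee_fin mulr_ge0 ?expR_ge0 ?(arcw_ge0 hc2).
- by rewrite lee_fin mulr_ge0 ?sqr_ge0// mulr_ge0.
rewrite (arcw_expabs hc2 _ c0) -!EFinM lee_fin le_eqVlt; apply/orP; left; apply/eqP; ring.
Qed.

(** Bipolar coordinates turn composition of the operators into convolution of
    their kernels, whichever circle carries the intermediate arc. *)
Lemma arcT_comp k1 k2 M1 b1 M2 b2 g t :
  expdec k1 M1 b1 -> expdec k2 M2 b2 -> 2^-1 < b1 -> 2^-1 < b2 -> g \in CL2fun m1 ->
  arcT m2 G2 ta2 ja2 k1 (arcR k2 g) t = arcT m1 G1 ta1 ja1 (convol k1 k2) g t.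
Proof.
move=> h1 h2 hb1 hb2 gL; have [c1 bd1] := h1; have [c2 bd2] := h2.
have [mg fg] := (CL2funE m1 g).1 gL.
have b10 : 0 < b1 by lra.
pose b := (2^-1 + Num.min b1 b2) / 2.
have mb : 2^-1 < Num.min b1 b2 by rewrite lt_min hb1.
have mb1 : Num.min b1 b2 <= b1 by rewrite ge_min lexx.
have mb2 : Num.min b1 b2 <= b2 by rewrite ge_min lexx orbT.
have bb : 2^-1 < b by rewrite /b; lra.
have b0 : 0 < b by lra.
have bb1 : b < b1 by rewrite /b; lra.
have h2' : expdec k2 M2 b by apply: expdecW h2; rewrite /b; lra.
pose F (z : T1 * T2) : C := ((arcw G1 ja1 z.1)%:C)%C * g z.1 *
   (((arcw G2 ja2 z.2)%:C)%C * (k1 (t - ta2 z.2) * k2 (ta2 z.2 - ta1 z.1))).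
have ck1 u : ccontinuous (fun s => k1 (u - s)).
  by apply: (ccontinuous_comp c1) => s; apply: cvgB; [exact: cvg_cst|exact: cvg_id].
have ck2 u : ccontinuous (fun s => k2 (s - u)).
  by apply: (ccontinuous_comp c2) => s; apply: cvgB; [exact: cvg_id|exact: cvg_cst].
have mF : cmeas F.
  apply: cmeasM.
    apply: cmeasM; last exact: (cmeas_comp mg measurable_fst).
    apply: cmeas_real; apply: measurableT_comp; last exact: measurable_fst.
    exact: (measurable_arcw hc1).
  apply: cmeasM.
    apply: cmeas_real; apply: measurableT_comp; last exact: measurable_snd.
    exact: (measurable_arcw hc2).
  apply: cmeasM; last exact: (cmeas_comp (cmeas_continuous c2) mta12).
  have mt : measurable_fun [set: T1 * T2] (fun z : T1 * T2 => ta2 z.2).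
    by apply: measurableT_comp; [exact: (chart_tau hc2)|exact: measurable_snd].
  exact: (@cmeas_comp R _ _ _ (measurableTypeR R) (fun s => k1 (t - s)) _ (cmeas_continuous (ck1 t)) mt).
(* the inner integral, for a kernel with absolute values and without *)
have inner (f1 f2 : R -> C) N1 N2 u : expdec f1 N1 b1 -> expdec f2 N2 b ->
    cintegrable m2 (fun w => ((arcw G2 ja2 w)%:C)%C * (f1 (t - ta2 w) * f2 (ta2 w - u))) /\
    cintegral m2 (fun w => ((arcw G2 ja2 w)%:C)%C * (f1 (t - ta2 w) * f2 (ta2 w - u))) =
    convol f1 f2 (t - u).
  move=> g1 g2; have [cg1 bg1] := g1; have [cg2 bg2] := g2.
  have N10 := expdec_M_ge0 g1; have N20 := expdec_M_ge0 g2.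
  have cF : ccontinuous (fun s => f1 (t - s) * f2 (s - u)).
    apply: ccontinuousM.
      by apply: (ccontinuous_comp cg1) => s; apply: cvgB; [exact: cvg_cst|exact: cvg_id].
    by apply: (ccontinuous_comp cg2) => s; apply: cvgB; [exact: cvg_id|exact: cvg_cst].
  have ch : continuous (fun s => N1 * N2 * expR (- (b1 * `|t - s|))).
    move=> s; apply: cvgM; first exact: cvg_cst.
    apply: (@continuous_comp _ _ _ (fun s => t - s) (fun v => expR (- (b1 * `|v|)))); last exact: continuous_expabs.
    by apply: cvgB; [exact: cvg_cst|exact: cvg_id].
  have ih : leb.-integrable [set: R] (fun s => (N1 * N2 * expR (- (b1 * `|t - s|)))%:E).
    have i1 : cintegrable leb (fun s => ((N1 * N2 * expR (- (b1 * `|s|)))%:C)%C).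
      by split; [exact: integrable_expabs|exact: integrable0].
    by have [[]] := cintegral_reflect t i1.
  have bd s : normc (f1 (t - s) * f2 (s - u)) <= N1 * N2 * expR (- (b1 * `|t - s|)).
    rewrite normcM mulrAC ler_pM ?normc_ge0// (le_trans (bg2 _))// ler_piMr//.
    by rewrite -expR0 ler_expR oppr_le0 mulr_ge0// ltW.
  have [i e] := arcw_cintegral hc2 cF ch ih bd; split => //; rewrite e.
  have ic := convol_integrable g1 g2 b0 bb1 (t - u).
  have [_ ea] := cintegral_affine (- u) ltr01 ic.
  rewrite invr1 mul1r in ea; rewrite /convol -ea; apply: cintegral_ext => s.
  by rewrite mul1r opprB addrA subrK.
have habs (f : R -> C) N a : expdec f N a -> expdec (fun s => ((normc (f s))%:C)%C) N a.
  move=> [cf bf]; split; last by move=> s; rewrite normc_real ger0_norm ?normc_ge0.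
  apply: ccontinuous_real => s.
  have : (fun s => normc (f s)) = (fun s => Num.sqrt (Re (f s) ^+ 2 + Im (f s) ^+ 2)).
    by apply/funext => v; rewrite normc_sqrtE.
  move=> ->; apply: (@continuous_comp _ _ _ (fun s => Re (f s) ^+ 2 + Im (f s) ^+ 2) Num.sqrt); last exact: sqrt_continuous.
  have [f1 f2] := cf.
  by apply: cvgD; rewrite /=; under eq_fun do rewrite expr2; apply: cvgM; [exact: f1|exact: f1|exact: f2|exact: f2].
have fin : (\int[m1]_y \int[m2]_w (normc (F (y, w)))%:E < +oo)%E.
  pose N := M1 * M2 * (2 / (b1 - b)).
  pose q (s : R) : C := ((expR (- (b * `|s|)))%:C)%C.
  have hq : expdec q 1 b.
    split; first by apply: ccontinuous_real => s; exact: continuous_expabs.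
    by move=> s; rewrite normc_real ger0_norm ?expR_ge0// mul1r.
  have iq := cintegrable_normc (arcT_integrable hc1 hq bb t gL).
  have iNq : m1.-integrable [set: T1] (fun y => (N * normc (((arcw G1 ja1 y)%:C)%C * q (t - ta1 y) * g y))%:E).
    by under eq_fun do rewrite EFinM; apply: integrableZl.
  have /integrableP[mNq] := iNq; apply: le_lt_trans.
  apply: ge0_le_integral => //.
  - by move=> y _; apply: integral_ge0 => w _; rewrite lee_fin normc_ge0.
  - apply: (@measurable_fun_fubini_tonelli_F _ _ T1 T2 R m2 (fun z => (normc (F z))%:E)).
      by apply/measurable_EFinP; exact: cmeas_normc.
    by move=> z; rewrite lee_fin normc_ge0.
  - exact: measurableT_comp.
  move=> y _; rewrite [leRHS]gee0_abs; last first.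
    by rewrite lee_fin mulr_ge0 ?normc_ge0// !mulr_ge0 ?(expdec_M_ge0 h1) ?(expdec_M_ge0 h2)// invr_ge0 subr_ge0 ltW.
  have [i e] := inner _ _ _ _ (ta1 y) (habs _ _ _ h1) (habs _ _ _ h2').
  have Fy w : normc (F (y, w)) = arcw G1 ja1 y * normc (g y) *
     (arcw G2 ja2 w * (normc (k1 (t - ta2 w)) * normc (k2 (ta2 w - ta1 y)))).
    rewrite /F [(y, w).1]/= [(y, w).2]/= normcM [normc (_ * g y)]normcM.
    rewrite [normc (_ * (k1 _ * k2 _))]normcM [normc (k1 _ * k2 _)]normcM !normc_real.
    by rewrite [`|arcw G1 _ _|]ger0_norm ?(arcw_ge0 hc1)// [`|arcw G2 _ _|]ger0_norm ?(arcw_ge0 hc2).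
  have ir : m2.-integrable [set: T2] (fun w => (arcw G2 ja2 w * (normc (k1 (t - ta2 w)) * normc (k2 (ta2 w - ta1 y))))%:E).
    have [ir _] := i; move: ir; congr (_.-integrable _ _); apply/funext => w.
    by rewrite -!real_C_M.
  have -> : (\int[m2]_w (normc (F (y, w)))%:E = (arcw G1 ja1 y * normc (g y) *
     \int[m2]_w (arcw G2 ja2 w * (normc (k1 (t - ta2 w)) * normc (k2 (ta2 w - ta1 y)))))%:E)%E.
    under eq_integral do rewrite Fy EFinM.
    rewrite integralZl// [RHS]EFinM; congr (_ * _)%E.
    by rewrite /Rintegral fineK//; exact: integrable_fin_num ir.
  rewrite lee_fin normcM [normc (_ * q _)]normcM !normc_real.
  rewrite [`|arcw G1 _ _|]ger0_norm ?(arcw_ge0 hc1)// [`|expR _|]ger0_norm ?expR_ge0//.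
  have -> : N * (arcw G1 ja1 y * expR (- (b * `|t - ta1 y|)) * normc (g y)) =
     arcw G1 ja1 y * normc (g y) * (N * expR (- (b * `|t - ta1 y|))) by ring.
  apply: ler_wpM2l; first by rewrite mulr_ge0 ?(arcw_ge0 hc1) ?normc_ge0.
  have bd := convol_le (habs _ _ _ h1) (habs _ _ _ h2') b0 bb1 (t - ta1 y).
  apply: le_trans bd; rewrite -e; apply: le_trans (Re_le_normc _); rewrite /cintegral [complex.Re _]/=.
  apply: le_trans (ler_norm _); rewrite le_eqVlt; apply/orP; left; apply/eqP.
  by apply: eq_Rintegral => w _; ring.
have e := cFubini mF fin.
transitivity (cintegral m2 (fun w => cintegral m1 (fun y => F (y, w)))).
  apply: cintegral_ext => w; rewrite /arcR /arcw indicE.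
  case: (boolP (w \in G2)) => wG; last first.
    rewrite mul0r !mul0r /F /= -[LHS](cintegral0 m1); apply: cintegral_ext => y.
    by rewrite /arcw [\1_G2 w]indicE (negbTE wG) !mul0r mulr0.
  rewrite /arcT -cintegralZ; last exact: (arcT_integrable hc1 h2 hb2 _ gL).
  apply: cintegral_ext => y; rewrite /F /= /arcw [\1_G2 w]indicE wG.
  by move: (k1 _) (k2 _) (_%:C)%C (_%:C)%C => u v a a'; ring.
rewrite -e; apply: cintegral_ext => y; rewrite /F /=.
have [i ei] := inner _ _ _ _ (ta1 y) h1 h2'.
rewrite cintegralZ; last exact: i.
by rewrite ei mulrAC.
Qed.

End TwoArcs.

(** * From operators on functions to operators on classes *)

Section Lift.
Context d1 (T1 : measurableType d1) d2 (T2 : measurableType d2) (R : realType).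
Variables (m1 : {measure set T1 -> \bar R}) (m2 : {measure set T2 -> \bar R}).
Local Notation C := R[i].
Local Open Scope quotient_scope.

(** Operators on functions that induce bounded operators between L^2 spaces. *)
Record L2op (F : (T1 -> C) -> (T2 -> C)) : Prop := MkL2op {
  L2op_lin : forall (a : C) f g, f \in CL2fun m1 -> g \in CL2fun m1 ->
    F (a *: f + g) = a *: F f + F g ;
  L2op_ae : forall f g, f \in CL2fun m1 -> g \in CL2fun m1 ->
    (\forall y \ae m1, f y = g y) -> F f = F g ;
  L2op_cmeas : forall f, f \in CL2fun m1 -> cmeas (F f) ;
  L2op_bounded : exists2 K : R, 0 <= K & forall f, f \in CL2fun m1 ->
    (\int[m2]_w (normc (F f w) ^+ 2)%:E <= K%:E * \int[m1]_y (normc (f y) ^+ 2)%:E)%E }.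

Lemma CL2class_pi d (T : measurableType d) (m : {measure set T -> \bar R}) (f : T -> C) (h : f \in CL2fun m) :
  CL2class m f = \pi_(CL2 m) (CL2Rep h).
Proof. by rewrite /CL2class; congr (\pi_(CL2 m) _); apply: val_inj; rewrite insubdK. Qed.

Lemma CL2class_ae d (T : measurableType d) (m : {measure set T -> \bar R}) (f g : T -> C) :
  f \in CL2fun m -> g \in CL2fun m ->
  CL2class m f = CL2class m g <-> \forall y \ae m, f y = g y.
Proof. by move=> hf hg; rewrite (CL2class_pi hf) (CL2class_pi hg); exact: CL2_piP. Qed.

Lemma CL2class_lin d (T : measurableType d) (m : {measure set T -> \bar R}) (a : C) (f g : T -> C) :
  f \in CL2fun m -> g \in CL2fun m ->
  CL2class m (a *: f + g) = a *: CL2class m f + CL2class m g.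
Proof.
move=> hf hg; have h : a *: f + g \in CL2fun m by rewrite rpredD// rpredZ.
rewrite (CL2class_pi h) (CL2class_pi hf) (CL2class_pi hg).
have -> : CL2Rep h = a *: CL2Rep hf + CL2Rep hg by apply: val_inj.
rewrite raddfD; congr (_ + _).
apply/CL2_piP; have := CL2_repr_pi (CL2Rep hf); apply: filterS => x fx.
by rewrite /= -[LHS]/(a *: CL2val (CL2Rep hf) x) -fx.
Qed.

Lemma normr_CL2class d (T : measurableType d) (m : {measure set T -> \bar R}) (f : T -> C) :
  f \in CL2fun m -> `|CL2class m f| = ((CL2norm m f)%:C)%C.
Proof. by move=> h; rewrite (CL2class_pi h); exact: CL2normc_pi. Qed.

Lemma repr_CL2fun d (T : measurableType d) (m : {measure set T -> \bar R}) (u : CL2 m) :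
  CL2val (repr u) \in CL2fun m.
Proof. exact: valP. Qed.

Lemma CL2class_repr d (T : measurableType d) (m : {measure set T -> \bar R}) (u : CL2 m) :
  CL2class m (repr u) = u.
Proof.
rewrite (CL2class_pi (repr_CL2fun u)) -[RHS]reprK; congr (\pi_(CL2 m) _).
exact: val_inj.
Qed.

Lemma repr_CL2class d (T : measurableType d) (m : {measure set T -> \bar R}) (f : T -> C) :
  f \in CL2fun m -> \forall y \ae m, CL2val (repr (CL2class m f)) y = f y.
Proof. by move=> h; rewrite (CL2class_pi h); exact: CL2_repr_pi. Qed.

(** The representative is arbitrary; [L2op_ae] makes the result independent of
    it. *)
Definition L2lift F (u : CL2 m1) : CL2 m2 := CL2class m2 (F (repr u)).

Lemma L2op_CL2fun F f : L2op F -> f \in CL2fun m1 -> F f \in CL2fun m2.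
Proof.
move=> hF hf; apply/CL2funE; split; first exact: (L2op_cmeas hF hf).
have [K K0 hK] := L2op_bounded hF; apply: (le_lt_trans (hK _ hf)).
have /CL2funE[_ h] := hf; apply: lte_mul_pinfty => //.
Qed.

Lemma L2lift_class F f : L2op F -> f \in CL2fun m1 ->
  L2lift F (CL2class m1 f) = CL2class m2 (F f).
Proof.
move=> hF hf; congr (CL2class m2 _); apply: (L2op_ae hF) => //.
  exact: repr_CL2fun.
exact: repr_CL2class.
Qed.

Lemma L2lift_lin F (a : C) u v : L2op F -> L2lift F (a *: u + v) = a *: L2lift F u + L2lift F v.
Proof.
move=> hF; rewrite -[u in LHS]CL2class_repr -[v in LHS]CL2class_repr.
have hu := repr_CL2fun u; have hv := repr_CL2fun v.
rewrite -CL2class_lin// (L2lift_class hF); last by rewrite rpredD// rpredZ.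
rewrite (L2op_lin hF)// CL2class_lin//; exact: L2op_CL2fun.
Qed.

Lemma L2lift_bounded F : L2op F -> exists2 K : R, 0 <= K &
  forall u, `|L2lift F u| <= (K%:C)%C * `|u|.
Proof.
move=> hF; have [K K0 hK] := L2op_bounded hF; exists (Num.sqrt K); first exact: sqrtr_ge0.
move=> u; rewrite -{2}[u]CL2class_repr /L2lift.
have hu := repr_CL2fun u; have hFu := L2op_CL2fun hF hu.
rewrite !normr_CL2class// -real_C_M lecR.
rewrite -(ler_pXn2r (n := 2)) ?nnegrE ?mulr_ge0 ?sqrtr_ge0 ?CL2norm_ge0//.
rewrite exprMn sqr_sqrtr// -lee_fin (EFinM K) (CL2norm_sqr hFu) (CL2norm_sqr hu).
exact: hK.
Qed.

Lemma L2opD F1 F2 : L2op F1 -> L2op F2 -> L2op (fun f => F1 f + F2 f).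
Proof.
move=> h1 h2; split.
- by move=> a f g hf hg; rewrite (L2op_lin h1)// (L2op_lin h2)// scalerDr addrACA.
- by move=> f g hf hg fg; rewrite (L2op_ae h1 hf hg fg) (L2op_ae h2 hf hg fg).
- by move=> f hf; apply: cmeasD; [exact: (L2op_cmeas h1 hf)|exact: (L2op_cmeas h2 hf)].
have [K1 K10 hK1] := L2op_bounded h1; have [K2 K20 hK2] := L2op_bounded h2.
exists (2 * K1 + 2 * K2); first by rewrite addr_ge0// mulr_ge0.
move=> f hf.
have m1' : measurable_fun [set: T2] (fun w => normc (F1 f w) ^+ 2).
  by apply: measurable_funX; apply: cmeas_normc; exact: (L2op_cmeas h1 hf).
have m2' : measurable_fun [set: T2] (fun w => normc (F2 f w) ^+ 2).
  by apply: measurable_funX; apply: cmeas_normc; exact: (L2op_cmeas h2 hf).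
apply: (@le_trans _ _ (\int[m2]_w ((2 * normc (F1 f w) ^+ 2)%:E + (2 * normc (F2 f w) ^+ 2)%:E))%E).
  apply: ge0_le_integral => //.
  - by move=> w _; rewrite lee_fin sqr_ge0.
  - apply/measurable_EFinP; apply: measurable_funX; apply: cmeas_normc.
    by apply: cmeasD; [exact: (L2op_cmeas h1 hf)|exact: (L2op_cmeas h2 hf)].
  - by apply: emeasurable_funD; apply/measurable_EFinP; apply: measurable_funM => //; exact: measurable_cst.
  move=> w _; rewrite -EFinD lee_fin.
  have h := normcD (F1 f w) (F2 f w).
  have n1 := normc_ge0 (F1 f w); have n2 := normc_ge0 (F2 f w).
  apply: (@le_trans _ _ ((normc (F1 f w) + normc (F2 f w)) ^+ 2)).
    by rewrite lerXn2r ?nnegrE ?normc_ge0// addr_ge0.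
  have := sqr_ge0 (normc (F1 f w) - normc (F2 f w)).
  rewrite sqrrB sqrrD; move: (_ ^+ 2) (_ ^+ 2) (_ * _) => a b c; lra.
rewrite ge0_integralD//; last 4 first.
- by move=> w _; rewrite lee_fin mulr_ge0// sqr_ge0.
- by apply/measurable_EFinP; apply: measurable_funM => //; exact: measurable_cst.
- by move=> w _; rewrite lee_fin mulr_ge0// sqr_ge0.
- by apply/measurable_EFinP; apply: measurable_funM => //; exact: measurable_cst.
under eq_integral do rewrite EFinM.
under [X in (_ + X)%E]eq_integral do rewrite EFinM.
rewrite !ge0_integralZl//; try exact/measurable_EFinP; try by move=> w _; rewrite lee_fin sqr_ge0.
rewrite (EFinD (2 * K1)) ge0_muleDl ?lee_fin ?mulr_ge0//; apply: leeD.
  by rewrite (EFinM 2) -muleA; apply: lee_wpmul2l; [rewrite lee_fin|exact: hK1].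
by rewrite (EFinM 2) -muleA; apply: lee_wpmul2l; [rewrite lee_fin|exact: hK2].
Qed.

End Lift.

Section ArcRestrict.
Context d1 (T1 : measurableType d1) d2 (T2 : measurableType d2) (R : realType).
Variables (m1 : {finite_measure set T1 -> \bar R}) (m2 : {finite_measure set T2 -> \bar R}).
Local Notation C := R[i].
Variables (G1 : set T1) (ta1 ja1 : T1 -> R) (K1 : R) (hc1 : arc_chart m1 G1 ta1 ja1 K1).
Variables (G2 : set T2) (ta2 ja2 : T2 -> R) (K2 : R) (hc2 : arc_chart m2 G2 ta2 ja2 K2).

Lemma arcT_lin k M b (a : C) f g t : expdec k M b -> 2^-1 < b ->
  f \in CL2fun m1 -> g \in CL2fun m1 ->
  arcT m1 G1 ta1 ja1 k (a *: f + g) t = a * arcT m1 G1 ta1 ja1 k f t + arcT m1 G1 ta1 ja1 k g t.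
Proof.
move=> hk b2 hf hg; have i1 := arcT_integrable hc1 hk b2 t hf.
have i2 := arcT_integrable hc1 hk b2 t hg.
rewrite /arcT -cintegralZ// -cintegralD//; last exact: cintegrableZ.
apply: cintegral_ext => y.
have -> : (a *: f + g) y = a * f y + g y by [].
by move: (f y) (g y) (k _) (_%:C)%C => u v w z; ring.
Qed.

Lemma arcT_ae k f g t : ccontinuous k -> cmeas f -> cmeas g ->
  (\forall y \ae m1, ((\1_G1 y : R)%:C)%C * f y = ((\1_G1 y : R)%:C)%C * g y) ->
  arcT m1 G1 ta1 ja1 k f t = arcT m1 G1 ta1 ja1 k g t.
Proof.
move=> ck mf mg fg.
have mk : cmeas (fun y => ((arcw G1 ja1 y)%:C)%C * k (t - ta1 y)).
  apply: cmeasM; first by apply: cmeas_real; exact: (measurable_arcw hc1).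
  apply: (cmeas_comp_tau hc1 (F := fun s => k (t - s))).
  by apply: (ccontinuous_comp ck) => u; apply: cvgB; [exact: cvg_cst|exact: cvg_id].
apply: cintegral_ae; [exact: cmeasM|exact: cmeasM|].
move: fg; apply: filterS => y e; rewrite /arcw real_C_M.
have alg (i j q v : C) : i * j * q * v = j * q * (i * v) by ring.
by rewrite alg e -alg.
Qed.

Lemma arcR_L2op k M b : expdec k M b -> 2^-1 < b ->
  L2op m1 m2 (@arcR _ T1 _ T2 R m1 G1 ta1 ja1 G2 ta2 k).
Proof.
move=> hk b2; have [ck _] := hk; split.
- move=> a f g hf hg; apply/funext => w; rewrite /arcR.
  have -> : (a *: (fun w => if w \in G2 then arcT m1 G1 ta1 ja1 k f (ta2 w) else 0) +
     (fun w => if w \in G2 then arcT m1 G1 ta1 ja1 k g (ta2 w) else 0)) w =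
     a * (if w \in G2 then arcT m1 G1 ta1 ja1 k f (ta2 w) else 0) + (if w \in G2 then arcT m1 G1 ta1 ja1 k g (ta2 w) else 0) by [].
  by case: ifP => _; [exact: (arcT_lin a _ hk b2 hf hg)|rewrite mulr0 addr0].
- move=> f g /CL2funE[mf _] /CL2funE[mg _] fg; apply/funext => w; rewrite /arcR.
  case: ifP => // _; apply: arcT_ae => //.
  by apply: filterS fg => y ->.
- by move=> f /CL2funE[mf _]; exact: (cmeas_arcR hc1 hc2).
exists (M ^+ 2 * (2 * `|K1| / (b - 2^-1)) * `|K2| * (2 / (b - 2^-1))).
  have c0 : 0 < b - 2^-1 by rewrite subr_gt0.
  apply: mulr_ge0; last by rewrite divr_ge0// ltW.
  apply: mulr_ge0 => //; apply: mulr_ge0; first exact: sqr_ge0.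
  by rewrite divr_ge0 ?mulr_ge0// ltW.
move=> f hf; exact: (arcR_sqr_integral hc1 hc2 hk b2 hf).
Qed.

End ArcRestrict.

(** * Two crossing circles *)

Section Frame.
Variable R : realType.
Implicit Types (m u v y : R * R) (ec es c l r t : R).

(** The plane in an orthonormal frame of origin [m]. *)
Definition fr m ec es u : R * R :=
  (m.1 + u.1 * ec - u.2 * es, m.2 + u.1 * es + u.2 * ec).

Lemma edist_fr m ec es u v : ec ^+ 2 + es ^+ 2 = 1 ->
  edist (fr m ec es u) (fr m ec es v) = edist u v.
Proof.
move=> e; rewrite /edist /fr /=; congr Num.sqrt.
by rewrite -[RHS]mul1r -[X in _ = X * _]e; ring.
Qed.

Lemma fr_surj m ec es y : ec ^+ 2 + es ^+ 2 = 1 -> exists u, fr m ec es u = y.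
Proof.
move=> e; exists ((y.1 - m.1) * ec + (y.2 - m.2) * es, - (y.1 - m.1) * es + (y.2 - m.2) * ec).
rewrite /fr /=; case: y => y1 y2 /=; congr pair.
  have -> : m.1 + ((y1 - m.1) * ec + (y2 - m.2) * es) * ec - (- (y1 - m.1) * es + (y2 - m.2) * ec) * es = m.1 + (y1 - m.1) * (ec ^+ 2 + es ^+ 2) by ring.
  by rewrite e; ring.
have -> : m.2 + ((y1 - m.1) * ec + (y2 - m.2) * es) * es + (- (y1 - m.1) * es + (y2 - m.2) * ec) * ec = m.2 + (y2 - m.2) * (ec ^+ 2 + es ^+ 2) by ring.
by rewrite e; ring.
Qed.

Lemma edist_sqr u v : edist u v ^+ 2 = (u.1 - v.1) ^+ 2 + (u.2 - v.2) ^+ 2.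
Proof. by rewrite /edist sqr_sqrtr// addr_ge0 ?sqr_ge0. Qed.

(** Two circles through the points of coordinates [(0, l)] and [(0, -l)], with
    centers [(-c1, 0)] and [(c2, 0)]. *)
Record conf (x1 : R * R) (r1 : R) (x2 : R * R) (r2 : R) m ec es (c1 c2 l : R) : Prop := Conf {
  conf_unit : ec ^+ 2 + es ^+ 2 = 1 ;
  conf_l : 0 < l ;
  conf_c : 0 < c1 + c2 ;
  conf_r1 : 0 < r1 ;
  conf_r2 : 0 < r2 ;
  conf_r1E : r1 ^+ 2 = c1 ^+ 2 + l ^+ 2 ;
  conf_r2E : r2 ^+ 2 = c2 ^+ 2 + l ^+ 2 ;
  conf_x1 : x1 = fr m ec es (- c1, 0) ;
  conf_x2 : x2 = fr m ec es (c2, 0) }.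

Lemma frN m ec es u : fr m (- ec) (- es) u = fr m ec es (- u.1, - u.2).
Proof. by rewrite /fr /=; congr pair; ring. Qed.

Lemma conf_sym x1 r1 x2 r2 m ec es (c1 c2 l : R) : conf x1 r1 x2 r2 m ec es c1 c2 l ->
  conf x2 r2 x1 r1 m (- ec) (- es) c2 c1 l.
Proof.
move=> [h1 h2 h3 h4 h5 h6 h7 h8 h9]; split => //.
- by rewrite !sqrrN.
- by rewrite addrC.
- by rewrite frN /= opprK oppr0.
- by rewrite frN /= oppr0.
Qed.

(** The origin of the frame is the foot of the radical axis on the line of the
    centers, and [l^2] is minus its power, a multiple of a product of four factors
    which are positive because the circles cross. *)
Lemma two_disks_conf (x1 x2 : R * R) (r1 r2 : R) : 0 < r1 -> 0 < r2 ->
  disk x1 r1 `&` disk x2 r2 !=set0 ->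
  ~ disk x1 r1 `<=` disk x2 r2 -> ~ disk x2 r2 `<=` disk x1 r1 ->
  exists m ec es c1 c2 l, conf x1 r1 x2 r2 m ec es c1 c2 l.
Proof.
move=> r10 r20 [z [z1 z2]] n12 n21; rewrite /disk/= in z1 z2.
pose d := edist x1 x2.
have d1 : d < r1 + r2 by have := eucl_triangle z x1 x2; rewrite -/d; lra.
have sub (a b : R * R) (ra rb : R) : edist a b + ra <= rb -> disk a ra `<=` disk b rb.
  move=> h y; rewrite /disk/= => ya; have := eucl_triangle a y b.
  by rewrite [edist a y]euclC; lra.
have d2 : r2 - r1 < d.
  by rewrite ltNge; apply/negP => h; apply: n12; apply: sub; rewrite -/d; lra.
have d3 : r1 - r2 < d.
  by rewrite ltNge; apply/negP => h; apply: n21; apply: sub; rewrite euclC -/d; lra.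
have d0 : 0 < d by lra.
have dn : d != 0 by rewrite gt_eqF.
have dE : (x2.1 - x1.1) ^+ 2 + (x2.2 - x1.2) ^+ 2 = d ^+ 2 by rewrite /d euclC edist_sqr.
pose ec := (x2.1 - x1.1) / d; pose es := (x2.2 - x1.2) / d.
pose c1 := (d ^+ 2 + r1 ^+ 2 - r2 ^+ 2) / (2 * d).
pose c2 := (d ^+ 2 + r2 ^+ 2 - r1 ^+ 2) / (2 * d).
have l2 : 0 < r1 ^+ 2 - c1 ^+ 2.
  have -> : r1 ^+ 2 - c1 ^+ 2 = ((d + r1 - r2) * (d + r1 + r2) * ((r2 - d + r1) * (r2 + d - r1))) / (2 * d) ^+ 2.
    by rewrite /c1; move: (d) dn => q qn; field.
  by rewrite divr_gt0 ?exprn_gt0 ?mulr_gt0//; lra.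
pose l := Num.sqrt (r1 ^+ 2 - c1 ^+ 2).
have lE : l ^+ 2 = r1 ^+ 2 - c1 ^+ 2 by rewrite sqr_sqrtr// ltW.
have c12 : c1 + c2 = d by rewrite /c1 /c2; move: (d) dn => q qn; field.
have c2E : c2 ^+ 2 - c1 ^+ 2 = r2 ^+ 2 - r1 ^+ 2.
  by rewrite /c1 /c2; move: (d) dn => q qn; field.
exists (x1.1 + c1 * ec, x1.2 + c1 * es), ec, es, c1, c2, l; split => //.
- by rewrite /ec /es !expr_div_n -mulrDl dE divff// expf_neq0.
- by rewrite sqrtr_gt0.
- by rewrite c12.
- by rewrite lE; ring.
- by rewrite lE; move: c2E; lra.
- by rewrite /fr /=; case: (x1) => a b /=; congr pair; ring.
- have ecE : x2.1 = x1.1 + d * ec by rewrite /ec; move: (d) dn => q qn; field.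
  have esE : x2.2 = x1.2 + d * es by rewrite /es; move: (d) dn => q qn; field.
  rewrite [LHS]surjective_pairing ecE esE -c12 /fr /=; congr pair; ring.
Qed.

Section Conf.
Variables (x1 x2 : R * R) (r1 r2 : R) (m : R * R) (ec es c1 c2 l : R).
Hypothesis hc : conf x1 r1 x2 r2 m ec es c1 c2 l.
Local Notation F := (fr m ec es).
Local Notation P := (F (0, l)).
Local Notation Q := (F (0, - l)).

Let e2 := conf_unit hc.

Lemma sqr_eqP (a b : R) : 0 <= a -> 0 <= b -> a ^+ 2 = b ^+ 2 <-> a = b.
Proof.
move=> a0 b0; split => [/eqP|->//].
by rewrite eqrXn2// => /eqP.
Qed.

Lemma circle1P u : edist (F u) x1 = r1 <-> u.1 ^+ 2 + u.2 ^+ 2 + 2 * c1 * u.1 = l ^+ 2.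
Proof.
rewrite -sqr_eqP ?eucl_ge0 ?(ltW (conf_r1 hc))// (conf_x1 hc) edist_fr// edist_sqr/= (conf_r1E hc).
by split; lra.
Qed.

Lemma circle2P u : edist (F u) x2 = r2 <-> u.1 ^+ 2 + u.2 ^+ 2 - 2 * c2 * u.1 = l ^+ 2.
Proof.
rewrite -sqr_eqP ?eucl_ge0 ?(ltW (conf_r2 hc))// (conf_x2 hc) edist_fr// edist_sqr/= (conf_r2E hc).
by split; lra.
Qed.

Lemma power1 u : u.1 ^+ 2 + u.2 ^+ 2 - 2 * c2 * u.1 = l ^+ 2 ->
  r1 ^+ 2 - edist (F u) x1 ^+ 2 = - (2 * (c1 + c2) * u.1).
Proof.
move=> h; rewrite (conf_x1 hc) edist_fr// edist_sqr/= (conf_r1E hc); lra.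
Qed.

Lemma power2 u : u.1 ^+ 2 + u.2 ^+ 2 + 2 * c1 * u.1 = l ^+ 2 ->
  r2 ^+ 2 - edist (F u) x2 ^+ 2 = 2 * (c1 + c2) * u.1.
Proof.
move=> h; rewrite (conf_x2 hc) edist_fr// edist_sqr/= (conf_r2E hc); lra.
Qed.

Lemma lt_sqr_eucl (y p : R * R) (r : R) : 0 < r -> (edist y p < r) = (0 < r ^+ 2 - edist y p ^+ 2).
Proof. by move=> r0; rewrite subr_gt0 ltr_pXn2r ?nnegrE ?eucl_ge0 ?(ltW r0). Qed.

Lemma gt_sqr_eucl (y p : R * R) (r : R) : 0 < r -> (r < edist y p) = (r ^+ 2 - edist y p ^+ 2 < 0).
Proof. by move=> r0; rewrite subr_lt0 ltr_pXn2r ?nnegrE ?eucl_ge0 ?(ltW r0). Qed.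

Lemma inside2 u : edist (F u) x1 = r1 -> (edist (F u) x2 < r2) = (0 < u.1).
Proof.
move=> /circle1P h; rewrite (lt_sqr_eucl _ _ (conf_r2 hc)) power2// pmulr_rgt0//.
by rewrite mulr_gt0// (conf_c hc).
Qed.

Lemma outside2 u : edist (F u) x1 = r1 -> (r2 < edist (F u) x2) = (u.1 < 0).
Proof.
move=> /circle1P h; rewrite (gt_sqr_eucl _ _ (conf_r2 hc)) power2// pmulr_rlt0//.
by rewrite mulr_gt0// (conf_c hc).
Qed.

Lemma inside1 u : edist (F u) x2 = r2 -> (edist (F u) x1 < r1) = (u.1 < 0).
Proof.
move=> /circle2P h; rewrite (lt_sqr_eucl _ _ (conf_r1 hc)) power1// oppr_gt0 pmulr_rlt0//.
by rewrite mulr_gt0// (conf_c hc).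
Qed.

(** The difference of the equations of the circles is [u.1 = 0]. *)
Lemma common_points y : edist y x1 = r1 -> edist y x2 = r2 -> y = P \/ y = Q.
Proof.
have [u <-] := fr_surj m y e2; move=> /circle1P h1 /circle2P h2.
have u1 : u.1 = 0.
  have : (c1 + c2) * u.1 = 0 by lra.
  by move/eqP; rewrite mulf_eq0 gt_eqF ?(conf_c hc)//= => /eqP.
move: h1; rewrite u1 expr0n/= add0r mulr0 addr0 => /eqP.
rewrite eqf_sqr => /orP[] /eqP u2; [left|right].
  by congr F; rewrite -u1 -u2 -surjective_pairing.
by congr F; rewrite -u1 -u2 -surjective_pairing.
Qed.

Lemma edist_PQ : edist P Q = 2 * l.
Proof.
rewrite edist_fr// /edist /= (_ : _ + _ = (2 * l) ^+ 2); last by ring.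
by rewrite sqrtr_sqr gtr0_norm// mulr_gt0// (conf_l hc).
Qed.

(** The product of the distances to the poles is proportional to the distance
    to the line through them (area of a triangle and its circumradius). *)
Lemma edist_poles_mul (c r : R) u : 0 < r -> r ^+ 2 = c ^+ 2 + l ^+ 2 ->
  u.1 ^+ 2 + u.2 ^+ 2 + 2 * c * u.1 = l ^+ 2 ->
  edist (F u) P * edist (F u) Q = 2 * r * `|u.1|.
Proof.
move=> r0 rE h; rewrite !edist_fr// /edist -sqrtrM ?addr_ge0 ?sqr_ge0//.
transitivity (Num.sqrt ((2 * r * u.1) ^+ 2)); last first.
  by rewrite sqrtr_sqr normrM [`|2 * r|]gtr0_norm// mulr_gt0.
congr Num.sqrt => /=.
have -> : (2 * r * u.1) ^+ 2 = 4 * (c ^+ 2 + l ^+ 2) * u.1 ^+ 2 by rewrite -rE; ring.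
have -> : (u.1 - 0) ^+ 2 + (u.2 - l) ^+ 2 = 2 * l ^+ 2 - 2 * c * u.1 - 2 * l * u.2 by lra.
have -> : (u.1 - 0) ^+ 2 + (u.2 - - l) ^+ 2 = 2 * l ^+ 2 - 2 * c * u.1 + 2 * l * u.2 by lra.
have hu : u.2 ^+ 2 = l ^+ 2 - 2 * c * u.1 - u.1 ^+ 2 by lra.
transitivity ((2 * l ^+ 2 - 2 * c * u.1) ^+ 2 - 4 * l ^+ 2 * u.2 ^+ 2); first by ring.
by rewrite hu; ring.
Qed.

Lemma conf_r12 : 0 < r1 * r2. Proof. by rewrite mulr_gt0 ?(conf_r1 hc) ?(conf_r2 hc). Qed.

Section kernel.
Variable th : R.
Hypotheses (cth : cos th = (l ^+ 2 - c1 * c2) / (r1 * r2))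
           (sth : sin th = l * (c1 + c2) / (r1 * r2)).

(** With [k = th] on the interior arc and [k = pi - th] on the exterior one, this
    is the Poisson kernel of the disk in bipolar coordinates.  The numerators are
    proportional to products of distances to the poles ([edist_poles_mul]), and the law of
    cosines identifies the denominators. *)
Lemma poisson_kernel (k : R) u v :
  u.1 ^+ 2 + u.2 ^+ 2 + 2 * c1 * u.1 = l ^+ 2 ->
  v.1 ^+ 2 + v.2 ^+ 2 - 2 * c2 * v.1 = l ^+ 2 ->
  v.1 < 0 -> u.1 != 0 -> sin k = sin th -> cos k * `|u.1| = cos th * u.1 ->
  (2 * pi)^-1 * ((r1 ^+ 2 - edist (F v) x1 ^+ 2) / (r1 * edist (F v) (F u) ^+ 2)) =
  stripP k (tau P Q (F v) - tau P Q (F u)) * jac P Q (F u).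
Proof.
move=> hu hv v0 u0 sk ck.
have r1n := lt0r_neq0 (conf_r1 hc); have r2n := lt0r_neq0 (conf_r2 hc).
have r10 := conf_r1 hc; have r20 := conf_r2 hc.
have l0 := conf_l hc; have lnz := lt0r_neq0 l0.
have p0 := pi_gt0 R; have pn : (pi : R) != 0 by rewrite gt_eqF.
have mu_u := edist_poles_mul r10 (conf_r1E hc) hu.
have hv' : v.1 ^+ 2 + v.2 ^+ 2 + 2 * (- c2) * v.1 = l ^+ 2 by rewrite -hv; ring.
have r2E' : r2 ^+ 2 = (- c2) ^+ 2 + l ^+ 2 by rewrite sqrrN (conf_r2E hc).
have mu_v := edist_poles_mul r20 r2E' hv'; rewrite ltr0_norm// in mu_v.
have sq a b : edist (F a) (F b) ^+ 2 = (a.1 - b.1) ^+ 2 + (a.2 - b.2) ^+ 2.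
  by rewrite edist_fr// edist_sqr.
have a2 := sq v (0, - l); have a2' := sq v (0, l).
have b2 := sq u (0, l); have b2' := sq u (0, - l); rewrite /= in a2 a2' b2 b2'.
have n2 := sq v u.
rewrite power1//.
set N := edist (F v) (F u) in n2 *.
have nn : u.1 != 0 -> 0 < `|u.1| by rewrite normr_gt0.
have u0' := nn u0.
have pos (x y : R) : 0 <= x -> 0 <= y -> 0 < x * y -> 0 < x /\ 0 < y.
  move=> x0 y0; rewrite !lt_neqAle x0 y0 !andbT eq_sym mulf_eq0 negb_or.
  by move=> /andP[/andP[hx hy] _]; rewrite ![0 == _]eq_sym.
have [b0 b0'] : 0 < edist (F u) P /\ 0 < edist (F u) Q.
  by apply: pos; rewrite ?eucl_ge0// mu_u !mulr_gt0.
have [a0' a0] : 0 < edist (F v) P /\ 0 < edist (F v) Q.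
  by apply: pos; rewrite ?eucl_ge0// mu_v !mulr_gt0// oppr_gt0.
rewrite /stripP /jac edist_PQ /tau /ch sk.
have e1 : expR (ln (edist (F v) Q) - ln (edist (F v) P) - (ln (edist (F u) Q) - ln (edist (F u) P))) =
  edist (F v) Q * edist (F u) P / (edist (F v) P * edist (F u) Q).
  rewrite !expRD !expRN expRD expRN !lnK ?posrE//; field; rewrite !gt_eqF//.
have e1' : expR (- (ln (edist (F v) Q) - ln (edist (F v) P) - (ln (edist (F u) Q) - ln (edist (F u) P)))) =
  edist (F v) P * edist (F u) Q / (edist (F v) Q * edist (F u) P).
  by rewrite expRN e1 invf_div.
rewrite e1 e1'.
move: (edist (F v) Q) (edist (F v) P) (edist (F u) Q) (edist (F u) P) a2 a2' b2 b2' a0 a0' b0 b0' mu_u mu_v {e1 e1'} =>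
  a a' b' b a2 a2' b2 b2' a0 a0' b0 b0' mu_u mu_v.
(* law of cosines for the two triangles on the chord of the poles *)
have key : (a * b) ^+ 2 + (a' * b') ^+ 2 + 2 * cos k * (a * b * (a' * b')) = 4 * l ^+ 2 * N ^+ 2.
  have -> : 2 * cos k * (a * b * (a' * b')) = 2 * cos k * ((a' * a) * (b * b')) by ring.
  rewrite mu_u mu_v.
  have -> : 2 * cos k * (2 * r2 * - v.1 * (2 * r1 * `|u.1|)) = - 8 * (r1 * r2) * v.1 * (cos k * `|u.1|) by ring.
  rewrite ck cth.
  have -> : - 8 * (r1 * r2) * v.1 * ((l ^+ 2 - c1 * c2) / (r1 * r2) * u.1) = - 8 * (l ^+ 2 - c1 * c2) * v.1 * u.1.
    by field; rewrite r1n r2n.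
  rewrite !exprMn a2 a2' b2 b2' n2.
  have -> : (v.1 - 0) ^+ 2 + (v.2 - - l) ^+ 2 = 2 * l ^+ 2 + 2 * c2 * v.1 + 2 * l * v.2 by lra.
  have -> : (v.1 - 0) ^+ 2 + (v.2 - l) ^+ 2 = 2 * l ^+ 2 + 2 * c2 * v.1 - 2 * l * v.2 by lra.
  have -> : (u.1 - 0) ^+ 2 + (u.2 - - l) ^+ 2 = 2 * l ^+ 2 - 2 * c1 * u.1 + 2 * l * u.2 by lra.
  have -> : (u.1 - 0) ^+ 2 + (u.2 - l) ^+ 2 = 2 * l ^+ 2 - 2 * c1 * u.1 - 2 * l * u.2 by lra.
  have -> : (v.1 - u.1) ^+ 2 + (v.2 - u.2) ^+ 2 = 2 * l ^+ 2 + 2 * c2 * v.1 - 2 * c1 * u.1 - 2 * (v.1 * u.1 + v.2 * u.2) by lra.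
  by ring.
have Nn : N != 0.
  apply/eqP => N0; move: n2; rewrite N0 expr0n/= => /esym/eqP.
  rewrite paddr_eq0 ?sqr_ge0// !sqrf_eq0 !subr_eq0 => /andP[/eqP e3 /eqP e4].
  move: hu; rewrite -e3 -e4 => hu; have : (c1 + c2) * v.1 = 0 by lra.
  by move/eqP; rewrite mulf_eq0 gt_eqF ?(conf_c hc)//= lt_eqF.
have an := lt0r_neq0 a0; have an' := lt0r_neq0 a0'.
have bn := lt0r_neq0 b0; have bn' := lt0r_neq0 b0'.
have Dn : (a * b) ^+ 2 + (a' * b') ^+ 2 + 2 * cos k * (a * b * (a' * b')) != 0.
  by rewrite key !mulf_neq0// expf_neq0.
have -> : sin th / (2 * pi * ((a * b / (a' * b') + a' * b' / (a * b)) / 2 + cos k)) * (2 * l / (b * b')) =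
   sin th * (a' * a) * (2 * l) / (pi * ((a * b) ^+ 2 + (a' * b') ^+ 2 + 2 * cos k * (a * b * (a' * b')))).
  move: (cos k) (sin th) (pi : R) pn Dn => q s q' pn Dn; field.
  rewrite an an' bn bn' pn !andbT/=.
  by apply: contra Dn => /eqP E; apply/eqP; rewrite -[RHS]E; ring.
rewrite key mu_v sth.
move: (pi : R) pn => q qn; field; rewrite ?r1n ?r2n ?lnz ?Nn ?qn//.
Qed.

End kernel.

End Conf.

End Frame.

(** * The Poisson integral in bipolar coordinates *)

Section FrameArc.
Variable R : realType.
Implicit Types (m x y : R * R) (ec es c l r s t : R).

Lemma fr_fst m ec es u : ec ^+ 2 + es ^+ 2 = 1 ->
  ((fr m ec es u).1 - m.1) * ec + ((fr m ec es u).2 - m.2) * es = u.1.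
Proof.
move=> e; rewrite /fr /=.
have -> : (m.1 + u.1 * ec - u.2 * es - m.1) * ec + (m.2 + u.1 * es + u.2 * ec - m.2) * es = u.1 * (ec ^+ 2 + es ^+ 2) by ring.
by rewrite e mulr1.
Qed.

Lemma cos_lt_abs s t : `|t| <= pi -> 0 <= s <= pi -> (cos s < cos t) = (`|t| < s).
Proof.
move=> ht hs; have -> : cos t = cos `|t| by case: (ger0P t) => // _; rewrite cosN.
by rewrite ltr_cos// in_itv/= normr_ge0.
Qed.

Lemma aperture c l r : 0 < l -> 0 < r -> r ^+ 2 = c ^+ 2 + l ^+ 2 ->
  exists2 s, 0 < s < pi & r * cos s = c /\ r * sin s = l.
Proof.
move=> l0 r0 rE; have rn := lt0r_neq0 r0.
have e : (c / r) ^+ 2 + (l / r) ^+ 2 = 1.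
  by rewrite !expr_div_n -mulrDl -rE divff// expf_neq0.
have [s /andP[s1 s2] [cs ss]] := polar e.
have lr : 0 < l / r by rewrite divr_gt0.
have s0 : 0 < s.
  rewrite ltNge; apply/negP => s0.
  have : 0 <= sin (- s) by apply: sin_ge0_pi; apply/andP; split; lra.
  by rewrite sinN ss; lra.
exists s; last by rewrite cs ss; split; rewrite mulrC divfK.
rewrite s0/= lt_neqAle s2 andbT; apply/eqP => sE.
by move: ss; rewrite sE sinpi => ss; move: lr; rewrite -ss ltxx.
Qed.

(** The points of a circle on one side of the chord of the poles form an arc with
    the poles as end points; the sign of [c] decides which of the two arcs is
    the longer. *)
Lemma frame_arc m x r ec es c l (G : set (R * R)) :
  ec ^+ 2 + es ^+ 2 = 1 -> 0 < l -> 0 < r -> r ^+ 2 = c ^+ 2 + l ^+ 2 ->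
  x = fr m ec es (- c, 0) ->
  (forall u, G (fr m ec es u) <-> edist (fr m ec es u) x = r /\ 0 < u.1) ->
  exists al s, [/\ 0 < s < pi, G = circle_arc x r al s,
    arcpt x r al s = fr m ec es (0, l) & arcpt x r al (- s) = fr m ec es (0, - l)].
Proof.
move=> e l0 r0 rE xE hG; have [al _ [ca sa]] := polar e.
have [s hs [cs ss]] := aperture l0 r0 rE.
have cpE t : arcpt x r al t = fr m ec es (- c + r * cos t, r * sin t).
  by rewrite /arcpt /circle_point xE /fr/= cosD sinD ca sa; congr pair; ring.
have /andP[s0 sp] := hs.
have lt t : `|t| <= pi -> (`|t| < s) = (0 < - c + r * cos t).
  move=> ht; rewrite -cos_lt_abs//; last by apply/andP; split; exact: ltW.
  by rewrite -(ltr_pM2l r0) cs addrC subr_gt0.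
exists al, s; split => //.
- apply/seteqP; split => y.
    have [u <-] := fr_surj m y e => Gy.
    have [h1 h2] := (hG u).1 Gy; have [t /andP[t1 t2] tE] := arcptP al r0 h1.
    exists t => //=; rewrite lt; last by rewrite ler_norml; apply/andP; split; lra.
    by move: h2; rewrite -(fr_fst m u e) -tE cpE fr_fst.
  move=> [t /= ts <-]; rewrite cpE; apply/hG; split.
    by rewrite -cpE; exact: edist_circle_point.
  by rewrite /= -lt//; apply: ltW; exact: lt_trans sp.
- by rewrite cpE cs ss addNr.
- by rewrite cpE cosN sinN cs mulrN ss addNr.
Qed.

Lemma frame_chart m x r ec es c l (G : set (R * R)) :
  ec ^+ 2 + es ^+ 2 = 1 -> 0 < l -> 0 < r -> r ^+ 2 = c ^+ 2 + l ^+ 2 ->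
  x = fr m ec es (- c, 0) ->
  (forall u, G (fr m ec es u) <-> edist (fr m ec es u) x = r /\ 0 < u.1) ->
  exists K, arc_chart (circle_measure x r) G
    (tau (fr m ec es (0, l)) (fr m ec es (0, - l)))
    (jac (fr m ec es (0, l)) (fr m ec es (0, - l))) K.
Proof.
move=> e l0 r0 rE xE hG; have [al [s [hs -> <- <-]]] := frame_arc e l0 r0 rE xE hG.
exact: circle_arc_chart.
Qed.

Lemma circle_ae_neq x r (p : R * R) : 0 < r -> \forall y \ae circle_measure x r, y <> p.
Proof.
move=> r0; have [pr|pr] := pselect (edist p x = r); last first.
  by have [A [mA A0 hA]] := circle_boundary_ae x r0 0; exists A; split => // y /= /contrapT yp; apply: hA => /=; rewrite yp.
have [t ht tE] := arcptP 0 r0 pr.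
have E : arcpt x r 0 @^-1` [set p] `&` `]- pi, pi]%classic = [set t].
  apply/seteqP; split => u /=.
    move=> [h]; rewrite in_itv/= => hu.
    have e : arcpt x r 0 u = arcpt x r 0 t by rewrite [RHS]tE.
    exact: (arcpt_inj r0 hu ht e).
  by move=> ->; rewrite in_itv/=.
exists [set p]; split.
- by apply: (circle_measurable r0 (al := 0)); rewrite E; exact: measurable_set1.
- rewrite (@circle_measureE R x r r0 0) E.
  change ((r%:E * @lebesgue_measure R [set t] = 0)%E).
  by rewrite lebesgue_measure_set1 mule0.
- by move=> y /= /contrapT.
Qed.

End FrameArc.

Section ConfCharts.
Variable R : realType.
Variables (x1 x2 : R * R) (r1 r2 : R) (m : R * R) (ec es c1 c2 l : R).
Hypothesis hc : conf x1 r1 x2 r2 m ec es c1 c2 l.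
Local Notation F := (fr m ec es).
Local Notation P := (F (0, l)).
Local Notation Q := (F (0, - l)).
Local Notation ta := (tau P Q).
Local Notation ja := (jac P Q).
Local Notation GI := (Gamma_int (disk x1 r1) (disk x2 r2)).
Local Notation GE := [set y | edist y x1 = r1 /\ r2 < edist y x2].
Variable r1_gt0 : 0 < r1.
Local Notation mu := (circle_fmeasure x1 r1_gt0).

Lemma GI_chart : exists K, arc_chart (circle_measure x1 r1) GI ta ja K.
Proof.
apply: (frame_chart (conf_unit hc) (conf_l hc) (conf_r1 hc) (conf_r1E hc) (conf_x1 hc)) => u.
rewrite (Gamma_intE _ _ (conf_r1 hc) (conf_r2 hc)); split => -[h1 h2]; split => //.
  by rewrite -(inside2 hc h1).
by rewrite (inside2 hc h1).
Qed.

(** The exterior arc is on the other side of the chord: turning the frame by half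
    a turn exchanges the sides and the poles. *)
Lemma GE_chart : exists K, arc_chart (circle_measure x1 r1) GE ta ja K.
Proof.
have FN u : fr m (- ec) (- es) u = F (- u.1, - u.2) by rewrite frN.
have [||||K] := @frame_chart R m x1 r1 (- ec) (- es) (- c1) l GE _ (conf_l hc) (conf_r1 hc).
- by rewrite !sqrrN; exact: conf_unit hc.
- by rewrite sqrrN; exact: conf_r1E hc.
- by rewrite FN/= opprK oppr0; exact: conf_x1 hc.
- move=> u; rewrite FN; split => -[h1 h2]; split => //.
    by move: h2; rewrite (outside2 hc h1)/= oppr_lt0.
  by rewrite (outside2 hc h1)/= oppr_lt0.
rewrite !FN /= oppr0 opprK => h; exists K.
have := arc_chartC h.
have -> : (fun y => - tau Q P y) = ta by apply/funext => y; rewrite -tauC.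
by have -> : jac Q P = ja by apply/funext => y; rewrite jacC.
Qed.

Variable th : R.
Hypotheses (hth : 0 < th < pi) (cth : cos th = (l ^+ 2 - c1 * c2) / (r1 * r2))
  (sth : sin th = l * (c1 + c2) / (r1 * r2)).

(** The measure does not charge the poles, which are the only points of the circle
    outside the two arcs. *)
Lemma poisson_split g v : edist (F v) x2 = r2 -> v.1 < 0 ->
  g \in CL2fun (circle_measure x1 r1) ->
  poisson x1 r1 g (F v) = arcT mu GI ta ja (stripPC th) g (ta (F v)) +
                          arcT mu GE ta ja (stripPC (pi - th)) g (ta (F v)).
Proof.
move=> hv v0 hg; have [KI hI] := GI_chart; have [KE hE] := GE_chart.
have hth' : 0 < pi - th < pi by move: hth; lra.
have [M1 _ h1] := expdec_stripPC hth; have [M2 _ h2] := expdec_stripPC hth'.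
have half1 : 2^-1 < 1 :> R by lra.
have i1 := @arcT_integrable _ _ _ mu GI ta ja KI hI _ _ _ h1 half1 g (ta (F v)) hg.
have i2 := @arcT_integrable _ _ _ mu GE ta ja KE hE _ _ _ h2 half1 g (ta (F v)) hg.
have pn : (pi : R) != 0 by rewrite gt_eqF ?pi_gt0.
have r10 := conf_r1 hc.
have iH := cintegrableD i1 i2; have r20 := conf_r2 hc; have [mg _] := (CL2funE _ g).1 hg.
rewrite /arcT -cintegralD// /poisson.
set H := (fun y => _ * g y + _) in iH *.
have e : \forall y \ae mu, (((r1 ^+ 2 - edist (F v) x1 ^+ 2) / (r1 * edist (F v) y ^+ 2))%:C)%C * g y =
    ((2 * pi)%:C)%C * H y.
  have [A [mA A0 hA]] := circle_boundary_ae x1 r10 0.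
  have [A' [mA' A0' hA']] := circle_ae_neq x1 P r10.
  have [A2 [mA2 A02 hA2]] := circle_ae_neq x1 Q r10.
  exists (A `|` A' `|` A2); split.
  - by apply: measurableU => //; exact: measurableU.
  - have := @measureU0 _ _ _ (circle_measure x1 r1) _ _ (measurableU _ _ mA mA') mA2 A02 => ->.
    by have := @measureU0 _ _ _ (circle_measure x1 r1) _ _ mA mA' A0' => ->.
  move=> y /= hy.
  have [ny|yr] := pselect (~ (edist y x1 = r1)); first by left; left; exact: hA.
  have [ny|yP] := pselect (~ (y <> P)); first by left; right; exact: hA'.
  have [ny|yQ] := pselect (~ (y <> Q)); first by right; exact: hA2.
  move/contrapT in yr; move/contrapT in yP; move/contrapT in yQ.
  exfalso; apply: hy; move: yr yP yQ.
  have [u <-] := fr_surj m y (conf_unit hc) => ur uP uQ.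
  have ku := (circle1P hc u).1 ur; have kv := (circle2P hc v).1 hv.
  have u0 : u.1 != 0.
    apply/eqP => u0.
    have i0 := inside2 hc ur; have o0 := outside2 hc ur; rewrite u0 ltxx in i0 o0.
    have [] // : F u = P \/ F u = Q.
    apply: (common_points hc) => //; apply/eqP.
    by rewrite eq_le [_ <= r2]leNgt [r2 <= _]leNgt o0 i0.
  rewrite /H /arcw !indicE.
  have alg (k : R) : (2 * pi)^-1 * ((r1 ^+ 2 - edist (F v) x1 ^+ 2) / (r1 * edist (F v) (F u) ^+ 2)) = k ->
      ((r1 ^+ 2 - edist (F v) x1 ^+ 2) / (r1 * edist (F v) (F u) ^+ 2)) = 2 * pi * k.
    by move=> <-; rewrite [RHS]mulrA divff ?mul1r// mulf_neq0.
  have alg1 (q k j j' : R) (k' w : R[i]) : ((q * (k * j))%:C)%C * w =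
      (q%:C)%C * (((1 * j)%:C)%C * (k%:C)%C * w + ((0 * j')%:C)%C * k' * w).
    by rewrite mul1r mul0r (real_C_M q) (real_C_M k); move: (q%:C)%C (k%:C)%C (j%:C)%C => *; rewrite -[((0 : R)%:C)%C]/(0 : R[i]); ring.
  have alg2 (q k j j' : R) (k' w : R[i]) : ((q * (k * j))%:C)%C * w =
      (q%:C)%C * (((0 * j')%:C)%C * k' * w + ((1 * j)%:C)%C * (k%:C)%C * w).
    by rewrite addrC; exact: alg1.
  have [u1|u1] := ltP 0 u.1.
    have -> : (F u \in GI) = true.
      by apply/mem_set; rewrite (Gamma_intE _ _ r10 r20); split => //; rewrite (inside2 hc ur).
    have -> : (F u \in GE) = false.
      apply/negP => /set_mem[_]; rewrite (outside2 hc ur) => h; have := lt_trans h u1.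
      by rewrite ltxx.
    have K := poisson_kernel hc cth sth ku kv v0 u0 (erefl : sin th = sin th) _.
    rewrite (alg _ (K _)); last by rewrite gtr0_norm.
    exact: alg1.
  have u1' : u.1 < 0 by rewrite lt_neqAle u0.
  have -> : (F u \in GI) = false.
    apply/negP => /set_mem; rewrite (Gamma_intE _ _ r10 r20) => -[_].
    by rewrite (inside2 hc ur) => h; have := lt_trans h u1'; rewrite ltxx.
  have -> : (F u \in GE) = true.
    by apply/mem_set; split => //; rewrite (outside2 hc ur).
  have sk : sin (pi - th) = sin th by rewrite sinB sinpi cospi; ring.
  have ck : cos (pi - th) * `|u.1| = cos th * u.1.
    by rewrite ltr0_norm// cosB sinpi cospi; ring.
  rewrite (alg _ (poisson_kernel hc cth sth ku kv v0 u0 sk ck)).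
  exact: alg2.
have mk : cmeas (fun y : caratheodory_type (hausdorff1_on (boundary (disk x1 r1))) => (((r1 ^+ 2 - edist (F v) x1 ^+ 2) / (r1 * edist (F v) y ^+ 2))%:C)%C).
  apply: cmeas_real; apply: (circle_measurable_fun r10 (al := 0)); apply: measurable_funTS.
  apply: measurable_funM; first exact: measurable_cst.
  apply: (@measurableT_comp _ _ _ _ _ _ (fun t : R => t^-1)); first exact: measurable_inv.
  apply: measurable_funM; first exact: measurable_cst.
  apply: measurable_funX.
  have -> : (fun t => edist (F v) (arcpt x1 r1 0 t)) = (fun t => edist (arcpt x1 r1 0 t) (F v)).
    by apply/funext => t; rewrite euclC.
  exact: measurable_edist_arcpt.
transitivity (((2 * pi)^-1%:C)%C * (((2 * pi)%:C)%C * cintegral mu H)).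
  congr (_ * _); rewrite -cintegralZ//.
  apply: (@cintegral_ae _ _ _ mu _ _ _ _ e); first exact: cmeasM.
  exact: (cintegrable_cmeas (cintegrableZ _ iH)).
by rewrite mulrA -real_C_M mulVf ?mul1r// mulf_neq0.
Qed.

End ConfCharts.

(** * Spectra of bounded operators *)

Section Abstract.
Variables (R : realType) (V : normedModType R[i]).
Implicit Types (f g A N : V -> V) (a l : R[i]) (u v : V).

(** Bounded linear maps, before they are packed into a structure. *)
Definition bdlin f : Prop :=
  (forall a u v, f (a *: u + v) = a *: f u + f v) /\
  exists2 K : R, 0 <= K & forall u, `|f u| <= (K%:C)%C * `|u|.

Lemma bdlin_id : bdlin id.
Proof. by split => //; exists 1 => // u; rewrite mul1r. Qed.

Lemma bdlinD f g : bdlin f -> bdlin g -> bdlin (fun u => f u + g u).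
Proof.
move=> [lf [K K0 bf]] [lg [L L0 bg]]; split => [a u v|].
  by rewrite lf lg scalerDr addrACA.
exists (K + L); first exact: addr_ge0.
move=> u; rewrite (le_trans (ler_normD _ _))// rmorphD/= mulrDl lerD//.
Qed.

Lemma bdlin_comp f g : bdlin f -> bdlin g -> bdlin (fun u => f (g u)).
Proof.
move=> [lf [K K0 bf]] [lg [L L0 bg]]; split => [a u v|]; first by rewrite lg lf.
exists (K * L); first exact: mulr_ge0.
move=> u; rewrite (le_trans (bf _))// real_C_M -[leRHS]mulrA ler_wpM2l//.
by rewrite ler0c.
Qed.

Lemma bdlinZ a f : bdlin f -> bdlin (fun u => a *: f u).
Proof.
move=> [lf [K K0 bf]]; split => [b u v|].
  by rewrite lf scalerDr !scalerA mulrC.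
exists (normc a * K); first by rewrite mulr_ge0// normc_ge0.
move=> u; rewrite normrZ real_C_M -normcE_norm -[leRHS]mulrA ler_wpM2l//.
Qed.

Lemma bdlin0 f : bdlin f -> f 0 = 0.
Proof. by move=> [lf _]; have := lf (-1) 0 0; rewrite !scaleN1r !addNr. Qed.

Lemma bdlin_add f u v : bdlin f -> f (u + v) = f u + f v.
Proof. by move=> [lf _]; rewrite -{1}[u]scale1r lf scale1r. Qed.

Lemma bdlin_scale f a u : bdlin f -> f (a *: u) = a *: f u.
Proof. by move=> hf; have [lf _] := hf; rewrite -[a *: u]addr0 lf bdlin0// addr0. Qed.

Lemma bdlin_linear f : bdlin f -> exists S : {linear V -> V}, continuous S /\ forall u, S u = f u.
Proof.
move=> [lf [K K0 bf]].
pose lm := GRing.isLinear.Build R[i] V V *:%R f lf.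
pose S : {linear V -> V} := HB.pack f lm.
exists S; split => //; apply: bounded_linear_continuous; apply/linear_boundedP.
exists (K%:C)%C; split; first by rewrite ger0_real// ler0c.
move=> r Kr x; apply: (le_trans (bf x)); rewrite ler_wpM2r//; exact: ltW.
Qed.

(** On the range of [A] the resolvent is [l^-1 (1 + N)]; one more application of
    [A] gives it on the whole space. *)
Lemma resolvent_of_remainder A N l : l != 0 -> bdlin A -> bdlin N ->
  (forall u, l *: N (A u) = A (A u) + A (N (A u))) ->
  (forall u, l *: N (A u) = A (A u) + N (A (A u))) -> ~ spectrum A l.
Proof.
move=> l0 hA hN I1 I2; rewrite /spectrum/=; move=> sp; apply: sp.
have hS : bdlin (fun u => l^-1 *: (u + l^-1 *: (A u + N (A u)))).
  apply: bdlinZ; apply: (bdlinD bdlin_id); apply: bdlinZ; apply: (bdlinD hA).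
  exact: bdlin_comp.
have [S [cS SE]] := bdlin_linear hS; exists S; split => // u; rewrite !SE.
  have -> : A (l *: u - A u) = l *: A u - A (A u).
    by rewrite -scaleN1r addrC (hA.1) scaleN1r (bdlin_scale _ _ hA) addrC.
  have -> : N (l *: A u - A (A u)) = l *: N (A u) - N (A (A u)).
    by rewrite -scaleN1r addrC (hN.1) scaleN1r (bdlin_scale _ _ hN) addrC.
  by rewrite I2 addrK subrK scalerA mulVf// scale1r subrK scalerA mulVf// scale1r.
rewrite !(bdlin_scale _ _ hA) !(bdlin_add _ _ hA) !(bdlin_scale _ _ hA) !(bdlin_add _ _ hA).
rewrite -I1 [l *: (l^-1 *: _)]scalerA divff// scale1r [l^-1 *: (l *: _)]scalerA mulVf// scale1r.
by rewrite addrK.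
Qed.

(** An inverse of [l - A] maps [(l - l') u] to [u] for every eigenvector [u], so
    its norm is at least [1 / |l - l'|]. *)
Lemma closure_eigenvalues A (E : set R[i]) :
  (forall l, E l -> exists u, eigenvector A l u) ->
  closure (E : set (R[i])^o) `<=` spectrum A.
Proof.
move=> hE l cl [S [cS S1 S2]].
have bS : bounded_near S (nbhs 0) by exact/linear_bounded_continuous.
have /linear_boundedP/pinfty_ex_gt0[r r0 br] := bS.
have rV : 0 < r^-1 by rewrite invr_gt0.
have [l' [El' ll']] := cl _ (@nbhsx_ballx _ (R[i])^o l _ rV).
rewrite -ball_normE/= in ll'.
have [u [u0 Au]] := hE _ El'.
have e : S ((l - l') *: u) = u by rewrite -[RHS]S1 Au scalerBl.
have := br ((l - l') *: u); rewrite e normrZ mulrA -subr_ge0 -{2}[`|u|]mul1r -mulrBl.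
rewrite pmulr_lge0 ?normr_gt0// subr_ge0 => h.
have : r * `|l - l'| < 1 by rewrite -ltr_pdivlMl// mulr1.
by move=> /(le_lt_trans h); rewrite ltxx.
Qed.

End Abstract.

(** * Composition of the traces on two circles *)

Section Admissible.
Variable R : realType.
Local Notation C := R[i].
Implicit Types (k : R -> C).

(** Decay faster than [exp (- |t| / 2)] makes the operators [arcR] bounded. *)
Definition adm k : Prop := exists M b, 2^-1 < b /\ expdec k M b.

(** Convolution is estimated for different rates of decay, and the second one may
    be lowered. *)
Lemma adm_rates k1 k2 : adm k1 -> adm k2 ->
  exists M1 b1 M2 b2, [/\ 2^-1 < b2, b2 < b1, expdec k1 M1 b1 & expdec k2 M2 b2].
Proof.
move=> [M1 [b1 [h1 e1]]] [M2 [b2 [h2 e2]]].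
pose b := (2^-1 + Num.min b1 b2) / 2.
have m0 : 2^-1 < Num.min b1 b2 by rewrite lt_min h1.
have m1 : Num.min b1 b2 <= b1 by rewrite ge_min lexx.
have m2 : Num.min b1 b2 <= b2 by rewrite ge_min lexx orbT.
exists M1, b1, M2, b; rewrite /b; split => //; try lra.
by apply: expdecW e2; lra.
Qed.

Lemma adm_convol k1 k2 : adm k1 -> adm k2 -> adm (convol k1 k2).
Proof.
move=> h1 h2; have [M1 [b1 [M2 [b2 [h b21 e1 e2]]]]] := adm_rates h1 h2.
by eexists; exists b2; split => //; apply: (expdec_convol e1 e2) => //; lra.
Qed.

Lemma adm_convolC k1 k2 : adm k1 -> adm k2 -> convol k1 k2 = convol k2 k1.
Proof.
move=> h1 h2; have [M1 [b1 [M2 [b2 [h b21 e1 e2]]]]] := adm_rates h1 h2.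
by apply/funext => t; rewrite (convolC e1 e2)//; lra.
Qed.

End Admissible.

Section LiftMore.
Context d1 (T1 : measurableType d1) d2 (T2 : measurableType d2) d3 (T3 : measurableType d3) (R : realType).
Variables (m1 : {measure set T1 -> \bar R}) (m2 : {measure set T2 -> \bar R}) (m3 : {measure set T3 -> \bar R}).
Local Notation C := R[i].

Lemma L2lift_comp (F : (T2 -> C) -> (T3 -> C)) (H : (T1 -> C) -> (T2 -> C)) : L2op m1 m2 H -> L2op m2 m3 F ->
  forall u : CL2 m1, L2lift m3 F (L2lift m2 H u) = L2lift m3 (F \o H) u.
Proof.
move=> hH hF u.
exact: (L2lift_class hF (L2op_CL2fun hH (repr_CL2fun u))).
Qed.

Lemma L2op_comp (F : (T2 -> C) -> (T3 -> C)) (H : (T1 -> C) -> (T2 -> C)) : L2op m1 m2 H -> L2op m2 m3 F ->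
  L2op m1 m3 (F \o H).
Proof.
move=> hH hF; split.
- move=> a f g hf hg; rewrite /= (L2op_lin hH)// (L2op_lin hF)//; exact: L2op_CL2fun hH _.
- by move=> f g hf hg fg; rewrite /= (L2op_ae hH hf hg fg).
- by move=> f hf; apply: (L2op_cmeas hF); exact: L2op_CL2fun hH _.
have [K K0 hK] := L2op_bounded hF; have [L L0 hL] := L2op_bounded hH.
exists (K * L); first exact: mulr_ge0.
move=> f hf; apply: (le_trans (hK _ (L2op_CL2fun hH hf))).
by rewrite (EFinM K) -muleA; apply: lee_wpmul2l; [rewrite lee_fin|exact: hL].
Qed.

Lemma CL2classD f g : f \in CL2fun m1 -> g \in CL2fun m1 ->
  CL2class m1 (f + g) = CL2class m1 f + CL2class m1 g.
Proof. by move=> hf hg; rewrite -[f in LHS]scale1r CL2class_lin// scale1r. Qed.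

Lemma CL2class0 : CL2class m1 0 = 0.
Proof.
have h : (0 : T1 -> C) \in CL2fun m1 by exact: rpred0.
apply: (addrI (CL2class m1 0)); rewrite -CL2classD//.
by rewrite !addr0.
Qed.

Lemma CL2classZ a f : f \in CL2fun m1 -> CL2class m1 (a *: f) = a *: CL2class m1 f.
Proof.
move=> hf; have h : (0 : T1 -> C) \in CL2fun m1 by exact: rpred0.
by rewrite -[a *: f]addr0 CL2class_lin// CL2class0 addr0.
Qed.

End LiftMore.

Section ArcExp.
Context d (T : measurableType d) (R : realType).
Variable m : {finite_measure set T -> \bar R}.
Local Notation C := R[i].
Local Notation Im := (@complex.Im R).
Variables (G : set T) (ta ja : T -> R) (K : R) (hc : arc_chart m G ta ja K).
Implicit Types (k z : C).

Definition arc_exp z (y : T) : C := if y \in G then cexp ('i%C * z * ((ta y)%:C)%C) else 0.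

(** The square of the modulus is at most [exp (2 |Im z| |tau|)], and
    [2 |Im z| < 1] is less than the growth of the density. *)
Lemma arc_exp_CL2fun z : `|Im z| < 2^-1 -> arc_exp z \in CL2fun m.
Proof.
move=> hz; apply/CL2funE; split.
  apply: (cmeas_if (chart_measurable hc)).
  exact: (cmeas_comp_tau hc (ccontinuous_expi ('i%C * z))).
pose c := 1 - 2 * `|Im z|.
have c0 : 0 < c by rewrite /c; lra.
have mw : measurable_fun [set: T] (fun y => arcw G ja y * expR (- (c * `|0 - ta y|))).
  apply: measurable_funM; first exact: (measurable_arcw hc).
  have cX : continuous (fun u : R => expR (- (c * `|0 - u|))).
    move=> u; apply: (@continuous_comp _ _ _ (fun u : R => 0 - u) (fun v => expR (- (c * `|v|)))); last exact: continuous_expabs.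
    by apply: cvgB; [exact: cvg_cst|exact: cvg_id].
  exact: (measurable_comp_tau hc cX).
apply: (@le_lt_trans _ _ (\int[m]_y (`|K|%:E * (arcw G ja y * expR (- (c * `|0 - ta y|)))%:E))%E).
  apply: ge0_le_integral => //.
  - by move=> y _; rewrite lee_fin sqr_ge0.
  - apply/measurable_EFinP; apply: measurable_funX; apply: cmeas_normc.
    apply: (cmeas_if (chart_measurable hc)).
    exact: (cmeas_comp_tau hc (ccontinuous_expi ('i%C * z))).
  - by apply: emeasurable_funM; [exact: measurable_cst|apply/measurable_EFinP; exact: mw].
  move=> y _; rewrite -EFinM lee_fin sub0r normrN /arc_exp.
  have w0 := arcw_ge0 hc y.
  case: ifPn => yG; last by rewrite normc0 expr0n/= mulr_ge0// mulr_ge0// expR_ge0.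
  have := arcw_ge hc y; rewrite indicE yG mul1r => h.
  rewrite mulrA; apply: (@le_trans _ _ (expR `|ta y| * expR (- (c * `|ta y|)))); last first.
    by rewrite ler_wpM2r ?expR_ge0.
  rewrite -expRD.
  apply: (@le_trans _ _ (expR (`|Im z| * `|ta y|) ^+ 2)).
    by rewrite ler_pXn2r ?nnegrE ?normc_ge0 ?expR_ge0// normc_expi_le.
  rewrite -expRM_natl ler_expR /c; lra.
rewrite ge0_integralZl//.
- by rewrite (arcw_expabs hc 0 c0) -EFinM ltry.
- by apply/measurable_EFinP.
- by move=> y _; rewrite lee_fin mulr_ge0 ?expR_ge0// (arcw_ge0 hc).
Qed.

(** The arc has positive measure. *)
Lemma arc_exp_class_neq0 z : arc_exp z \in CL2fun m -> CL2class m (arc_exp z) != 0.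
Proof.
move=> hz; apply/eqP; rewrite -(CL2class0 m) => /CL2class_ae h0.
have {}h0 := h0 hz (rpred0 _).
have := arcw_expabs hc 0 ltr01.
have -> : (\int[m]_y (arcw G ja y * expR (- (1 * `|0 - ta y|)))%:E = 0)%E.
  have mw : measurable_fun [set: T] (fun y => (arcw G ja y * expR (- (1 * `|0 - ta y|)))%:E).
    apply/measurable_EFinP; apply: measurable_funM; first exact: (measurable_arcw hc).
    have cX : continuous (fun u : R => expR (- (1 * `|0 - u|))).
      move=> u; apply: (@continuous_comp _ _ _ (fun u : R => 0 - u) (fun v => expR (- (1 * `|v|)))); last exact: continuous_expabs.
      by apply: cvgB; [exact: cvg_cst|exact: cvg_id].
    exact: (measurable_comp_tau hc cX).
  rewrite -[RHS](@integral0 _ T R m setT); apply: ae_eq_integral => //.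
  apply: filterS h0 => y + _; rewrite /arc_exp /arcw indicE; case: ifP => _; last by rewrite !mul0r.
  by move=> /eqP; rewrite (negbTE (cexp_neq0 _)).
by move=> /eqP; rewrite eq_sym divr1 eqe pnatr_eq0.
Qed.

Lemma arcT_exp p M b z t : expdec p M b -> 2^-1 < b -> `|Im z| < 2^-1 ->
  arcT m G ta ja p (arc_exp z) t = ft p (- z) * cexp ('i%C * z * (t%:C)%C).
Proof.
move=> hp hb hz; have M0 := expdec_M_ge0 hp; have [cp bp] := hp.
pose c := b - `|Im z|.
have c0 : 0 < c by rewrite /c; lra.
have hq := expdec_ft (- z) hp; have [cq bq] := hq.
have iz : `|Im (- z)| = `|Im z| by rewrite cImN normrN.
rewrite iz -/c in hq bq.
have iq := expdec_integrable c0 hq.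
pose H s := p (t - s) * cexp ('i%C * z * (s%:C)%C).
have HE s : H s = cexp ('i%C * z * (t%:C)%C) * (p (t - s) * cexp ('i%C * - z * ((t - s)%:C)%C)).
  rewrite /H [RHS]mulrCA -cexpD; congr (_ * cexp _).
  rewrite rmorphB/=; ring.
have [iH eH] := cintegral_reflect t iq.
have iH' : cintegrable (@lebesgue_measure R) H.
  have -> : H = fun s => cexp ('i%C * z * (t%:C)%C) * (p (t - s) * cexp ('i%C * - z * ((t - s)%:C)%C)).
    by apply/funext.
  exact: cintegrableZ.
transitivity (cintegral m (fun y => ((arcw G ja y)%:C)%C * H (ta y))).
  apply: cintegral_ext => y; rewrite /H /arc_exp /arcw indicE -!mulrA.
  case: ifP => // _; have -> : ((0 * ja y)%:C)%C = 0 :> C by rewrite mul0r.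
  by rewrite !mul0r.
have cH : ccontinuous H.
  apply: ccontinuousM; last exact: ccontinuous_expi.
  by apply: (ccontinuous_comp cp) => u; apply: cvgB; [exact: cvg_cst|exact: cvg_id].
pose h s := M * normc (cexp ('i%C * z * (t%:C)%C)) * expR (- (c * `|t - s|)).
have ch : continuous h.
  move=> u; apply: cvgM; first exact: cvg_cst.
  apply: (@continuous_comp _ _ _ (fun u : R => t - u) (fun v => expR (- (c * `|v|)))); last exact: continuous_expabs.
  by apply: cvgB; [exact: cvg_cst|exact: cvg_id].
have ih : (@lebesgue_measure R).-integrable [set: R] (fun s => (h s)%:E).
  have i0 : cintegrable (@lebesgue_measure R) (fun s => ((M * normc (cexp ('i%C * z * (t%:C)%C)) * expR (- (c * `|s|)))%:C)%C).
    by split; [exact: integrable_expabs|exact: integrable0].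
  by have [[]] := cintegral_reflect t i0.
have Hh s : normc (H s) <= h s.
  rewrite HE [normc (_ * _)]normcM /h [M * _]mulrC -[leRHS]mulrA.
  by apply: ler_wpM2l; [exact: normc_ge0|exact: bq].
have [_ ->] := arcw_cintegral hc cH ch ih Hh.
have -> : cintegral (@lebesgue_measure R) H = cintegral (@lebesgue_measure R) (fun s => cexp ('i%C * z * (t%:C)%C) * (p (t - s) * cexp ('i%C * - z * ((t - s)%:C)%C))).
  exact: cintegral_ext.
by rewrite cintegralZ// eH mulrC.
Qed.

End ArcExp.

Section Step.
Context d1 (T1 : measurableType d1) d2 (T2 : measurableType d2) (R : realType).
Variables (m1 : {finite_measure set T1 -> \bar R}) (m2 : {finite_measure set T2 -> \bar R}).
Local Notation C := R[i].
Variables (G1 E1 : set T1) (ta1 ja1 : T1 -> R) (K1 L1 : R).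
Hypotheses (hc1 : arc_chart m1 G1 ta1 ja1 K1) (he1 : arc_chart m1 E1 ta1 ja1 L1).
Variables (G2 : set T2) (ta2 ja2 : T2 -> R) (K2 : R).
Hypotheses (hc2 : arc_chart m2 G2 ta2 ja2 K2).
Hypotheses (dis1 : forall y, E1 y -> ~ G1 y).
Variables (p q : R -> C).
Hypotheses (hp : adm p) (hq : adm q).

Definition off d (T : measurableType d) (G : set T) (f : T -> C) : Prop :=
  forall y, ~ G y -> f y = 0.

(** The trace in coordinates: one kernel for the interior arc [G1], another one
    for the exterior arc [E1]. *)
Definition traceR f : T2 -> C :=
  arcR m1 G1 ta1 ja1 G2 ta2 p f + arcR m1 E1 ta1 ja1 G2 ta2 q f.

Lemma arcR_L2op_adm k : adm k -> L2op m1 m2 (arcR m1 G1 ta1 ja1 G2 ta2 k).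
Proof. by move=> [M [b [h1 h2]]]; exact: (arcR_L2op hc1 hc2 h2 h1). Qed.

Lemma traceR_L2op : L2op m1 m2 traceR.
Proof.
apply: L2opD; first exact: arcR_L2op_adm.
by have [M [b [h1 h2]]] := hq; exact: (arcR_L2op he1 hc2 h2 h1).
Qed.

Lemma off_arcR k f : off G2 (arcR m1 G1 ta1 ja1 G2 ta2 k f).
Proof. by move=> y h; rewrite /arcR memNset. Qed.

Lemma off_traceR f : off G2 (traceR f).
Proof.
by move=> y h; rewrite /traceR fctE /arcR memNset// addr0.
Qed.

(** The exterior arc does not see functions supported by the interior one. *)
Lemma traceR_off f : off G1 f -> traceR f = arcR m1 G1 ta1 ja1 G2 ta2 p f.
Proof.
move=> hf; rewrite /traceR -[RHS]addr0; congr (_ + _); apply/funext => y.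
rewrite /arcR; case: ifP => // _; rewrite /arcT -[RHS](cintegral0 m1).
apply: cintegral_ext => x; rewrite /arcw indicE; case: (boolP (x \in E1)) => xE.
  by rewrite hf ?mulr0//; apply: dis1; exact: set_mem.
by have -> : ((false%:R * ja1 x)%:C)%C = 0 :> C; [rewrite mul0r|rewrite !mul0r].
Qed.

Lemma arcR_kernel (l : C) k k1 k2 f : adm k -> adm k1 -> adm k2 ->
  (forall t, l * k t = k1 t + k2 t) -> f \in CL2fun m1 ->
  l *: arcR m1 G1 ta1 ja1 G2 ta2 k f =
  arcR m1 G1 ta1 ja1 G2 ta2 k1 f + arcR m1 G1 ta1 ja1 G2 ta2 k2 f.
Proof.
move=> [M [b [h1 h2]]] [M1 [b1 [h11 h12]]] [M2 [b2 [h21 h22]]] lk hf.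
apply/funext => w; rewrite !fctE /arcR; case: ifP => _; last by rewrite addr0 scaler0.
rewrite /arcT; have i := arcT_integrable hc1 h2 h1 (ta2 w) hf.
have i1 := arcT_integrable hc1 h12 h11 (ta2 w) hf.
have i2 := arcT_integrable hc1 h22 h21 (ta2 w) hf.
rewrite -cintegralD// -[LHS]/(l * _) -cintegralZ//; apply: cintegral_ext => y.
by rewrite -mulrDl -mulrDr -lk; move: (k _) (_%:C)%C (f y) => u v z; ring.
Qed.

End Step.

Section Comp.
Context d1 (T1 : measurableType d1) d2 (T2 : measurableType d2) d3 (T3 : measurableType d3) (R : realType).
Variables (m1 : {finite_measure set T1 -> \bar R}) (m2 : {finite_measure set T2 -> \bar R}).
Local Notation C := R[i].
Variables (G1 : set T1) (ta1 ja1 : T1 -> R) (K1 : R) (hc1 : arc_chart m1 G1 ta1 ja1 K1).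
Variables (G2 : set T2) (ta2 ja2 : T2 -> R) (K2 : R) (hc2 : arc_chart m2 G2 ta2 ja2 K2).
Variables (G3 : set T3) (ta3 : T3 -> R).

Lemma arcR_comp k1 k2 f : adm k1 -> adm k2 -> f \in CL2fun m1 ->
  arcR m2 G2 ta2 ja2 G3 ta3 k1 (arcR m1 G1 ta1 ja1 G2 ta2 k2 f) =
  arcR m1 G1 ta1 ja1 G3 ta3 (convol k1 k2) f.
Proof.
move=> [M1 [b1 [h11 h12]]] [M2 [b2 [h21 h22]]] hf; apply/funext => w.
by rewrite {1}/arcR [RHS]/arcR (arcT_comp hc1 hc2 _ h12 h22).
Qed.

End Comp.

Section TwoArcOperator.
Context d1 (T1 : measurableType d1) d2 (T2 : measurableType d2) (R : realType).
Variables (m1 : {finite_measure set T1 -> \bar R}) (m2 : {finite_measure set T2 -> \bar R}).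
Local Notation C := R[i].
Local Notation Im := (@complex.Im R).
Variables (G1 E1 : set T1) (ta1 ja1 : T1 -> R) (K1 L1 : R).
Hypotheses (hc1 : arc_chart m1 G1 ta1 ja1 K1) (he1 : arc_chart m1 E1 ta1 ja1 L1).
Variables (G2 E2 : set T2) (ta2 ja2 : T2 -> R) (K2 L2 : R).
Hypotheses (hc2 : arc_chart m2 G2 ta2 ja2 K2) (he2 : arc_chart m2 E2 ta2 ja2 L2).
Hypotheses (dis1 : forall y, E1 y -> ~ G1 y) (dis2 : forall y, E2 y -> ~ G2 y).
Variables (p q : R -> C).
Hypotheses (hp : adm p) (hq : adm q).

Local Notation F12 := (traceR m1 G1 E1 ta1 ja1 G2 ta2 p q).
Local Notation F21 := (traceR m2 G2 E2 ta2 ja2 G1 ta1 p q).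
Local Notation R11 := (arcR m1 G1 ta1 ja1 G1 ta1).
Local Notation R12 := (arcR m1 G1 ta1 ja1 G2 ta2).
Local Notation R21 := (arcR m2 G2 ta2 ja2 G1 ta1).
Local Notation R22 := (arcR m2 G2 ta2 ja2 G2 ta2).

Let h12 : L2op m1 m2 F12. Proof. exact: (traceR_L2op hc1 he1 hc2). Qed.
Let h21 : L2op m2 m1 F21. Proof. exact: (traceR_L2op hc2 he2 hc1). Qed.
Let hA : L2op m1 m1 (F21 \o F12). Proof. exact: L2op_comp h12 h21. Qed.

Lemma L2op_bdlin (F : (T1 -> C) -> T1 -> C) : L2op m1 m1 F -> bdlin (L2lift m1 F : CL2 m1 -> CL2 m1).
Proof.
move=> hF; split; first by move=> a u v; exact: L2lift_lin.
exact: L2lift_bounded.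
Qed.

Lemma F21E f : F21 (F12 f) = R21 p (F12 f).
Proof. by apply: traceR_off => //; exact: off_traceR. Qed.

Lemma F12E f : off G1 f -> F12 f = R12 p f.
Proof. exact: traceR_off. Qed.

(** The range of the operator consists of functions supported by [G1], on which it
    acts as the convolution with [p] twice; the operator with kernel [k] commutes
    with it because convolution is commutative. *)
Theorem two_arc_resolvent (l : C) k : l != 0 -> adm k ->
  (forall t, l * k t = convol p p t + convol p (convol p k) t) ->
  ~ spectrum ((L2lift m1 F21 : CL2 m2 -> CL2 m1) \o (L2lift m2 F12 : CL2 m1 -> CL2 m2)) l.
Proof.
move=> l0 hk lk.
have -> : (L2lift m1 F21 : CL2 m2 -> CL2 m1) \o (L2lift m2 F12 : CL2 m1 -> CL2 m2) = L2lift m1 (F21 \o F12).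
  by apply/funext => u; exact: (L2lift_comp h12 h21).
have hN : L2op m1 m1 (R11 k) by exact: (arcR_L2op_adm hc1 hc1).
have hpp := adm_convol hp hp; have hpk := adm_convol hp hk; have hppk := adm_convol hp hpk.
have hR12 := arcR_L2op_adm hc1 hc2 hp; have hR21 := arcR_L2op_adm hc2 hc1 hp.
pose A : CL2 m1 -> CL2 m1 := L2lift m1 (F21 \o F12).
pose N : CL2 m1 -> CL2 m1 := L2lift m1 (R11 k).
suff I u : l *: N (A u) = A (A u) + A (N (A u)) /\ l *: N (A u) = A (A u) + N (A (A u)).
  by apply: (resolvent_of_remainder l0 (L2op_bdlin hA) (L2op_bdlin hN)) => u; have [] := I u.
set f := CL2val (repr u); have hf : f \in CL2fun m1 := repr_CL2fun u.
set v := F21 (F12 f).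
have hv : v \in CL2fun m1 := L2op_CL2fun hA hf.
have ov : off G1 v by exact: off_traceR.
have hAv : F21 (F12 v) \in CL2fun m1 := L2op_CL2fun hA hv.
have hNv : R11 k v \in CL2fun m1 := L2op_CL2fun hN hv.
have hANv : F21 (F12 (R11 k v)) \in CL2fun m1 := L2op_CL2fun hA hNv.
have hNAv : R11 k (F21 (F12 v)) \in CL2fun m1 := L2op_CL2fun hN hAv.
have NE : N (A u) = CL2class m1 (R11 k v) := L2lift_class hN hv.
have AE : A (A u) = CL2class m1 (F21 (F12 v)) := L2lift_class hA hv.
have ANE : A (N (A u)) = CL2class m1 (F21 (F12 (R11 k v))).
  by rewrite NE; exact: (L2lift_class hA hNv).
have NAE : N (A (A u)) = CL2class m1 (R11 k (F21 (F12 v))).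
  by rewrite AE; exact: (L2lift_class hN hAv).
have e0 : F21 (F12 v) = R11 (convol p p) v.
  by rewrite F21E (F12E ov) (arcR_comp hc1 hc2).
have e1 : F21 (F12 (R11 k v)) = R11 (convol p (convol p k)) v.
  have c1 : R12 p (R11 k v) = R12 (convol p k) v by exact: (arcR_comp hc1 hc1).
  rewrite F21E F12E; last exact: off_arcR.
  by rewrite c1; exact: (arcR_comp hc1 hc2).
have hpv : R12 p v \in CL2fun m2 := L2op_CL2fun hR12 hv.
have e2 : R11 k (F21 (F12 v)) = R11 (convol p (convol p k)) v.
  have c1 : R11 k (R21 p (R12 p v)) = R21 (convol p k) (R12 p v).
    by rewrite -(adm_convolC hk hp); exact: (arcR_comp hc2 hc1).
  have c2 : R21 (convol p k) (R12 p v) = R21 p (R22 k (R12 p v)).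
    by apply/esym; exact: (arcR_comp hc2 hc2).
  have c3 : R22 k (R12 p v) = R12 (convol p k) v.
    by rewrite -(adm_convolC hk hp); exact: (arcR_comp hc1 hc2).
  rewrite F21E (F12E ov) c1 c2 c3; exact: (arcR_comp hc1 hc2).
have key : l *: R11 k v = R11 (convol p p) v + R11 (convol p (convol p k)) v.
  exact: (arcR_kernel hc1).
have cl : l *: N (A u) = CL2class m1 (R11 (convol p p) v + R11 (convol p (convol p k)) v).
  by rewrite NE -key (CL2classZ l hNv).
split.
  by rewrite cl -e0 -{1}e1 AE ANE; exact: (CL2classD hAv hANv).
have cl2 : l *: N (A u) = CL2class m1 (F21 (F12 v) + R11 k (F21 (F12 v))).
  by rewrite cl e2 e0.
by rewrite cl2 NAE AE; exact: (CL2classD hAv hNAv).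
Qed.

Theorem two_arc_eigenvector (z : C) : `|Im z| < 2^-1 ->
  eigenvector ((L2lift m1 F21 : CL2 m2 -> CL2 m1) \o (L2lift m2 F12 : CL2 m1 -> CL2 m2))
    (ft p (- z) ^+ 2) (CL2class m1 (arc_exp G1 ta1 z)).
Proof.
move=> hz.
have hx := arc_exp_CL2fun hc1 hz.
have [M [b [hb hpe]]] := hp.
split; first exact: (arc_exp_class_neq0 hc1).
have e1 : R12 p (arc_exp G1 ta1 z) = ft p (- z) *: arc_exp G2 ta2 z.
  apply/funext => w; rewrite /arcR fctE /arc_exp; case: ifP => _; last by rewrite scaler0.
  exact: (arcT_exp hc1 _ hpe hb hz).
have e2 : R21 p (arc_exp G2 ta2 z) = ft p (- z) *: arc_exp G1 ta1 z.
  apply/funext => w; rewrite /arcR fctE /arc_exp; case: ifP => _; last by rewrite scaler0.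
  exact: (arcT_exp hc2 _ hpe hb hz).
have oe : off G1 (arc_exp G1 ta1 z) by move=> y hy; rewrite /arc_exp memNset.
have -> : ((L2lift m1 F21 : CL2 m2 -> CL2 m1) \o (L2lift m2 F12 : CL2 m1 -> CL2 m2)) (CL2class m1 (arc_exp G1 ta1 z)) =
    L2lift m1 (F21 \o F12) (CL2class m1 (arc_exp G1 ta1 z)).
  exact: (L2lift_comp h12 h21).
rewrite (L2lift_class hA hx) /= F21E F12E// e1.
have hx2 := arc_exp_CL2fun hc2 hz.
have hR21 := arcR_L2op_adm hc2 hc1 hp.
have hz2 : (0 : T2 -> C) \in CL2fun m2 by exact: rpred0.
have r0 : R21 p 0 = 0.
  have := L2op_lin hR21 1 hz2 hz2; rewrite !scale1r addr0 => /eqP.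
  by rewrite -subr_eq0 opprD addrA subrr add0r oppr_eq0 => /eqP.
have := L2op_lin hR21 (ft p (- z)) hx2 hz2; rewrite r0 !addr0 => ->.
by rewrite e2 scalerA -expr2 (CL2classZ _ hx).
Qed.

End TwoArcOperator.

(** * The set of squares of values of the transform *)

Section PhatFacts.
Variable R : realType.
Local Notation C := R[i].
Local Notation Re := (@complex.Re R).
Local Notation Im := (@complex.Im R).
Implicit Types (z w l : C) (th : R).

Lemma csinhN z : csinh (- z) = - csinh z.
Proof. by rewrite /csinh opprK -[RHS]mulNr opprB. Qed.

Lemma csinhJ z : csinh (conjc z) = conjc (csinh z).
Proof.
rewrite /csinh; have -> : - conjc z = conjc (- z) by case: z.
rewrite !cexpJ !C2E; case: (cexp z) => a b; case: (cexp (- z)) => c d.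
by apply: cx_ext => /=; ring.
Qed.

Lemma PhatN th z : Phat th (- z) = Phat th z.
Proof. by rewrite /Phat oppr_eq0; case: eqP => // _; rewrite !mulrN !csinhN invrN mulrNN. Qed.

Lemma conjc_real (r : R) : conjc ((r%:C)%C) = (r%:C)%C.
Proof. by rewrite /conjc/= oppr0. Qed.

Lemma PhatJ th z : conjc (Phat th z) = Phat th (conjc z).
Proof.
rewrite /Phat; have -> : (conjc z == 0) = (z == 0) by rewrite conjc_eq0.
case: eqP => _; first exact: conjc_real.
have cM (r : R) : ((r%:C)%C * conjc z) = conjc ((r%:C)%C * z).
  by case: (z) => a b; apply: cx_ext => /=; ring.
by rewrite !cM !csinhJ [LHS]rmorphM fmorphV.
Qed.

Lemma ImJ z : Im (conjc z) = - Im z. Proof. by case: z. Qed.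

(** The topology of the complex numbers is given by balls of complex radius,
    which are positive reals. *)
Lemma closure_normc (E : set C) l :
  closure (E : set (C)^o) l <-> forall e : R, 0 < e -> exists2 w, E w & normc (l - w) < e.
Proof.
split=> [cl e e0|h B].
  have e0' : 0 < (e%:C)%C :> C by rewrite ltcE/= eqxx.
  have [w [Ew lw]] := cl _ (@nbhsx_ballx _ (C)^o l _ e0').
  exists w => //; rewrite -ball_normE/= in lw.
  by move: lw; rewrite normcE_norm ltcR.
move=> /nbhs_ballP[e /= e0 eB].
have [e1 e1E] : exists e1, e = (e1%:C)%C.
  by exists (Re e); move: e0 {eB}; case: e => a b; rewrite ltcE/= => /andP[/eqP -> _].
have [w Ew lw] := h e1 ltac:(by move: e0; rewrite e1E ltcE/= eqxx).
exists w; split => //; apply: eB; rewrite -ball_normE/= normcE_norm e1E ltcR.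
exact: lw.
Qed.

Lemma Phat_real_small th (e : R) : 0 < th < pi -> 0 < e ->
  exists2 t : R, 0 < t & normc (Phat th (t%:C)%C ^+ 2) < e.
Proof.
move=> hth e0; have /andP[t0 tp] := hth.
have d0 : 0 < pi - th by rewrite subr_gt0.
pose t := 1 + (16 / e) / (pi - th).
have h0 : 0 < 16 / e / (pi - th) by rewrite !divr_gt0.
have tg : 0 < t by rewrite /t; lra.
exists t => //.
have t1 : 1 <= `|Re ((t%:C)%C : C)| by rewrite /= ger0_norm /t; lra.
have := Phat_decay hth t1; rewrite /= (ger0_norm (ltW tg)) => h.
rewrite normcX; apply: (@le_lt_trans _ _ ((4 * expR (- ((pi - th) * t))) ^+ 2)).
  by rewrite ler_pXn2r ?nnegrE ?normc_ge0// mulr_ge0// expR_ge0.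
pose y := (pi - th) * t.
have yE : y = (pi - th) + 16 / e by rewrite /y /t; move: d0; move: (pi - th) => q q0; field; rewrite !gt_eqF.
have y0 : 16 / e < y by rewrite yE; lra.
have p16 : 0 < 16 / e by rewrite divr_gt0.
rewrite -/y exprMn -expRM_natl.
have e1 : 1 + 2 * y <= expR (2 * y) by apply: expR_ge1Dx.
have -> : 2%:R * - y = - (2 * y) by ring.
rewrite expRN ltr_pdivrMr ?expR_gt0//.
have : 16 < e * y by rewrite mulrC -ltr_pdivrMr.
have : e * y <= e * expR (2 * y) by rewrite ler_pM2l//; lra.
rewrite (_ : 4 ^+ 2 = 16 :> R); last by ring.
lra.
Qed.

(** [sinh (i s) = i sin s]. *)
Lemma Phat_half th : Phat th ('i%C * (2^-1%:C)%C) = ((sin (th / 2))%:C)%C :> C.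
Proof.
have hs (r : R) : csinh ((r%:C)%C * ('i%C * (2^-1%:C)%C)) = 'i%C * ((sin (r / 2))%:C)%C :> C.
  have -> : (r%:C%C * ('i%C * (2^-1%:C)%C)) = ('i%C * ((r / 2)%:C)%C) :> C.
    by rewrite real_C_M; ring.
  rewrite /csinh C2E; apply: cx_ext.
    rewrite [LHS]cReM [RHS]cReM !cReD !cImD !(Re_cexp, Im_cexp) !(cReN, cImN) !cReM !cImM /=.
    rewrite !(mul0r, mul1r, mulr0, mulr1, add0r, addr0, subr0, sub0r, oppr0, expR0, cosN, sinN, subrr).
    ring.
  rewrite [LHS]cImM [RHS]cImM !cReD !cImD !(Re_cexp, Im_cexp) !(cReN, cImN) !cReM !cImM /=.
  rewrite !(mul0r, mul1r, mulr0, mulr1, add0r, addr0, subr0, sub0r, oppr0, expR0, cosN, sinN, subrr).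
  by field.
rewrite /Phat ifN; last by rewrite mulf_neq0// ?neq0Ci ?eq_complex/= ?eqxx ?andbT ?invr_eq0.
rewrite !hs sin_pihalf mulr1.
by rewrite mulrAC divff ?mul1r// neq0Ci.
Qed.

(** Convexity of the exponential, from its tangent at the middle point. *)
Lemma expR_convex (y t : R) : `|y| <= 2^-1 ->
  expR (- (y * t)) <= (2^-1 + y) * expR (- (2^-1 * t)) + (2^-1 - y) * expR (2^-1 * t).
Proof.
rewrite ler_norml => /andP[y1 y2].
set m := - (y * t).
have tan u : expR m * (1 + (u - m)) <= expR u.
  by rewrite -[in leRHS](addrNK m u) [leRHS]expRD mulrC ler_wpM2r ?expR_ge0// expR_ge1Dx.
have h1 := tan (- (2^-1 * t)); have h2 := tan (2^-1 * t).
apply: (@le_trans _ _ ((2^-1 + y) * (expR m * (1 + (- (2^-1 * t) - m))) + (2^-1 - y) * (expR m * (1 + (2^-1 * t - m))))).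
  rewrite le_eqVlt; apply/orP; left; apply/eqP; rewrite /m; move: (expR _) => E; by field.
by apply: lerD; apply: ler_wpM2l => //; lra.
Qed.

(** The modulus is at most the integral of [stripP th t * exp (- y t)], a convex
    function of [y] which takes the same value at [1/2] and [- 1/2]. *)
Lemma Phat_le th z : 0 < th < pi -> `|Im z| < 2^-1 -> normc (Phat th z) <= sin (th / 2).
Proof.
move=> hth hz; have [M M0 hM] := expdec_stripPC hth; have [cP _] := hM.
have hz1 : `|Im z| < 1 by lra.
rewrite -(ft_stripP hz1 hth).
set y := Im z in hz.
pose P := stripPC th; pose h := (2^-1 : R).
pose w1 : C := 'i%C * (h%:C)%C; pose w2 : C := - w1.
have Iw1 : `|Im w1| = h.
  by rewrite (_ : Im w1 = h) ?ger0_norm ?invr_ge0// /w1 cImM /=; ring.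
have Iw2 : `|Im w2| = h by rewrite cImN normrN.
have e1 := expdec_ft w1 hM; have e2 := expdec_ft w2 hM; rewrite Iw1 in e1; rewrite Iw2 in e2.
have h1 : 0 < 1 - h by rewrite /h; lra.
have i1 := expdec_integrable h1 e1; have i2 := expdec_integrable h1 e2.
pose g t := stripP th t * ((2^-1 + y) * expR (- (2^-1 * t)) + (2^-1 - y) * expR (2^-1 * t)).
have cw1 t : cexp ('i%C * w1 * (t%:C)%C) = ((expR (- (2^-1 * t)))%:C)%C :> C.
  rewrite -cexp_real; congr cexp; rewrite /w1 /h.
  by apply: cx_ext => /=; ring.
have cw2 t : cexp ('i%C * w2 * (t%:C)%C) = ((expR (2^-1 * t))%:C)%C :> C.
  rewrite -cexp_real; congr cexp; rewrite /w2 /w1 /h.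
  by apply: cx_ext => /=; ring.
have gE t : ((g t)%:C)%C = ((2^-1 + y)%:C)%C * (P t * cexp ('i%C * w1 * (t%:C)%C)) +
    ((2^-1 - y)%:C)%C * (P t * cexp ('i%C * w2 * (t%:C)%C)) :> C.
  by rewrite cw1 cw2 /P /stripPC -!real_C_M -rmorphD/=; congr (_%:C)%C; rewrite /g; ring.
have ig : cintegrable (@lebesgue_measure R) (fun t => ((g t)%:C)%C).
  under eq_fun do rewrite gE.
  by apply: cintegrableD; exact: cintegrableZ.
have [ig' _] := ig; rewrite /= in ig'.
have bnd t : normc (P t * cexp ('i%C * z * (t%:C)%C)) <= g t.
  rewrite [normc (_ * _)]normcM normc_expi normc_real ger0_norm ?stripP_ge0//.
  by apply: ler_wpM2l; [exact: stripP_ge0|apply: expR_convex; exact: ltW].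
rewrite /ft; apply: (le_trans (normc_cintegral_le _ ig' bnd)).
  by apply: cmeas_continuous; apply: ccontinuousM => //; exact: ccontinuous_expi.
have -> : \int[@lebesgue_measure R]_t g t = Re (cintegral (@lebesgue_measure R) (fun t => ((g t)%:C)%C)) by [].
under cintegral_ext do rewrite gE.
rewrite cintegralD ?cintegralZ//; [|exact: cintegrableZ|exact: cintegrableZ].
have f1 : cintegral (@lebesgue_measure R) (fun t => P t * cexp ('i%C * w1 * (t%:C)%C)) = ((sin (th / 2))%:C)%C.
  rewrite -/(ft P w1) (ft_stripP _ hth) ?Phat_half// Iw1 /h; lra.
have f2 : cintegral (@lebesgue_measure R) (fun t => P t * cexp ('i%C * w2 * (t%:C)%C)) = ((sin (th / 2))%:C)%C.
  rewrite -/(ft P w2) (ft_stripP _ hth) /w2 ?PhatN ?Phat_half// -/w2 Iw2 /h; lra.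
rewrite f1 f2 -!real_C_M -rmorphD/= -mulrDl (_ : _ + _ + _ = 1); last by lra.
by rewrite mul1r.
Qed.

Section SpectralSet.
Variable th : R.
Hypothesis hth : 0 < th < pi.
Let E : set C := [set conjc l | l in [set Phat th z ^+ 2 | z in strip R]].

(** The strip is invariant under conjugation, hence so is the set. *)
Lemma spectral_setP w : E w <-> exists2 z, `|Im z| < 2^-1 & w = Phat th z ^+ 2.
Proof.
split=> [[_ [z hz <-] <-]|[z hz ->]].
  by exists (conjc z); [rewrite ImJ normrN|rewrite rmorphXn/= PhatJ].
exists (Phat th (conjc z) ^+ 2); first by exists (conjc z) => //; rewrite /strip/= ImJ normrN.
rewrite rmorphXn/= PhatJ; congr (Phat th _ ^+ 2); exact: conjcK.
Qed.

Lemma closure_spectral_set0 : closure (E : set (C)^o) 0.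
Proof.
apply/closure_normc => e e0; have [t t0 ht] := Phat_real_small hth e0.
exists (Phat th (t%:C)%C ^+ 2); last by rewrite sub0r normcNE.
by apply/spectral_setP; exists ((t%:C)%C) => //=; rewrite normr0.
Qed.

Lemma spectral_set_sup : sup [set normc l | l in closure (E : set (C)^o)] = (1 - cos th) / 2.
Proof.
have sE : (1 - cos th) / 2 = sin (th / 2) ^+ 2.
  by rewrite {1}(_ : th = th / 2 + th / 2) ?cosD -?expr2 ?cos2sin2; [field|field].
have /andP[t0 tp] := hth.
have s0 : 0 <= sin (th / 2) by apply: sin_ge0_pi; apply/andP; split; lra.
have ub : ubound [set normc l | l in closure (E : set (C)^o)] ((1 - cos th) / 2).
  move=> _ [l cl <-]; rewrite leNgt; apply/negP => h.
  have d0 : 0 < normc l - (1 - cos th) / 2 by rewrite subr_gt0.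
  have [w /spectral_setP[z hz wE] lw] := (closure_normc E l).1 cl _ d0.
  have : normc w <= (1 - cos th) / 2.
    by rewrite wE normcX sE ler_pXn2r ?nnegrE ?normc_ge0//; exact: Phat_le.
  by have := normc_sub_ge l w; lra.
apply/eqP; rewrite eq_le; apply/andP; split.
  apply: ge_sup => //; exists (normc (0 : C)), 0 => //; exact: closure_spectral_set0.
apply: ub_le_sup; first by exists ((1 - cos th) / 2).
exists ((((1 - cos th) / 2)%:C)%C); last first.
  by rewrite normc_real ger0_norm// sE sqr_ge0.
apply/closure_normc => e e0.
have [L L0 hL] := ft_stripP_lipschitz hth.
pose dl := Num.min (8^-1) (e / (4 * L)).
have q0 : 0 < e / (4 * L) by rewrite divr_gt0// mulr_gt0.
have dl0 : 0 < dl by rewrite lt_min invr_gt0 q0 andbT.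
have dl8 : dl <= 8^-1 by rewrite ge_min lexx.
have dle : L * dl <= e / 4.
  rewrite mulrC -ler_pdivlMr// ge_min; apply/orP; right.
  by rewrite le_eqVlt; apply/orP; left; apply/eqP; field; rewrite gt_eqF.
pose w0 : C := 'i%C * (2^-1%:C)%C; pose d : C := - ('i%C * (dl%:C)%C).
have Iw0 : Im w0 = 2^-1 by rewrite cImM /=; ring.
have Id : Im d = - dl by rewrite cImN cImM /=; ring.
have Iz : `|Im (w0 + d)| < 2^-1 by rewrite cImD Iw0 Id ger0_norm; lra.
have nd : normc d = dl by rewrite normcNE normcM normi normc_real mul1r gtr0_norm.
exists (Phat th (w0 + d) ^+ 2); first by apply/spectral_setP; exists (w0 + d).
have := hL w0 d; rewrite Iw0 ger0_norm ?invr_ge0// lexx nd dl8 => /(_ isT isT).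
rewrite !ft_stripP//; [|by rewrite Iw0 ger0_norm; lra|by lra].
rewrite Phat_half => hd.
rewrite sE rmorphXn/= normcBC subr_sqr [normc (_ * _)]normcM.
have n1 : normc (Phat th (w0 + d) + ((sin (th / 2))%:C)%C) <= 2.
  rewrite (le_trans (normcD _ _))// normc_real ger0_norm//.
  by have := Phat_le hth Iz; have := sin_le1 (th / 2); lra.
apply: (@le_lt_trans _ _ (L * dl * 2)); last by lra.
by apply: ler_pM; rewrite ?normc_ge0.
Qed.

End SpectralSet.

End PhatFacts.

(** * Spectrum of the composition of the traces *)

Section Reflect.
Context d1 (T1 : measurableType d1) d2 (T2 : measurableType d2) (R : realType).
Variables (m1 : {finite_measure set T1 -> \bar R}).
Local Notation C := R[i].

(** Exchanging the poles changes the sign of the coordinates; even kernels do not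
    notice. *)
Lemma arcR_opp (G1 : set T1) (ta1 ja1 : T1 -> R) (G2 : set T2) (ta2 : T2 -> R) (k : R -> C) g :
  (forall t, k (- t) = k t) ->
  arcR m1 G1 (fun y => - ta1 y) ja1 G2 (fun y => - ta2 y) k g = arcR m1 G1 ta1 ja1 G2 ta2 k g.
Proof.
move=> ek; apply/funext => w; rewrite /arcR; case: ifP => // _.
by apply: cintegral_ext => y; rewrite -opprD ek.
Qed.

Lemma traceR_opp (G1 E1 : set T1) (ta1 ja1 : T1 -> R) (G2 : set T2) (ta2 : T2 -> R) (p q : R -> C) :
  (forall t, p (- t) = p t) -> (forall t, q (- t) = q t) ->
  traceR m1 G1 E1 (fun y => - ta1 y) ja1 G2 (fun y => - ta2 y) p q =
  traceR m1 G1 E1 ta1 ja1 G2 ta2 p q.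
Proof. by move=> ep eq; apply/funext => f; rewrite /traceR !arcR_opp. Qed.

End Reflect.

Section Trace.
Variable R : realType.
Variables (x1 x2 : R * R) (r1 r2 : R) (m : R * R) (ec es c1 c2 l : R).
Hypothesis hc : conf x1 r1 x2 r2 m ec es c1 c2 l.
Local Notation F := (fr m ec es).
Local Notation P := (F (0, l)).
Local Notation Q := (F (0, - l)).
Local Notation ta := (tau P Q).
Local Notation ja := (jac P Q).
Local Notation GI := (Gamma_int (disk x1 r1) (disk x2 r2)).
Local Notation GE := [set y | edist y x1 = r1 /\ r2 < edist y x2].
Local Notation GI2 := (Gamma_int (disk x2 r2) (disk x1 r1)).
Variables (th : R) (r1p : 0 < r1).
Hypotheses (hth : 0 < th < pi) (cth : cos th = (l ^+ 2 - c1 * c2) / (r1 * r2))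
  (sth : sin th = l * (c1 + c2) / (r1 * r2)).
Local Notation mu := (circle_fmeasure x1 r1p).

Lemma gamma_trace : gamma_op x1 r1 x2 r2 =
  (L2lift (circle_measure x2 r2) (traceR mu GI GE ta ja GI2 ta (stripPC th) (stripPC (pi - th)))
    : CL2 (circle_measure x1 r1) -> CL2 (circle_measure x2 r2)).
Proof.
apply/funext => u; rewrite /gamma_op /L2lift; congr CL2class; apply/funext => z.
rewrite /traceR fctE /arcR; case: ifP => [|_]; last by rewrite addr0.
move=> /set_mem; have [v <-] := fr_surj m z (conf_unit hc).
rewrite (Gamma_intE _ _ (conf_r2 hc) (conf_r1 hc)) => -[h1 h2].
rewrite (inside1 hc h1) in h2.
apply: (poisson_split hc) => //; exact: repr_CL2fun.
Qed.

End Trace.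

Section Final.
Variable R : realType.
Variables (x1 x2 : R * R) (r1 r2 : R) (m : R * R) (ec es c1 c2 l : R).
Hypothesis hc : conf x1 r1 x2 r2 m ec es c1 c2 l.
Local Notation C := R[i].
Local Notation Im := (@complex.Im R).
Local Notation F := (fr m ec es).
Local Notation P := (F (0, l)).
Local Notation Q := (F (0, - l)).
Local Notation ta := (tau P Q).
Local Notation ja := (jac P Q).
Local Notation GI1 := (Gamma_int (disk x1 r1) (disk x2 r2)).
Local Notation GE1 := [set y | edist y x1 = r1 /\ r2 < edist y x2].
Local Notation GI2 := (Gamma_int (disk x2 r2) (disk x1 r1)).
Local Notation GE2 := [set y | edist y x2 = r2 /\ r1 < edist y x1].
Local Notation X1 := (circle_measure x1 r1).
Local Notation X2 := (circle_measure x2 r2).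

(** At a common point, the segments to the centers have lengths [r1] and [r2] and
    scalar product [l^2 - c1 c2]. *)
Lemma conf_angle p : edist p x1 = r1 -> edist p x2 = r2 ->
  [/\ 0 < angle x1 p x2 < pi,
   cos (angle x1 p x2) = (l ^+ 2 - c1 * c2) / (r1 * r2) &
   sin (angle x1 p x2) = l * (c1 + c2) / (r1 * r2)].
Proof.
move=> p1 p2; have r10 := conf_r1 hc; have r20 := conf_r2 hc; have r120 := conf_r12 hc.
have e : ((l ^+ 2 - c1 * c2) / (r1 * r2)) ^+ 2 + (l * (c1 + c2) / (r1 * r2)) ^+ 2 = 1.
  rewrite !expr_div_n -mulrDl (_ : (l ^+ 2 - c1 * c2) ^+ 2 + (l * (c1 + c2)) ^+ 2 = (r1 * r2) ^+ 2) ?divff// ?expf_neq0 ?gt_eqF//.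
  by rewrite [(r1 * r2) ^+ 2]exprMn (conf_r1E hc) (conf_r2E hc); ring.
have [t /andP[t1 t2] [ct st]] := polar e.
have s0 : 0 < sin t by rewrite st divr_gt0// mulr_gt0 ?(conf_l hc) ?(conf_c hc).
have t0 : 0 < t.
  rewrite ltNge; apply/negP => t0; have : 0 <= sin (- t) by apply: sin_ge0_pi; apply/andP; split; lra.
  by rewrite sinN; lra.
have tp : t < pi.
  rewrite lt_neqAle t2 andbT; apply/eqP => tE; move: s0; by rewrite tE sinpi ltxx.
suff -> : angle x1 p x2 = t by rewrite t0 tp ct st.
rewrite /angle -[RHS]cosK; last by rewrite in_itv/= !ltW.
rewrite [edist x1 p]euclC [edist x2 p]euclC p1 p2 ct; congr (acos (_ / _)).
have := conf_unit hc => eu.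
have [->|->] := common_points hc p1 p2; rewrite (conf_x1 hc) (conf_x2 hc) /fr /=.
  by transitivity ((ec ^+ 2 + es ^+ 2) * (l ^+ 2 - c1 * c2)); [ring|rewrite eu mul1r].
by transitivity ((ec ^+ 2 + es ^+ 2) * (l ^+ 2 - c1 * c2)); [ring|rewrite eu mul1r].
Qed.

Lemma sym_poles : fr m (- ec) (- es) (0, l) = Q /\ fr m (- ec) (- es) (0, - l) = P.
Proof. by rewrite !frN /= oppr0 opprK. Qed.

Lemma chart_sym d (T : measurableType d) (mu : {measure set T -> \bar R}) (G : set T) (h : T -> R * R) :
  (exists K, arc_chart mu G (fun y => tau Q P (h y)) (fun y => jac Q P (h y)) K) ->
  exists K, arc_chart mu G (fun y => ta (h y)) (fun y => ja (h y)) K.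
Proof.
move=> [K hK]; exists K; have := arc_chartC hK.
have -> : (fun y => - tau Q P (h y)) = (fun y => ta (h y)) by apply/funext => y; rewrite -tauC.
by have -> : (fun y => jac Q P (h y)) = (fun y => ja (h y)) by apply/funext => y; rewrite jacC.
Qed.

Lemma GI2_chart : exists K, arc_chart X2 GI2 ta ja K.
Proof.
have [K] := GI_chart (conf_sym hc); have [-> ->] := sym_poles => h.
by apply: (@chart_sym _ _ X2 GI2 id); exists K.
Qed.

Lemma GE2_chart : exists K, arc_chart X2 GE2 ta ja K.
Proof.
have [K] := GE_chart (conf_sym hc); have [-> ->] := sym_poles => h.
by apply: (@chart_sym _ _ X2 GE2 id); exists K.
Qed.

Section Angle.
Variables (th : R).
Hypotheses (hth : 0 < th < pi) (cth : cos th = (l ^+ 2 - c1 * c2) / (r1 * r2))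
  (sth : sin th = l * (c1 + c2) / (r1 * r2)).
Variables (r1p : 0 < r1) (r2p : 0 < r2).
Local Notation m1 := (circle_fmeasure x1 r1p).
Local Notation m2 := (circle_fmeasure x2 r2p).
Local Notation p := (stripPC th).
Local Notation q := (stripPC (pi - th)).
Local Notation gamma12 := (gamma_op x2 r2 x1 r1 \o gamma_op x1 r1 x2 r2).

Let hth' : 0 < pi - th < pi. Proof. by move: hth; lra. Qed.

Lemma adm_stripPC (k : R) : 0 < k < pi -> adm (stripPC k).
Proof. by move=> /expdec_stripPC[M _ hM]; exists M, 1; split => //; lra. Qed.

Let hp : adm p. Proof. exact: adm_stripPC. Qed.
Let hq : adm q. Proof. exact: adm_stripPC. Qed.

Let dis1 y : GE1 y -> ~ GI1 y.
Proof.
move=> [_ h]; rewrite (Gamma_intE _ _ r1p r2p) => -[_ h'].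
by have := lt_trans h h'; rewrite ltxx.
Qed.

Let dis2 y : GE2 y -> ~ GI2 y.
Proof.
move=> [_ h]; rewrite (Gamma_intE _ _ r2p r1p) => -[_ h'].
by have := lt_trans h h'; rewrite ltxx.
Qed.

Lemma gamma12E : gamma12 =
  (L2lift X1 (traceR m2 GI2 GE2 ta ja GI1 ta p q) : CL2 X2 -> CL2 X1) \o
  (L2lift X2 (traceR m1 GI1 GE1 ta ja GI2 ta p q) : CL2 X1 -> CL2 X2).
Proof.
rewrite (gamma_trace hc r1p hth cth sth).
have cth' : cos th = (l ^+ 2 - c2 * c1) / (r2 * r1) by rewrite cth mulrC [r1 * r2]mulrC mulrC [c1 * c2]mulrC.
have sth' : sin th = l * (c2 + c1) / (r2 * r1) by rewrite sth [c1 + c2]addrC [r1 * r2]mulrC.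
rewrite (gamma_trace (conf_sym hc) r2p hth cth' sth').
have [-> ->] := sym_poles.
suff -> : traceR m2 GI2 GE2 (tau Q P) (jac Q P) GI1 (tau Q P) p q =
    traceR m2 GI2 GE2 ta ja GI1 ta p q by [].
have -> : tau Q P = (fun y => - ta y) by apply/funext => y; rewrite -tauC.
have -> : jac Q P = ja by apply/funext => y; rewrite jacC.
by apply: traceR_opp => t; exact: stripPCN.
Qed.

Lemma gamma12_eigenvector (z : C) : `|Im z| < 2^-1 ->
  arc_exp GI1 ta z \in CL2fun X1 /\
  eigenvector gamma12 (Phat th z ^+ 2) (CL2class X1 (arc_exp GI1 ta z)).
Proof.
move=> hz; have [K1 h1] := GI_chart hc; have [L1 e1] := GE_chart hc.
have [K2 h2] := GI2_chart; have [L2 e2] := GE2_chart.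
split; first exact: (@arc_exp_CL2fun _ _ _ m1 GI1 ta ja K1 h1 z hz).
have := @two_arc_eigenvector _ _ _ _ R m1 m2 GI1 GE1 ta ja K1 L1 h1 e1 GI2 GE2 ta ja K2 L2 h2 e2 dis1 dis2 p q hp hq z hz.
rewrite ft_stripP//; last by rewrite cImN normrN; lra.
by rewrite PhatN gamma12E.
Qed.

Lemma gamma12_spectrum : spectrum gamma12 =
  closure ([set conjc l | l in [set Phat th z ^+ 2 | z in strip R]] : set (R[i])^o).
Proof.
apply/seteqP; split; last first.
  apply: closure_eigenvalues => w /spectral_setP[z hz ->].
  by exists (CL2class X1 (arc_exp GI1 ta z)); have [] := gamma12_eigenvector hz.
move=> w sw; apply: contrapT => ncl; apply: sw.
have [e e0 he] : exists2 e : R, 0 < e & forall z : C, `|Im z| < 2^-1 -> e <= normc (w - ft p z ^+ 2).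
  apply: contrapT => h; apply: ncl; apply/closure_normc => e e0.
  apply: contrapT => h'; apply: h; exists e => // z hz; rewrite leNgt; apply/negP => hw.
  apply: h'; exists (ft p z ^+ 2) => //; apply/spectral_setP; exists z => //.
  by rewrite ft_stripP//; lra.
have w0 : w != 0.
  by apply/eqP => w0; apply: ncl; rewrite w0; exact: closure_spectral_set0.
have [K [b /andP[b1 _] [M hK hKe]]] := resolvent_kernel hth e0 he.
have [K1 h1] := GI_chart hc; have [L1 e1] := GE_chart hc.
have [K2 h2] := GI2_chart; have [L2 e2] := GE2_chart.
have hKa : adm K by exists M, b.
have := @two_arc_resolvent _ _ _ _ R m1 m2 GI1 GE1 ta ja K1 L1 h1 e1 GI2 GE2 ta ja K2 L2 h2 e2 dis1 dis2 p q hp hq w K w0 hKa hKe.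
rewrite -gamma12E => /contrapT; exact.
Qed.

End Angle.

End Final.

(** * The eigenfunctions in terms of the angle *)

Lemma CL2fun_ae d (T : measurableType d) (R : realType) (mu : {measure set T -> \bar R})
  (f g : T -> R[i]) : cmeas f -> g \in CL2fun mu -> (\forall y \ae mu, f y = g y) ->
  f \in CL2fun mu.
Proof.
move=> cf /CL2funE[cg gfin] fg; apply/CL2funE; split => //.
apply: le_lt_trans gfin; rewrite le_eqVlt; apply/orP; left; apply/eqP.
apply: ae_eq_integral => //.
- by apply/measurable_EFinP; apply: measurable_funX; exact: cmeas_normc.
- by apply/measurable_EFinP; apply: measurable_funX; exact: cmeas_normc.
by apply: filterS fg => y -> _.
Qed.

Section Eigenfunction.
Variable R : realType.
Local Notation C := R[i].
Local Notation Im := (@complex.Im R).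

(** Off the circle, functions may be changed at will: the measure is defined on
    all sets that do not meet the circle. *)
Lemma eq_on_circle (x : R * R) (r : R) (f g : R * R -> C) : 0 < r ->
  (forall y, edist y x = r -> f y = g y) -> g \in CL2fun (circle_measure x r) ->
  f \in CL2fun (circle_measure x r) /\
  CL2class (circle_measure x r) f = CL2class (circle_measure x r) g.
Proof.
move=> r0 fg hg; have [[g1 g2] gfin] := (CL2funE (circle_measure x r) g).1 hg.
pose S : set (caratheodory_type (hausdorff1_on (boundary (disk x r)))) := [set y | edist y x = r].
have null A : measurable ((A `&` ~` S) : set (caratheodory_type (hausdorff1_on (boundary (disk x r))))).
  apply: (circle_measurable r0 (al := 0)).
  rewrite (_ : _ `&` _ = set0); first exact: measurable0.
  apply/seteqP; split => t //= -[[_ h] _]; apply: h; exact: edist_circle_point.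
have mS : measurable S by rewrite -[S]setCK -[~` S]setTI; apply: measurableC; exact: null.
have meas (h : C -> R) : measurable_fun [set: caratheodory_type (hausdorff1_on (boundary (disk x r)))] (fun y => h (g y)) ->
    measurable_fun [set: caratheodory_type (hausdorff1_on (boundary (disk x r)))] (fun y => h (f y)).
  move=> mg _ B mB; rewrite setTI.
  have -> : (fun y => h (f y)) @^-1` B =
      ((fun y => h (g y)) @^-1` B `&` S) `|` ((fun y => h (f y)) @^-1` B `&` ~` S).
    apply/seteqP; split => y /=.
      move=> By; have [yS|yS] := pselect (S y); [left|by right].
      by split => //; rewrite -fg.
    by move=> [[By yS]|[]//]; rewrite fg.
  apply: measurableU; last exact: null.
  by apply: measurableI => //; rewrite -[X in measurable X]setTI; exact: mg.
have cf : cmeas (f : caratheodory_type (hausdorff1_on (boundary (disk x r))) -> C) by split; exact: meas.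
have ae : \forall y \ae circle_measure x r, f y = g y.
  have [A [mA A0 hA]] := circle_boundary_ae x r0 0; exists A; split => // y hy; apply: hA => /= yr.
  by apply: hy => /=; exact: fg.
have hf : f \in CL2fun (circle_measure x r).
  exact: (CL2fun_ae cf hg ae).
by split => //; apply/(CL2class_ae hf hg).
Qed.

(** Half-angle formulas: the base is
    [sin ((s + t) / 2) / sin ((s - t) / 2)]. *)
Lemma eigenfunction_base (s t : R) : 0 < s < pi -> `|t| < s ->
  ln ((1 - cos (t + s)) / (cos t - cos s)) = bip s t.
Proof.
move=> hs ts; have [a0 b0] := sin_half_gt0 hs ts; rewrite /bip.
have -> : 1 - cos (t + s) = 2 * sin ((s + t) / 2) ^+ 2.
  rewrite (_ : t + s = (s + t) / 2 + (s + t) / 2); last by field.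
  by rewrite cosD -!expr2 cos2sin2; ring.
have -> : cos t - cos s = 2 * (sin ((s + t) / 2) * sin ((s - t) / 2)).
  rewrite {1}(_ : t = (s + t) / 2 - (s - t) / 2); last by field.
  rewrite {3}(_ : s = (s + t) / 2 + (s - t) / 2); last by field.
  by rewrite cosB cosD; ring.
rewrite -ln_div ?posrE//; congr ln.
by move: (sin _) (sin _) a0 b0 => a b a0 b0; field; rewrite !gt_eqF.
Qed.

Variables (x1 x2 : R * R) (r1 r2 : R) (m : R * R) (ec es c1 c2 l : R).
Hypothesis hc : conf x1 r1 x2 r2 m ec es c1 c2 l.
Local Notation F := (fr m ec es).
Local Notation P := (F (0, l)).
Local Notation Q := (F (0, - l)).
Local Notation ta := (tau P Q).
Local Notation GI := (Gamma_int (disk x1 r1) (disk x2 r2)).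
Variables (al s : R).
Hypothesis hs : 0 < s < pi.
Hypothesis hG : GI = [set circle_point x1 r1 (al + phi) | phi in `]- s, s[ ].
Local Notation cp := (arcpt x1 r1 al).

Lemma arc_GI t : GI (cp t) -> exists2 u, `|u| < s & cp u = cp t.
Proof.
by rewrite hG => -[u /=]; rewrite in_itv/= -ltr_norml => us e; exists u.
Qed.

(** The end points are limits of points of the arc but do not belong to it. *)
Lemma arc_end t : `|t| = s -> edist (cp t) x2 = r2.
Proof.
move=> ts; have /andP[s0 sp] := hs; have r10 := conf_r1 hc; have r20 := conf_r2 hc.
have t1 : edist (cp t) x1 = r1 by exact: edist_circle_point.
have tr : - pi < t <= pi by move: sp; rewrite -ts ltr_norml => /andP[h1 /ltW h2]; apply/andP.
apply/eqP; rewrite eq_le; apply/andP; split; last first.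
  rewrite leNgt; apply/negP => h.
  have [|u us e] := @arc_GI t; first by rewrite (Gamma_intE _ _ r10 r20).
  have ur : - pi < u <= pi.
    by have : `|u| < pi by [apply: lt_trans sp]; rewrite ltr_norml => /andP[h1 /ltW h2]; apply/andP.
  have ut := arcpt_inj r10 ur tr e.
  by move: us; rewrite ut ts ltxx.
rewrite leNgt; apply/negP => h.
have cg : {for t, continuous (fun t => edist (cp t) x2)}.
  exact: (@continuous_comp _ _ _ cp (fun y => edist y x2) t (@continuous_arcpt _ _ _ _ t) (@eucl_continuous R x2 (cp t))).
have nb : \forall u \near t, r2 < edist (cp u) x2 by exact: (cvgr_gt _ cg).
have /nbhs_ballP[e /= e0 he] := nb.
pose d := Num.min 2^-1 (e / (2 * pi)).
have p0 := pi_gt0 R.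
have ep : 0 < e / (2 * pi) by rewrite divr_gt0// mulr_gt0.
have d0 : 0 < d by rewrite lt_min invr_gt0 ep andbT.
have d1 : d <= 2^-1 by rewrite ge_min lexx.
have d2 : d * pi < e.
  apply: (@le_lt_trans _ _ (e / (2 * pi) * pi)).
    by rewrite ler_pM2r// ge_min lexx orbT.
  have -> : e / (2 * pi) * pi = e / 2 by move: p0; move: (pi : R) => q q0; field; rewrite gt_eqF.
  lra.
pose u := t * (1 - d).
have us : `|u| < s.
  by rewrite /u normrM ts gtr0_norm; [rewrite gtr_pMr//; lra|lra].
have /= := he u _; rewrite -ball_normE/=.
have -> : t - u = t * d by rewrite /u; ring.
rewrite normrM ts (gtr0_norm d0) => hu.
have : GI (cp u) by rewrite hG; exists u => //=; rewrite in_itv/= -ltr_norml.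
rewrite (Gamma_intE _ _ r10 r20) => -[_ h1].
have h2 : r2 < edist (cp u) x2.
  by apply: hu; apply: lt_trans d2; rewrite mulrC ltr_pM2l.
by have := lt_trans h1 h2; rewrite ltxx.
Qed.

(** The end points of the arc lie on both circles.  Which one is [P] depends on
    the sense in which the angle is measured. *)
Lemma tau_ends : tau (cp s) (cp (- s)) = ta \/ tau (cp s) (cp (- s)) = (fun y => - ta y).
Proof.
have /andP[s0 sp] := hs; have r10 := conf_r1 hc.
have e1 : edist (cp s) x2 = r2 by apply: arc_end; rewrite gtr0_norm.
have e2 : edist (cp (- s)) x2 = r2 by apply: arc_end; rewrite normrN gtr0_norm.
have f1 : edist (cp s) x1 = r1 by exact: edist_circle_point.
have f2 : edist (cp (- s)) x1 = r1 by exact: edist_circle_point.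
have ne : cp s <> cp (- s).
  move=> e; have i1 : - pi < s <= pi by apply/andP; split; lra.
  have i2 : - pi < - s <= pi by apply/andP; split; lra.
  by have := arcpt_inj r10 i1 i2 e; lra.
have [h1|h1] := common_points hc f1 e1; have [h2|h2] := common_points hc f2 e2; rewrite h1 h2 in ne *.
- by case: ne.
- by left.
- by right; apply/funext => y; rewrite -tauC.
- by case: ne.
Qed.

Lemma eigenfunctionE (z0 : C) (f : R * R -> C) :
  (forall phi : R, phi \in `]- s, s[ ->
     f (circle_point x1 r1 (al + phi)) =
     cpow ((1 - cos (phi + s)) / (cos phi - cos s)) ('i%C * conjc z0)) ->
  (forall y, Gamma_ext (disk x1 r1) (disk x2 r2) y -> f y = 0) ->
  exists2 z, z = conjc z0 \/ z = - conjc z0 &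
    forall y, edist y x1 = r1 -> f y = arc_exp GI ta z y.
Proof.
move=> hf hf0; have r10 := conf_r1 hc; have r20 := conf_r2 hc.
have ext z y : edist y x1 = r1 -> (forall t, `|t| < s -> y = cp t ->
    f y = cexp ('i%C * z * ((ta y)%:C)%C)) -> f y = arc_exp GI ta z y.
  move=> yr h; rewrite /arc_exp; case: ifPn => [/set_mem yG|/negP yG].
    move: (yG); rewrite {1}hG => -[t /=]; rewrite in_itv/= -ltr_norml => ts ty.
    by apply: (h t).
  apply: hf0; rewrite (Gamma_extE _ _ r10 r20); split => //; rewrite leNgt; apply/negP => h'.
  by apply: yG; apply/mem_set; rewrite (Gamma_intE _ _ r10 r20).
have fE t : `|t| < s -> f (cp t) = cexp ('i%C * conjc z0 * ((tau (cp s) (cp (- s)) (cp t))%:C)%C).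
  move=> ts; rewrite /arcpt hf; last by rewrite in_itv/= -ltr_norml.
  by rewrite /cpow eigenfunction_base// (tau_arc _ _ r10 hs).
have [e|e] := tau_ends.
  exists (conjc z0); [by left|move=> y yr; apply: ext => // t ts ->].
  by rewrite fE// e.
exists (- conjc z0); [by right|move=> y yr; apply: ext => // t ts ->].
by rewrite fE// e rmorphN/= !mulrN mulNr.
Qed.

End Eigenfunction.

Theorem theorem5p5 (R : realType) (x1 x2 : R * R) (r1 r2 : R)
    (r1_gt0 : 0 < r1) (r2_gt0 : 0 < r2)
    (meet : disk x1 r1 `&` disk x2 r2 !=set0)
    (not_sub12 : ~ disk x1 r1 `<=` disk x2 r2)
    (not_sub21 : ~ disk x2 r2 `<=` disk x1 r1)
    (p : R * R)
    (p_bd : (boundary (disk x1 r1) `&` boundary (disk x2 r2)) p) :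
  let theta := angle x1 p x2 in
  let gamma12 := gamma_op x2 r2 x1 r1 \o gamma_op x1 r1 x2 r2 in
  [/\ spectrum gamma12 =
        closure ([set conjc l | l in [set Phat theta z ^+ 2 | z in strip R]]
                 : set (R[i])^o),
      spectral_radius gamma12 = (1 - cos theta) / 2 &
      forall (alpha sigma : R), 0 < sigma < pi ->
        Gamma_int (disk x1 r1) (disk x2 r2) =
          [set circle_point x1 r1 (alpha + phi) | phi in `]- sigma, sigma[ ] ->
      forall z0 : R[i], z0 \in strip R ->
      forall f : R * R -> R[i],
        (forall phi : R, phi \in `]- sigma, sigma[ ->
           f (circle_point x1 r1 (alpha + phi)) =
           cpow ((1 - cos (phi + sigma)) / (cos phi - cos sigma))
                ('i%C * conjc z0)) ->
        (forall y, Gamma_ext (disk x1 r1) (disk x2 r2) y -> f y = 0) ->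
        f \in CL2fun (circle_measure x1 r1) /\
        eigenvector gamma12 (conjc (Phat theta z0 ^+ 2))
                    (CL2class (circle_measure x1 r1) f)].
Proof.
move=> theta gamma12.
have [m [ec [es [c1 [c2 [l hc]]]]]] := two_disks_conf r1_gt0 r2_gt0 meet not_sub12 not_sub21.
have [p1 p2] : edist p x1 = r1 /\ edist p x2 = r2.
  by move: p_bd; rewrite !boundary_disk// => -[].
have [hth cth sth] := conf_angle hc p1 p2; rewrite -/theta in hth cth sth.
have sp := gamma12_spectrum hc hth cth sth r1_gt0 r2_gt0.
split => [//||alpha sigma hs hG z0 /set_mem hz0 f hf hf0].
  by rewrite /spectral_radius /gamma12 sp; exact: spectral_set_sup.
have [z hz fE] := eigenfunctionE hc hs hG hf hf0.
have Iz : `|complex.Im z| < 2^-1.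
  by case: hz => ->; rewrite ?cImN ImJ ?opprK ?normrN.
have [he ev] := gamma12_eigenvector hc hth cth sth r1_gt0 r2_gt0 Iz.
have [hfL fcl] := eq_on_circle r1_gt0 fE he.
split => //; rewrite fcl.
have -> : conjc (Phat theta z0 ^+ 2) = Phat theta z ^+ 2; last exact: ev.
by rewrite rmorphXn/= PhatJ; case: hz => ->; rewrite ?PhatN.
Qed.
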